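(* Every planar or projective-planar graph of girth at least $10$ has a homomorphism to the $5$-cycle $C_5$.
   Context: All graphs are finite and simple. A homomorphism from $G$ to $H$ is a function $f:V(G)\to V(H)$ such that $f(u)f(v)\in E(H)$ for every $uv\in E(G)$. A graph is projective-planar if it can be drawn in the projective plane without crossings. The girth of a graph is the length of its shortest cycle (infinite if there is no cycle). *)

(* Defs.v *)
From HB Require Import structures.
From mathcomp Require Import all_boot all_order all_algebra generic_quotient.
From mathcomp Require Import all_classical all_reals all_analysis.
Import Order.TTheory GRing.Theory Num.Theory.
Import numFieldNormedType.Exports.

Set Implicit Arguments.
Unset Strict Implicit.
Unset Printing Implicit Defensive.

Local Open Scope classical_set_scope.
Local Open Scope ring_scope.

Record sgraph := SGraph {
  vertex :> finType;
  adj : rel vertex;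
  adj_sym : symmetric adj;
  adj_irr : irreflexive adj
}.

Definition is_hom (G H : sgraph) (f : G -> H) : Prop :=
  forall u v : G, adj u v -> adj (f u) (f v).

Definition C5_adj : rel 'I_5 := fun i j => (j == ordS i) || (i == ordS j).

Lemma C5_adj_sym : symmetric C5_adj.
Proof. by move=> i j; rewrite /C5_adj orbC. Qed.

Lemma C5_adj_irr : irreflexive C5_adj.
Proof. by case=> [[|[|[|[|[|i]]]]] // ?]. Qed.

Definition C5 : sgraph := SGraph C5_adj_sym C5_adj_irr.

(* The size bound excludes the closed walks [::] and [:: u; v], which satisfy
   [ucycle] but are not cycles of a simple graph. *)
Definition is_cycle (G : sgraph) (c : seq G) : Prop :=
  ucycle (@adj G) c /\ (2 < size c)%N.

(* The infimum of the empty set is +oo, the girth of a forest. *)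
Definition girth (R : realType) (G : sgraph) : \bar R :=
  ereal_inf [set ((size c)%:R)%:E | c in [set c : seq G | is_cycle c]].

(* When the space X is Hausdorff, such a g is a homeomorphism onto its
   image. *)
Definition simple_arc (R : realType) (X : topologicalType) (x y : X)
    (A : set X) : Prop :=
  exists g : R -> X,
    [/\ {within `[0, 1], continuous g},
        {in `[0, 1] &, injective g},
        g 0 = x, g 1 = y & A = g @` `[0, 1]].

(* The edge uv is drawn as the set a u v, which does not depend on the order
   of its ends; the values a u v for nonadjacent u and v are irrelevant. *)
Record drawing (R : realType) (X : topologicalType) (G : sgraph)
    (p : G -> X) (a : G -> G -> set X) : Prop := Drawing {
  drawing_inj : injective p;
  drawing_arc : forall u v : G, adj u v -> simple_arc R (p u) (p v) (a u v);
  drawing_sym : forall u v : G, adj u v -> a u v = a v u;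
  drawing_vertex : forall u v w : G,
    adj u v -> a u v (p w) -> w \in [set u; v]%SET;
  drawing_cross : forall u v u' v' : G, adj u v -> adj u' v' ->
    [set u; v]%SET != [set u'; v']%SET ->
    a u v `&` a u' v' `<=`
      [set p w | w in [set w | w \in ([set u; v] :&: [set u'; v'])%SET]]
}.

Definition drawable (R : realType) (X : topologicalType) (G : sgraph) : Prop :=
  exists (p : G -> X) (a : G -> G -> set X), drawing R p a.

Definition sphere (R : realType) : set 'rV[R]_3 :=
  [set x | \sum_(i < 3) x 0 i ^+ 2 = 1].
Arguments sphere : clear implicits.

Definition antipodal (R : realType) : rel (sphere R) :=
  fun x y => (set_val x == set_val y) || (set_val x == - set_val y).

Lemma antipodal_equiv (R : realType) : equiv_class_of (@antipodal R).
Proof.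
split=> [x|x y|y x z]; rewrite /antipodal.
- by rewrite eqxx.
- by rewrite eq_sym -eqr_oppLR (eq_sym (- _)).
- by move=> /orP[] /eqP -> /orP[] /eqP ->; rewrite ?opprK eqxx ?orbT.
Qed.

Canonical antipodal_equivRel (R : realType) : equiv_rel (sphere R) :=
  EquivRelPack (antipodal_equiv R).

Definition projective_plane (R : realType) : topologicalType :=
  quotient_topology {eq_quot antipodal_equivRel R}%qT.

Definition planar (R : realType) (G : sgraph) : Prop :=
  drawable R (R * R)%type G.

Definition projective_planar (R : realType) (G : sgraph) : Prop :=
  drawable R (projective_plane R) G.

(* Main.v *)
(* The girth of a graph G drawn in the projective plane bounds its density:
   4 e(S) + 5 <= 5 |S| for every nonempty set S of vertices, where e(S) counts
   the edges inside S. Over F_2, every region of the drawing of G[S] is bounded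
   by an even subgraph, which is zero or contains a cycle, hence has at least
   ten edges; by duality e(S) <= |S| + max (k - 1) 0, where k is the number of
   nonzero boundaries, while |S| >= 10 unless e(S) < |S|. The duality is that of
   a fine triangulated grid in which, by compactness and connectedness of the
   arcs, the vertices of G own disjoint connected sets of lattice points that
   touch along the edges of G.

   Density alone then gives the homomorphism. For the induction, vertices take
   states in the dihedral group of the pentagon, and an edge of weight w, for
   2 <= w <= 5, stands for a path of length 5 - w between a position of one end
   and a position of the other. The slack of a set B of vertices is 5 |B| minus
   the weight of the edges inside B. If all nonempty sets have slack at least 3,
   and no cycle of slack 3 is unsatisfiable, then the whole graph is satisfiable:
   in a minimal counterexample, contracting a coloured set shows that the proper
   sets with at least two vertices have slack at least 6, which excludes a list
   of local configurations, and discharging contradicts the total slack. *)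
Require Import Defs.
From HB Require Import structures.
From mathcomp Require Import all_boot zify boolp.
Set Implicit Arguments.
Unset Strict Implicit.
Unset Printing Implicit Defensive.

(** * Gain graphs over the dihedral group of the pentagon *)

(* [lia] can get lost in a large context; [blia] first keeps the arithmetic
   hypotheses only. *)
Ltac arith_prop T :=
  lazymatch T with
  | is_true (leq _ _) => idtac
  | @eq ?U _ _ => unify U nat
  | is_true (@eq_op ?U _ _) => unify (Equality.sort U) nat
  | is_true (andb ?a ?b) => arith_prop (is_true a); arith_prop (is_true b)
  | is_true (orb ?a ?b) => arith_prop (is_true a); arith_prop (is_true b)
  | is_true (negb ?a) => arith_prop (is_true a)
  | ?a /\ ?b => arith_prop a; arith_prop b
  | ?a \/ ?b => arith_prop a; arith_prop b
  | ~ ?a => arith_prop a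
  | ?a -> ?b => arith_prop a; arith_prop b
  | _ => fail
  end.
Ltac blia := intros;
  repeat match goal with
  | x := _ |- _ => clearbody x
  | H : ?T |- _ => tryif arith_prop T then fail else clear H
  end; lia.

(** A coloured set can be moved as a whole by the symmetries of the pentagon, so contracting it must
    leave a vertex whose states are dihedral motions. This is why the induction leaves graphs for
    weighted graphs with positions, a class closed under contraction. The scale of the weights makes
    slack a length: a cycle whose two edges share a position at every vertex is a subdivided cycle
    whose length is its slack. The pentagon has closed walks of every length from 4 on and none of
    length 3, hence the threshold 3 and the separate clause for cycles of slack 3. Different
    positions at a vertex may make such a cycle satisfiable, so the clause speaks of satisfiability
    and not of shape. The constant 5 of the density bound is five times the Euler characteristic of
    the projective plane, every edge lying on at most two boundaries of at least ten edges. Since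
    density gives more than slack 3, the clause on cycles is vacuous for the given graph; it matters
    only inside the induction. *)

Inductive z5 := Z0 | Z1 | Z2 | Z3 | Z4.

Definition eqz5 (x y : z5) : bool :=
  match x, y with
  | Z0, Z0 | Z1, Z1 | Z2, Z2 | Z3, Z3 | Z4, Z4 => true
  | _, _ => false
  end.

Lemma eqz5P : Equality.axiom eqz5.
Proof. by case; case; constructor. Qed.

HB.instance Definition _ := hasDecEq.Build z5 eqz5P.

Definition succ5 (x : z5) : z5 :=
  match x with Z0 => Z1 | Z1 => Z2 | Z2 => Z3 | Z3 => Z4 | Z4 => Z0 end.

Definition opp5 (x : z5) : z5 :=
  match x with Z0 => Z0 | Z1 => Z4 | Z2 => Z3 | Z3 => Z2 | Z4 => Z1 end.

Definition add5 (x y : z5) : z5 :=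
  match y with
  | Z0 => x
  | Z1 => succ5 x
  | Z2 => succ5 (succ5 x)
  | Z3 => succ5 (succ5 (succ5 x))
  | Z4 => succ5 (succ5 (succ5 (succ5 x)))
  end.

Definition sub5 x y := add5 x (opp5 y).

(* Nested conditionals, unlike [&&] and [||], are evaluated lazily by
   [vm_compute]. *)
Definition all5 (P : z5 -> bool) :=
  if P Z0 then if P Z1 then if P Z2 then if P Z3 then P Z4
  else false else false else false else false.
Definition ex5 (P : z5 -> bool) :=
  if P Z0 then true else if P Z1 then true else if P Z2 then true else
  if P Z3 then true else P Z4.

Lemma all5P (P : z5 -> bool) : reflect (forall x, P x) (all5 P).
Proof.
rewrite -[all5 P]/[&& P Z0, P Z1, P Z2, P Z3 & P Z4].
apply: (iffP and5P) => [[H0 H1 H2 H3 H4]|H]; last by split; apply: H.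
by case.
Qed.

Lemma ex5P (P : z5 -> bool) : reflect (exists x, P x) (ex5 P).
Proof.
rewrite -[ex5 P]/[|| P Z0, P Z1, P Z2, P Z3 | P Z4].
apply: (iffP idP) => [|[[] Hx]]; rewrite ?Hx ?orbT //.
by case/or4P => [?|?|?|/orP[?|?]]; [exists Z0|exists Z1|exists Z2|exists Z3|exists Z4].
Qed.

(* The dihedral group of the pentagon: [(r, false)] is [x |-> r + x] and
   [(r, true)] is [x |-> r - x]. *)
Definition state := (z5 * bool)%type.

Definition act (s : state) (x : z5) : z5 :=
  add5 s.1 (if s.2 then opp5 x else x).

Definition cmp (s t : state) : state := (act s t.1, s.2 (+) t.2).

Lemma act_cmp s t x : act (cmp s t) x = act s (act t x).
Proof. by case: s t x => [[] []] [[] []] []. Qed.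

Definition allS (P : state -> bool) :=
  all5 (fun r => if P (r, true) then P (r, false) else false).
Definition exS (P : state -> bool) :=
  ex5 (fun r => if P (r, true) then true else P (r, false)).

Lemma allSP (P : state -> bool) : reflect (forall s, P s) (allS P).
Proof.
apply: (iffP (all5P _)) => [H [r b]|H r]; last by rewrite !H.
by have /andP[] : P (r, true) && P (r, false); [exact: (H r) | case: b].
Qed.

Lemma exSP (P : state -> bool) : reflect (exists s, P s) (exS P).
Proof.
apply: (iffP (ex5P _)) => [[r /(@orP (P _))[]]|[[r []] H]].
- by exists (r, true).
- by exists (r, false).
- by exists r; rewrite H.
- by exists r; rewrite H; case: ifP.
Qed.

(* An edge of weight [w] stands for a path of length [5 - w]: it allows the
   differences that a walk of that length in the pentagon can realise. *)
Definition okw (w : nat) (x y : z5) : bool :=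
  match w, sub5 x y with
  | 5, Z0 => true
  | 5, _ => false
  | 4, Z1 | 4, Z4 => true
  | 4, _ => false
  | 3, Z1 | 3, Z4 => false
  | 2, Z0 => false
  | _, _ => true
  end.

Lemma okwC w x y : okw w x y = okw w y x.
Proof. by case: w => [|[|[|[|[|[|w]]]]]]; case: x y => [] []. Qed.

Lemma okw_act w s x y : okw w (act s x) (act s y) = okw w x y.
Proof.
by case: w => [|[|[|[|[|[|w]]]]]]; case: s x y => [[] []] [] [].
Qed.

Definition states : seq state :=
  [seq (r, b) | r <- [:: Z0; Z1; Z2; Z3; Z4], b <- [:: true; false]].

(** Of the five values at a position, an edge of weight [w] rules out [w - 1], and each value is
    taken by two of the ten states. *)
Lemma count_okw w p y : (2 <= w <= 5)%N ->
  count (fun s => ~~ okw w (act s p) y) states = (2 * w.-1)%N.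
Proof.
by case: w => [|[|[|[|[|[|w]]]]]] //= _; case: p y => [] [].
Qed.

(** * Weighted graphs with positions, and their colourings *)

Section Instances.
Variable V : finType.

(* [(a, v, b, w)] as a dart at [u]: the edge of weight [w] joining position
   [a] of [u] to position [b] of [v]. *)
Definition dart := (z5 * V * z5 * nat)%type.
Definition dp (d : dart) := d.1.1.1.
Definition dn (d : dart) := d.1.1.2.
Definition dq (d : dart) := d.1.2.
Definition dw (d : dart) := d.2.

Definition edge := (V * dart)%type.
Definition revE (e : edge) : edge := (dn e.2, (dq e.2, e.1, dp e.2, dw e.2)).

Implicit Types (es : seq edge) (B : {set V}) (phi : V -> state).

Definition wfE (e : edge) := (e.1 != dn e.2) && (2 <= dw e.2 <= 5)%N.
Definition wf es := all wfE es.

Definition inE_ B (e : edge) := (e.1 \in B) && (dn e.2 \in B).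
Definition okE phi (e : edge) :=
  okw (dw e.2) (act (phi e.1) (dp e.2)) (act (phi (dn e.2)) (dq e.2)).
Definition sat es B phi := all (fun e => inE_ B e ==> okE phi e) es.

(** Every edge is read in both directions, so it occurs once at each end. The star is a list because
    contraction produces parallel edges, which must be counted with multiplicity. *)
Definition star es v : seq dart :=
  [seq e.2 | e <- es ++ map revE es & e.1 == v].
Definition okD phi (s : state) (d : dart) :=
  okw (dw d) (act s (dp d)) (act (phi (dn d)) (dq d)).

Definition wsum es B := (\sum_(e <- es | inE_ B e) dw e.2)%N.
Definition deg es B v := count (fun d => dn d \in B) (star es v).

Lemma revEK : involutive revE.
Proof. by case=> u [[[a v] b] w]. Qed.

Lemma wf_cat es es' : wf (es ++ es') = wf es && wf es'.
Proof. exact: all_cat. Qed.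

Lemma inE_rev B e : inE_ B (revE e) = inE_ B e.
Proof. by rewrite /inE_ andbC. Qed.

Lemma okE_rev phi e : okE phi (revE e) = okE phi e.
Proof. by rewrite /okE okwC. Qed.

Lemma wsum_cat es es' B : wsum (es ++ es') B = (wsum es B + wsum es' B)%N.
Proof. by rewrite /wsum big_cat. Qed.

Lemma star_cat es es' v : perm_eq (star (es ++ es') v) (star es v ++ star es' v).
Proof.
rewrite /star -map_cat perm_map // -filter_cat perm_filter //.
by rewrite map_cat -!catA perm_cat2l perm_catCA.
Qed.

Lemma mem_star es v d :
  (d \in star es v) = ((v, d) \in es) || (revE (v, d) \in es).
Proof.
apply/mapP/orP => [[e]|].
  rewrite mem_filter mem_cat => /andP[/eqP <-] /orP[] H ->; first by left; case: e H.
  right; case/mapP: H => e' He' ->.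
  have -> : (revE e').1 = (revE e').1 by [].
  by rewrite -[((revE e').1, _)]surjective_pairing revEK.
case=> H; exists (v, d) => //; rewrite mem_filter eqxx mem_cat.
  by rewrite H.
by rewrite -[(v, d)]revEK map_f ?orbT.
Qed.

Lemma star_wf es v d : wf es -> d \in star es v ->
  (dn d != v) && (2 <= dw d <= 5)%N.
Proof.
move=> /allP Hwf; rewrite mem_star => /orP[] /Hwf; rewrite /wfE /= eq_sym //.
Qed.

Lemma wsum_star es v B : wf es -> v \notin B ->
  wsum es (v |: B) = (wsum es B + \sum_(d <- star es v | dn d \in B) dw d)%N.
Proof.
move=> + HvB; elim: es => [|[u [[[a x] b] w]] es IH].
  by rewrite /wsum /star !big_nil.
rewrite /wf /= => /andP[/andP[/= Hux _] Hwf].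
rewrite (perm_big _ (star_cat [:: (u, (a, x, b, w))] es v)).
rewrite big_cat /= -[_ :: es]cat1s !wsum_cat IH // addnACA; congr (_ + _)%N.
rewrite /wsum /star /= /inE_ /= /dn /=.
rewrite !big_cons !big_nil /= !in_setU1.
rewrite /dn /= in Hux.
case Huv: (u == v); case Hxv: (x == v); rewrite /= ?big_cons ?big_nil /dn /dw /=.
- by rewrite (eqP Huv) (eqP Hxv) eqxx in Hux.
- by rewrite (eqP Huv) (negbTE HvB) /=; case: ifP.
- by rewrite (eqP Hxv) (negbTE HvB) /= andbT andbF; case: ifP.
- by rewrite !addn0.
Qed.

Lemma sat_sub es B B' phi : B \subset B' -> sat es B' phi -> sat es B phi.
Proof.
move=> sB /allP H; apply/allP => e He; apply/implyP => /andP[H1 H2].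
by have := H e He; rewrite /inE_ (subsetP sB _ H1) (subsetP sB _ H2).
Qed.

Lemma sat_cat es es' B phi : sat (es ++ es') B phi = sat es B phi && sat es' B phi.
Proof. exact: all_cat. Qed.

Lemma sat_ext es v B phi s : wf es -> v \notin B -> sat es B phi ->
  {in star es v, forall d, dn d \in B -> okD phi s d} ->
  sat es (v |: B) (fun x => if x == v then s else phi x).
Proof.
move=> Hwf HvB /allP Hs Hd; apply/allP => e He; apply/implyP.
have /andP[Hne _] := allP Hwf e He.
have := Hs e He; case: e He Hne => u [[[a x] b] w] He /=.
rewrite /inE_ /= /dn /= => Hux H; rewrite !in_setU1 /okE /= /dn /dp /dq /dw /=.
case Huv: (u == v); case Hxv: (x == v) => //=.
- by move: Hux; rewrite (eqP Huv) (eqP Hxv) eqxx.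
- move=> HxB; have := Hd (a, x, b, w); rewrite mem_star -(eqP Huv) He /=.
  by move=> /(_ isT HxB).
- rewrite andbT => HuB; have := Hd (b, u, a, w); rewrite mem_star -(eqP Hxv).
  rewrite [revE _]/= /revE /= /dn /dq /dp /dw /= He orbT => /(_ isT HuB).
  by rewrite /okD /= okwC.
- by move=> HB; move: H; rewrite HB /= /okE /=.
Qed.

(* Each dart of weight [w] excludes [2(w-1)] of the ten states. *)
Lemma free_state (ds : seq dart) phi :
  {in ds, forall d, (2 <= dw d <= 5)%N} ->
  (\sum_(d <- ds) (dw d).-1 < 5)%N ->
  exists s, {in ds, forall d, okD phi s d}.
Proof.
move=> Hw Hsum.
have : (count (fun s => has (fun d => ~~ okD phi s d) ds) states < 10)%N.
  apply: (@leq_ltn_trans (\sum_(d <- ds) 2 * (dw d).-1)); last first.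
    by rewrite -big_distrr /=; lia.
  elim: ds Hw {Hsum} => [|d ds IH] Hw; first by rewrite big_nil count_pred0.
  rewrite big_cons.
  have Hd : (2 <= dw d <= 5)%N by apply: Hw; rewrite mem_head.
  rewrite -(count_okw (dp d) (act (phi (dn d)) (dq d)) Hd).
  set P := (X in (count X _ + _)%N); pose Q s := has (fun d => ~~ okD phi s d) ds.
  rewrite (eq_count (a2 := predU P Q)) //.
  apply: leq_trans (leq_addr (count (predI P Q) states) _) _.
  rewrite count_predUI.
  by rewrite leq_add2l IH // => x Hx; apply: Hw; rewrite in_cons Hx orbT.
move=> Hc; suff /hasP[s _ Hs] : has (fun s => all (okD phi s) ds) states.
  by exists s; apply/allP.
rewrite has_count; have := count_predC (fun s => all (okD phi s) ds) states.
rewrite (_ : size states = 10%N) // => Hsz.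
rewrite (_ : count (predC _) states =
   count (fun s => has (fun d => ~~ okD phi s d) ds) states) in Hsz; last first.
  by apply: eq_count => s /=; rewrite has_predC.
lia.
Qed.

End Instances.

(** * Contracting a coloured set *)

Section Contraction.
Variable V : finType.
Implicit Types (es : seq (edge V)) (A B C : {set V}) (phi f : V -> state).

(* Identifies [C], once it is coloured by [f], with its member [r]: a state of [r]
   is a dihedral motion applied to the whole colouring of [C]. *)
Definition contrE C r f (e : edge V) : edge V :=
  (if e.1 \in C then r else e.1,
   (if e.1 \in C then act (f e.1) (dp e.2) else dp e.2,
    if dn e.2 \in C then r else dn e.2,
    if dn e.2 \in C then act (f (dn e.2)) (dq e.2) else dq e.2,
    dw e.2)).
Definition contr C r f es := [seq contrE C r f e | e <- es & ~~ inE_ C e].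

Variables (C : {set V}) (r : V) (f : V -> state).
Hypothesis rC : r \in C.

Lemma wf_contr es : wf es -> wf (contr C r f es).
Proof.
move=> /allP Hwf; apply/allP => e' /mapP[e]; rewrite mem_filter => /andP[HC He] ->.
have /andP[Hne Hw] := Hwf e He; rewrite /wfE /= Hw andbT /dn /= -/(dn e.2).
move: HC; rewrite /inE_; case: ifP => HuC; case: ifP => HvC //= _.
  by apply: contraFneq HvC => <-.
by apply: contraFneq HuC => ->.
Qed.

Lemma contr_in B e : B :&: C = [set r] ->
  inE_ B (contrE C r f e) = inE_ (B :|: C) e.
Proof.
move=> BC; have rB : r \in B by have := set11 r; rewrite -BC inE => /andP[].
by rewrite /inE_ /= {2}/dn /= !inE; case: ifP; case: ifP; rewrite ?rB ?orbT ?orbF.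
Qed.

(** As [B] and [C] share one vertex, this says that the slack of [B] after contraction is the slack
    of [B :|: C] minus the slack of [C] plus 5. *)
Lemma wsum_contr es B : B :&: C = [set r] ->
  wsum es (B :|: C) = (wsum (contr C r f es) B + wsum es C)%N.
Proof.
move=> BC; rewrite /wsum /contr big_map big_filter_cond /=.
rewrite (bigID (inE_ C)) /= addnC; congr (_ + _)%N.
  by apply: eq_bigl => e; rewrite contr_in // andbC.
apply: eq_bigl => e; apply/andP/idP => [[]//|HC]; split=> //.
by move: HC => /andP[H1 H2]; rewrite /inE_ !inE H1 H2 !orbT.
Qed.

Lemma wsum_contr0 es B : [disjoint B & C] ->
  wsum (contr C r f es) B = wsum es B.
Proof.
move=> dBC; rewrite /wsum /contr big_map big_filter_cond /=.
have nrB : r \notin B by have := disjointFl dBC rC => ->.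
apply: eq_bigl => e; rewrite /inE_ /= {3}/dn /=.
case: (boolP (e.1 \in C)) => HuC; case: (boolP (dn e.2 \in C)) => HvC;
  rewrite /= ?(negbTE nrB) ?andbF //.
- by rewrite (disjointFl dBC HuC).
- by rewrite (disjointFl dBC HuC).
- by rewrite (disjointFl dBC HvC) andbF.
Qed.

Lemma sat_contr es B phi : B :&: C = [set r] -> sat es C f ->
  sat (contr C r f es) B phi ->
  sat es (B :|: C) (fun u => if u \in C then cmp (phi r) (f u) else phi u).
Proof.
move=> BC /allP HsC /allP Hs; apply/allP => e He; apply/implyP => Hin.
case: (boolP (inE_ C e)) => HC.
  have := HsC e He; rewrite HC /= /okE; case/andP: HC => -> ->.
  by rewrite !act_cmp okw_act.
have := Hs (contrE C r f e); rewrite contr_in // Hin /=.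
rewrite map_f ?mem_filter ?HC // => /(_ isT).
rewrite /okE /= /dw /dp /dn /dq /= -!/(dn _).
by case: ifP; case: ifP; rewrite ?act_cmp.
Qed.

Lemma star_contr es B v : B :&: C = [set r] -> v \in B :\: C ->
  deg (contr C r f es) B v = deg es (B :|: C) v.
Proof.
move=> BC; rewrite inE => /andP[HvC HvB].
have rB : r \in B by have := set11 r; rewrite -BC inE => /andP[].
have vr : r != v by apply: contraNneq HvC => <-.
rewrite /deg /star !count_map !count_filter.
rewrite !count_cat ?count_map ?count_filter /contr ?count_map ?count_filter.
congr (_ + _)%N; apply: eq_count => e /=.
- rewrite {1}/dn /= -/(dn _) !inE /inE_.
  case: (boolP (e.1 \in C)) => HuC /=.
    rewrite (negbTE vr) andbF /=; case: eqP => [E|]; last by rewrite andbF.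
    by rewrite E (negbTE HvC) in HuC.
  by rewrite andbT; case: ifP => Hx; rewrite ?rB ?orbT ?orbF.
- rewrite {1 3}/dn /= -!/(dn _) !inE /inE_.
  case: (boolP (dn e.2 \in C)) => HuC /=.
    rewrite (negbTE vr) andbF /=; case: eqP => [E|]; last by rewrite andbF.
    by rewrite E (negbTE HvC) in HuC.
  by rewrite andbF andbT /dn /=; case: ifP => Hx; rewrite ?rB ?orbT ?orbF.
Qed.

End Contraction.

(** * Minimal counterexamples and the growth of slack *)

Section Good.
Variable V : finType.
Implicit Types (es : seq (edge V)) (A B C : {set V}) (phi f : V -> state).

(* Slack 3 does not suffice for a cycle: its satisfiability then depends on the
   composition of the positions met along it. *)
Definition good es (B0 : {set V}) :=
  forall B, B \subset B0 -> B != set0 ->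
    (wsum es B + 3 <= 5 * #|B|)%N /\
    ((wsum es B + 3 = 5 * #|B|)%N -> {in B, forall v, deg es B v <= 2}%N ->
     exists phi, sat es B phi).

Lemma good_sub es B B' : B \subset B' -> good es B' -> good es B.
Proof. by move=> sB H C sC; apply: H; apply: subset_trans sC sB. Qed.

Lemma not_good es B0 : ~ good es B0 ->
  exists B, [/\ B \subset B0, B != set0 &
    (5 * #|B| < wsum es B + 3)%N \/
    [/\ (wsum es B + 3 = 5 * #|B|)%N, {in B, forall v, deg es B v <= 2}%N &
        ~ exists phi, sat es B phi]].
Proof.
move=> /existsNP[B] /not_implyP[sB] /not_implyP[nB] H; exists B; split=> //.
case: (leqP (wsum es B + 3) (5 * #|B|)) => Hw; last by left.
right; have [//|] : ~ (wsum es B + 3 <= 5 * #|B|)%N \/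
   ~ ((wsum es B + 3)%N = (5 * #|B|)%N ->
     {in B, forall v, deg es B v <= 2}%N -> exists phi, sat es B phi).
  by apply/not_andP.
by move=> /not_implyP[E] /not_implyP[D U].
Qed.

(** Only the number of vertices is minimal, over all edge lists on the same type: a reduction may
    add edges freely provided that a vertex disappears. All edges lie inside [V0], so stars need no
    reference to it. *)
Record mincex es (V0 : {set V}) : Prop := MinCex {
  mc_wf : wf es;
  mc_in : {in es, forall e, inE_ V0 e};
  mc_good : good es V0;
  mc_unsat : ~ exists phi, sat es V0 phi;
  mc_min : forall es' (V1 : {set V}), wf es' -> (#|V1| < #|V0|)%N ->
    good es' V1 -> exists phi, sat es' V1 phi
}.

Lemma mc_goodE es V0 B : mincex es V0 -> B \subset V0 -> B != set0 ->
  (wsum es B + 3 <= 5 * #|B|)%N /\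
  ((wsum es B + 3 = 5 * #|B|)%N -> {in B, forall v, deg es B v <= 2}%N ->
   exists phi, sat es B phi).
Proof. by move=> M; exact: (mc_good M). Qed.

Lemma mc_minE es V0 es' (V1 : {set V}) : mincex es V0 -> wf es' ->
  (#|V1| < #|V0|)%N -> good es' V1 -> exists phi, sat es' V1 phi.
Proof. by move=> M; exact: (mc_min M). Qed.

Lemma mc_starE es V0 v d : mincex es V0 -> d \in star es v ->
  v \in V0 /\ dn d \in V0.
Proof.
by move=> M; rewrite mem_star => /orP[] /(mc_in M); rewrite /inE_ /= => /andP[].
Qed.

Variables (es : seq (edge V)) (V0 : {set V}).
Hypothesis M : mincex es V0.

Lemma proper_sat B : B \proper V0 -> exists phi, sat es B phi.
Proof.
move=> pB; apply: (mc_minE M) (mc_wf M) _ _; first exact: proper_card.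
exact: good_sub (proper_sub pB) (mc_good M).
Qed.

(** Colour [A], contract it, and apply minimality: if the contracted graph were good, its colouring
    would lift to [V0]. A violating set there has slack at most 2, or slack 3 with small degrees;
    expanding the contracted vertex turns this into a drop of the slack by at least 3, or by 2, from
    [A] to a larger set. *)
Lemma slack_step A : A \proper V0 -> (1 < #|A|)%N ->
  exists B, [/\ A \proper B, B \subset V0 &
   (wsum es A + 5 * #|B| + 3 <= wsum es B + 5 * #|A|)%N \/
   (wsum es A + 5 * #|B| + 2 <= wsum es B + 5 * #|A|)%N /\
   {in B :\: A, forall v, deg es B v <= 2}%N].
Proof.
move=> pA cA; have [f Hf] := proper_sat pA.
have [r rA] : exists r, r \in A by apply/card_gt0P; lia.
pose V1 := r |: (V0 :\: A).
have cV1 : (#|V1| < #|V0|)%N.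
  rewrite /V1 cardsU1 !inE rA /= cardsDS ?proper_sub //.
  by have := subset_leq_card (proper_sub pA); lia.
have V1A : V1 :&: A = [set r].
  apply/setP => x; rewrite !inE; case: eqP => [->|_] //=.
  by case: (x \in A); rewrite ?andbF.
have V1U : V1 :|: A = V0.
  apply/setP => x; rewrite !inE; case: eqP => [->|_] /=.
    by rewrite (subsetP (proper_sub pA)).
  case: (boolP (x \in A)) => //= Hx; first by rewrite (subsetP (proper_sub pA)).
  by rewrite orbF.
have nsat : ~ exists phi, sat (contr A r f es) V1 phi.
  move=> [phi Hphi]; apply: (mc_unsat M); rewrite -V1U.
  by eexists; apply: sat_contr Hphi.
have /not_good[B [sB nB HB]] : ~ good (contr A r f es) V1.
  by move=> /(mc_minE M (wf_contr f rA (mc_wf M)) cV1).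
(* A violating set without [r] is disjoint from [A] and untouched by the contraction; it is proper
   in [V0], so it is satisfiable and has the slack required by [good]. *)
have rB : r \in B.
  case: (boolP (r \in B)) => // nrB; exfalso.
  have dBA : [disjoint B & A].
    rewrite disjoint_subset; apply/subsetP => x Hx; rewrite inE.
    have := subsetP sB x Hx; rewrite !inE; case: eqP => [E|_ /andP[]//].
    by rewrite -E Hx in nrB.
  have sB0 : B \subset V0.
    by apply: subset_trans sB _; rewrite -V1U subsetUl.
  have [H1 H2] := mc_goodE M sB0 nB.
  rewrite (wsum_contr0 f rA es dBA) in HB; case: HB => [|[E _ U]]; first lia.
  apply: U; have [|phi Hphi] := @proper_sat B.
    rewrite properEneq sB0 andbT; apply: contraNneq nrB => ->.
    exact: (subsetP (proper_sub pA)).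
  exists phi; apply/allP => e' /mapP[e]; rewrite mem_filter => /andP[HA He] ->.
  apply/implyP => HinB.
  have [E1 E2] : (e.1 \in A) = false /\ (dn e.2 \in A) = false.
    move: HinB; rewrite /inE_ /= {1}/dn /=.
    by case: ifP; case: ifP; rewrite ?(negbTE nrB) ?andbF.
  have Ee : contrE A r f e = e.
    by rewrite /contrE E1 E2; case: (e) => [? [[[? ?] ?] ?]].
  by move: HinB; rewrite Ee => HinB; have := allP Hphi e He; rewrite HinB.
have BA : B :&: A = [set r].
  apply/setP => x; rewrite !inE; case: (boolP (x \in B)) => /= Hx; last first.
    by case: eqP => // E; rewrite E rB in Hx.
  have := subsetP sB x Hx; rewrite !inE; case: eqP => [->|_ /andP[/negbTE]] //.
have sBU : B :|: A \subset V0 by rewrite -V1U setSU.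
have cBU : (#|B :|: A| = #|B| + #|A| - 1)%N.
  by have := cardsUI B A; rewrite BA cards1; lia.
have B1 : (0 < #|B|)%N by rewrite card_gt0.
have EW := wsum_contr f es BA.
(* The contracted vertex alone has slack 5, since the edges inside [A] are dropped; so the violating
   set has another vertex. *)
have pBU : A \proper B :|: A.
  rewrite properEcard subsetUr /= cBU; suff: (1 < #|B|)%N by lia.
  rewrite ltnNge; apply/negP => cB.
  have EB : B = [set r].
    by apply/eqP; rewrite eq_sym eqEcard sub1set rB cards1.
  have E0 : wsum (contr A r f es) B = 0%N.
    have : wsum es (B :|: A) = wsum es A.
      by congr wsum; rewrite EB; apply/setUidPr; rewrite sub1set.
    by lia.
  rewrite E0 EB cards1 in HB; case: HB => [|[]]; by [|lia].
exists (B :|: A); split=> //.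
case: HB => [HB|[HB HD _]]; first by left; lia.
right; split; first lia.
move=> v; rewrite !inE => /andP[nvA /orP[vB|vA]]; last by rewrite vA in nvA.
rewrite -(@star_contr _ A r f rA) //; first exact: HD.
by rewrite !inE nvA vB.
Qed.

(** Iterating [slack_step] climbs to [V0], whose slack is at least 3, and every step lowers the
    slack by at least 2. Slack 5 therefore leaves room for only one step, of the second kind,
    straight to [V0]. *)
Lemma slack_ge5 A : A \proper V0 -> (1 < #|A|)%N ->
  (wsum es A + 5 <= 5 * #|A|)%N /\
  ((wsum es A + 5 = 5 * #|A|)%N -> (wsum es V0 + 3 = 5 * #|V0|)%N /\
    {in V0 :\: A, forall v, deg es V0 v <= 2}%N).
Proof.
have [n] := ubnP (#|V0| - #|A|); elim: n => // n IHn in A * => Hn pA cA.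
have [B [pAB sB HB]] := slack_step pA cA.
have cAB := proper_card pAB.
case: (eqVneq B V0) => [EB|nB].
  rewrite EB in HB.
  have [] := mc_goodE M (subxx V0); last first.
    by move=> Hw _; case: HB => [HB|[HB HD]]; split; (lia || move=> E; split=> //; lia).
  by rewrite -card_gt0 -EB; lia.
have pB : B \proper V0 by rewrite properEneq nB.
have cBV := proper_card pB.
have [H5 _] : (wsum es B + 5 <= 5 * #|B|)%N /\
  ((wsum es B + 5 = 5 * #|B|)%N -> (wsum es V0 + 3 = 5 * #|V0|)%N /\
    {in V0 :\: B, forall v, deg es V0 v <= 2}%N).
  by apply: IHn => //; lia.
by case: HB => [|[HB _]]; split; lia.
Qed.

End Good.

Definition allw (P : nat -> bool) := all P [:: 2; 3; 4; 5].
(** Weight 0 encodes the absence of an edge: [okw 0] always holds. *)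
Definition exw (P : nat -> bool) :=
  if P 0%N then true else if P 2 then true else if P 3 then true else
  if P 4 then true else P 5.

Lemma allwP P w : allw P -> (2 <= w <= 5)%N -> P w.
Proof.
by move=> /allP H Hw; apply: H; case: w Hw => [|[|[|[|[|[|w]]]]]].
Qed.

Lemma exwP P : exw P -> exists w, [/\ (w == 0) || (2 <= w <= 5)%N & P w].
Proof.
move=> H; have /hasP[w Hw HP] : has P [:: 0; 2; 3; 4; 5].
  by move: H; rewrite /exw /= orbF; case: (P 0%N) => //; case: (P 2) => //; case: (P 3) => //; case: (P 4).
by exists w; split=> //; rewrite !inE in Hw; lia. Qed.

(** Two edges at the same position are a path of length [10 - w1 - w2], which an edge of weight
    [w1 + w2 - 5] expresses exactly. At different positions the middle vertex can turn, and a
    strictly lighter edge suffices. *)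
Lemma suppress_fact p1 p2 w1 w2 :
  (2 <= w1 <= 5)%N -> (2 <= w2 <= 5)%N -> (7 <= w1 + w2 <= 9)%N ->
  exists w, [/\ (w == 0) || (2 <= w <= 5)%N,
    forall x y, okw w x y ->
      exists s, okw w1 (act s p1) x && okw w2 (act s p2) y &
    (w + 5 < w1 + w2)%N \/ [/\ p1 = p2, (w + 5 = w1 + w2)%N &
      forall s x y, okw w1 (act s p1) x -> okw w2 (act s p2) y -> okw w x y]].
Proof.
pose T w1 w2 p1 p2 w :=
  all5 (fun x => all5 (fun y => okw w x y ==>
    exS (fun s => okw w1 (act s p1) x && okw w2 (act s p2) y))) &&
  ((w + 5 < w1 + w2)%N || [&& p1 == p2, (w + 5 == w1 + w2)%N &
   allS (fun s => all5 (fun x => all5 (fun y =>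
     okw w1 (act s p1) x ==> okw w2 (act s p2) y ==> okw w x y)))]).
have H : allw (fun w1 => allw (fun w2 => (7 <= w1 + w2 <= 9)%N ==>
   all5 (fun p1 => all5 (fun p2 => exw (T w1 w2 p1 p2))))).
  by vm_compute.
move=> /(allwP H) /= {}H /(allwP H) /= /implyP{}H /H /all5P/(_ p1)/all5P/(_ p2).
move=> /exwP[w [Hw /andP[H1 H2]]]; exists w; split=> //.
  by move=> x y Hxy; have /implyP/(_ Hxy)/exSP := all5P _ (all5P _ H1 x) y.
case/orP: H2 => [|/and3P[/eqP-> /eqP-> H2]]; [by left|right; split=> // s x y Hx Hy].
by move: (all5P _ (all5P _ (allSP _ H2 s) x) y); rewrite Hx Hy.
Qed.

(** A pair of parallel edges of total weight 7 is the shortest cycle of slack 3; it can be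
    unsatisfiable only if the two positions agree at both ends. *)
Lemma digon_fact p1 p2 x1 x2 w1 w2 : p1 != p2 ->
  (2 <= w1 <= 5)%N -> (2 <= w2 <= 5)%N -> (w1 + w2 = 7)%N ->
  forall t, exists s, okw w1 (act s p1) (act t x1) && okw w2 (act s p2) (act t x2).
Proof.
have H : allw (fun w1 => allw (fun w2 => (w1 + w2 == 7)%N ==>
  all5 (fun p1 => all5 (fun p2 => (p1 != p2) ==> all5 (fun x1 => all5 (fun x2 =>
   exS (fun s => okw w1 (act s p1) x1 && okw w2 (act s p2) x2))))))).
  by vm_compute.
move=> Hp /(allwP H) /= {}H /(allwP H) /= /implyP{}H /eqP/H.
move=> /all5P/(_ p1)/all5P/(_ p2)/implyP/(_ Hp) H' t.
by apply/exSP; apply: (all5P _ (all5P _ H' _) _).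
Qed.

Section Mult.
Variable V : finType.
Implicit Types (es : seq (edge V)) (A B C : {set V}) (phi f : V -> state).

Definition mult es u v := count (fun d => dn d == v) (star es u).

Lemma multC es u v : mult es u v = mult es v u.
Proof.
rewrite /mult /star !count_map !count_filter !count_cat !count_map addnC.
by congr (_ + _)%N; apply: eq_count => e /=; rewrite andbC.
Qed.

Lemma degU1 es B v x : v \notin B ->
  deg es (v |: B) x = (mult es x v + deg es B x)%N.
Proof.
move=> HvB; rewrite /deg /mult -count_predUI.
rewrite [X in (_ + X)%N](_ : _ = 0%N) ?addn0; last first.
  apply/eqP; rewrite eqn0Ngt -has_count; apply/hasPn => d _ /=.
  by apply/negP => /andP[/eqP ->]; rewrite (negbTE HvB).
by apply: eq_count => d /=; rewrite !inE.
Qed.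

Lemma deg_cat es es' B x : deg (es ++ es') B x = (deg es B x + deg es' B x)%N.
Proof. by rewrite /deg -count_cat; apply/permP; exact: star_cat. Qed.

Lemma deg_sub es A B x : A \subset B -> (deg es A x <= deg es B x)%N.
Proof. by move=> /subsetP sAB; apply: sub_count => d /= /sAB. Qed.

Lemma deg1 e B x : deg [:: e] B x =
  (((e.1 == x) && (dn e.2 \in B)) + ((dn e.2 == x) && (e.1 \in B)))%N.
Proof.
rewrite /deg /star count_map count_filter /= addn0.
by rewrite /dn /= andbC [in X in (_ + X)%N]andbC.
Qed.

Definition optE (w : nat) (e : edge V) := if w == 0%N then [::] else [:: e].

Lemma wsum1 e B : wsum [:: e] B = if inE_ B e then dw e.2 else 0%N.
Proof. by rewrite /wsum big_cons big_nil addn0. Qed.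

Lemma wsum_set1 es v : wf es -> wsum es [set v] = 0%N.
Proof.
move=> /allP Hw; rewrite /wsum big1_seq // => e /andP[/andP[]].
by rewrite !inE => /eqP E1 /eqP E2 /Hw /andP[]; rewrite E1 E2 eqxx.
Qed.

Lemma wsum2 es u v : wf es -> u != v ->
  wsum es [set u; v] = (\sum_(d <- star es u | dn d == v) dw d)%N.
Proof.
move=> Hw uv; rewrite wsum_star ?inE // (wsum_set1 v Hw).
by apply: eq_bigl => d; rewrite !inE.
Qed.

Lemma sat0 es phi : sat es set0 phi.
Proof. by apply/allP => e _; rewrite /inE_ !inE. Qed.

End Mult.

(** * Minimum degree three *)

Section MinCex.
Variable V : finType.
Implicit Types (es : seq (edge V)) (A B C : {set V}) (phi f : V -> state).

Variables (es : seq (edge V)) (V0 : {set V}).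
Hypothesis M : mincex es V0.

Lemma deg_V0 v : deg es V0 v = size (star es v).
Proof.
apply/eqP; rewrite /deg -all_count; by apply/allP => d /(mc_starE M)[_].
Qed.

(** Otherwise any colouring of the other vertices leaves one of the ten states free at [v]. *)
Lemma excess_ge5 v : v \in V0 -> (5 <= \sum_(d <- star es v) (dw d).-1)%N.
Proof.
move=> vV; rewrite leqNgt; apply/negP => Hlt; apply: (mc_unsat M).
have [phi Hphi] := proper_sat M (properD1 vV).
have [|s Hs] := @free_state _ (star es v) phi _ Hlt.
  by move=> d /(star_wf (mc_wf M))/andP[].
rewrite -(setD1K vV); eexists; apply: sat_ext (mc_wf M) _ Hphi _; first by rewrite !inE eqxx.
by move=> d Hd _; apply: Hs.
Qed.

Lemma regular_sat : (wsum es V0 + 3 = 5 * #|V0|)%N ->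
  {in V0, forall v, deg es V0 v <= 2}%N -> V0 = set0.
Proof.
move=> H3 H2; apply/eqP/negPn/negP => n0; apply: (mc_unsat M).
by have [_] := mc_goodE M (subxx V0) n0; apply.
Qed.

(** A single dart cannot have excess 5. For two darts the vertex is suppressed: the edge that
    replaces it keeps the smaller graph good, and a colouring of that graph extends back. *)
Lemma star_ge3 v : v \in V0 -> (2 < size (star es v))%N.
Proof.
move=> vV; rewrite ltnNge; apply/negP => Hsz.
have n0 : V0 != set0 by apply/set0Pn; exists v.
have HR := excess_ge5 vV.
have Hw d : d \in star es v -> (dn d != v) && (2 <= dw d <= 5)%N by exact: (star_wf (mc_wf M)).
have HV d : d \in star es v -> dn d \in V0 by case/(mc_starE M).
have Hdeg := deg_V0 v.
case Es : (star es v) Hsz HR Hw HV Hdeg => [|d1 [|d2 [|]]] //= _.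
- by rewrite big_nil.
- rewrite big_seq1 => H5 /(_ d1); rewrite mem_head => /(_ isT) /andP[_]; lia.
rewrite big_cons big_seq1 => HR Hw HV degv.
have /andP[n1v w1] := Hw d1 (mem_head _ _).
have /andP[n2v w2] : (dn d2 != v) && (2 <= dw d2 <= 5)%N.
  by apply: Hw; rewrite !inE eqxx orbT.
have n1V := HV d1 (mem_head _ _).
have n2V : dn d2 \in V0 by apply: HV; rewrite !inE eqxx orbT.
have Wp x : x != v -> wsum es [set v; x] =
    (\sum_(d <- [:: d1; d2] | dn d == x) dw d)%N.
  by move=> xv; rewrite (wsum2 (mc_wf M)) 1?eq_sym // Es.
have sub2 x : x \in V0 -> [set v; x] \subset V0.
  by move=> xV; rewrite subUset !sub1set vV.
(* With a common neighbour, excess 5 gives the pair total weight at least 7, hence slack 3: the pair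
   is the whole graph or contradicts [slack_ge5]. *)
case: (eqVneq (dn d1) (dn d2)) => [E12|n12].
  have := Wp (dn d2) n2v; rewrite !big_cons big_nil E12 eqxx addn0 => W.
  have c2 : #|[set v; dn d2]| = 2%N by rewrite cards2 eq_sym n2v.
  have [Hw3 _] : (wsum es [set v; dn d2] + 3 <= 5 * #|[set v; dn d2]|)%N /\ True.
    by split=> //; have [] := mc_goodE M (sub2 _ n2V) (_ : [set v; dn d2] != set0) => //;
      rewrite -card_gt0 c2.
  case: (eqVneq [set v; dn d2] V0) => [EV|nV].
    suff : V0 = set0 by move/eqP; rewrite (negbTE n0).
    apply: regular_sat; first by rewrite -EV W c2; lia.
    move=> x; rewrite -EV !inE => /orP[/eqP ->|/eqP ->].
      by rewrite EV degv.
    have dv0 : deg es [set dn d2] (dn d2) = 0%N.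
      apply/eqP; rewrite -leqn0 leqNgt -has_count; apply/hasPn => d.
      by move=> /(star_wf (mc_wf M))/andP[]; rewrite inE.
    rewrite degU1 ?inE 1?eq_sym // dv0 addn0 multC /mult Es.
    by apply: leq_trans (count_size _ _) _.
  have pV : [set v; dn d2] \proper V0 by rewrite properEneq nV sub2.
  have [] := slack_ge5 M pV; rewrite c2 //; lia.
have E1 := Wp _ n1v; have E2 := Wp _ n2v.
rewrite !big_cons big_nil eqxx [dn d2 == _]eq_sym (negbTE n12) addn0 in E1.
rewrite !big_cons big_nil eqxx (negbTE n12) addn0 in E2.
(* Two edges of weight 5 make both pairs tight in [slack_ge5]; together the two equality clauses
   bound all degrees by 2, which [regular_sat] excludes. *)
case: (leqP (dw d1 + dw d2) 9) => w12; last first.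
  suff : V0 = set0 by move/eqP; rewrite (negbTE n0).
  have P x y : x \in V0 -> y \in V0 -> x != v -> y != v -> y != x ->
      wsum es [set v; x] = 5 -> (wsum es V0 + 3 = 5 * #|V0|)%N /\
      {in V0 :\: [set v; x], forall z, deg es V0 z <= 2}%N.
    move=> xV yV xv yv yx E.
    have pV : [set v; x] \proper V0.
      rewrite properE sub2 //=; apply/subsetPn; exists y => //.
      by rewrite !inE negb_or yv yx.
    have c2 : #|[set v; x]| = 2%N by rewrite cards2 eq_sym xv.
    by have [] := slack_ge5 M pV; rewrite c2 // => _; apply; rewrite E.
  have n21 : dn d2 != dn d1 by rewrite eq_sym.
  have [H3 D1] := P _ _ n1V n2V n1v n2v n21 ltac:(lia).
  have [_ D2] := P _ _ n2V n1V n2v n1v n12 ltac:(lia).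
  apply: regular_sat => // x xV.
  case: (eqVneq x v) => [->|xv]; first by rewrite degv.
  case: (eqVneq x (dn d1)) => [->|x1].
    by apply: D2; rewrite !inE negb_or n1v n12.
  by apply: D1; rewrite !inE negb_or xv x1.
have [w [ww Hex Hw']] := suppress_fact (dp d1) (dp d2) w1 w2 ltac:(lia).
have w125 : (w + 5 <= dw d1 + dw d2)%N by case: Hw' => [/ltnW//|[_ -> _]].
pose new : edge V := (dn d1, (dq d1, dn d2, dq d2, w)).
pose es' := es ++ optE w new.
have wf' : wf es'.
  rewrite wf_cat (mc_wf M) /= /optE; case: eqP => //= w0; rewrite andbT /wfE /= n12.
  by move: ww; rewrite /dw /=; lia.
have vV1 : v \notin V0 :\ v by rewrite !inE eqxx.
have [phi Hphi] : exists phi, sat es' (V0 :\ v) phi.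
  apply: (mc_minE M) => //; first exact: proper_card (properD1 vV).
  move=> B sB nB.
  have sBV : B \subset V0 := subset_trans sB (subsetDl _ _).
  have vB : v \notin B by apply: contra vV1; apply: (subsetP sB).
  have [W3 Hs] := mc_goodE M sBV nB.
  have same : wsum (optE w new) B = 0%N ->
      (wsum es' B + 3 <= 5 * #|B|)%N /\
      ((wsum es' B + 3)%N = (5 * #|B|)%N ->
       {in B, forall x, deg es' B x <= 2}%N -> exists phi, sat es' B phi).
    rewrite /es' wsum_cat => E0; rewrite E0 addn0; split=> // H3 HD.
    have [|phi Hphi] := Hs H3.
      by move=> x xB; apply: leq_trans (HD x xB); rewrite deg_cat leq_addr.
    exists phi; rewrite sat_cat Hphi /=; apply/allP => e He; apply/implyP => inB.
    have : (0 < wsum (optE w new) B)%N.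
      move: He; rewrite /optE; case: eqP => // /eqP w0; rewrite inE => /eqP Ee.
      by rewrite Ee in inB; rewrite wsum1 inB lt0n.
    by rewrite E0.
  case: (posnP (wsum (optE w new) B)) => [/same//|].
  rewrite {1}/optE; case: eqP => [_|/eqP w0]; first by rewrite /wsum big_nil.
  rewrite wsum1; case: ifP => // inB _.
  have [/= n1B n2B] := andP inB.
  have W' : wsum es' B = (wsum es B + w)%N.
    by rewrite /es' wsum_cat /optE (negbTE w0) wsum1 inB.
  have Wv : wsum es (v |: B) = (wsum es B + (dw d1 + dw d2))%N.
    by rewrite (wsum_star (mc_wf M)) // Es !big_cons big_nil n1B [dn d2 \in B]n2B addn0.
  have sv : v |: B \subset V0 by rewrite subUset sub1set vV.
  have cv : #|v |: B| = #|B|.+1 by rewrite cardsU1 vB.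
  have [|Wv3 Hsv] := mc_goodE M sv; first by rewrite -card_gt0 cv.
  split; first by clear -W' Wv Wv3 cv w125; lia.
  (* Slack 3 through the new edge forces the exact case, in which [v |: B] is a cycle of slack 3 in
     the old graph; its colouring satisfies the new edge by the converse part of [suppress_fact]. *)
  move=> E3 HD; have [w12'|[Ep w12' Hcomp]] := Hw'.
    by clear -W' Wv Wv3 cv w12' E3; lia.
  have [|x|phi Hphi] := Hsv; first by clear -W' Wv Wv3 cv w12' E3; lia.
    rewrite degU1 // !inE => /orP[/eqP ->|xB].
      have -> : mult es v v = 0%N.
        apply/eqP; rewrite -leqn0 leqNgt -has_count; apply/hasPn => d.
        by move=> /(star_wf (mc_wf M))/andP[/negbTE ->].
      rewrite -degv deg_sub //.
    apply: leq_trans (HD x xB).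
    rewrite /es' deg_cat multC /mult Es /= addn0 addnC leq_add2l.
    by rewrite /optE (negbTE w0) deg1 /= [dn new.2]/(dn d2) n1B n2B !andbT.
  exists phi; rewrite sat_cat (sat_sub _ Hphi) ?subsetUr //=.
  rewrite /optE (negbTE w0) /sat /= andbT inB /= /okE /=.
  have star_ok d : d \in star es v -> dn d \in B -> okD phi (phi v) d.
    rewrite mem_star => /orP[] Hd dB; have := allP Hphi _ Hd;
      rewrite ?inE_rev /inE_ /= !inE eqxx dB orbT /= ?okE_rev; exact.
  apply: Hcomp (phi v) _ _ _ _.
    by apply: star_ok => //; rewrite Es mem_head.
  by apply: star_ok => //; rewrite Es !inE eqxx orbT.
have Hphi' : sat es (V0 :\ v) phi by move: Hphi; rewrite sat_cat => /andP[].
have [s Hs] : exists s, okD phi s d1 && okD phi s d2.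
  apply: Hex; move: Hphi; rewrite sat_cat /optE => /andP[_].
  case: eqP => [->|_]; first by case: (act _ _) (act _ _) => [] [].
  by rewrite /sat /= andbT /inE_ /= !inE n1v n1V [dn new.2]/(dn d2) n2v n2V.
apply: (mc_unsat M); rewrite -(setD1K vV); eexists; apply: (sat_ext (s := s) (mc_wf M) vV1 Hphi').
by move=> d; rewrite Es !inE => /orP[/eqP ->|/eqP ->] _; case/andP: Hs.
Qed.

(** Slack 5 would leave outside [A] a vertex with at most two darts. *)
Lemma slack_ge6 A : A \proper V0 -> (1 < #|A|)%N -> (wsum es A + 6 <= 5 * #|A|)%N.
Proof.
move=> pA cA; have [H5 H5'] := slack_ge5 M pA cA.
rewrite leqNgt; apply/negP => Hlt.
have E5 : (wsum es A + 5 = 5 * #|A|)%N by clear -H5 Hlt; lia.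
have [_ D] := H5' E5.
have /properP[_ [x xV xA]] := pA.
have /D : x \in V0 :\: A by rewrite !inE xA xV.
by rewrite deg_V0 leqNgt star_ge3.
Qed.

End MinCex.

(** * Slack seven at a vertex with two darts at one position *)

Lemma uncross_fact w1 w2 : (2 <= w1 <= 4)%N -> (2 <= w2 <= 4)%N ->
  exists w, [/\ (w == 0) || (2 <= w <= 5)%N, (w == 0) || (w + 3 <= w1 + w2)%N &
   forall x y, okw w x y -> exists t, forall z, okw 4 z t ->
     okw w1 z x && okw w2 z y].
Proof.
pose T w1 w2 w := ((w == 0) || (w + 3 <= w1 + w2)%N) &&
  all5 (fun x => all5 (fun y => okw w x y ==> ex5 (fun t => all5 (fun z =>
    okw 4 z t ==> okw w1 z x && okw w2 z y)))).
have H : all (fun w1 => all (fun w2 => exw (T w1 w2)) [:: 2; 3; 4]) [:: 2; 3; 4].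
  by vm_compute.
move=> H1 H2; have {}H1 : w1 \in [:: 2; 3; 4] by rewrite !inE; lia.
have {}H2 : w2 \in [:: 2; 3; 4] by rewrite !inE; lia.
have /exwP[w [ww /andP[w3 Hw]]] := allP (allP H _ H1) _ H2.
exists w; split=> // x y; move: (all5P _ (all5P _ Hw x) y) => /implyP{}Hw /Hw.
by move=> /ex5P[t /all5P Ht]; exists t => z; apply/implyP.
Qed.

Lemma act_surj s y : exists z, act s z = y.
Proof.
have : allS (fun s => all5 (fun y => ex5 (fun z => act s z == y))) by vm_compute.
by move=> /allSP/(_ s)/all5P/(_ y)/ex5P[z /eqP]; exists z.
Qed.

Section Uncross.
Variable V : finType.
Implicit Types (es : seq (edge V)) (A B C : {set V}) (phi f : V -> state).

Definition cross v C (e : edge V) :=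
  ((e.1 == v) && (dn e.2 \in C)) || ((dn e.2 == v) && (e.1 \in C)).
Definition uncross es v C := [seq e <- es | ~~ cross v C e].

Lemma star_uncross es v C : wf es -> v \notin C ->
  star (uncross es v C) v = [seq d <- star es v | dn d \notin C].
Proof.
move=> /allP Hwf vC; rewrite /star /uncross !filter_cat !map_cat !filter_cat.
have E1 (s : seq (edge V)) : {subset s <= es} ->
   [seq e.2 | e <- [seq e <- s | ~~ cross v C e] & e.1 == v] =
   [seq d <- [seq e.2 | e <- s & e.1 == v] | dn d \notin C].
  move=> Hs; rewrite filter_map -!filter_predI; congr map.
  apply: eq_in_filter => e /Hs/Hwf/andP[Hne _] /=; rewrite /cross.
  case: eqP => [E|_]; rewrite ?andbF //= andbT.
  by rewrite -E [dn _ == _]eq_sym (negbTE Hne) /= orbF.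
rewrite E1 //; congr cat.
rewrite !filter_map -!map_comp -!filter_predI; congr map.
apply: eq_in_filter => e /Hwf/andP[Hne _] /=; rewrite /cross /= -/(dn _).
rewrite {1 3}/dn /= -/(dn e.2).
case: (eqVneq (dn e.2) v) => [E|_]; rewrite ?andbF //= !andbT.
by rewrite -E (negbTE Hne).
Qed.

Lemma star_uncross0 es v C u : u != v -> u \notin C ->
  star (uncross es v C) u = star es u.
Proof.
move=> uv uC; rewrite /star /uncross !filter_cat !map_cat.
rewrite -filter_predI !filter_map -filter_predI; congr cat; congr map.
  apply: eq_filter => e /=; rewrite /cross; case: eqP => //= ->.
  by rewrite (negbTE uv) (negbTE uC) andbF.
congr map; apply: eq_filter => e /=; rewrite /cross; case: eqP => //= ->.
by rewrite (negbTE uv) (negbTE uC) andbF.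
Qed.

Lemma wf_uncross es v C : wf es -> wf (uncross es v C).
Proof. by move=> /allP H; apply/allP => e; rewrite mem_filter => /andP[_ /H]. Qed.

Lemma wsum_uncross0 es v C B : v \notin B -> wsum (uncross es v C) B = wsum es B.
Proof.
move=> vB; rewrite /wsum /uncross big_filter_cond; apply: eq_bigl => e.
rewrite /inE_ /cross; case: eqP => [->|_]; first by rewrite (negbTE vB) andbF.
by case: eqP => [->|_] //=; rewrite (negbTE vB) andbF andbF.
Qed.

Lemma wsum_uncross es v C B : wf es -> v \notin C -> v \notin B -> C \subset B ->
  wsum es (v |: B) = (wsum (uncross es v C) (v |: B) +
    \sum_(d <- star es v | dn d \in C) dw d)%N.
Proof.
move=> Hw vC vB sCB; rewrite !wsum_star ?wf_uncross // wsum_uncross0 //.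
rewrite star_uncross // -addnA; congr (_ + _)%N.
rewrite big_filter_cond (bigID (fun d => dn d \in C)) /= addnC; congr (_ + _)%N.
  by apply: eq_bigl => d; rewrite andbC.
apply: eq_bigl => d; case: (boolP (dn d \in C)) => // dC; rewrite ?andbF //.
by rewrite (subsetP sCB).
Qed.

Lemma wsum_uncross_disj es v C B : [disjoint B & C] ->
  wsum (uncross es v C) B = wsum es B.
Proof.
move=> dBC; rewrite /wsum /uncross big_filter_cond; apply: eq_bigl => e.
rewrite /inE_ /cross; case: (boolP (e.1 \in B)) => H1; rewrite ?andbF //.
case: (boolP (dn e.2 \in B)) => H2; rewrite ?andbF //.
by rewrite (disjointFr dBC H1) (disjointFr dBC H2) !andbF.
Qed.

End Uncross.

Section Slack7.
Variable V : finType.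
Implicit Types (es : seq (edge V)) (A B C D : {set V}) (phi f : V -> state).
Variables (es : seq (edge V)) (V0 : {set V}).
Hypothesis M : mincex es V0.

(** On two vertices all darts at [v] lead to the other one. Their total weight is excess plus
    number, at least 5 + 3, while slack 3 allows only 7. *)
Lemma card_V0 : V0 != set0 -> (2 < #|V0|)%N.
Proof.
move=> /[dup] n0 /set0Pn[v vV]; rewrite ltnNge; apply/negP => c2.
have d3v := star_ge3 M vV; have [u uV uv] : exists2 u, u \in V0 & u != v.
  case Es: (star es v) d3v => [|d s] // _.
  have dS : d \in star es v by rewrite Es mem_head.
  exists (dn d); first by case: (mc_starE M dS).
  by case/andP: (star_wf (mc_wf M) dS).
have EV : V0 = [set v; u].
  by apply/esym/eqP; rewrite eqEcard subUset !sub1set vV uV cards2 eq_sym uv.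
have [W3 _] := mc_goodE M (subxx V0) n0.
have W : wsum es V0 = (\sum_(d <- star es v) dw d)%N.
  rewrite EV (wsum2 (mc_wf M)) 1?eq_sym //; rewrite big_seq_cond [RHS]big_seq.
  apply: eq_bigl => d; rewrite andbC; case: (boolP (d \in star es v)) => dS; rewrite ?andbF //.
  have [_] := mc_starE M dS; have /andP[/negbTE nv _] := star_wf (mc_wf M) dS.
  by rewrite EV !inE nv andbT.
have W' : (\sum_(d <- star es v) dw d =
    \sum_(d <- star es v) (dw d).-1 + size (star es v))%N.
  rewrite -sum1_size -big_split /= big_seq [RHS]big_seq; apply: eq_bigr => d.
  by move=> /(star_wf (mc_wf M))/andP[_]; lia.
have := excess_ge5 M vV; rewrite EV cards2 eq_sym uv in W3; rewrite EV in W; lia.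
Qed.

Lemma subset5 D : D \proper V0 -> D != set0 -> (wsum es D + 5 <= 5 * #|D|)%N.
Proof.
move=> pD nD; case: (leqP #|D| 1) => [c1|c1]; last first.
  by have := slack_ge6 M pD c1; lia.
have /cards1P[x ->] : #|D| == 1 by rewrite eqn_leq c1 card_gt0.
by rewrite cards1 (wsum_set1 _ (mc_wf M)).
Qed.

(** The two ends of an edge of weight 5 would have slack at most 5. *)
Lemma w4 v d : d \in star es v -> (2 <= dw d <= 4)%N.
Proof.
move=> dS; have [vV nV] := mc_starE M dS.
have /andP[nv /andP[w2 w5]] := star_wf (mc_wf M) dS; rewrite w2 /=.
have c3 : (2 < #|V0|)%N by apply: card_V0; apply/set0Pn; exists v.
have c2 : #|[set v; dn d]| = 2%N by rewrite cards2 eq_sym nv.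
have := @slack_ge6 _ _ _ M [set v; dn d]; rewrite c2 => /(_ _ isT).
rewrite (wsum2 (mc_wf M)) 1?eq_sym // (perm_big _ (perm_to_rem dS)) /= big_cons eqxx.
suff -> : [set v; dn d] \proper V0 by move=> /(_ isT); lia.
by rewrite properEcard subUset !sub1set vV nV c2.
Qed.

(** If the slack were 6, the vertex [v] could be detached: [A :\ v] is coloured under one extra edge
    between the two neighbours, so that all edges from [v] to it can be traded for a single edge of
    weight 4, and is then contracted. The contracted graph is smaller and still good. *)
Lemma slack_ge7_exit A v d1 d2 : A \proper V0 -> v \in A ->
  perm_eq [seq d <- star es v | dn d \in A] [:: d1; d2] ->
  dp d1 = dp d2 -> dn d1 != dn d2 ->
  (exists2 d, d \in star es v & dn d \notin A) ->
  (wsum es A + 7 <= 5 * #|A|)%N.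
Proof.
move=> pA vA Hp Epos n12 [d0 d0S d0A].
have vV : v \in V0 by apply: (subsetP (proper_sub pA)).
have dS x : x \in [:: d1; d2] -> x \in star es v /\ dn x \in A.
  by rewrite -(perm_mem Hp) mem_filter => /andP[].
have [d1S d1A] : d1 \in star es v /\ dn d1 \in A by apply: dS; rewrite mem_head.
have [d2S d2A] : d2 \in star es v /\ dn d2 \in A by apply: dS; rewrite !inE eqxx orbT.
have /andP[n1v _] := star_wf (mc_wf M) d1S.
have /andP[n2v _] := star_wf (mc_wf M) d2S.
pose C := A :\ v.
have vC : v \notin C by rewrite !inE eqxx.
have n1C : dn d1 \in C by rewrite !inE n1v.
have n2C : dn d2 \in C by rewrite !inE n2v.
have EA : v |: C = A by rewrite /C setD1K.
have sumC : (\sum_(d <- star es v | dn d \in C) dw d = dw d1 + dw d2)%N.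
  have -> : (\sum_(d <- star es v | dn d \in C) dw d =
             \sum_(d <- [seq d <- star es v | dn d \in A]) dw d)%N.
    rewrite big_filter big_seq_cond [RHS]big_seq_cond; apply: eq_bigl => d.
    case: (boolP (d \in star es v)) => // dv; rewrite !inE.
    by have /andP[-> _] := star_wf (mc_wf M) dv.
  by rewrite (perm_big _ Hp) /= !big_cons big_nil addn0.
have WA : wsum es A = (wsum es C + (dw d1 + dw d2))%N.
  by rewrite -EA (wsum_star (mc_wf M)) // sumC.
have cA : #|A| = #|C|.+1 by rewrite -EA cardsU1 vC.
have cC : (1 < #|C|)%N.
  by apply/card_gt1P; exists (dn d1), (dn d2).
have pC : C \proper V0 by apply: sub_proper_trans pA; apply: subsetDl.
have W6 := slack_ge6 M pA ltac:(blia).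
rewrite leqNgt; apply/negP => W7.
have {W6 W7} W6 : (wsum es A + 6 = 5 * #|A|)%N by blia.
(* The edge [new] of weight [w] guarantees a colour [t] all of whose neighbours on the pentagon
   satisfy both darts of [v] into [A]. *)
have [w [ww w12 Hw]] := uncross_fact (w4 d1S) (w4 d2S).
pose new : edge V := (dn d1, (dq d1, dn d2, dq d2, w)).
have [f Hf] : exists f, sat (es ++ optE w new) C f.
  apply: (mc_minE M); last 1 first.
  - move=> D sD nD; have pD : D \proper V0 := sub_proper_trans sD pC.
    have W5 := subset5 pD nD.
    have vD : v \notin D by apply: contra vC; apply: (subsetP sD).
    suff : (wsum (es ++ optE w new) D + 4 <= 5 * #|D|)%N by blia.
    rewrite wsum_cat /optE; case: eqP => [_|/eqP w0]; first by rewrite /wsum big_nil -/(wsum _ _); blia.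
    rewrite wsum1; case: ifP => [/andP[/= n1D n2D]|_]; last blia.
    have sum12 : (dw d1 + dw d2 <= \sum_(d <- star es v | dn d \in D) dw d)%N.
      have : (\sum_(d <- [seq d <- star es v | dn d \in A] | dn d \in D) dw d =
              dw d1 + dw d2)%N.
        by rewrite (perm_big _ Hp) /= !big_cons big_nil n1D [dn d2 \in D]n2D addn0.
      move <-; rewrite big_filter_cond /= big_mkcond [leqRHS]big_mkcond.
      by apply: leq_sum => d _; case: (dn d \in A) => //=.
    have pvD : v |: D \proper V0.
      apply: sub_proper_trans pA; rewrite subUset sub1set vA.
      by apply: subset_trans sD _; apply: subsetDl.
    have cD : #|v |: D| = #|D|.+1 by rewrite cardsU1 vD.
    have := slack_ge6 M pvD; rewrite cD (wsum_star (mc_wf M)) // => /(_ _).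
    rewrite ltnS card_gt0 nD => /(_ isT).
    move: w12 sum12; rewrite (negbTE w0) /=; blia.
  - rewrite wf_cat (mc_wf M) /optE; case: eqP => //= w0; rewrite andbT /wfE /= n12.
    by move: ww; rewrite /dw /=; case: eqP.
  - exact: proper_card pC.
have {Hf} [HfC Hnew] : sat es C f /\ okw w (act (f (dn d1)) (dq d1)) (act (f (dn d2)) (dq d2)).
  move: Hf; rewrite sat_cat => /andP[-> ]; rewrite /optE.
  case: eqP => [->|_]; first by case: (act _ _) (act _ _) => [] [].
  by rewrite /sat /= andbT /inE_ /= n1C [dn new.2]/(dn d2) n2C.
have [t Ht] := Hw _ _ Hnew.
pose r := dn d1.
pose es1 := uncross es v C.
pose ne : edge V := (v, (dp d1, r, t, 4)).
pose es2 := contr C r f es1 ++ [:: ne].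
pose V1 := v |: (r |: (V0 :\: A)).
have rv : r != v by [].
have wf1 : wf es1 := wf_uncross _ _ (mc_wf M).
have wf2 : wf es2.
  by rewrite wf_cat wf_contr //= /wfE /= eq_sym n1v.
have HfC1 : sat es1 C f.
  by apply/allP => e; rewrite mem_filter => /andP[_]; apply: (allP HfC).
have V1C : V1 :&: C = [set r].
  apply/setP => x; rewrite !inE; case: (eqVneq x v) => [->|xv] /=.
    by rewrite eq_sym (negbTE rv).
  by case: (eqVneq x r) => [->|xr] //=; case: (x \in A); rewrite ?andbF.
have V1U : V1 :|: C = V0.
  apply/setP => x; rewrite !inE; case: (eqVneq x v) => [->|xv] //=.
  case: (eqVneq x r) => [->|xr] /=; first by rewrite (subsetP (proper_sub pA)).
  case: (boolP (x \in A)) => xA /=; last by rewrite orbF.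
  by rewrite (subsetP (proper_sub pA)).
have cV1 : (#|V1| < #|V0|)%N.
  have := cardsUI V1 C; rewrite V1U V1C cards1; blia.
have W5 : (wsum es C = 5 * #|A| - 6 - dw d1 - dw d2)%N by blia.
have [phi Hphi] : exists phi, sat es2 V1 phi.
  apply: (mc_minE M) => // B sB nB.
  have BV0 : B :|: C \subset V0 by rewrite -V1U setSU.
  have B1 : (0 < #|B|)%N by rewrite card_gt0.
  rewrite /es2 wsum_cat wsum1 /inE_ /=.
  case: (boolP (r \in B)) => rB; last first.
    have dBC : [disjoint B & C].
      rewrite disjoint_subset; apply/subsetP => x xB; rewrite inE.
      apply/negP => xC; have : x \in V1 :&: C by rewrite inE (subsetP sB).
      by rewrite V1C inE => /eqP E; rewrite -E xB in rB.
    rewrite andbF addn0 wsum_contr0 // wsum_uncross_disj //.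
    suff : (wsum es B + 5 <= 5 * #|B|)%N by blia.
    apply: subset5 nB; rewrite properE (subset_trans (subsetUl _ _) BV0) /=.
    apply/subsetPn; exists r => //; exact: (subsetP (proper_sub pC)).
  have BC : B :&: C = [set r].
    apply/setP => x; rewrite in_setI; case: (boolP (x \in B)) => xB /=.
      by rewrite -V1C in_setI (subsetP sB _ xB).
    by rewrite inE; apply/esym/negbTE; apply: contraNneq xB => ->.
  have cBC : (#|B :|: C| + 1 = #|B| + #|C|)%N.
    by have := cardsUI B C; rewrite BC cards1; blia.
  have EW := wsum_contr f es1 BC.
  have W1C : wsum es1 C = wsum es C by apply: wsum_uncross0.
  case: (boolP (v \in B)) => vB; rewrite andbT.
    have EBC : v |: ((B :|: C) :\ v) = B :|: C by rewrite setD1K // inE vB.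
    have sC : C \subset (B :|: C) :\ v.
      by apply/subsetP => x xC; rewrite in_setD1 in_setU xC orbT andbT; apply: contraNneq vC => <-.
    have := wsum_uncross (mc_wf M) vC (_ : v \notin (B :|: C) :\ v) sC.
    rewrite EBC sumC !inE eqxx => /(_ isT); rewrite -/es1 => EU.
    case: (eqVneq (B :|: C) V0) => [EV|nV]; last first.
      have pBC : B :|: C \proper V0 by rewrite properEneq nV.
      have := slack_ge6 M pBC; blia.
    rewrite EV in cBC EU EW.
    have W3' : (wsum es V0 + 3 <= 5 * #|V0|)%N.
      by have [|//] := mc_goodE M (subxx V0); apply/set0Pn; exists v.
    split; first blia.
    (* Slack 3 on the whole graph is harmless: a vertex outside [A] keeps at least three darts, so
       this is not a cycle. *)
    move=> _ HD; exfalso.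
    have /properP[_ [x xV xA]] := pA.
    have xB : x \in B.
      have : x \in B :|: C by rewrite EV.
      by rewrite !inE (negbTE xA) andbF orbF.
    have xC : x \notin C by rewrite !inE (negbTE xA) andbF.
    have := HD x xB; rewrite deg_cat star_contr //; last by rewrite in_setD xC.
    rewrite /deg star_uncross0 //; last by apply: contraNneq xA => ->.
    rewrite EV -/(deg es V0 x) (deg_V0 M); have := star_ge3 M xV; blia.
  rewrite addn0.
  have vBC : v \notin B :|: C by rewrite inE negb_or vB.
  have W1B : wsum es1 (B :|: C) = wsum es (B :|: C) by apply: wsum_uncross0.
  have cvBC : #|v |: (B :|: C)| = #|B :|: C|.+1 by rewrite cardsU1 vBC.
  have svBC : v |: (B :|: C) \subset V0 by rewrite subUset sub1set vV.
  have Wv := wsum_star (mc_wf M) vBC.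
  rewrite (bigID (fun d => dn d \in C)) /= in Wv.
  have sumC' : (\sum_(i <- star es v | (dn i \in B :|: C) && (dn i \in C)) dw i =
                dw d1 + dw d2)%N.
    rewrite -sumC; apply: eq_bigl => d; rewrite !inE.
    by case: (dn d \in A); rewrite ?andbF ?andbT ?orbT //; case: eqP; rewrite ?orbT ?andbF.
  rewrite sumC' in Wv.
  set X := (\sum_(i <- star es v | _ && _) dw i)%N in Wv.
  suff : (wsum (contr C r f es1) B + 4 <= 5 * #|B|)%N by blia.
  case: (eqVneq (v |: (B :|: C)) V0) => [EV|nV]; last first.
    have pBC : v |: (B :|: C) \proper V0 by rewrite properEneq nV.
    have := slack_ge6 M pBC; blia.
  have W3' : (wsum es V0 + 3 <= 5 * #|V0|)%N.
    by have [|//] := mc_goodE M (subxx V0); apply/set0Pn; exists v.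
  (* The exit of [v] out of [A] supplies the weight that is missing when the set together with [v]
     is all of [V0], where only slack 3 is known. *)
  have X2 : (2 <= X)%N.
    have [_ d0V] := mc_starE M d0S.
    have /andP[d0v /andP[d02 _]] := star_wf (mc_wf M) d0S.
    have d0C : dn d0 \notin C by rewrite !inE (negbTE d0A) andbF.
    have d0BC : dn d0 \in B :|: C.
      by have := d0V; rewrite -EV in_setU1 (negbTE d0v).
    rewrite /X (perm_big _ (perm_to_rem d0S)) /= big_cons d0BC d0C /=; blia.
  rewrite EV in Wv cvBC; blia.
apply: (mc_unsat M).
have Hs2 : sat (contr C r f es1) V1 phi by move: Hphi; rewrite sat_cat => /andP[].
have Hne : okw 4 (act (phi v) (dp d1)) (act (phi r) t).
  have /andP[_ Hn] : sat (contr C r f es1) V1 phi && sat [:: ne] V1 phi by rewrite -sat_cat.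
  have In : inE_ V1 ne by apply/andP; split; rewrite /V1 !inE eqxx ?orbT.
  by have := allP Hn ne (mem_head _ _); rewrite In.
have := sat_contr V1C HfC1 Hs2; rewrite V1U; set psi := (fun u => _) => Hpsi.
exists psi; apply/allP => e He; apply/implyP => _.
case: (boolP (cross v C e)) => Hc; last first.
  have := allP Hpsi e; rewrite mem_filter Hc He => /(_ isT).
  by rewrite (mc_in M He).
have psiv : psi v = phi v by rewrite /psi (negbTE vC).
have [z Hz] := act_surj (phi r) (act (phi v) (dp d1)).
have Ht' : okw 4 z t by rewrite -(okw_act 4 (phi r)) Hz.
have /andP[Hz1 Hz2] := Ht z Ht'.
have okd d : d \in star es v -> dn d \in C -> okD psi (psi v) d.
  move=> dv dC; have : d \in [:: d1; d2].
    by rewrite -(perm_mem Hp) mem_filter dv -EA inE dC orbT.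
  rewrite psiv /okD !inE => /orP[] /eqP ->.
    by rewrite /psi n1C act_cmp -Hz okw_act.
  by rewrite /psi n2C act_cmp -Epos -Hz okw_act.
case/orP: Hc => /andP[/eqP E eC].
  have -> : okE psi e = okD psi (psi v) e.2 by rewrite /okE /okD E.
  by apply: okd => //; rewrite mem_star -E -surjective_pairing He.
rewrite -okE_rev.
have -> : okE psi (revE e) = okD psi (psi v) (revE e).2 by rewrite /okE /okD /= E.
apply: okd => //; rewrite mem_star -{1}E.
have -> : (dn e.2, (revE e).2) = revE e by [].
have -> : (v, (revE e).2) = revE e by rewrite -E.
by rewrite revEK He orbT.
Qed.

End Slack7.

(** * Critical cycles *)

Section Handshake.
Variable V : finType.
Implicit Types (es : seq (edge V)) (A B C : {set V}) (phi f : V -> state).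

Lemma star_sum es (F : V -> dart V -> nat) :
  (\sum_v \sum_(d <- star es v) F v d =
   \sum_(e <- es) (F e.1 e.2 + F (revE e).1 (revE e).2))%N.
Proof.
under eq_bigr => v _ do rewrite big_map big_filter.
rewrite (exchange_big_dep predT) //= big_cat big_map /= -big_split /=.
apply: eq_bigr => e _; congr (_ + _)%N.
  by rewrite (big_pred1 e.1) // => v /=; rewrite eq_sym.
by rewrite (big_pred1 (dn e.2)) // => v /=; rewrite eq_sym.
Qed.

Lemma star_swap es (F : V -> V -> nat -> nat) :
  (\sum_v \sum_(d <- star es v) F v (dn d) (dw d) =
   \sum_v \sum_(d <- star es v) F (dn d) v (dw d))%N.
Proof.
rewrite (star_sum es (fun v d => F v (dn d) (dw d))).
rewrite (star_sum es (fun v d => F (dn d) v (dw d))).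
by apply: eq_bigr => e _; rewrite addnC.
Qed.

Lemma handshake es B :
  (\sum_(v in B) \sum_(d <- star es v | dn d \in B) dw d = 2 * wsum es B)%N.
Proof.
have := star_sum es (fun v d => if (v \in B) && (dn d \in B) then dw d else 0%N).
rewrite [X in _ = X](_ : _ = 2 * wsum es B)%N; last first.
  rewrite /wsum big_distrr /= [RHS]big_mkcond; apply: eq_bigr => e _ /=.
  by rewrite /inE_ [in X in (_ + X)%N]andbC; case: ifP => //; rewrite mul2n addnn.
move <-; rewrite big_mkcond /=; apply: eq_bigr => v _.
case: ifP => vB; last by rewrite big1.
by rewrite big_mkcond.
Qed.

(* The unsatisfiable cycles of slack 3. *)
Definition critical es B :=
  [/\ (wsum es B + 3 = 5 * #|B|)%N,
   {in B, forall v, exists d1 d2,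
      [/\ perm_eq [seq d <- star es v | dn d \in B] [:: d1; d2],
          (7 <= dw d1 + dw d2)%N &
          (dw d1 + dw d2 <= 9)%N -> dp d1 = dp d2]} &
   ~ exists phi, sat es B phi].

(** The deficiencies [10 - dw d1 - dw d2] of the vertices of a critical cycle add up to ten times
    the number of vertices minus twice the weight, that is to 6. This bounds the length of critical
    cycles. *)
Lemma critical_sum es B (g : V -> nat) : critical es B ->
  {in B, forall v d1 d2,
     perm_eq [seq d <- star es v | dn d \in B] [:: d1; d2] ->
     (dw d1 + dw d2 + g v <= 10)%N} ->
  (\sum_(v in B) g v <= 6)%N.
Proof.
move=> [W3 Hk _] Hg; have := handshake es B.
have : (\sum_(v in B) \sum_(d <- star es v | dn d \in B) dw d +
        \sum_(v in B) g v <= \sum_(v in B) 10)%N.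
  rewrite -big_split /=; apply: leq_sum => v vB.
  have [d1 [d2 [Hp _ _]]] := Hk v vB.
  have := Hg v vB d1 d2 Hp; rewrite -[X in (X + _ <= _)%N -> _]/(_ + _)%N.
  by rewrite -big_filter (perm_big _ Hp) /= !big_cons big_nil addn0.
rewrite sum_nat_const; blia.
Qed.

Lemma critical_end es ns B x d0 : critical (es ++ ns) B -> x \in B ->
  [seq d <- star ns x | dn d \in B] = [:: d0] ->
  exists d, [/\ [seq d <- star es x | dn d \in B] = [:: d],
    (7 <= dw d0 + dw d)%N & (dw d0 + dw d <= 9)%N -> dp d = dp d0].
Proof.
move=> [_ Hk _] xB E0; have [d1 [d2 [Hp w7 w9]]] := Hk x xB.
have {}Hp : perm_eq ([seq d <- star es x | dn d \in B] ++ [:: d0]) [:: d1; d2].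
  rewrite -E0 -filter_cat -(permPl (perm_filter _ (star_cat es ns x))) //.
have := perm_size Hp; rewrite size_cat.
case E : [seq _ <- _ | _] Hp => [|d [|? ?]] Hp; rewrite /= ?addn1 // => _.
have := perm_mem Hp; exists d; split=> //.
- have : perm_eq [:: dw d; dw d0] [:: dw d1; dw d2] by exact: (perm_map (@dw V) Hp).
  by move=> /(perm_sumn); rewrite /=; blia.
- move=> w9'; have /perm_sumn : perm_eq [:: dw d; dw d0] [:: dw d1; dw d2].
    exact: (perm_map (@dw V) Hp).
  rewrite /= => Hs; have {}w9 : dp d1 = dp d2 by apply: w9; blia.
  have Hd y : y \in [:: d; d0] -> dp y = dp d2.
    by rewrite (perm_mem Hp) !inE => /orP[] /eqP ->.
  by rewrite !Hd // !inE eqxx ?orbT.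
Qed.

Definition newE (u : V) a v b w : seq (edge V) := optE w (u, (a, v, b, w)).

Lemma wsum_newE u a v b w B :
  wsum (newE u a v b w) B = if (u \in B) && (v \in B) then w else 0%N.
Proof.
rewrite /newE /optE; case: eqP => [->|_]; first by rewrite /wsum big_nil if_same.
by rewrite wsum1 /inE_.
Qed.

Lemma sat_newE u a v b w B phi : sat (newE u a v b w) B phi =
  ((u \in B) && (v \in B) ==> okw w (act (phi u) a) (act (phi v) b)).
Proof.
rewrite /newE /optE; case: eqP => [->|_]; last by rewrite /sat /= andbT.
by case: (act _ _) (act _ _) => [] []; rewrite implybT.
Qed.

Lemma wf_newE u a v b w : u != v -> (w == 0%N) || (2 <= w <= 5)%N ->
  wf (newE u a v b w).
Proof.
move=> uv; rewrite /newE /optE; case: eqP => //= _ w25.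
by rewrite andbT; apply/andP.
Qed.

Lemma star_newE u a v b w x : w != 0%N -> u != v ->
  star (newE u a v b w) x = if x == u then [:: (a, v, b, w)] else
    if x == v then [:: (b, u, a, w)] else [::].
Proof.
move=> w0 uv; rewrite /newE /optE (negbTE w0) /star /= /dn /= !(eq_sym _ x).
case: (eqVneq x u) => [->|xu]; first by rewrite (negbTE uv).
by case: (eqVneq x v).
Qed.

Lemma wsum_starp es v B l : wf es -> v \notin B -> perm_eq (star es v) l ->
  wsum es (v |: B) =
    (wsum es B + foldr (fun d n => (dn d \in B) * dw d + n) 0 l)%N.
Proof.
move=> Hwf vB Hp; rewrite wsum_star // (perm_big _ Hp) /=; congr (_ + _)%N.
elim: l {Hp} => [|d l IH]; rewrite ?big_nil //= big_cons IH.
by case: (_ \in _); rewrite ?mul1n ?mul0n.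
Qed.

End Handshake.

(** * Reductions: deleting vertices in favour of gadget edges *)

Section Reduction.
Variable V : finType.
Implicit Types (es : seq (edge V)) (A B C D : {set V}) (phi f : V -> state).
Variables (es : seq (edge V)) (V0 : {set V}).
Hypothesis M : mincex es V0.

(** In an inclusion-minimal bad set [B] all proper subsets are satisfiable, so every vertex has
    excess 5 inside [B], hence two darts of total weight at least 7. If these sit at different
    positions with total at most 9, suppressing the vertex needs an edge lighter than [w1 + w2 - 5];
    sets containing that edge keep slack 4, and a colouring extends back. When both darts reach the
    same neighbour, [digon_fact] applies. *)
Lemma minimal_critical es' (V1 : {set V}) : wf es' -> (#|V1| < #|V0|)%N ->
  (forall D, D \subset V1 -> D != set0 -> (wsum es' D + 3 <= 5 * #|D|)%N) ->
  ~ (exists phi, sat es' V1 phi) ->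
  exists B, [/\ B \subset V1, B != set0 & critical es' B].
Proof.
move=> wf' cV1 H3 U1.
pose bad B := [/\ B \subset V1, B != set0, (wsum es' B + 3 = 5 * #|B|)%N,
  {in B, forall v, deg es' B v <= 2}%N & ~ exists phi, sat es' B phi].
have /ex_minset[B /minsetP[/asboolP HB Bmin]] : exists B, `[< bad B >].
  have /not_good[B [sB nB [HB|[HB HD U]]]] : ~ good es' V1.
  - by move=> /(mc_minE M wf' cV1).
  - by have := H3 B sB nB; blia.
  - by exists B; apply/asboolP.
have [sB nB W3 D2 U] := HB.
have subsat D : D \proper B -> exists phi, sat es' D phi.
  move=> pD; have sD := proper_sub pD.
  apply: (mc_minE M wf').
    by apply: leq_ltn_trans (subset_leq_card (subset_trans sD sB)) cV1.
  move=> C sC nC; have sCB := subset_trans sC sD.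
  split; first by apply: H3 => //; apply: subset_trans sB.
  move=> E HD; apply: contrapT => UC.
  have EC : C = B.
    by apply: Bmin => //; apply/asboolP; split=> //; apply: subset_trans sB.
  by move: pD; rewrite -EC properE sC andbF.
have degl v : size [seq d <- star es' v | dn d \in B] = deg es' B v.
  by rewrite size_filter.
exists B; split=> //; split=> // v vB.
have pD : B :\ v \proper B := properD1 vB.
have vD : v \notin B :\ v by rewrite !inE eqxx.
have wB : (#|B| <= #|V1|)%N := subset_leq_card sB.
have ext phi : sat es' (B :\ v) phi ->
    ~ exists s, {in [seq d <- star es' v | dn d \in B], forall d, okD phi s d}.
  move=> Hphi [s Hs]; apply: U; rewrite -(setD1K vB).
  eexists; apply: (sat_ext (s := s)) wf' vD Hphi _ => d dS.
  by rewrite in_setD1 => /andP[_ dB]; apply: Hs; rewrite mem_filter dB.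
have Hw d : d \in [seq d <- star es' v | dn d \in B] ->
    [/\ dn d != v, dn d \in B & (2 <= dw d <= 5)%N].
  by rewrite mem_filter => /andP[-> /(star_wf wf')/andP[-> ->]].
have [phi Hphi] := subsat _ pD.
have Hsum : (5 <= \sum_(d <- [seq d <- star es' v | dn d \in B]) (dw d).-1)%N.
  rewrite leqNgt; apply/negP => Hlt; apply: (ext phi) => //.
  by apply: free_state Hlt => d /Hw[].
have := degl v; have := D2 v vB.
case El : [seq d <- star es' v | dn d \in B] Hsum Hw ext => [|d1 [|d2 [|? ?]]];
  rewrite /= ?big_cons ?big_nil // => Hsum Hw ext.
- by have [_ _] := Hw d1 (mem_head _ _); blia.
- have [n1v n1B w1] := Hw d1 (mem_head _ _).
  have [n2v n2B w2] : [/\ dn d2 != v, dn d2 \in B & (2 <= dw d2 <= 5)%N].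
    by apply: Hw; rewrite !inE eqxx orbT.
  move=> _ _; exists d1, d2; split=> //; first by blia.
  move=> w12; apply/eqP/negPn/negP => p12.
  have extend phi' s : sat es' (B :\ v) phi' ->
      okw (dw d1) (act s (dp d1)) (act (phi' (dn d1)) (dq d1)) &&
      okw (dw d2) (act s (dp d2)) (act (phi' (dn d2)) (dq d2)) -> False.
    move=> H1 /andP[H2 H2']; apply: (ext phi' H1); exists s => d.
    by rewrite !inE => /orP[] /eqP ->.
  case: (eqVneq (dn d1) (dn d2)) => [E12|n12].
    have W : wsum es' [set v; dn d1] = (dw d1 + dw d2)%N.
      rewrite wsum2 1?eq_sym // -[RHS](_ : \sum_(d <- [:: d1; d2] | dn d == dn d1) dw d = _)%N.
        rewrite -El big_filter_cond /=; apply: eq_bigl => d.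
        by case: eqP => [->|]; rewrite ?n1B ?andbF.
      by rewrite !big_cons big_nil -E12 eqxx addn0.
    have c2 : #|[set v; dn d1]| = 2%N by rewrite cards2 eq_sym n1v.
    have := H3 [set v; dn d1]; rewrite c2 W => /(_ _ _).
    have -> : [set v; dn d1] \subset V1.
      by rewrite subUset !sub1set !(subsetP sB).
    rewrite -card_gt0 c2 => /(_ isT isT) W7.
    have W7' : (dw d1 + dw d2 = 7)%N by blia.
    have [s Hs] := digon_fact (dq d1) (dq d2) p12 w1 w2 W7' (phi (dn d1)).
    by apply: (extend phi s Hphi); rewrite -E12.
  have w79 : (7 <= dw d1 + dw d2 <= 9)%N by blia.
  have [w [ww Hex Hw']] := suppress_fact (dp d1) (dp d2) w1 w2 w79.
  have {Hw'} w125 : (w + 5 < dw d1 + dw d2)%N.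
    by case: Hw' => [//|[E _ _]]; rewrite E eqxx in p12.
  pose new : edge V := (dn d1, (dq d1, dn d2, dq d2, w)).
  have [psi] : exists psi, sat (es' ++ optE w new) (B :\ v) psi.
    apply: (mc_minE M).
    - rewrite wf_cat wf' /optE; case: eqP => //= w0; rewrite andbT /wfE /= n12.
      by move: ww; rewrite /dw /=; case: eqP.
    - by have := proper_card pD; blia.
    move=> C sC nC.
    have sCB : C \subset B := subset_trans sC (proper_sub pD).
    have pC : C \proper B := sub_proper_trans sC pD.
    have vC : v \notin C by apply: contra vD; apply: (subsetP sC).
    have W3C := H3 C (subset_trans sCB sB) nC.
    case: (boolP (inE_ C new && (w != 0%N))) => [/andP[/andP[/= n1C n2C] w0]|Hn].
      suff : (wsum (es' ++ optE w new) C + 4 <= 5 * #|C|)%N by split; blia.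
      have svC : v |: C \subset V1.
        by rewrite subUset sub1set (subsetP sB _ vB) (subset_trans sCB).
      have cvC : #|v |: C| = #|C|.+1 by rewrite cardsU1 vC.
      have := H3 _ svC; rewrite -card_gt0 cvC => /(_ isT).
      rewrite wsum_star // wsum_cat /optE (negbTE w0) wsum1 /inE_ /= n1C.
      rewrite n2C /=.
      have -> : (\sum_(d <- star es' v | dn d \in C) dw d = dw d1 + dw d2)%N.
        transitivity (\sum_(d <- [:: d1; d2] | dn d \in C) dw d)%N.
          rewrite -El big_filter_cond; apply: eq_bigl => d.
          by case: (boolP (dn d \in C)) => [/(subsetP sCB) ->|]; rewrite ?andbF.
        by rewrite !big_cons big_nil n1C n2C addn0.
      by blia.
    have Wo : wsum (optE w new) C = 0%N.
      rewrite /optE; case: eqP Hn => [_|_] Hn; first by rewrite /wsum big_nil.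
      by rewrite wsum1; move: Hn; rewrite andbT => /negbTE ->.
    rewrite wsum_cat Wo addn0; split=> // _ _.
    have [psi Hpsi] := subsat C pC; exists psi; rewrite sat_cat Hpsi /=.
    rewrite /optE; case: eqP Hn => [//|_]; rewrite andbT => Hn.
    by rewrite /sat /= (negbTE Hn).
  rewrite sat_cat => /andP[H1 H2].
  have [|s Hs] := Hex (act (psi (dn d1)) (dq d1)) (act (psi (dn d2)) (dq d2)).
    move: H2; rewrite /optE; case: eqP => [-> _|_].
      by case: (act _ _) (act _ _) => [] [].
    by rewrite /sat /= andbT /inE_ /= !in_setD1 n1v n1B [dn _]/(dn d2) n2v n2B.
  exact: (extend psi s H1 Hs).
- by move=> ? ?; exfalso; blia.
Qed.

(** The scheme behind all the local exclusions: if colourings of the modified graph without [C]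
    extend to [V0], then the modified graph must contain a set of slack at most 2 or a critical
    cycle. *)
Lemma reduction C es' : C \subset V0 -> C != set0 -> wf es' ->
  (forall phi, sat es' (V0 :\: C) phi -> exists psi, sat es V0 psi) ->
  exists B, [/\ B \subset V0 :\: C, B != set0 &
    (5 * #|B| < wsum es' B + 3)%N \/ critical es' B].
Proof.
move=> sC nC wf' Hext.
have [[B [sB nB HB]]|H] := pselect (exists B, [/\ B \subset V0 :\: C, B != set0 &
    (5 * #|B| < wsum es' B + 3)%N]).
  by exists B; split=> //; left.
have [|||B [sB nB HB]] := @minimal_critical es' (V0 :\: C) wf'.
- by have := subset_leq_card sC; move: nC; rewrite -card_gt0 cardsDS //; blia.
- move=> D sD nD; rewrite leqNgt; apply/negP => HD; apply: H; exists D.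
  by split=> //; blia.
- by move=> [phi /Hext]; apply: mc_unsat M.
- by exists B; split=> //; right.
Qed.

End Reduction.

(** The gadget may sit at a position [q] of the first neighbour other than the one used by the
    deleted edge; this freedom makes the third dart, of weight 2, satisfiable for every [x3]. *)
Lemma two_node_fact p1 p2 p3 q1 w1 w2 :
  (2 <= w1 <= 4)%N -> (2 <= w2 <= 4)%N -> (6 <= w1 + w2)%N ->
  exists q w, [/\ (2 <= w <= 5)%N, (w + 3 <= w1 + w2)%N &
    forall t x2 x3, okw w (act t q) x2 ->
      exists s, [&& okw w1 (act s p1) (act t q1), okw w2 (act s p2) x2 &
        okw 2 (act s p3) x3]].
Proof.
pose P p1 p2 p3 q1 w1 w2 q w := if (2 <= w <= 5)%N && (w + 3 <= w1 + w2)%N then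
  allS (fun t => all5 (fun x2 => if okw w (act t q) x2 then
    all5 (fun x3 => exS (fun s => if okw w1 (act s p1) (act t q1) then
      okw w2 (act s p2) x2 && okw 2 (act s p3) x3 else false)) else true))
  else false.
have H : all (fun w1 => all (fun w2 => if (6 <= w1 + w2)%N then
   all5 (fun p1 => all5 (fun p2 => all5 (fun p3 => all5 (fun q1 =>
   ex5 (fun q => exw (P p1 p2 p3 q1 w1 w2 q))))))
   else true)
   [:: 2; 3; 4]) [:: 2; 3; 4].
  by vm_compute.
move=> H1 H2 H6; have {}H1 : w1 \in [:: 2; 3; 4] by rewrite !inE; lia.
have {}H2 : w2 \in [:: 2; 3; 4] by rewrite !inE; lia.
have := allP (allP H _ H1) _ H2; clear H; rewrite H6.
move=> /all5P/(_ p1)/all5P/(_ p2)/all5P/(_ p3)/all5P/(_ q1)/ex5P[q Hq].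
have [w [_ Hw]] := exwP Hq.
exists q, w; move: Hw; rewrite /P; case: ifP => // /andP[w25 w3] Hw; split=> // t x2 x3 Ht.
move: (all5P _ (allSP _ Hw t) x2); rewrite Ht => /all5P/(_ x3)/exSP[s Hs].
by exists s; move: Hs; case: ifP.
Qed.

Section Local.
Variable V : finType.
Implicit Types (es : seq (edge V)) (A B C D : {set V}) (phi f : V -> state).
Variables (es : seq (edge V)) (V0 : {set V}).
Hypothesis M : mincex es V0.

Lemma star_in v (l : seq (dart V)) d : perm_eq (star es v) l -> d \in l ->
  [/\ v \in V0, dn d \in V0, dn d != v & (2 <= dw d <= 4)%N].
Proof.
move=> Hp; rewrite -(perm_mem Hp) => dS; have [vV nV] := mc_starE M dS.
by have /andP[nv _] := star_wf (mc_wf M) dS; split=> //; apply: w4 M _ _ dS.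
Qed.

Lemma star_mult v (l : seq (dart V)) x : perm_eq (star es v) l ->
  mult es v x = count (fun d => dn d == x) l.
Proof. by move=> /permP; apply. Qed.

Lemma card_gt2 v : v \in V0 -> (2 < #|V0|)%N.
Proof. by move=> vV; apply: card_V0 M _; apply/set0Pn; exists v. Qed.

Lemma proper2 u v : u \in V0 -> v \in V0 -> u != v -> [set u; v] \proper V0.
Proof.
move=> uV vV uv; rewrite properEcard subUset !sub1set uV vV cards2 uv /=.
exact: card_gt2 uV.
Qed.

Lemma parallel v d1 d2 (l : seq (dart V)) : perm_eq (star es v) [:: d1, d2 & l] ->
  (4 < dw d1 + dw d2)%N -> dn d1 != dn d2.
Proof.
move=> Hp w12; apply/eqP => E.
have [vV n1V n1v _] := star_in Hp (mem_head _ _).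
have pV : [set v; dn d1] \proper V0 by apply: proper2; rewrite // eq_sym.
have := slack_ge6 M pV; rewrite cards2 eq_sym n1v (wsum2 (mc_wf M)) 1?eq_sym //.
rewrite (perm_big _ Hp) /= !big_cons E eqxx; lia.
Qed.

Lemma p3 B : B \subset V0 -> B != set0 -> (wsum es B + 3 <= 5 * #|B|)%N.
Proof. by move=> sB nB; have [] := mc_goodE M sB nB. Qed.

Lemma full_degree v B x : v |: B = V0 -> v \notin B -> x \in V0 ->
  (2 < mult es v x + deg es B x)%N.
Proof.
move=> E vB xV; rewrite multC -degU1 // E (deg_V0 M).
exact: (star_ge3 M xV).
Qed.

Lemma extend1 v phi s : v \in V0 -> sat es (V0 :\ v) phi ->
  {in star es v, forall d, okD phi s d} -> exists psi, sat es V0 psi.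
Proof.
move=> vV Hphi Hs; rewrite -(setD1K vV); eexists.
apply: (sat_ext (s := s)) (mc_wf M) _ Hphi _; first by rewrite !inE eqxx.
by move=> d dS _; apply: Hs.
Qed.

(** The gadget of [two_node_fact] replaces [v] by an edge whose weight is at least 3 below
    [dw d1 + dw d2]. Then slack 6 of [v |: B] forbids every obstruction except a critical cycle on
    all of [V0 :\ v], and there the degrees are too small. *)
Lemma cubic_weight_neq2 v d1 d2 d3 : perm_eq (star es v) [:: d1; d2; d3] -> dw d3 <> 2.
Proof.
move=> Hp E3; have [vV n1V n1v w1] := star_in Hp (mem_head _ _).
have [_ n2V n2v w2] : [/\ v \in V0, dn d2 \in V0, dn d2 != v & (2 <= dw d2 <= 4)%N].
  by apply: star_in Hp _; rewrite !inE eqxx orbT.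
have [_ n3V n3v w3] : [/\ v \in V0, dn d3 \in V0, dn d3 != v & (2 <= dw d3 <= 4)%N].
  by apply: star_in Hp _; rewrite !inE eqxx !orbT.
have := excess_ge5 M vV; rewrite (perm_big _ Hp) !big_cons big_nil /= => H5.
have w6 : (6 <= dw d1 + dw d2)%N by blia.
have n12 : dn d1 != dn d2 by apply: parallel Hp _; blia.
have [q [w [w25 w36 Hw]]] := two_node_fact (dp d1) (dp d2) (dp d3) (dq d1) w1 w2 w6.
have [|||phi|B [sB nB HB]] := @reduction _ _ _ M [set v]
  (es ++ newE (dn d1) q (dn d2) (dq d2) w).
- by rewrite sub1set.
- by rewrite -card_gt0 cards1.
- by rewrite wf_cat (mc_wf M) wf_newE // w25 orbT.
- rewrite sat_cat sat_newE !in_setD1 n1v n2v n1V n2V /= => /andP[Hphi Hn].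
  have [s /and3P[h1 h2 h3]] := Hw _ _ (act (phi (dn d3)) (dq d3)) Hn.
  apply: (extend1 (s := s) vV Hphi) => d; rewrite (perm_mem Hp) !inE.
  by case/or3P => /eqP -> //; rewrite /okD E3.
have vB : v \notin B by apply/negP => /(subsetP sB); rewrite !inE eqxx.
have pB : B \proper V0 by apply: sub_proper_trans sB (properD1 vV).
have W5 := subset5 M pB nB.
have W : wsum (es ++ newE (dn d1) q (dn d2) (dq d2) w) B =
  (wsum es B + if (dn d1 \in B) && (dn d2 \in B) then w else 0)%N.
  by rewrite wsum_cat wsum_newE.
case: (boolP ((dn d1 \in B) && (dn d2 \in B))) W => [/andP[n1B n2B]|_] W; last first.
  by case: HB => [|[]]; blia.
have svB : v |: B \subset V0.
  by rewrite subUset sub1set vV (proper_sub pB).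
have cvB : #|v |: B| = #|B|.+1 by rewrite cardsU1 vB.
have := wsum_starp (mc_wf M) vB Hp; rewrite /= n1B n2B E3 => WvB.
have B0 : (0 < #|B|)%N by rewrite card_gt0.
case: (eqVneq (v |: B) V0) => [EV|nV]; last first.
  have pvB : v |: B \proper V0 by rewrite properEneq nV.
  by have := slack_ge6 M pvB; case: HB => [|[]]; blia.
have n3B : dn d3 \in B.
  by have := n3V; rewrite -{1}EV in_setU1 (negbTE n3v).
have W3 : (wsum es V0 + 3 <= 5 * #|V0|)%N.
  by apply: p3 => //; rewrite -EV -card_gt0 cvB.
rewrite EV in WvB cvB; rewrite n3B in WvB.
case: HB => [|KB]; first by blia.
have w0 : w != 0%N by blia.
have [|x1 [E1 _ _]] := critical_end (d0 := (q, dn d2, dq d2, w)) KB n1B.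
  by rewrite star_newE // eqxx /= [dn _]/(dn d2) n2B.
have [|x2 [E2 _ _]] := critical_end (d0 := (dq d2, dn d1, q, w)) KB n2B.
  by rewrite star_newE // eqxx [dn d2 == _]eq_sym (negbTE n12) /= [dn _]/(dn d1) n1B.
(* Each end of the gadget has one old dart on the cycle, so it needs two darts to [v]; only [d3]
   could be the second one, and it serves at most one of the two ends. *)
have D1 := full_degree EV vB n1V; have D2 := full_degree EV vB n2V.
rewrite /deg -size_filter E1 (star_mult _ Hp) /= in D1.
rewrite /deg -size_filter E2 (star_mult _ Hp) /= in D2.
rewrite !eqxx [dn d2 == _]eq_sym (negbTE n12) /= in D1 D2.
case: (eqVneq (dn d3) (dn d1)) D1 D2 => [->|_]; rewrite ?(negbTE n12) //=.
Qed.

Lemma cubic_weight_ge3 v d : size (star es v) = 3 -> d \in star es v -> (3 <= dw d)%N.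
Proof.
move=> s3 dS; have /perm_size := perm_to_rem dS; rewrite s3 /=.
case E : (rem d (star es v)) => [|a [|b [|? ?]]] //= _.
have [] := andP (w4 M dS); rewrite leq_eqVlt => /orP[/eqP E2|//] _.
have /cubic_weight_neq2 : perm_eq (star es v) [:: a; b; d].
  have := perm_to_rem dS; rewrite E => h; apply: perm_trans h _.
  exact: permEl (perm_catC [:: d] [:: a; b]).
by rewrite -E2.
Qed.

(** Excess plus number gives 9 from four darts on; three darts have weight at least 3 each. *)
Lemma weight_ge9 v : v \in V0 -> (9 <= \sum_(d <- star es v) dw d)%N.
Proof.
move=> vV; have := excess_ge5 M vV; have := star_ge3 M vV.
have -> : (\sum_(d <- star es v) dw d =
    \sum_(d <- star es v) (dw d).-1 + size (star es v))%N.
  rewrite -sum1_size -big_split /= big_seq [RHS]big_seq; apply: eq_bigr => d.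
  by move=> /(w4 M); lia.
case: (eqVneq (size (star es v)) 3) => [s3 _ _|]; last by lia.
have : (3 * 2 <= \sum_(d <- star es v) (dw d).-1)%N; last by rewrite s3; lia.
rewrite -{1}s3 -sum1_size big_distrl /= big_seq [leqRHS]big_seq.
by apply: leq_sum => d /(cubic_weight_ge3 s3); lia.
Qed.

Lemma sum_V0 : (\sum_(v in V0) \sum_(d <- star es v) dw d = 2 * wsum es V0)%N.
Proof.
rewrite -handshake; apply: eq_bigr => v _; rewrite big_seq [RHS]big_seq_cond.
apply: eq_bigl => d; case: (boolP (d \in _)) => //= dS.
by have [_ ->] := mc_starE M dS.
Qed.

(** Nine per vertex is at most twice the total weight, and slack 3 bounds that by ten per vertex
    minus 6. *)
Lemma card_ge6 v : v \in V0 -> (6 <= #|V0|)%N.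
Proof.
move=> vV; have := sum_V0.
have : (\sum_(v in V0) 9 <= \sum_(v in V0) \sum_(d <- star es v) dw d)%N.
  by apply: leq_sum => x xV; apply: weight_ge9.
rewrite sum_nat_const; have := p3 (subxx V0) _; rewrite -card_gt0.
have : (0 < #|V0|)%N by rewrite card_gt0; apply/set0Pn; exists v.
by move=> -> /(_ isT); lia.
Qed.

Definition revd v (d : dart V) : dart V := (dq d, v, dp d, dw d).

Lemma star_rev u v : perm_eq [seq d <- star es u | dn d == v]
  [seq revd v d | d <- star es v & dn d == u].
Proof.
rewrite /star !filter_map -!map_comp -!filter_predI.
set E := es ++ _; have PE : perm_eq E (map (@revE V) E).
  rewrite map_cat (mapK (@revEK V)); exact: permEl (perm_catC _ _).
apply: (perm_trans (y := [seq (revE e).2 | e <- E & (dn e.2 == u) && (e.1 == v)])).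
  rewrite (map_comp snd (@revE V)) -(filter_map (@revE V) (fun e => (e.1 == u) && (dn e.2 == v))).
  apply: perm_map; rewrite (eq_filter (a2 := fun e => (e.1 == u) && (dn e.2 == v))).
    exact: perm_filter.
  by move=> e /=; rewrite andbC.
rewrite (_ : [seq (revE e).2 | e <- _] = map (revd v \o snd)
    [seq e <- E | (dn e.2 == u) && (e.1 == v)]) //.
by apply/eq_in_map => e; rewrite mem_filter => /andP[/andP[_ /eqP <-] _].
Qed.

Lemma revd_star v d : d \in star es v -> revd v d \in star es (dn d).
Proof.
move=> dS; have : revd v d \in [seq x <- star es (dn d) | dn x == v].
  by rewrite (perm_mem (star_rev _ _)) map_f // mem_filter eqxx.
by rewrite mem_filter => /andP[].
Qed.

Lemma filterU1 x v B : v \notin B -> perm_eq [seq d <- star es x | dn d \in v |: B]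
  ([seq d <- star es x | dn d \in B] ++ [seq d <- star es x | dn d == v]).
Proof.
move=> vB; apply/permP => a; rewrite count_cat !count_filter -count_predUI.
rewrite [X in (_ + X)%N](_ : _ = 0%N) ?addn0; last first.
  apply/eqP; rewrite eqn0Ngt -has_count; apply/hasPn => d _ /=.
  by apply/negP => /andP[/andP[_ H] /andP[_ /eqP E]]; rewrite E (negbTE vB) in H.
by apply: eq_count => d /=; rewrite !inE -andb_orr orbC.
Qed.

Lemma slack_ge7 A x d1 d2 : A \proper V0 -> x \in A ->
  perm_eq [seq d <- star es x | dn d \in A] [:: d1; d2] ->
  dp d1 = dp d2 -> dn d1 != dn d2 -> (wsum es A + 7 <= 5 * #|A|)%N.
Proof.
move=> pA xA Hp Ep n12; apply: (slack_ge7_exit M pA xA Hp Ep n12).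
have xV := subsetP (proper_sub pA) _ xA; have := star_ge3 M xV.
have := perm_size Hp; rewrite size_filter /= => E2 s3.
have /hasP[d dS dA] : has (fun d => dn d \notin A) (star es x); last by exists d.
rewrite has_count; have := count_predC (fun d => dn d \in A) (star es x).
have -> : count (predC (fun d => dn d \in A)) (star es x) =
  count (fun d => dn d \notin A) (star es x) by [].
by rewrite E2; blia.
Qed.

(** The defect of modularity is the weight of the edges between [A :\: B] and [B :\: A]: it is 0
    with no such edge, or at least 2. *)
Lemma wsumUI A B :
  (wsum es (A :|: B) + wsum es (A :&: B) = wsum es A + wsum es B)%N /\
   (forall u d, u \in A -> u \notin B -> d \in star es u -> dn d \in A :|: B ->
      dn d \in A) \/
  (wsum es A + wsum es B + 2 <= wsum es (A :|: B) + wsum es (A :&: B))%N.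
Proof.
pose c := (\sum_(e <- es | [&& inE_ (A :|: B) e, ~~ inE_ A e & ~~ inE_ B e]) dw e.2)%N.
have E : (wsum es (A :|: B) + wsum es (A :&: B) = wsum es A + wsum es B + c)%N.
  rewrite /c /wsum; elim: (es) => [|e l IH]; first by rewrite !big_nil.
  rewrite !big_cons; move: IH.
  set x1 := bigop _ _ _; set x2 := bigop _ _ _; set x3 := bigop _ _ _.
  set x4 := bigop _ _ _; set x5 := bigop _ _ _.
  rewrite /inE_ !inE; case: (e.1 \in A); case: (e.1 \in B);
    case: (dn e.2 \in A); case: (dn e.2 \in B) => /=; blia.
case: (posnP c) => c0; [left|right].
  split=> [|u d uA uB dS dAB]; first by rewrite E c0 addn0.
  apply/negPn/negP => dA.
  have [e eS He] : exists2 e, e \in es &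
      [&& inE_ (A :|: B) e, ~~ inE_ A e & ~~ inE_ B e].
    move: dS; rewrite mem_star => /orP[] H; eexists; try exact: H;
    rewrite ?inE_rev /inE_ /= dAB in_setU uA (negbTE uB) (negbTE dA) ?andbF //.
  have := c0; rewrite /c (perm_big _ (perm_to_rem eS)) /= big_cons He.
  by have /andP[_ /andP[]] := allP (mc_wf M) _ eS; lia.
have : (2 <= c)%N; last by lia.
move: c0; rewrite lt0n sum_nat_seq_neq0 => /hasP[e eS /andP[He _]].
rewrite /c (perm_big _ (perm_to_rem eS)) /= big_cons He.
by have /andP[_ /andP[]] := allP (mc_wf M) _ eS; lia.
Qed.

End Local.

(** * Vertices with weights 2, 2, 2, 3 *)

Definition gad5 p p4 : nat :=
  if p == p4 then 4 else if sub5 p4 p \in [:: Z1; Z4] then 3 else 2.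

Lemma gad5_fact p1 p2 p3 p4 x1 x2 x3 y : okw (gad5 p1 p4) x1 y ->
  exists s, [&& okw 2 (act s p1) x1, okw 2 (act s p2) x2, okw 2 (act s p3) x3 &
    okw 3 (act s p4) y].
Proof.
have : all5 (fun p1 => all5 (fun p2 => all5 (fun p3 => all5 (fun p4 =>
   all5 (fun x1 => all5 (fun y => if okw (gad5 p1 p4) x1 y then
    all5 (fun x2 => all5 (fun x3 => exS (fun s => if okw 2 (act s p1) x1 then
     [&& okw 2 (act s p2) x2, okw 2 (act s p3) x3 & okw 3 (act s p4) y]
     else false))) else true)))))).
  by vm_compute.
move=> /all5P/(_ p1)/all5P/(_ p2)/all5P/(_ p3)/all5P/(_ p4)/all5P/(_ x1)/all5P/(_ y).
move=> + H; rewrite H => /all5P/(_ x2)/all5P/(_ x3)/exSP[s Hs].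
by exists s; exact: Hs.
Qed.

(** Weights 2, 2, 2, 3 exclude up to ten states. When two of the darts of weight 2 see the same
    colour from the same position they exclude the same states, and at most 2 + 4 + 2 are lost. *)
Lemma free5_fact p p3 x y z : okw 2 x y -> ~~ okw 4 x y ->
  exists s, [&& okw 2 (act s p) x, okw 3 (act s p) y & okw 2 (act s p3) z].
Proof.
have : all5 (fun p => all5 (fun p3 => all5 (fun x => all5 (fun y => all5 (fun z =>
   (okw 2 x y && ~~ okw 4 x y) ==> exS (fun s =>
   [&& okw 2 (act s p) x, okw 3 (act s p) y & okw 2 (act s p3) z])))))).
  by vm_compute.
move=> /all5P/(_ p)/all5P/(_ p3)/all5P/(_ x)/all5P/(_ y)/all5P/(_ z) + h1 h2.
by rewrite h1 h2 => /exSP.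
Qed.

(** Both pairs are at distance two on the pentagon, and the dihedral group acts transitively on such
    ordered pairs. *)
Lemma align_fact x y x' y' : okw 2 x y -> ~~ okw 4 x y ->
  okw 2 x' y' -> ~~ okw 4 x' y' -> exists g, act g y' = y /\ act g x' = x.
Proof.
have : all5 (fun x => all5 (fun y => all5 (fun x' => all5 (fun y' =>
  [&& okw 2 x y, ~~ okw 4 x y, okw 2 x' y' & ~~ okw 4 x' y'] ==>
  exS (fun g => (act g y' == y) && (act g x' == x)))))).
  by vm_compute.
move=> /all5P/(_ x)/all5P/(_ y)/all5P/(_ x')/all5P/(_ y') + h1 h2 h3 h4.
by rewrite h1 h2 h3 h4 => /exSP[g /andP[/eqP ? /eqP ?]]; exists g.
Qed.

Section Local.
Variable V : finType.
Implicit Types (es : seq (edge V)) (A B C D : {set V}) (phi f : V -> state).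
Variables (es : seq (edge V)) (V0 : {set V}).
Hypothesis M : mincex es V0.

Lemma mult0 x u d : mult es x u = 0 -> d \in star es x -> dn d != u.
Proof.
move=> /eqP; rewrite /mult -leqn0 leqNgt -has_count => /hasPn H dS; exact: (H d dS).
Qed.

(** The form of [slack_ge7] met after a reduction: at an end [x] of a gadget edge the old dart of a
    critical cycle sits at the position of the deleted edge to [v], so these two are the darts at
    one position. *)
Lemma slack_ge7_end A B v x e d l : A \proper V0 -> B \subset A -> v \in A ->
  v \notin B -> x \in B -> [seq y <- star es x | dn y \in B] = [:: e] ->
  perm_eq (star es v) l -> [seq y <- l | dn y == x] = [:: d] -> dp e = dq d ->
  (forall u, u \in A -> u \notin B -> u != v -> mult es x u = 0) ->
  (wsum es A + 7 <= 5 * #|A|)%N.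
Proof.
move=> pA sBA vA vB xB E1 Hp Ed Ep H0.
apply: (slack_ge7 M pA (x := x) (d1 := e) (d2 := revd v d)) => //.
- exact: (subsetP sBA).
- rewrite (_ : [seq y <- _ | _] = [seq y <- star es x | dn y \in v |: B]).
    apply: perm_trans (filterU1 es _ vB) _; rewrite E1 perm_cons.
    apply: perm_trans (star_rev es _ _) _.
    by apply: perm_trans (perm_map _ (perm_filter _ Hp)) _; rewrite Ed.
  apply: eq_in_filter => y yS; rewrite in_setU1.
  apply/idP/idP => [yA|/orP[/eqP ->//|/(subsetP sBA)//]].
  case: (eqVneq (dn y) v) => //= yv; apply/negPn/negP => yB.
  by have /mult0/(_ yS) := H0 _ yA yB yv; rewrite eqxx.
- have : dn e \in B.
    have : e \in [seq y <- star es x | dn y \in B] by rewrite E1 mem_head.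
    by rewrite mem_filter => /andP[].
  by apply: contraTneq => E; rewrite (_ : dn e = v).
Qed.

(** The vertex is replaced by an edge between the ends of [d1] and [d4], [d2] and [d3] being
    satisfiable whatever their colours. The slack bounds rule out every obstruction but one: equal
    positions, weight 4, and a critical cycle, whose old slack is then 3 + 4. *)
Lemma no2223_gadget v d1 d2 d3 d4 : perm_eq (star es v) [:: d1; d2; d3; d4] ->
  dw d1 = 2 -> dw d2 = 2 -> dw d3 = 2 -> dw d4 = 3 ->
  dp d1 = dp d4 /\ exists B,
    [/\ B \subset V0 :\ v, dn d1 \in B, dn d4 \in B,
        (dn d2 \notin B) && (dn d3 \notin B) &
        (wsum es B + 7 = 5 * #|B|)%N /\
        critical (es ++ newE (dn d1) (dq d1) (dn d4) (dq d4) 4) B].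
Proof.
move=> Hp e1 e2 e3 e4; have [vV n1V n1v _] := star_in M Hp (mem_head _ _).
have [_ n2V n2v _] : [/\ v \in V0, dn d2 \in V0, dn d2 != v & (2 <= dw d2 <= 4)%N].
  by apply: (star_in M) Hp _; rewrite !inE eqxx orbT.
have [_ n3V n3v _] : [/\ v \in V0, dn d3 \in V0, dn d3 != v & (2 <= dw d3 <= 4)%N].
  by apply: (star_in M) Hp _; rewrite !inE eqxx !orbT.
have [_ n4V n4v _] : [/\ v \in V0, dn d4 \in V0, dn d4 != v & (2 <= dw d4 <= 4)%N].
  by apply: (star_in M) Hp _; rewrite !inE eqxx !orbT.
have ne4 d : d \in [:: d1; d2; d3] -> dn d != dn d4.
  move=> Hd; have dw2 : dw d = 2 by move: Hd; rewrite !inE => /or3P[] /eqP ->.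
  have p3 : perm_eq [:: d1; d2; d3] (d :: rem d [:: d1; d2; d3]) := perm_to_rem Hd.
  apply: (parallel M (v := v) (l := rem d [:: d1; d2; d3])); last by rewrite dw2 e4.
  apply: perm_trans Hp _.
  rewrite -[[:: d1; d2; d3; d4]]/([:: d1; d2; d3] ++ [:: d4]).
  apply: (perm_trans (y := [:: d4] ++ [:: d1; d2; d3])); first exact: permEl (perm_catC _ _).
  rewrite -[[:: d, d4 & _]]/([:: d] ++ [:: d4] ++ rem d [:: d1; d2; d3]).
  by rewrite perm_sym perm_catCA perm_cat2l perm_sym.
have n14 : dn d1 != dn d4 by apply: ne4; rewrite mem_head.
have n24 : dn d2 != dn d4 by apply: ne4; rewrite !inE eqxx orbT.
have n34 : dn d3 != dn d4 by apply: ne4; rewrite !inE eqxx !orbT.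
have n41 : dn d4 != dn d1 by rewrite eq_sym.
pose w := gad5 (dp d1) (dp d4).
have w24 : (2 <= w <= 4)%N by rewrite /w /gad5; case: ifP => // _; case: ifP.
have Hgad := @gad5_fact (dp d1) (dp d2) (dp d3) (dp d4); rewrite -/w in Hgad.
have wp : w = 4 -> dp d1 = dp d4.
  by rewrite /w /gad5; case: eqP => // _; case: ifP.
have pw : dp d1 = dp d4 -> w = 4 by rewrite /w /gad5 => ->; rewrite eqxx.
clearbody w.
have w0 : w != 0%N by blia.
have [|||phi|B [sB nB HB]] := @reduction _ _ _ M [set v]
  (es ++ newE (dn d1) (dq d1) (dn d4) (dq d4) w).
- by rewrite sub1set.
- by rewrite -card_gt0 cards1.
- by rewrite wf_cat (mc_wf M) wf_newE //; blia.
- rewrite sat_cat sat_newE !in_setD1 n1v n4v n1V n4V /= => /andP[Hphi Hn].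
  have [s /and4P[h1 h2 h3 h4]] := Hgad _ (act (phi (dn d2)) (dq d2)) (act (phi (dn d3)) (dq d3)) _ Hn.
  apply: (extend1 M (s := s) vV Hphi) => d; rewrite (perm_mem Hp) !inE.
  by case/or4P => /eqP ->; rewrite /okD ?e1 ?e2 ?e3 ?e4.
have vB : v \notin B by apply/negP => /(subsetP sB); rewrite !inE eqxx.
have pB : B \proper V0 by apply: sub_proper_trans sB (properD1 vV).
have W5 := subset5 M pB nB.
have W : wsum (es ++ newE (dn d1) (dq d1) (dn d4) (dq d4) w) B =
  (wsum es B + if (dn d1 \in B) && (dn d4 \in B) then w else 0)%N.
  by rewrite wsum_cat wsum_newE.
case: (boolP ((dn d1 \in B) && (dn d4 \in B))) W => [/andP[n1B n4B]|_] W; last first.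
  by case: HB => [|[]]; blia.
have svB : v |: B \subset V0 by rewrite subUset sub1set vV (proper_sub pB).
have cvB : #|v |: B| = #|B|.+1 by rewrite cardsU1 vB.
have B0 : (0 < #|B|)%N by rewrite card_gt0.
have := wsum_starp (mc_wf M) vB Hp; rewrite /= n1B n4B e1 e2 e3 e4 => WvB.
have K1 : critical (es ++ newE (dn d1) (dq d1) (dn d4) (dq d4) w) B ->
  exists x, [/\ [seq d <- star es (dn d1) | dn d \in B] = [:: x],
      (7 <= w + dw x)%N & (w + dw x <= 9)%N -> dp x = dq d1].
  move=> KB; apply: (critical_end (d0 := (dq d1, dn d4, dq d4, w)) KB n1B).
  by rewrite star_newE // eqxx /= [dn _]/(dn d4) n4B.
case: (eqVneq (v |: B) V0) => [EV|nV].
  have n2B : dn d2 \in B by have := n2V; rewrite -{1}EV in_setU1 (negbTE n2v).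
  have n3B : dn d3 \in B by have := n3V; rewrite -{1}EV in_setU1 (negbTE n3v).
  have W3 : (wsum es V0 + 3 <= 5 * #|V0|)%N.
    by apply: (p3 M) => //; rewrite -EV -card_gt0 cvB.
  rewrite EV n2B n3B in WvB; rewrite EV in cvB.
  case: HB => [|KB]; first by blia.
  have [|x2 [E2 _ _]] := critical_end (d0 := (dq d4, dn d1, dq d1, w)) KB n4B.
    by rewrite star_newE // eqxx (negbTE n41) /= [dn _]/(dn d1) n1B.
  have := full_degree M EV vB n4V; rewrite /deg -size_filter E2 (star_mult _ Hp) /=.
  by rewrite (negbTE n14) (negbTE n24) (negbTE n34) eqxx.
have pvB : v |: B \proper V0 by rewrite properEneq nV.
have W6 := slack_ge6 M pvB.
case: (boolP (dn d2 \in B)) WvB => [n2B|n2B] WvB.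
  by case: HB => [|[]]; blia.
case: (boolP (dn d3 \in B)) WvB => [n3B|n3B] WvB.
  by case: HB => [|[]]; blia.
have [Ep|np] := eqVneq (dp d1) (dp d4).
  have W7 : (wsum es (v |: B) + 7 <= 5 * #|v |: B|)%N.
    apply: (slack_ge7 M pvB (x := v) (d1 := d1) (d2 := d4)) => //; first by rewrite !inE eqxx.
    apply: perm_trans (perm_filter _ Hp) _.
    by rewrite /= !in_setU1 n1B n4B (negbTE n2B) (negbTE n3B) (negbTE n2v) (negbTE n3v) !orbT.
  have Ew := pw Ep; split=> //; exists B; split=> //; first by rewrite n2B.
  by case: HB => [|KB]; [|case: (KB)]; rewrite -?Ew; [blia|split=> //; blia].
have w3 : (w <= 3)%N.
  have [] : w <> 4 /\ (w <= 4)%N; last by blia.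
  by split; [move=> /wp /eqP; rewrite (negbTE np)|blia].
case: HB => [|KB]; first by blia.
have [x [E1 w7 w9]] := K1 KB.
have E3 : (wsum (es ++ newE (dn d1) (dq d1) (dn d4) (dq d4) w) B + 3 = 5 * #|B|)%N by case: KB.
have /andP[dxB xS] : (dn x \in B) && (x \in star es (dn d1)).
  by rewrite -(mem_filter (fun d => dn d \in B)) E1 mem_head.
have wx := w4 M xS.
suff : (wsum es (v |: B) + 7 <= 5 * #|v |: B|)%N by blia.
apply: (slack_ge7_end pvB (subsetUr _ _) _ vB n1B E1 Hp (d := d1)).
- by rewrite !inE eqxx.
- rewrite /= eqxx [dn d4 == _]eq_sym (negbTE n14).
  by case: eqP => [E|_]; [rewrite E n1B in n2B|case: eqP => [E|_] //; rewrite E n1B in n3B].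
- by rewrite w9 //; blia.
- by move=> u; rewrite in_setU1 => /orP[/eqP ->|->] //; rewrite eqxx.
Qed.

Lemma gadget_sat u a v b w B : B \proper V0 -> u != v -> (2 <= w <= 5)%N ->
  (forall D, D \subset B -> u \in D -> v \in D ->
     (wsum es D + w + 4 <= 5 * #|D|)%N) ->
  exists phi, sat es B phi /\ (u \in B -> v \in B ->
     okw w (act (phi u) a) (act (phi v) b)).
Proof.
move=> pB uv w25 H.
have [phi] : exists phi, sat (es ++ newE u a v b w) B phi.
  apply: (mc_minE M); last 1 first.
  - move=> D sD nD; suff : (wsum (es ++ newE u a v b w) D + 4 <= 5 * #|D|)%N.
      by split; blia.
    have W5 := subset5 M (sub_proper_trans sD pB) nD.
    rewrite wsum_cat wsum_newE; case: ifP => [/andP[uD vD]|_]; last by blia.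
    exact: H.
  - by rewrite wf_cat (mc_wf M) wf_newE // w25 orbT.
  - exact: proper_card.
rewrite sat_cat sat_newE => /andP[Hphi Hn]; exists phi; split=> // uB vB.
by move: Hn; rewrite uB vB.
Qed.

(** With weight 2 on the new edge all sets through it keep slack 4, so a colouring exists; with
    weight 4 there is none. Hence the two ends are at distance exactly two. *)
Lemma gadget_far u a v b B : B \proper V0 -> u != v -> u \in B -> v \in B ->
  critical (es ++ newE u a v b 4) B ->
  exists phi, [/\ sat es B phi, okw 2 (act (phi u) a) (act (phi v) b) &
    ~~ okw 4 (act (phi u) a) (act (phi v) b)].
Proof.
move=> pB uv uB vB KB; have [|phi [Hphi Hw]] := @gadget_sat u a v b 2 B pB uv isT.
  move=> D sD uD vD; have cD : (1 < #|D|)%N by apply/card_gt1P; exists u, v.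
  by have := slack_ge6 M (sub_proper_trans sD pB) cD; blia.
exists phi; split; [by []|exact: Hw|apply/negP => H4].
by case: KB => _ _; apply; exists phi; rewrite sat_cat Hphi sat_newE H4 implybT.
Qed.

(** Two critical sets, through [d1], [d4] and through [d2], [d4], meet only in the end of [d4] and
    have no edge across. Their colourings can be turned so that [d1] and [d2] see the same colour;
    the union is contracted in this state, and afterwards [v] has a free state. *)
Lemma no2223 v d1 d2 d3 d4 : perm_eq (star es v) [:: d1; d2; d3; d4] ->
  dw d1 = 2 -> dw d2 = 2 -> dw d3 = 2 -> dw d4 = 3 -> False.
Proof.
move=> Hp e1 e2 e3 e4; have [vV n1V n1v _] := star_in M Hp (mem_head _ _).
have [_ n3V n3v _] : [/\ v \in V0, dn d3 \in V0, dn d3 != v & (2 <= dw d3 <= 4)%N].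
  by apply: (star_in M) Hp _; rewrite !inE eqxx !orbT.
have [p14 [B1 [s1 n1B1 n4B1 /andP[n2B1 n3B1] [W1 K1]]]] :=
  no2223_gadget Hp e1 e2 e3 e4.
have Hp' : perm_eq (star es v) [:: d2; d1; d3; d4].
  by apply: perm_trans Hp _; rewrite -[[:: d2, d1 & _]]/([:: d2] ++ [:: d1] ++ _)
    perm_sym perm_catCA perm_refl.
have [p24 [B2 [s2 n2B2 n4B2 /andP[n1B2 n3B2] [W2 K2]]]] :=
  no2223_gadget Hp' e2 e1 e3 e4.
have pV := properD1 vV.
have pB1 := sub_proper_trans s1 pV; have pB2 := sub_proper_trans s2 pV.
have n14 : dn d1 != dn d4 by apply: contraNneq n1B2 => ->.
have n24 : dn d2 != dn d4 by apply: contraNneq n2B1 => ->.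
have n12 : dn d1 != dn d2 by apply: contraNneq n1B2 => ->.
have n31 : dn d3 != dn d1 by apply: contraNneq n3B1 => ->.
have n32 : dn d3 != dn d2 by apply: contraNneq n3B2 => ->.
have n34 : dn d3 != dn d4 by apply: contraNneq n3B2 => ->.
pose U := B1 :|: B2.
have sU : U \subset V0 :\ v by rewrite subUset s1.
have vU : v \notin U by apply/negP => /(subsetP sU); rewrite !inE eqxx.
have pU := sub_proper_trans sU pV.
have [n1U n2U n4U] : [/\ dn d1 \in U, dn d2 \in U & dn d4 \in U].
  by rewrite /U !in_setU n1B1 n2B2 n4B1 orbT.
have n3U : dn d3 \notin U by rewrite in_setU negb_or n3B1.
have pvU : v |: U \proper V0.
  apply/properP; split; first by rewrite subUset sub1set vV (proper_sub pU).
  by exists (dn d3) => //; rewrite in_setU1 negb_or n3v.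
have cvU : #|v |: U| = #|U|.+1 by rewrite cardsU1 vU.
have := wsum_starp (mc_wf M) vU Hp.
rewrite /= n1U n2U n4U (negbTE n3U) e1 e2 e3 e4 => WvU.
have cU1 : (1 < #|U|)%N by apply/card_gt1P; exists (dn d1), (dn d4).
have W6 : (wsum es (v |: U) + 6 <= 5 * #|v |: U|)%N by apply: (slack_ge6 M pvU); blia.
have nI : B1 :&: B2 != set0 by apply/set0Pn; exists (dn d4); rewrite inE n4B1.
have pI : B1 :&: B2 \proper V0 := sub_proper_trans (subsetIl _ _) pB1.
have I5 := subset5 M pI nI.
have cUI : (#|U| + #|B1 :&: B2| = #|B1| + #|B2|)%N := cardsUI B1 B2.
have [|] := wsumUI M B1 B2; rewrite -/U; last by blia.
case=> WUI cross.
have [|x1 [E1 w17 w19]] := critical_end (d0 := (dq d1, dn d4, dq d4, 4)) K1 n1B1.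
  by rewrite star_newE // eqxx /= [dn _]/(dn d4) n4B1.
have x1S : x1 \in star es (dn d1).
  have : x1 \in [seq d <- star es (dn d1) | dn d \in B1] by rewrite E1 mem_head.
  by rewrite mem_filter => /andP[].
have {}w19 : dp x1 = dq d1 by apply: w19; change (4 + dw x1 <= 9)%N; have := w4 M x1S; blia.
(* A larger intersection has slack 6, which leaves at most 7 + 7 - 6 for the union and 6 for the
   union with [v], against [slack_ge7_end]. *)
have I1 : #|B1 :&: B2| = 1%N.
  apply/eqP; rewrite eqn_leq card_gt0 nI andbT leqNgt; apply/negP => cI.
  have := slack_ge6 M pI cI => I6.
  suff : (wsum es (v |: U) + 7 <= 5 * #|v |: U|)%N by blia.
  apply: (slack_ge7_end pvU (B := U) (subsetUr _ _) _ vU n1U (e := x1) _ Hp (d := d1)) => //.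
  - by rewrite !inE eqxx.
  - rewrite -E1; apply: eq_in_filter => d dS; apply/idP/idP.
      exact: cross n1B1 n1B2 dS.
    by move=> dB; rewrite /U in_setU dB.
  - by rewrite /= eqxx [dn d2 == _]eq_sym (negbTE n12) (negbTE n31)
      [dn d4 == _]eq_sym (negbTE n14).
  - by move=> u; rewrite in_setU1 => /orP[/eqP ->|->] //; rewrite eqxx.
have EI : B1 :&: B2 = [set dn d4].
  by apply/esym/eqP; rewrite eqEcard I1 cards1 sub1set inE n4B1 n4B2.
have WU : (wsum es U + 9 = 5 * #|U|)%N.
  by move: WUI; rewrite EI (wsum_set1 _ (mc_wf M)); blia.
have [f1 [sat1 f12 f14]] := gadget_far pB1 n14 n1B1 n4B1 K1.
have [f2 [sat2 f22 f24]] := gadget_far pB2 n24 n2B2 n4B2 K2.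
have [g [g4 g1]] := align_fact f12 f14 f22 f24.
have [|x2 [E2 w27 w29]] := critical_end (d0 := (dq d4, dn d2, dq d2, 4)) K2 n4B2.
  by rewrite star_newE // eqxx [dn d4 == _]eq_sym (negbTE n24) /= [dn _]/(dn d2) n2B2.
have x2S : x2 \in star es (dn d4).
  have : x2 \in [seq d <- star es (dn d4) | dn d \in B2] by rewrite E2 mem_head.
  by rewrite mem_filter => /andP[].
have {}w29 : dp x2 = dq d4 by apply: w29; change (4 + dw x2 <= 9)%N; have := w4 M x2S; blia.
(* At the common vertex [f1] and the turned [f2] may be different states; they agree at the position
   [dq d4], where its only dart into [B2] sits. *)
pose f u := if u \in B1 then f1 u else cmp g (f2 u).
have fB2 u d : u \in B2 -> d \in star es u -> dn d \in B2 ->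
    act (f u) (dp d) = act g (act (f2 u) (dp d)).
  move=> uB2 dS dB2; rewrite /f; case: ifP => uB1; last by rewrite act_cmp.
  have : u \in B1 :&: B2 by rewrite inE uB1.
  rewrite EI inE => /eqP Eu; rewrite Eu in dS *.
  have : d \in [seq d <- star es (dn d4) | dn d \in B2] by rewrite mem_filter dB2.
  by rewrite E2 inE => /eqP ->; rewrite w29 g4.
have satU : sat es U f.
  apply/allP => e eS; apply/implyP => eU.
  case: (boolP (inE_ B1 e)) => eB1.
    have := allP sat1 e eS; rewrite eB1 /okE /f.
    by case/andP: eB1 => -> ->.
  have eB2 : inE_ B2 e.
    have dS : e.2 \in star es e.1 by rewrite mem_star -surjective_pairing eS.
    have dS' : (revE e).2 \in star es (dn e.2).
      by rewrite mem_star -[(dn e.2, _)]/(revE e) revEK eS orbT.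
    apply/negPn/negP => eB2; case/andP: eU => uU dU.
    move: (uU) (dU); rewrite {1 2}/U !in_setU.
    move: eB1 eB2; rewrite /inE_.
    case: (boolP (e.1 \in B1)) => /= u1; case: (boolP (e.1 \in B2)) => /= u2 //.
    - by move=> /negbTE -> /negbTE ->.
    - by move=> /negP []; apply: cross u1 u2 dS dU.
    - move=> _ /negbTE h; rewrite h orbF => _ d1B; have := cross _ _ d1B _ dS'.
      by rewrite h => /(_ isT uU); rewrite [dn _]/(e.1) (negbTE u1).
  have := allP sat2 e eS; rewrite eB2 /okE /=; case/andP: eB2 => u2 v2.
  have dS : e.2 \in star es e.1 by rewrite mem_star -surjective_pairing eS.
  have dS' : (revE e).2 \in star es (dn e.2).
    by rewrite mem_star -[(dn e.2, _)]/(revE e) revEK eS orbT.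
  by rewrite (fB2 _ _ u2 dS v2) -[dq e.2]/(dp (revE e).2) (fB2 _ _ v2 dS' u2) okw_act.
pose r := dn d4; pose V1 := r |: ((V0 :\ v) :\: U).
have V1U : V1 :&: U = [set r].
  apply/setP => x; rewrite /V1 in_setI in_setU1 in_setD in_set1.
  case: (eqVneq x r) => [->|_] /=; first by rewrite n4U.
  by case: (x \in U); rewrite ?andbF.
have V1V : V1 :|: U = V0 :\ v.
  apply/setP => x; rewrite in_setU /V1 in_setU1 in_setD.
  case: (boolP (x \in U)) => xU /=; first by rewrite orbT (subsetP sU).
  by rewrite orbF; case: (eqVneq x r) => [E|//]; rewrite E n4U in xU.
have [phi Hphi] : exists phi, sat (contr U r f es) V1 phi.
  apply: (mc_minE M); last 1 first.
  - move=> B sB nB.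
    have BV0 : B :|: U \subset V0 :\ v by rewrite -V1V setSU.
    case: (boolP (r \in B)) => rB; last first.
      have dBU : [disjoint B & U].
        rewrite disjoint_subset; apply/subsetP => x xB; rewrite inE.
        apply/negP => xU; have : x \in V1 :&: U by rewrite in_setI (subsetP sB).
        by rewrite V1U in_set1 => /eqP E; rewrite -E xB in rB.
      rewrite wsum_contr0 //.
      suff : (wsum es B + 5 <= 5 * #|B|)%N by blia.
      apply: (subset5 M) nB; apply: sub_proper_trans pV.
      by apply: subset_trans BV0; apply: subsetUl.
    have BU : B :&: U = [set r].
      apply/setP => x; rewrite in_setI; case: (boolP (x \in B)) => xB /=.
        by rewrite -V1U in_setI (subsetP sB _ xB).
      by rewrite in_set1; apply/esym/negbTE; apply: contraNneq xB => ->.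
    have cBU : (#|B :|: U| + 1 = #|B| + #|U|)%N.
      by have := cardsUI B U; rewrite BU cards1; blia.
    have EW := wsum_contr f es BU.
    have vX : v \notin B :|: U by apply/negP => /(subsetP BV0); rewrite !inE eqxx.
    have cvX : #|v |: (B :|: U)| = #|B :|: U|.+1 by rewrite cardsU1 vX.
    have := wsum_starp (mc_wf M) vX Hp; rewrite /= !(in_setU _ B U) n1U n2U n4U !orbT.
    rewrite e1 e2 e3 e4 => WvX.
    have svX : v |: (B :|: U) \subset V0.
      by rewrite subUset sub1set vV (subset_trans BV0) ?subsetDl.
    have cX : (1 < #|v |: (B :|: U)|)%N by rewrite cvX ltnS card_gt0; apply/set0Pn; exists r; rewrite in_setU rB.
    case: (eqVneq (v |: (B :|: U)) V0) => [EV|nV]; last first.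
      have pvX : v |: (B :|: U) \proper V0 by rewrite properEneq nV.
      have X6 := slack_ge6 M pvX cX.
      suff : (wsum (contr U r f es) B + 4 <= 5 * #|B|)%N by split; blia.
      by move: WvX; case: (_ || _); blia.
    have n3B : dn d3 \in B.
      by have := n3V; rewrite -{1}EV in_setU1 in_setU (negbTE n3v) (negbTE n3U) orbF.
    rewrite n3B /= EV in WvX; rewrite EV in cvX.
    have W3 : (wsum es V0 + 3 <= 5 * #|V0|)%N.
      by apply: (p3 M) => //; apply/set0Pn; exists v.
    split; first by blia.
    (* The end of [d3] receives weight 2, so it is not cubic; losing its one dart to [v] it keeps
       degree at least 3, and the set of slack 3 is no cycle. *)
    move=> _ HD; exfalso; have := HD _ n3B; rewrite star_contr ?in_setD ?n3U //.
    have n3X : dn d3 \in B :|: U by rewrite in_setU n3B.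
    have : size (star es (dn d3)) = (mult es (dn d3) v + deg es (B :|: U) (dn d3))%N.
      by rewrite -degU1 // EV (deg_V0 M).
    rewrite multC (star_mult _ Hp) /= ![_ == dn d3]eq_sym.
    rewrite (negbTE n31) (negbTE n32) [dn d4 == _]eq_sym (negbTE n34) eqxx /=.
    have : (2 < size (star es (dn d3)))%N := star_ge3 M n3V.
    have : size (star es (dn d3)) <> 3.
      move=> s3; have d3S : d3 \in star es v by rewrite (perm_mem Hp) !inE eqxx !orbT.
      by have := cubic_weight_ge3 M s3 (revd_star d3S); change (3 <= dw d3 -> False)%N; rewrite e3.
    by blia.
  - exact: wf_contr n4U _ (mc_wf M).
  - have : (#|V1| < #|V0|)%N.
      have := cardsUI V1 U; rewrite V1U V1V cards1.
      by have := proper_card pV; blia.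
    by [].
have := sat_contr V1U satU Hphi; rewrite V1V; set psi := (fun u => _) => Hpsi.
have y2 : okw 2 (act (psi (dn d1)) (dq d1)) (act (psi (dn d4)) (dq d4)).
  by rewrite /psi n1U n4U !act_cmp okw_act /f n1B1 n4B1.
have y4 : ~~ okw 4 (act (psi (dn d1)) (dq d1)) (act (psi (dn d4)) (dq d4)).
  by rewrite /psi n1U n4U !act_cmp okw_act /f n1B1 n4B1.
have Epsi : act (psi (dn d2)) (dq d2) = act (psi (dn d1)) (dq d1).
  by rewrite /psi n1U n2U !act_cmp /f n1B1 (negbTE n2B1) act_cmp g1.
have [s /and3P[h1 h2 h3]] := free5_fact (dp d4) (dp d3) (act (psi (dn d3)) (dq d3)) y2 y4.
apply: (mc_unsat M); apply: (extend1 M (s := s) vV Hpsi) => d.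
rewrite (perm_mem Hp) !inE.
by case/or4P => /eqP ->; rewrite /okD ?e1 ?e2 ?e3 ?e4 ?p14 ?p24 ?Epsi.
Qed.

End Local.

(** * Cubic vertices with weights 3, 3, 3 and their neighbours *)

Lemma gad6_fact pa pb q : exists w,
  [/\ (w == 0%N) || (2 <= w <= 5)%N, (w <= 4)%N || ((pa == q) && (pb == q)) &
   forall x y, okw w x y -> forall z, exists s,
     [&& okw 3 (act s pa) x, okw 3 (act s pb) y & okw 3 (act s q) z]].
Proof.
have : all5 (fun pa => all5 (fun pb => all5 (fun q => exw (fun w =>
  ((w <= 4)%N || ((pa == q) && (pb == q))) &&
  all5 (fun x => all5 (fun y => if okw w x y then all5 (fun z => exS (fun s =>
  [&& okw 3 (act s pa) x, okw 3 (act s pb) y & okw 3 (act s q) z])) else true)))))).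
  by vm_compute.
move=> /all5P/(_ pa)/all5P/(_ pb)/all5P/(_ q)/exwP[w [ww /andP[w45 H]]].
exists w; split=> // x y Hxy z; move: (all5P _ (all5P _ H x) y).
by rewrite Hxy => /all5P/(_ z)/exSP.
Qed.

Section Critical.
Variable V : finType.
Implicit Types (es : seq (edge V)) (A B C D : {set V}).

Lemma critical_sum2 es ns B (g : V -> nat) : critical (es ++ ns) B ->
  {in B, forall v, (\sum_(d <- star es v | dn d \in B) dw d +
    \sum_(d <- star ns v | dn d \in B) dw d + g v <= 10)%N} ->
  (\sum_(v in B) g v <= 6)%N.
Proof.
move=> KB H; apply: critical_sum KB _ => v vB d1 d2 Hp.
have := H v vB.
have <- : (\sum_(d <- star (es ++ ns) v | dn d \in B) dw d = dw d1 + dw d2)%N.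
  by rewrite -big_filter (perm_big _ Hp) /= !big_cons big_nil addn0.
by rewrite (perm_big _ (star_cat es ns v)) big_cat.
Qed.

Lemma critical_old es ns B x : critical (es ++ ns) B -> x \in B ->
  [seq d <- star ns x | dn d \in B] = [::] ->
  exists d1 d2, [/\ perm_eq [seq d <- star es x | dn d \in B] [:: d1; d2],
    (7 <= dw d1 + dw d2)%N & (dw d1 + dw d2 <= 9)%N -> dp d1 = dp d2].
Proof.
move=> [_ Hk _] xB E0; have [d1 [d2 [Hp w7 w9]]] := Hk x xB.
exists d1, d2; split=> //; apply: perm_trans Hp.
rewrite perm_sym; apply: perm_trans (perm_filter _ (star_cat es ns x)) _.
by rewrite filter_cat E0 cats0.
Qed.

Lemma sum_star_newE u a v b w x B : u != v ->
  (\sum_(d <- star (newE u a v b w) x | dn d \in B) dw d <=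
   if x == u then w else if x == v then w else 0)%N.
Proof.
move=> uv; case: (eqVneq w 0%N) => [->|w0]; first by rewrite /newE /star big_nil.
rewrite star_newE //; case: ifP => _; last case: ifP => _; rewrite ?big_cons big_nil //.
  by case: ifP; rewrite ?addn0.
by case: ifP; rewrite ?addn0.
Qed.

End Critical.

Section Local.
Variable V : finType.
Implicit Types (es : seq (edge V)) (A B C D : {set V}) (phi f : V -> state).
Variables (es : seq (edge V)) (V0 : {set V}).
Hypothesis M : mincex es V0.

(* The ways in which a critical cycle through a new edge from [a] to [b] can
   close up. *)
Definition linked a qa b qb :=
  [\/ (qa, b, qb, 2) \in star es a,
      exists s r, (qa, s, r, 4) \in star es a /\ (r, b, qb, 3) \in star es s |
      exists2 d, d \in star es b & dw d = 4].

Lemma dartE (d : dart V) : d = (dp d, dn d, dq d, dw d).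
Proof. by case: d => [[[? ?] ?] ?]. Qed.

Lemma filter1 x B (d : dart V) : [seq y <- star es x | dn y \in B] = [:: d] ->
  (d \in star es x) /\ (dn d \in B).
Proof.
move=> E; have : d \in [seq y <- star es x | dn y \in B] by rewrite E mem_head.
by rewrite mem_filter => /andP[].
Qed.

Lemma filter1_eq x B (d y : dart V) : [seq y <- star es x | dn y \in B] = [:: d] ->
  y \in star es x -> dn y \in B -> y = d.
Proof.
move=> E yS yB; have : y \in [seq y <- star es x | dn y \in B] by rewrite mem_filter yB.
by rewrite E inE => /eqP.
Qed.

(** The critical cycle is followed from the end of [da]: it closes at once along an old edge, after
    one further vertex, or has at least four vertices. In the last case its deficiencies exceed 6
    unless the old dart at the end of [db] has weight 4. *)
Lemma link_of_critical v e da db B :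
  perm_eq (star es v) [:: e; da; db] -> dw e = 3 -> dw da = 3 -> dw db = 3 ->
  dp da = dp e -> dp db = dp e -> B \subset V0 :\: [set v; dn e] ->
  dn da \in B -> dn db \in B -> dn da != dn db ->
  critical (es ++ newE (dn da) (dq da) (dn db) (dq db) 5) B ->
  linked (dn da) (dq da) (dn db) (dq db).
Proof.
move=> Hp we wa wb pa pb sB aB bB nab KB.
have nba : dn db != dn da by rewrite eq_sym.
have [vV eV ev _] := star_in M Hp (mem_head _ _).
have vB : v \notin B by apply/negP => /(subsetP sB); rewrite !inE eqxx.
have eB : dn e \notin B by apply/negP => /(subsetP sB); rewrite !inE eqxx orbT.
have sBV : B \subset V0 := subset_trans sB (subsetDl _ _).
(* No set between [v] and [B] is saturated, by the lemma on nodes with two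
   darts at the same position. *)
have W7 D : D \subset B -> dn da \in D -> dn db \in D ->
    (wsum es D + 8 <= 5 * #|D|)%N.
  move=> sD aD bD; have vD : v \notin D by apply: contra vB; apply: (subsetP sD).
  have eD : dn e \notin D by apply: contra eB; apply: (subsetP sD).
  have pvD : v |: D \proper V0.
    apply/properP; split; first by rewrite subUset sub1set vV (subset_trans sD).
    by exists (dn e) => //; rewrite in_setU1 negb_or ev.
  have : (wsum es (v |: D) + 7 <= 5 * #|v |: D|)%N.
    apply: (slack_ge7 M pvD (x := v) (d1 := da) (d2 := db)) => //; first by rewrite !inE eqxx.
      apply: perm_trans (perm_filter _ Hp) _.
      by rewrite /= !in_setU1 aD bD (negbTE eD) (negbTE ev) !orbT.
    by rewrite pa.
  rewrite (wsum_starp (mc_wf M) vD Hp) /= aD bD (negbTE eD) wa wb cardsU1 vD; blia.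
have [|x1 [E1 w17 w19]] := critical_end (d0 := (dq da, dn db, dq db, 5)) KB aB.
  by rewrite star_newE // eqxx /= [dn _]/(dn db) bB.
have [|x2 [E2 w27 w29]] := critical_end (d0 := (dq db, dn da, dq da, 5)) KB bB.
  by rewrite star_newE // eqxx (negbTE nba) /= [dn _]/(dn da) aB.
have [x1S x1B] := filter1 E1; have [x2S x2B] := filter1 E2.
have x14 := w4 M x1S; have x24 := w4 M x2S.
have {}w19 : dp x1 = dq da by apply: w19; change (5 + dw x1 <= 9)%N; blia.
have {}w29 : dp x2 = dq db by apply: w29; change (5 + dw x2 <= 9)%N; blia.
have tob z y : z \in B -> y \in star es z -> dn y = dn db -> dq y = dq db /\ dw x2 = dw y.
  move=> zB yS Ey; have yS' := revd_star yS; rewrite Ey in yS'.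
  by have := filter1_eq E2 yS' zB; rewrite -w29 => <-.
case: (eqVneq (dn x1) (dn db)) => [Eb|nb].
  have [Eq _] := tob _ _ aB x1S Eb.
  constructor 1; suff <- : x1 = (dq da, dn db, dq db, 2) by [].
  have sD : [set dn da; dn db] \subset B by rewrite subUset !sub1set aB.
  have := W7 _ sD; rewrite !inE !eqxx orbT cards2 nab => /(_ isT isT).
  rewrite (wsum2 (mc_wf M) nab) (perm_big _ (perm_to_rem x1S)) /= big_cons Eb eqxx => W.
  have W2 : dw x1 = 2 by blia.
  by rewrite {1}(dartE x1) w19 Eb Eq W2.
have na : dn x1 != dn da by have /andP[] := star_wf (mc_wf M) x1S.
have [|y1 [y2 [Hy y7 y9]]] := critical_old KB x1B.
  by rewrite star_newE // (negbTE na) (negbTE nb).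
have rS := revd_star x1S.
have rY : revd (dn da) x1 \in [:: y1; y2] by rewrite -(perm_mem Hy) mem_filter aB rS.
have yS y : y \in [:: y1; y2] -> y \in star es (dn x1) /\ dn y \in B.
  by rewrite -(perm_mem Hy) mem_filter => /andP[].
have [y1S y1B] : y1 \in star es (dn x1) /\ dn y1 \in B by apply: yS; rewrite mem_head.
have [y2S y2B] : y2 \in star es (dn x1) /\ dn y2 \in B by apply: yS; rewrite !inE eqxx orbT.
have y14 := w4 M y1S; have y24 := w4 M y2S.
have {}y9 : dp y1 = dp y2 by apply: y9; blia.
have y12 : dn y1 != dn y2.
  apply: (parallel M (v := dn x1) (l := [seq d <- star es (dn x1) | dn d \notin B])); last by blia.
  rewrite perm_sym; apply: perm_trans (permEl (perm_filterC (fun d => dn d \in B) _)).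
  by rewrite -[[:: y1, y2 & _]]/([:: y1; y2] ++ _) perm_cat2r perm_sym.
have [y [yS' yB ya wy py]] : exists y, [/\ y \in star es (dn x1), dn y \in B,
    dn y != dn da, (7 <= dw x1 + dw y)%N & dp y = dq x1].
  move: rY; rewrite !inE => /orP[] /eqP E; move: y7 y12 y9; rewrite -E => y7 y12 y9.
    by exists y2; rewrite -y9; split=> //; rewrite eq_sym.
  by exists y1; rewrite y9; split=> //; rewrite addnC.
have wy4 := w4 M yS'.
case: (eqVneq (dn y) (dn db)) => [Eb|nyb].
  have [Eq Ew] := tob _ _ x1B yS' Eb.
  have : dw x1 = 4 \/ dw y = 4 by blia.
  case=> W4; last by constructor 3; exists x2 => //; rewrite Ew.
  constructor 2; exists (dn x1), (dq x1).
  have Ex1 : x1 = (dq da, dn x1, dq x1, 4) by rewrite {1}(dartE x1) w19 W4.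
  rewrite -Ex1; split=> //; suff <- : y = (dq x1, dn db, dq db, 3) by [].
  have sD : dn x1 |: [set dn da; dn db] \subset B by rewrite !subUset !sub1set aB x1B.
  have xD : dn x1 \notin [set dn da; dn db] by rewrite !inE negb_or na.
  have := W7 _ sD; rewrite !inE !eqxx !orbT cardsU1 xD cards2 nab => /(_ isT isT).
  have yS1 : y \in rem (revd (dn da) x1) (star es (dn x1)).
    have : y \in star es (dn x1) by [].
    rewrite (perm_mem (perm_to_rem rS)) inE => /orP[/eqP Ey|//].
    by rewrite Ey eqxx in ya.
  have Ps : perm_eq (star es (dn x1)) [:: revd (dn da) x1, y &
     rem y (rem (revd (dn da) x1) (star es (dn x1)))].
    by apply: perm_trans (perm_to_rem rS) _; rewrite perm_cons perm_to_rem.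
  have [z [l [Ez1 Ez2 {}Ps]]] : exists z l, [/\ dn z = dn da, dw z = dw x1 &
    perm_eq (star es (dn x1)) [:: z, y & l]] by do 2 eexists; split; last exact: Ps.
  rewrite (wsum_starp (mc_wf M) xD Ps) /= !inE Eb Ez1 Ez2 !eqxx !orbT => W.
  have W3 : dw y = 3 by blia.
  by rewrite {1}(dartE y) py Eb Eq W3.
constructor 3; exists x2 => //; apply/eqP/negPn/negP => n4.
have x23 : (dw x2 <= 3)%N by blia.
(* Deficiencies for [critical_sum]: 10 - 5 - 4 at the end of [da], 10 - 5 - 3 at the end of [db],
   and 10 - 4 - 4 elsewhere. Four vertices give 7. *)
pose g u : nat := if u == dn da then 1 else 2.
have : (\sum_(u in B) g u <= 6)%N.
  apply: (critical_sum2 KB) => u uB; rewrite /g.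
  have := @sum_star_newE _ (dn da) (dq da) (dn db) (dq db) 5 u B nab.
  case: (eqVneq u (dn da)) => [->|ua] Hnew.
    rewrite (_ : (\sum_(d <- star es (dn da) | dn d \in B) dw d = dw x1)%N); first by blia.
    by rewrite -big_filter E1 big_seq1.
  move: Hnew; case: (eqVneq u (dn db)) => [->|ub] Hnew.
    rewrite (_ : (\sum_(d <- star es (dn db) | dn d \in B) dw d = dw x2)%N); first by blia.
    by rewrite -big_filter E2 big_seq1.
  have [|d1 [d2 [Hd _ _]]] := critical_old KB uB.
    by rewrite star_newE // (negbTE ua) (negbTE ub).
  have -> : (\sum_(d <- star es u | dn d \in B) dw d = dw d1 + dw d2)%N.
    by rewrite -big_filter (perm_big _ Hd) /= !big_cons big_nil addn0.
  have dS d : d \in [:: d1; d2] -> (2 <= dw d <= 4)%N.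
    by rewrite -(perm_mem Hd) mem_filter => /andP[_ /(w4 M)].
  have := dS d1 (mem_head _ _); have := dS d2; rewrite !inE eqxx orbT => /(_ isT); blia.
have sx : dn y != dn x1 by have /andP[] := star_wf (mc_wf M) yS'.
rewrite (bigD1 (dn da)) //= (bigD1 (dn db)) ?bB //= (bigD1 (dn x1)) ?x1B ?na //=.
rewrite (bigD1 (dn y)) ?yB ?ya ?nyb //= /g eqxx (negbTE nba) (negbTE na) (negbTE ya).
by blia.
Qed.

(** With [v] deleted the darts [lu] always leave a free state at [dn e], so both vertices can be
    deleted for one gadget edge. Its weight is 5 only if the three positions at [v] agree; a lighter
    gadget leaves an obstruction excluded by [slack_ge7_end], and weight 5 leaves the cycles
    analysed in [link_of_critical]. *)
Lemma X_reduction v e da db lu : perm_eq (star es v) [:: e; da; db] ->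
  dw e = 3 -> dw da = 3 -> dw db = 3 ->
  perm_eq (star es (dn e)) (revd v e :: lu) -> (\sum_(d <- lu) (dw d).-1 < 5)%N ->
  [/\ dp da = dp e, dp db = dp e & linked (dn da) (dq da) (dn db) (dq db)].
Proof.
move=> Hp we wa wb Hu Hlu.
have [vV eV ev _] := star_in M Hp (mem_head _ _).
have [_ aV av _] : [/\ v \in V0, dn da \in V0, dn da != v & (2 <= dw da <= 4)%N].
  by apply: (star_in M) Hp _; rewrite !inE eqxx orbT.
have [_ bV bv _] : [/\ v \in V0, dn db \in V0, dn db != v & (2 <= dw db <= 4)%N].
  by apply: (star_in M) Hp _; rewrite !inE eqxx !orbT.
have nea : dn e != dn da by apply: (parallel M Hp); rewrite we wa.
have neb : dn e != dn db.
  apply: (parallel M (v := v) (d1 := e) (d2 := db) (l := [:: da])); last by rewrite we wb.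
  apply: perm_trans Hp _; rewrite perm_cons; exact: permEl (perm_catC [:: da] [:: db]).
have nab : dn da != dn db.
  apply: (parallel M (v := v) (d1 := da) (d2 := db) (l := [:: e])); last by rewrite wa wb.
  apply: perm_trans Hp _; exact: permEl (perm_catC [:: e] [:: da; db]).
have [nae nbe] : dn da != dn e /\ dn db != dn e by rewrite ![_ == dn e]eq_sym.
have [w [ww w45 Hw]] := gad6_fact (dp da) (dp db) (dp e).
pose C := [set v; dn e].
have aC : dn da \in V0 :\: C by rewrite !inE negb_or av nae.
have bC : dn db \in V0 :\: C by rewrite !inE negb_or bv nbe.
have [|||phi|B [sB nB HB]] := @reduction _ _ _ M C
  (es ++ newE (dn da) (dq da) (dn db) (dq db) w).
- by rewrite subUset !sub1set vV.
- by apply/set0Pn; exists v; rewrite !inE eqxx.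
- by rewrite wf_cat (mc_wf M) wf_newE.
- rewrite sat_cat sat_newE aC bC /= => /andP[Hphi Hn].
  have [|t Ht] := @free_state _ lu phi _ Hlu.
    move=> d dl; have : d \in star es (dn e) by rewrite (perm_mem Hu) inE dl orbT.
    by move=> /(star_wf (mc_wf M))/andP[].
  have eC : dn e \notin V0 :\: C by rewrite !inE eqxx orbT.
  have EC : dn e |: (V0 :\: C) = V0 :\ v.
    apply/setP => x; rewrite !inE; case: (eqVneq x (dn e)) => [->|_].
      by rewrite ev eV.
    by rewrite orbF.
  have := sat_ext (s := t) (mc_wf M) eC Hphi; rewrite EC => Hsat.
  have [s /and3P[h1 h2 h3]] := Hw _ _ Hn (act t (dq e)).
  apply: (extend1 M (s := s) vV (Hsat _)) => d.
    rewrite (perm_mem Hu) inE => /orP[/eqP ->|/Ht //].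
    by rewrite !inE eqxx.
  rewrite (perm_mem Hp) !inE /okD => /or3P[] /eqP ->.
  + by rewrite eqxx we.
  + by rewrite (negbTE nae) wa.
  + by rewrite (negbTE nbe) wb.
have vB : v \notin B by apply/negP => /(subsetP sB); rewrite !inE eqxx.
have eB : dn e \notin B by apply/negP => /(subsetP sB); rewrite !inE eqxx orbT.
have sBV : B \subset V0 := subset_trans sB (subsetDl _ _).
have pB : B \proper V0 by apply/properP; split=> //; exists v.
have W5 := subset5 M pB nB.
have W : wsum (es ++ newE (dn da) (dq da) (dn db) (dq db) w) B =
  (wsum es B + if (dn da \in B) && (dn db \in B) then w else 0)%N.
  by rewrite wsum_cat wsum_newE.
case: (boolP ((dn da \in B) && (dn db \in B))) W => [/andP[aB bB]|_] W; last first.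
  by case: HB => [|[]]; blia.
have cvB : #|v |: B| = #|B|.+1 by rewrite cardsU1 vB.
have B0 : (0 < #|B|)%N by rewrite card_gt0.
have pvB : v |: B \proper V0.
  apply/properP; split; first by rewrite subUset sub1set vV.
  by exists (dn e) => //; rewrite in_setU1 negb_or ev.
have := wsum_starp (mc_wf M) vB Hp; rewrite /= aB bB (negbTE eB) wa wb => WvB.
have W6 : (wsum es (v |: B) + 6 <= 5 * #|v |: B|)%N by apply: (slack_ge6 M pvB); blia.
case: (leqP w 4) w45 => /= w45 Epos.
  case: HB => [|KB]; first by blia.
  have W3 : (wsum (es ++ newE (dn da) (dq da) (dn db) (dq db) w) B + 3 = 5 * #|B|)%N by case: KB.
  have W4 : w = 4 by blia.
  rewrite W4 in KB.
  have [|x1 [E1 w17 w19]] := critical_end (d0 := (dq da, dn db, dq db, 4)) KB aB.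
    by rewrite star_newE // eqxx /= [dn _]/(dn db) bB.
  have [x1S _] := filter1 E1; have x14 := w4 M x1S.
  suff : (wsum es (v |: B) + 7 <= 5 * #|v |: B|)%N by blia.
  apply: (slack_ge7_end M pvB (subsetUr _ _) _ vB aB E1 Hp (d := da)).
  - by rewrite !inE eqxx.
  - by rewrite /= eqxx (negbTE nea) [dn db == _]eq_sym (negbTE nab).
  - by apply: w19; change (4 + dw x1 <= 9)%N; blia.
  - by move=> u; rewrite in_setU1 => /orP[/eqP ->|->] //; rewrite eqxx.
have [/eqP pa /eqP pb] := andP Epos; split=> //.
have W7 : (wsum es (v |: B) + 7 <= 5 * #|v |: B|)%N.
  apply: (slack_ge7 M pvB (x := v) (d1 := da) (d2 := db)) => //; first by rewrite !inE eqxx.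
    apply: perm_trans (perm_filter _ Hp) _.
    by rewrite /= !in_setU1 aB bB (negbTE eB) (negbTE ev) !orbT.
  by rewrite pa.
have W5' : w = 5 by blia.
case: HB => [|KB]; first by blia.
by rewrite W5' in KB; apply: link_of_critical Hp we wa wb pa pb sB aB bB nab KB.
Qed.

End Local.

(** Here [t] is the state of a vertex with darts of weights 4 and 3, and [s] that of its neighbour,
    which sees it at the position of the dart of weight 4, sees [y] directly, and sees an arbitrary
    third colour [m]. *)
Lemma gad3_fact pz pc : exists w, [/\ (w == 0%N) || (2 <= w <= 5)%N, (w <= 4)%N &
   forall xc y, okw w xc y -> forall m p, exists t s,
     [&& okw 4 (act t pz) y, okw 3 (act t pc) xc, okw 3 (act s p) (act t pz),
         okw 3 (act s p) y & okw 3 (act s p) m]].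
Proof.
have : all5 (fun pz => all5 (fun pc => exw (fun w => (w <= 4)%N &&
  all5 (fun xc => all5 (fun y => if okw w xc y then all5 (fun m => all5 (fun p =>
   exS (fun t => if okw 4 (act t pz) y && okw 3 (act t pc) xc then exS (fun s =>
   [&& okw 3 (act s p) (act t pz), okw 3 (act s p) y & okw 3 (act s p) m])
   else false))) else true))))).
  by vm_compute.
move=> /all5P/(_ pz)/all5P/(_ pc)/exwP[w [ww /andP[w4 H]]]; exists w; split=> // xc y Hxy m p.
move: (all5P _ (all5P _ H xc) y); rewrite Hxy => /all5P/(_ m)/all5P/(_ p)/exSP[t].
by case: ifP => // /andP[h1 h2] /exSP[s Hs]; exists t, s; rewrite h1 h2.
Qed.

Definition upd (V : finType) (phi : V -> state) (v : V) s x :=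
  if x == v then s else phi x.

Section Local.
Variable V : finType.
Implicit Types (es : seq (edge V)) (A B C D : {set V}) (phi f : V -> state).
Variables (es : seq (edge V)) (V0 : {set V}).
Hypothesis M : mincex es V0.

Lemma proper_lt B v : B \subset V0 -> v \in V0 -> (#|B| <= 5)%N -> B \proper V0.
Proof. by move=> sB vV cB; rewrite properEcard sB; have := card_ge6 M vV; lia. Qed.

Lemma unique_to u v d d' : d \in star es u -> d' \in star es u -> dn d = v ->
  dn d' = v -> (2 < dw d)%N -> d = d'.
Proof.
move=> dS dS' E E' w3; apply/eqP/negPn/negP => nd.
have dS2 : d' \in rem d (star es u).
  by have := dS'; rewrite (perm_mem (perm_to_rem dS)) inE eq_sym (negbTE nd).
have Hp : perm_eq (star es u) [:: d, d' & rem d' (rem d (star es u))].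
  by apply: perm_trans (perm_to_rem dS) _; rewrite perm_cons perm_to_rem.
have nn : (4 < dw d + dw d')%N by have := w4 M dS'; blia.
by have := parallel M Hp nn; rewrite E E' eqxx.
Qed.

(** The reduction deletes [v], [dn e] and [dn dz], joins the two other neighbours of [dn dz] by a
    gadget, and sharpens the edge of weight 3 from [dn ds] to [dn db] to weight 5, so that [v] and
    [dn dz] see one and the same colour there. *)
Lemma no_link43 v e dz db lu dc ds :
  perm_eq (star es v) [:: e; dz; db] -> dw e = 3 -> dw dz = 3 -> dw db = 3 ->
  perm_eq (star es (dn e)) (revd v e :: lu) -> (\sum_(d <- lu) (dw d).-1 < 5)%N ->
  {in lu, forall d, dw d <= 3}%N ->
  perm_eq (star es (dn dz)) [:: revd v dz; dc; ds] -> dw dc = 3 -> dw ds = 4 ->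
  dp dz = dp e -> dp db = dp e -> dp ds = dq dz ->
  (dq ds, dn db, dq db, 3) \in star es (dn ds) -> False.
Proof.
move=> Hp we wz wb Hu Hlu lu3 Hz wc ws pz pb psz sbS.
have [vV eV ev _] := star_in M Hp (mem_head _ _).
have [_ zV zv _] : [/\ v \in V0, dn dz \in V0, dn dz != v & (2 <= dw dz <= 4)%N].
  by apply: (star_in M) Hp _; rewrite !inE eqxx orbT.
have [_ bV bv _] : [/\ v \in V0, dn db \in V0, dn db != v & (2 <= dw db <= 4)%N].
  by apply: (star_in M) Hp _; rewrite !inE eqxx !orbT.
have [_ cV cz _] : [/\ dn dz \in V0, dn dc \in V0, dn dc != dn dz & (2 <= dw dc <= 4)%N].
  by apply: (star_in M) Hz _; rewrite !inE eqxx orbT.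
have [_ sV sz _] : [/\ dn dz \in V0, dn ds \in V0, dn ds != dn dz & (2 <= dw ds <= 4)%N].
  by apply: (star_in M) Hz _; rewrite !inE eqxx !orbT.
have bs : dn db != dn ds by have /andP[] := star_wf (mc_wf M) sbS.
have perm3 (T : eqType) (a b c : T) : perm_eq [:: a; b; c] [:: a; c; b].
  by rewrite perm_cons; exact: permEl (perm_catC [:: b] [:: c]).
have perm3' (T : eqType) (a b c : T) : perm_eq [:: a; b; c] [:: b; c; a].
  exact: permEl (perm_catC [:: a] [:: b; c]).
have uz : dn e != dn dz by apply: (parallel M Hp); rewrite we wz.
have ub : dn e != dn db.
  by apply: (parallel M (perm_trans Hp (perm3 _ _ _ _))); rewrite we wb.
have zb : dn dz != dn db.
  by apply: (parallel M (perm_trans Hp (perm3' _ _ _ _))); rewrite wz wb.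
have vc : v != dn dc by apply: (parallel M Hz); rewrite wc [dw _]wz.
have vs : v != dn ds.
  by apply: (parallel M (perm_trans Hz (perm3 _ _ _ _))); rewrite ws [dw _]wz.
have cs : dn dc != dn ds.
  by apply: (parallel M (perm_trans Hz (perm3' _ _ _ _))); rewrite wc ws.
have dsS : ds \in star es (dn dz) by rewrite (perm_mem Hz) !inE eqxx !orbT.
have dcS : dc \in star es (dn dz) by rewrite (perm_mem Hz) !inE eqxx !orbT.
have us : dn e != dn ds.
  apply/eqP => E; have := revd_star dsS; rewrite -E (perm_mem Hu) inE => /orP[/eqP E2|/lu3].
    have E3 : dn dz = v := congr1 (@dn V) E2.
    by rewrite E3 eqxx in zv.
  by change (dw ds <= 3 -> False)%N; rewrite ws.
have sbS' : revd (dn ds) (dq ds, dn db, dq db, 3) \in star es (dn db) := revd_star sbS.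
have bS1 : revd v db \in star es (dn db).
  by apply: revd_star; rewrite (perm_mem Hp) !inE eqxx !orbT.
have Wzs2 D : dn dz \notin D -> v \notin D -> wsum es (dn dz |: D) =
    (wsum es D + ((dn dc \in D) * 3 + ((dn ds \in D) * 4 + 0)))%N.
  by move=> zD vD; rewrite (wsum_starp (mc_wf M) zD Hz) /= wc ws [dn _ \in D](negbTE vD).
have Wv D : v \notin D -> wsum es (v |: D) = (wsum es D +
    ((dn e \in D) * 3 + ((dn dz \in D) * 3 + ((dn db \in D) * 3 + 0))))%N.
  by move=> vD; rewrite (wsum_starp (mc_wf M) vD Hp) /= we wz wb.
have sbW3 : (3 <= wsum es [set dn ds; dn db])%N.
  rewrite (wsum2 (mc_wf M)) 1?eq_sym // (perm_big _ (perm_to_rem sbS)) /= big_cons.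
  by rewrite eqxx leq_addr.
have cb : dn dc != dn db.
  apply/eqP => E; set D := [set dn ds; dn db] in sbW3.
  have zD : dn dz \notin D by rewrite !inE negb_or ![dn dz == _]eq_sym sz eq_sym zb.
  have vD : v \notin D by rewrite !inE negb_or vs eq_sym bv.
  have vzD : v \notin dn dz |: D by rewrite in_setU1 negb_or eq_sym zv vD.
  have c4 : #|v |: (dn dz |: D)| = 4%N by rewrite cardsU1 vzD cardsU1 zD cards2 (eq_sym (dn ds)) bs.
  have pV : v |: (dn dz |: D) \proper V0.
    by apply: (proper_lt (v := v)); rewrite // ?c4 // !subUset !sub1set vV zV sV bV.
  have := slack_ge6 M pV; rewrite c4 (Wv _ vzD) (Wzs2 _ zD vD) E !inE !eqxx !orbT /=.
  by blia.
have [w [ww w44 Hw]] := gad3_fact (dp ds) (dp dc).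
have vzb : perm_eq (star es v) [:: dz; db; e] := perm_trans Hp (perm3' _ _ _ _).
case: (eqVneq (dn dc) (dn e)) => [ce|cne].
  pose D := [set dn e; dn ds]; pose D4 := v |: (dn dz |: D).
  have zD : dn dz \notin D by rewrite !inE negb_or ![dn dz == _]eq_sym sz uz.
  have vD : v \notin D by rewrite !inE negb_or vs eq_sym ev.
  have vzD : v \notin dn dz |: D by rewrite in_setU1 negb_or eq_sym zv vD.
  have bD4 : dn db \notin D4.
    by rewrite !inE !negb_or bv [dn db == dn dz]eq_sym zb [dn db == dn e]eq_sym ub bs.
  have c4 : #|D4| = 4%N by rewrite cardsU1 vzD cardsU1 zD cards2 us.
  have c5 : #|dn db |: D4| = 5%N by rewrite cardsU1 bD4 c4.
  have pV : dn db |: D4 \proper V0.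
    by apply: (proper_lt (v := v)); rewrite // ?c5 // !subUset !sub1set vV zV sV bV eV.
  have W13 : (13 <= wsum es D4)%N.
    by rewrite (Wv _ vzD) (Wzs2 _ zD vD) ce !inE !eqxx !orbT /=; blia.
  have vD4 : v \in D4 by rewrite !inE eqxx.
  have sD4 : dn ds \in D4 by rewrite !inE eqxx !orbT.
  set l := [seq d <- star es (dn db) | dn d \in D4].
  have l1 : revd v db \in l by rewrite mem_filter bS1 andbT.
  have l2 : revd (dn ds) (dq ds, dn db, dq db, 3) \in rem (revd v db) l.
    have : revd (dn ds) (dq ds, dn db, dq db, 3) \in l by rewrite mem_filter sbS' andbT.
    rewrite (perm_mem (perm_to_rem l1)) inE => /orP[/eqP E|//].
    have E' : dn ds = v := congr1 (@dn V) E.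
    by rewrite E' eqxx in vs.
  have Pl : perm_eq l [:: revd v db, revd (dn ds) (dq ds, dn db, dq db, 3) &
      rem (revd (dn ds) (dq ds, dn db, dq db, 3)) (rem (revd v db) l)].
    by apply: perm_trans (perm_to_rem l1) _; rewrite perm_cons perm_to_rem.
  have {l1 l2} [b1 [b2 [l' [[n1 w1 q1] [n2 w2 q2] {}Pl]]]] : exists b1 b2 l',
    [/\ [/\ dn b1 = v, dw b1 = 3 & dp b1 = dq db],
      [/\ dn b2 = dn ds, dw b2 = 3 & dp b2 = dq db] & perm_eq l [:: b1, b2 & l']].
    by do 3 eexists; split; last exact: Pl.
  have cV5 : (1 < #|dn db |: D4|)%N by rewrite c5.
  have W6 := slack_ge6 M pV cV5.
  have Wb : (wsum es (dn db |: D4) = wsum es D4 + (3 + (3 + \sum_(d <- l') dw d)))%N.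
    by rewrite (wsum_star (mc_wf M)) // -big_filter -/l (perm_big _ Pl) /= !big_cons w1 w2.
  have El : l' = [::].
    case: l' Pl Wb => // x l' Pl; rewrite big_cons => Wb.
    have xS : x \in star es (dn db).
      have : x \in l by rewrite (perm_mem Pl) !inE eqxx !orbT.
      by rewrite mem_filter => /andP[].
    by have := w4 M xS; blia.
  have : (wsum es (dn db |: D4) + 7 <= 5 * #|dn db |: D4|)%N.
    apply: (slack_ge7 M pV (x := dn db) (d1 := b1) (d2 := b2)).
    - by rewrite !inE eqxx.
    - rewrite -El; apply: perm_trans Pl; rewrite (_ : [seq d <- _ | _] = l) //.
      apply: eq_in_filter => d dS.
      by have /andP[/negbTE db' _] := star_wf (mc_wf M) dS; rewrite in_setU1 db'.
    - by rewrite q1.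
    - by rewrite n1 n2.
  by rewrite Wb El big_nil; blia.
pose C := [set v; dn dz; dn e].
(* The edge of weight 3 is removed before the one of weight 5 is added: equal colours satisfy weight
   3, and a set containing both ends gains only 2. *)
pose es1 := uncross es (dn ds) [set dn db].
pose ns := newE (dn ds) (dq ds) (dn db) (dq db) 5 ++
  newE (dn dc) (dq dc) (dn ds) (dq ds) w.
have sdb : dn ds \notin [set dn db] by rewrite inE eq_sym.
have sC : dn ds \in V0 :\: C by rewrite !inE !negb_or sV sz eq_sym vs eq_sym us.
have bC : dn db \in V0 :\: C.
  by rewrite !inE !negb_or bV bv [dn db == dn dz]eq_sym zb [dn db == dn e]eq_sym ub.
have cC : dn dc \in V0 :\: C by rewrite !inE !negb_or cV cz eq_sym vc cne.
have [|||phi|B [sB nB HB]] := @reduction _ _ _ M C (es1 ++ ns).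
- by rewrite !subUset !sub1set vV zV eV.
- by apply/set0Pn; exists v; rewrite !inE eqxx.
- by rewrite !wf_cat wf_uncross ?(mc_wf M) // !wf_newE // eq_sym.
- rewrite !sat_cat !sat_newE sC bC cC /= => /and3P[Hphi Hsb Hn].
  have Esb : act (phi (dn ds)) (dq ds) = act (phi (dn db)) (dq db).
    by move: Hsb; case: (act _ _) (act _ _) => [] [].
  have ok3 x : okw 3 x x by case: x.
  have {}Hphi : sat es (V0 :\: C) phi.
    apply/allP => x xS; apply/implyP => xin.
    case: (boolP (cross (dn ds) [set dn db] x)) => Hc; last first.
      by have := allP Hphi x; rewrite mem_filter Hc xS xin => /(_ isT).
    have okd d : d \in star es (dn ds) -> dn d = dn db -> okD phi (phi (dn ds)) d.
      move=> dS Ed; rewrite -(unique_to sbS dS (erefl (dn db)) Ed) //.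
      change (okw 3 (act (phi (dn ds)) (dq ds)) (act (phi (dn db)) (dq db))).
      by rewrite Esb ok3.
    case/orP: Hc => /andP[/eqP E]; rewrite inE => /eqP E'.
      have := okd x.2; rewrite E' -E mem_star -surjective_pairing xS.
      by move=> /(_ isT (erefl _)).
    rewrite -okE_rev; have := okd (revE x).2; rewrite -{1}E mem_star.
    rewrite -[(dn x.2, (revE x).2)]/(revE x) revEK xS orbT => /(_ isT E').
    by rewrite /okD /okE /= E.
  have [|tu Htu] := @free_state _ lu phi _ Hlu.
    move=> d dl; have : d \in star es (dn e) by rewrite (perm_mem Hu) inE dl orbT.
    by move=> /(star_wf (mc_wf M))/andP[].
  have [t [s' /and5P[h1 h2 h3 h4 h5]]] := Hw _ _ Hn (act tu (dq e)) (dp e).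
  have eC : dn e \notin V0 :\: C by rewrite !inE eqxx !orbT.
  have zC : dn dz \notin dn e |: (V0 :\: C).
    by rewrite !inE negb_or [dn dz == _]eq_sym uz eqxx !orbT.
  have EC : dn dz |: (dn e |: (V0 :\: C)) = V0 :\ v.
    apply/setP => x; rewrite !inE; case: (eqVneq x (dn dz)) => [->|_].
      by rewrite zv zV.
    case: (eqVneq x (dn e)) => [->|_]; first by rewrite ev eV.
    by rewrite !orbF.
  pose phi1 := upd phi (dn e) tu; pose phi2 := upd phi1 (dn dz) t.
  have Hs1 : sat es (dn e |: (V0 :\: C)) phi1.
    apply: (sat_ext (s := tu) (mc_wf M) eC Hphi) => d.
    rewrite (perm_mem Hu) inE => /orP[/eqP ->|/Htu //].
    by rewrite !inE eqxx.
  have Hs2 : sat es (V0 :\ v) phi2.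
    rewrite -EC; apply: (sat_ext (s := t) (mc_wf M) zC Hs1) => d.
    rewrite (perm_mem Hz) in_cons in_cons mem_seq1 => /or3P[] /eqP -> dC.
    - have : v \in dn e |: (V0 :\: C) := dC.
      by rewrite in_setU1 eq_sym (negbTE ev) in_setD !inE eqxx.
    - by rewrite /okD /phi1 /upd (negbTE cne) wc.
    - by rewrite /okD /phi1 /upd eq_sym (negbTE us) ws.
  apply: (extend1 M (s := s') vV Hs2) => d; rewrite (perm_mem Hp) !inE.
  rewrite /okD /phi2 /phi1 /upd => /or3P[] /eqP ->.
  - by rewrite (negbTE uz) eqxx we.
  - by rewrite eqxx pz wz -psz.
  - by rewrite eq_sym (negbTE zb) eq_sym (negbTE ub) pb wb -Esb.
have vB : v \notin B by apply/negP => /(subsetP sB); rewrite !inE eqxx.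
have zB : dn dz \notin B by apply/negP => /(subsetP sB); rewrite !inE eqxx !orbT.
have uB : dn e \notin B by apply/negP => /(subsetP sB); rewrite !inE eqxx !orbT.
have sBV : B \subset V0 := subset_trans sB (subsetDl _ _).
have pB : B \proper V0 by apply/properP; split=> //; exists v.
have W5 := subset5 M pB nB.
have Wns : wsum ns B = ((if (dn ds \in B) && (dn db \in B) then 5 else 0) +
    (if (dn dc \in B) && (dn ds \in B) then w else 0))%N.
  by rewrite wsum_cat !wsum_newE.
suff W4 : (wsum (es1 ++ ns) B + 4 <= 5 * #|B|)%N by case: HB => [|[]]; blia.
rewrite wsum_cat Wns.
have sB1 : (wsum es1 B <= wsum es B)%N.
  rewrite /wsum big_filter_cond big_mkcond [leqRHS]big_mkcond leq_sum // => x _.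
  by case: (~~ _).
case: (boolP (dn ds \in B)) => sinB; last by rewrite /= andbF; blia.
have pzB : dn dz |: B \proper V0.
  apply/properP; split; first by rewrite subUset sub1set zV.
  by exists v; rewrite // in_setU1 negb_or eq_sym zv.
have czB : #|dn dz |: B| = #|B|.+1 by rewrite cardsU1 zB.
have cB : (0 < #|B|)%N by rewrite card_gt0.
have WzB := Wzs2 _ zB vB; rewrite sinB in WzB.
have Z6 : (wsum es (dn dz |: B) + 6 <= 5 * #|dn dz |: B|)%N by apply: (slack_ge6 M pzB); blia.
case: (boolP (dn db \in B)) => binB /=; last first.
  by rewrite andbT; case: (dn dc \in B) WzB => WzB; blia.
have Wb : (wsum es1 B + 3 <= wsum es B)%N.
  have EB : dn ds |: (B :\ dn ds) = B by rewrite setD1K.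
  have sbB : [set dn db] \subset B :\ dn ds by rewrite sub1set in_setD1 bs.
  have sB' : dn ds \notin B :\ dn ds by rewrite in_setD1 eqxx.
  have := wsum_uncross (mc_wf M) sdb sB' sbB; rewrite EB -/es1 => ->.
  rewrite leq_add2l (perm_big _ (perm_to_rem sbS)) /= big_cons in_set1 eqxx.
  exact: leq_addr.
have cB2 : (1 < #|B|)%N by apply/card_gt1P; exists (dn ds), (dn db); rewrite sinB binB eq_sym bs.
have B6 := slack_ge6 M pB cB2.
case: (boolP (dn dc \in B)) WzB => cinB WzB /=; last by blia.
have vzB : v \notin dn dz |: B by rewrite in_setU1 negb_or eq_sym zv.
have pvB : v |: (dn dz |: B) \proper V0.
  apply/properP; split; first by rewrite !subUset !sub1set vV zV.
  by exists (dn e); rewrite // !in_setU1 !negb_or ev uz.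
have cvB : #|v |: (dn dz |: B)| = #|B|.+2 by rewrite cardsU1 vzB czB.
have := Wv _ vzB; rewrite !(in_setU1 _ (dn dz)) eqxx binB orbT (negbTE uz) (negbTE uB) => WvB.
have : (wsum es (v |: (dn dz |: B)) + 7 <= 5 * #|v |: (dn dz |: B)|)%N.
  apply: (slack_ge7 M pvB (x := v) (d1 := dz) (d2 := db)) => //.
  - by rewrite in_setU1 eqxx.
  - apply: perm_trans (perm_filter _ Hp) _.
    by rewrite /= !in_setU1 eqxx binB (negbTE ev) (negbTE uz) (negbTE uB) !orbT.
  - by rewrite pz.
by rewrite WvB WzB cvB; blia.
Qed.

End Local.

(** * Two neighbours with weights 3, 3, 4 *)

Lemma exists_state (Ps : seq (state -> bool)) :
  (\sum_(P <- Ps) count (fun s => ~~ P s) states < 10)%N ->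
  exists s, all (fun P => P s) Ps.
Proof.
move=> Hs; suff /hasP[s _ Hs'] : has (fun s => all (fun P => P s) Ps) states.
  by exists s.
have : (count (fun s => has (fun P => ~~ P s) Ps) states <
  count predT states)%N.
  apply: leq_ltn_trans (_ : _ <= \sum_(P <- Ps) count (fun s => ~~ P s) states)%N Hs.
  elim: (Ps) => [|P l IH]; first by rewrite big_nil count_pred0.
  rewrite big_cons; apply: leq_trans (_ : count (fun s => ~~ P s) states +
    count (fun s => has (fun P => ~~ P s) l) states <= _)%N; last by rewrite leq_add2l.
  by rewrite -count_predUI; apply: leq_trans (leq_addr _ _); apply: sub_count.
rewrite count_predT has_count.
have := count_predC (fun s => all (fun P => P s) Ps) states.
rewrite (_ : count (predC _) states = count (fun s => has (fun P => ~~ P s) Ps) states).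
  by lia.
by apply: eq_count => s /=; rewrite -has_predC.
Qed.

(* [rich P q]: the states satisfying [P] take at least two values at the
   position [q]; an edge of weight 3 at [q] then excludes at most two states
   of its other end. *)
Definition rich (P : state -> bool) q :=
  ex5 (fun y => ex5 (fun y' => if y == y' then false else
    exS (fun t => P t && (act t q == y)) && exS (fun t => P t && (act t q == y')))).

Definition seen (P : state -> bool) q p (s : state) :=
  exS (fun t => P t && okw 3 (act s p) (act t q)).

Lemma count_seen P q p : rich P q ->
  (count (fun s => ~~ seen P q p s) states <= 2)%N.
Proof.
move=> /ex5P[y /ex5P[y']]; case: eqP => // /eqP yy /andP[/exSP[t /andP[Pt /eqP Et]]].
move=> /exSP[t' /andP[Pt' /eqP Et']].
pose ok2 s := okw 3 (act s p) y || okw 3 (act s p) y'.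
apply: (@leq_trans (count (fun s => ~~ ok2 s) states)).
  apply: sub_count => s /=; apply: contra => /orP[] H; apply/exSP.
    by exists t; rewrite Pt Et.
  by exists t'; rewrite Pt' Et'.
have : all5 (fun p => all5 (fun y => all5 (fun y' => if y == y' then true else
  (count (fun s => ~~ (okw 3 (act s p) y || okw 3 (act s p) y')) states <= 2)%N))).
  by vm_compute.
by move=> /all5P/(_ p)/all5P/(_ y)/all5P/(_ y'); rewrite (negbTE yy).
Qed.

Lemma gad1_fact q pc pu : exists w, [/\ (w == 0%N) || (2 <= w <= 5)%N, (w <= 4)%N &
  forall xc xu, okw w xc xu ->
    rich (fun t => okw 3 (act t pc) xc && okw 4 (act t pu) xu) q].
Proof.
have : all5 (fun q => all5 (fun pc => all5 (fun pu => exw (fun w => (w <= 4)%N &&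
  all5 (fun xc => all5 (fun xu => if okw w xc xu then
    rich (fun t => okw 3 (act t pc) xc && okw 4 (act t pu) xu) q else true)))))).
  by vm_compute.
move=> /all5P/(_ q)/all5P/(_ pc)/all5P/(_ pu)/exwP[w [ww /andP[w4 H]]].
exists w; split=> // xc xu Hx.
by move: (all5P _ (all5P _ H xc) xu); rewrite Hx.
Qed.

Lemma act_shift s p x : act (cmp s (opp5 p, false)) x = act s (sub5 x p).
Proof. by case: s p x => [[] []] [] []. Qed.

(** A translation at each corner moves one of its two positions to [Z0], and a common translation
    moves [xu] to [Z0]; this brings the remaining check within reach of computation. *)
Lemma triangle_fact p1 p2 p3 q1 r1 s1 q2 r2 s2 xw xu xv :
  p1 != p2 -> q1 != r1 -> q2 != r2 ->
  exists s t t', [&& okw 3 (act s p3) xw, okw 4 (act t s1) xu, okw 4 (act t' s2) xv,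
    okw 3 (act s p1) (act t q1), okw 3 (act s p2) (act t' q2) &
    okw 3 (act t r1) (act t' r2)].
Proof.
have H : all5 (fun t1 => if t1 == Z0 then true else
  all5 (fun t2 => if t2 == Z0 then true else
  all5 (fun t3 => if t3 == Z0 then true else
  all5 (fun pw => all5 (fun pu => all5 (fun pv => all5 (fun xw => all5 (fun xv =>
  exS (fun t => if okw 4 (act t pu) Z0 then exS (fun t' =>
    if okw 4 (act t' pv) xv && okw 3 (act t t2) (act t' t3) then exS (fun s =>
     [&& okw 3 (act s Z0) (act t Z0), okw 3 (act s pw) xw &
         okw 3 (act s t1) (act t' Z0)])
    else false) else false))))))))).
  by vm_compute.
have ne x y : x != y -> (sub5 y x == Z0) = false by case: x y => [] [].
have ss x : sub5 x x = Z0 by case: x.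
move: H => + /ne h1 /ne h2 /ne h3.
move=> /all5P/(_ (sub5 p2 p1)); rewrite h1.
move=> /all5P/(_ (sub5 r1 q1)); rewrite h2.
move=> /all5P/(_ (sub5 r2 q2)); rewrite h3.
move=> /all5P/(_ (sub5 p3 p1))/all5P/(_ (sub5 s1 q1))/all5P/(_ (sub5 s2 q2)).
move=> /all5P/(_ (sub5 xw xu))/all5P/(_ (sub5 xv xu)).
move=> /exSP[t]; case: ifP => // e1 /exSP[t']; case: ifP => // /andP[e2 e3].
move=> /exSP[s /and3P[e4 e5 e6]].
pose g : state := (xu, false).
have gE x : act g (sub5 x xu) = x by rewrite /g; case: (x); case: (xu).
have g0 : act g Z0 = xu by rewrite /g; case: (xu).
exists (cmp g (cmp s (opp5 p1, false))), (cmp g (cmp t (opp5 q1, false))),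
  (cmp g (cmp t' (opp5 q2, false))).
have f1 : okw 3 (act g (act s (sub5 p3 p1))) xw.
  by rewrite -[X in okw _ _ X](gE xw) okw_act.
have f2 : okw 4 (act g (act t (sub5 s1 q1))) xu.
  by rewrite -[X in okw _ _ X]g0 okw_act.
have f3 : okw 4 (act g (act t' (sub5 s2 q2))) xv.
  by rewrite -[X in okw _ _ X](gE xv) okw_act.
by rewrite !(act_cmp g) !act_shift !ss f1 f2 f3 !okw_act e3 e4 e6.
Qed.

Lemma perm3_132 (T : eqType) (a b c : T) : perm_eq [:: a; b; c] [:: a; c; b].
Proof. by rewrite perm_cons; exact: permEl (perm_catC [:: b] [:: c]). Qed.

Lemma perm3_231 (T : eqType) (a b c : T) : perm_eq [:: a; b; c] [:: b; c; a].
Proof. exact: permEl (perm_catC [:: a] [:: b; c]). Qed.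

Lemma perm3_213 (T : eqType) (a b c : T) : perm_eq [:: a; b; c] [:: b; a; c].
Proof. exact: perm_trans (perm3_231 _ _ _) (perm3_132 _ _ _). Qed.

Section Local.
Variable V : finType.
Implicit Types (es : seq (edge V)) (A B C D : {set V}) (phi f : V -> state).
Variables (es : seq (edge V)) (V0 : {set V}).
Hypothesis M : mincex es V0.

Lemma distinct3 v d1 d2 d3 : perm_eq (star es v) [:: d1; d2; d3] ->
  (3 <= dw d1)%N -> (3 <= dw d2)%N -> (3 <= dw d3)%N ->
  [/\ dn d1 != dn d2, dn d1 != dn d3 & dn d2 != dn d3].
Proof.
move=> Hp w1 w2 w3; split.
- by apply: (parallel M Hp); blia.
- by apply: (parallel M (perm_trans Hp (perm3_132 _ _ _))); blia.
- by apply: (parallel M (perm_trans Hp (perm3_231 _ _ _))); blia.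
Qed.

Lemma star_in3 v d1 d2 d3 : perm_eq (star es v) [:: d1; d2; d3] ->
  [/\ v \in V0, (dn d1 \in V0) && (dn d1 != v), (dn d2 \in V0) && (dn d2 != v) &
      (dn d3 \in V0) && (dn d3 != v)].
Proof.
move=> Hp; have H d : d \in [:: d1; d2; d3] -> (dn d \in V0) && (dn d != v).
  by move=> /(star_in M Hp)[_ -> ->].
split; [by have [] := star_in M Hp (mem_head _ _)|exact: H (mem_head _ _)|..];
  by apply: H; rewrite !inE eqxx ?orbT.
Qed.

(** The triangle on [v] and the two neighbours has slack 6, so by [slack_ge7] the two inner darts
    have different positions at every corner. Then [triangle_fact] colours it against any colouring
    of the rest. *)
Lemma triangle_positions v d1 d2 d3 r1 c1 u1 r2 c2 u2 :
  perm_eq (star es v) [:: d1; d2; d3] -> dw d1 = 3 -> dw d2 = 3 -> dw d3 = 3 ->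
  perm_eq (star es (dn d1)) [:: r1; c1; u1] -> dw r1 = 3 -> dw c1 = 3 -> dw u1 = 4 ->
  perm_eq (star es (dn d2)) [:: r2; c2; u2] -> dw r2 = 3 -> dw c2 = 3 -> dw u2 = 4 ->
  dn r1 = v -> dn r2 = v -> dp r1 = dq d1 -> dp r2 = dq d2 ->
  dn c1 = dn d2 -> False.
Proof.
move=> Hp w1 w2 w3 H1 wr1 wc1 wu1 H2 wr2 wc2 wu2 nr1 nr2 pr1 pr2 nc1.
have [n12 n13 n23] : [/\ dn d1 != dn d2, dn d1 != dn d3 & dn d2 != dn d3].
  by apply: (distinct3 Hp); rewrite ?w1 ?w2 ?w3.
have [m12 m13 m23] : [/\ dn r1 != dn c1, dn r1 != dn u1 & dn c1 != dn u1].
  by apply: (distinct3 H1); rewrite ?wr1 ?wc1 ?wu1.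
have [k12 k13 k23] : [/\ dn r2 != dn c2, dn r2 != dn u2 & dn c2 != dn u2].
  by apply: (distinct3 H2); rewrite ?wr2 ?wc2 ?wu2.
have [vV /andP[z1V z1v] /andP[z2V z2v] /andP[x3V x3v]] := star_in3 Hp.
have [_ _ /andP[_ c1z] /andP[u1V u1z]] := star_in3 H1.
have [_ _ /andP[_ c2z] /andP[u2V u2z]] := star_in3 H2.
have c1S : c1 \in star es (dn d1) by rewrite (perm_mem H1) !inE eqxx orbT.
have Ec2 : c2 = revd (dn d1) c1.
  have := revd_star c1S; rewrite nc1 (perm_mem H2) !inE => /or3P[] /eqP E //.
    have E' : dn d1 = dn r2 := congr1 (@dn V) E.
    by rewrite E' nr2 eqxx in z1v.
  have E' : dw c1 = dw u2 := congr1 (@dw V) E.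
  by rewrite wc1 wu2 in E'.
have nc2 : dn c2 = dn d1 by rewrite Ec2.
have pc2 : dp c2 = dq c1 by rewrite Ec2.
have qc2 : dq c2 = dp c1 by rewrite Ec2.
rewrite nr1 in m12 m13; rewrite nc1 in m12 m23.
rewrite nr2 in k12 k13; rewrite nc2 in k12 k23.
pose A := v |: [set dn d1; dn d2].
have vA : v \notin [set dn d1; dn d2] by rewrite !inE negb_or m12 k12.
have cA : #|A| = 3%N by rewrite /A cardsU1 vA cards2 n12.
have pA : A \proper V0.
  by apply: (proper_lt M (v := v)); rewrite ?cA // !subUset !sub1set vV z1V z2V.
have WA : wsum es A = 9%N.
  rewrite (wsum_starp (mc_wf M) vA Hp) (wsum2 (mc_wf M) n12) (perm_big _ H1) /=.
  rewrite !big_cons big_nil nr1 nc1 !eqxx eq_sym [dn u1 == _]eq_sym.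
  rewrite [dn d2 == v](negbTE z2v) (negbTE m23) wc1 !inE !eqxx orbT w1 w2.
  by rewrite [dn d3 == _]eq_sym (negbTE n13) [dn d3 == _]eq_sym (negbTE n23).
have noLY x a b : x \in A -> perm_eq [seq d <- star es x | dn d \in A] [:: a; b] ->
    dn a != dn b -> dp a != dp b.
  move=> xA Hx ab; apply/eqP => E.
  by have := slack_ge7 M pA xA Hx E ab; rewrite cA WA.
have inA x : (x \in A) = [|| x == v, x == dn d1 | x == dn d2] by rewrite !inE.
have pd : dp d1 != dp d2.
  apply: (noLY v) => //; first by rewrite inA eqxx.
  apply: perm_trans (perm_filter _ Hp) _; rewrite /= !inA !eqxx !orbT.
  by rewrite (negbTE x3v) [dn d3 == _]eq_sym (negbTE n13) [dn d3 == _]eq_sym (negbTE n23).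
have pd1 : dq d1 != dp c1.
  rewrite -pr1; apply: (noLY (dn d1)); first by rewrite inA eqxx orbT.
    apply: perm_trans (perm_filter _ H1) _; rewrite /= !inA nr1 nc1 !eqxx !orbT /=.
    by rewrite [dn u1 == v]eq_sym (negbTE m13) (negbTE u1z) [dn u1 == _]eq_sym (negbTE m23).
  by rewrite nr1 nc1.
have pd2 : dq d2 != dq c1.
  rewrite -pr2 -pc2; apply: (noLY (dn d2)); first by rewrite inA eqxx !orbT.
    apply: perm_trans (perm_filter _ H2) _; rewrite /= !inA nr2 nc2 !eqxx !orbT /=.
    by rewrite [dn u2 == v]eq_sym (negbTE k13) (negbTE u2z) [dn u2 == _]eq_sym (negbTE k23).
  by rewrite nr2 nc2.
pose B := V0 :\: A.
have [phi Hphi] : exists phi, sat es B phi.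
  apply: (proper_sat M); apply/properP; split; first exact: subsetDl.
  by exists v => //; rewrite in_setD inA eqxx.
have [s [t [t' /and5P[h1 h2 h3 h4 /andP[h5 h6]]]]] := @triangle_fact (dp d1) (dp d2) (dp d3)
  (dq d1) (dp c1) (dp u1) (dq d2) (dq c1) (dp u2) (act (phi (dn d3)) (dq d3))
  (act (phi (dn u1)) (dq u1)) (act (phi (dn u2)) (dq u2)) pd pd1 pd2.
have z1B : dn d1 \notin B by rewrite in_setD inA eqxx orbT.
have z2B : dn d2 \notin dn d1 |: B.
  by rewrite in_setU1 negb_or eq_sym n12 in_setD inA eqxx !orbT.
have EB : dn d2 |: (dn d1 |: B) = V0 :\ v.
  apply/setP => x; rewrite !in_setU1 in_setD1 in_setD inA.
  case: (eqVneq x (dn d2)) => [->|_]; first by rewrite z2v z2V.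
  case: (eqVneq x (dn d1)) => [->|_]; first by rewrite z1v z1V.
  by rewrite !orbF.
have vB : v \notin B by rewrite in_setD inA eqxx.
pose phi1 := upd phi (dn d1) t; pose phi2 := upd phi1 (dn d2) t'.
have Hs1 : sat es (dn d1 |: B) phi1.
  apply: (sat_ext (s := t) (mc_wf M) z1B Hphi) => d.
  rewrite (perm_mem H1) in_cons in_cons mem_seq1 => /or3P[] /eqP ->.
  - by rewrite nr1 (negbTE vB).
  - by rewrite nc1 in_setD inA eqxx !orbT.
  - by rewrite /okD wu1.
have Hs2 : sat es (V0 :\ v) phi2.
  rewrite -EB; apply: (sat_ext (s := t') (mc_wf M) z2B Hs1) => d.
  rewrite (perm_mem H2) in_cons in_cons mem_seq1 => /or3P[] /eqP ->.
  - by rewrite nr2 in_setU1 eq_sym (negbTE z1v) (negbTE vB).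
  - by rewrite /okD wc2 nc2 /phi1 /upd eqxx pc2 qc2 okwC.
  - by rewrite /okD wu2 /phi1 /upd [dn u2 == _]eq_sym (negbTE k23).
apply: (mc_unsat M); apply: (extend1 M (s := s) vV Hs2) => d.
rewrite (perm_mem Hp) !inE /okD /phi2 /phi1 /upd => /or3P[] /eqP ->.
- by rewrite (negbTE n12) eqxx w1.
- by rewrite eqxx w2.
- by rewrite [dn d3 == _]eq_sym (negbTE n23) [dn d3 == _]eq_sym (negbTE n13) w3.
Qed.

End Local.

Section Critical.
Variable V : finType.
Implicit Types (es ns : seq (edge V)) (A B C D : {set V}).

Lemma mem_star_cat es ns x d :
  (d \in star (es ++ ns) x) = (d \in star es x) || (d \in star ns x).
Proof. by rewrite (perm_mem (star_cat es ns x)) mem_cat. Qed.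

Lemma newE_dw u a v b w x d : d \in star (@newE V u a v b w) x -> dw d = w.
Proof.
rewrite mem_star /newE /optE; case: eqP => //= _.
by rewrite !inE => /orP[] /eqP H; [have [_ ->] := H | have := congr1 (fun e => dw e.2) H].
Qed.

Lemma critical_end' es ns B x d0 : critical (es ++ ns) B -> x \in B ->
  perm_eq [seq d <- star ns x | dn d \in B] [:: d0] ->
  exists d, [/\ [seq d <- star es x | dn d \in B] = [:: d],
    (7 <= dw d0 + dw d)%N & (dw d0 + dw d <= 9)%N -> dp d = dp d0].
Proof. by move=> KB xB Hn; apply: (critical_end KB xB); apply: (perm_small_eq _ Hn). Qed.

Lemma critical_deg es B x : critical es B -> x \in B -> deg es B x = 2.
Proof.
move=> [_ Hk _] xB; have [d1 [d2 [Hp _ _]]] := Hk x xB.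
by rewrite /deg -size_filter (perm_size Hp).
Qed.

Lemma deg0_wsum es B x : wf es -> x \in B -> deg es B x = 0 ->
  wsum es B = wsum es (B :\ x).
Proof.
move=> Hw xB D0; rewrite -{1}(setD1K xB) wsum_star ?in_setD1 ?eqxx //.
rewrite big_seq_cond big1 ?addn0 // => d /andP[dS].
rewrite in_setD1 => /andP[_ dB]; move/eqP: D0; rewrite /deg -leqn0 leqNgt -has_count.
by move/hasPn/(_ _ dS)/negP/(_ dB).
Qed.

Lemma deg_newE u a v b w B x : w != 0%N -> deg (@newE V u a v b w) B x =
  (((u == x) && (v \in B)) + ((v == x) && (u \in B)))%N.
Proof. by move=> w0; rewrite /newE /optE (negbTE w0) deg1. Qed.

End Critical.

Section Local.
Variable V : finType.
Implicit Types (es : seq (edge V)) (A B C D : {set V}) (phi f : V -> state).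
Variables (es : seq (edge V)) (V0 : {set V}).
Hypothesis M : mincex es V0.

Section TwoZ.
Variables (v : V) (d1 d2 d3 r1 c1 u1 r2 c2 u2 : dart V).
Hypothesis Hp : perm_eq (star es v) [:: d1; d2; d3].
Hypotheses (w1 : dw d1 = 3) (w2 : dw d2 = 3) (w3 : dw d3 = 3).
Hypothesis H1 : perm_eq (star es (dn d1)) [:: r1; c1; u1].
Hypotheses (wr1 : dw r1 = 3) (wc1 : dw c1 = 3) (wu1 : dw u1 = 4).
Hypothesis H2 : perm_eq (star es (dn d2)) [:: r2; c2; u2].
Hypotheses (wr2 : dw r2 = 3) (wc2 : dw c2 = 3) (wu2 : dw u2 = 4).
Hypotheses (nr1 : dn r1 = v) (nr2 : dn r2 = v).
Hypotheses (pr1 : dp r1 = dq d1) (pr2 : dp r2 = dq d2).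

(** The one obstruction that the slack bounds allow. Together with [v] and its two neighbours it has
    slack 6, which [slack_ge7_end] excludes at an end of the first gadget not shared with the
    second. If both ends are shared, neither has an old dart inside [B], and [B] would have no
    weight. *)
Lemma two_Z_exception B (ns := newE (dn c1) (dq c1) (dn u1) (dq u1) 4 ++
    newE (dn c2) (dq c2) (dn u2) (dq u2) 4) :
  critical (es ++ ns) B -> (wsum es B + 11 = 5 * #|B|)%N ->
  B \subset V0 :\: (v |: [set dn d1; dn d2]) ->
  [&& dn c1 \in B, dn u1 \in B, dn c2 \in B & dn u2 \in B] -> False.
Proof.
move=> KB W11 sB /and4P[c1B u1B c2B u2B].
have [n12 n13 n23] : [/\ dn d1 != dn d2, dn d1 != dn d3 & dn d2 != dn d3].
  by apply: (distinct3 M Hp); rewrite ?w1 ?w2 ?w3.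
have [m12 m13 m23] : [/\ dn r1 != dn c1, dn r1 != dn u1 & dn c1 != dn u1].
  by apply: (distinct3 M H1); rewrite ?wr1 ?wc1 ?wu1.
have [k12 k13 k23] : [/\ dn r2 != dn c2, dn r2 != dn u2 & dn c2 != dn u2].
  by apply: (distinct3 M H2); rewrite ?wr2 ?wc2 ?wu2.
have [vV /andP[z1V z1v] /andP[z2V z2v] /andP[x3V x3v]] := star_in3 M Hp.
rewrite nr1 in m12 m13; rewrite nr2 in k12 k13.
have vB : v \notin B by apply/negP => /(subsetP sB); rewrite !inE eqxx.
have z1B : dn d1 \notin B by apply/negP => /(subsetP sB); rewrite !inE eqxx orbT.
have z2B : dn d2 \notin B by apply/negP => /(subsetP sB); rewrite !inE eqxx !orbT.
have sBV : B \subset V0 := subset_trans sB (subsetDl _ _).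
have w0 : (4 != 0)%N by [].
(* All weights, old and new, are at most 4, so each deficiency is at least 2; at most three vertices
   remain, and slack 11 needs three. *)
have c3 : #|B| = 3%N.
  have : (\sum_(x in B) 2 <= 6)%N.
    apply: (critical_sum KB) => x xB a b Hab.
    have le4 d : d \in [:: a; b] -> (dw d <= 4)%N.
      rewrite -(perm_mem Hab) mem_filter !mem_star_cat => /andP[_ /or3P[]].
      - by move=> /(w4 M)/andP[].
      - by move=> /newE_dw ->.
      - by move=> /newE_dw ->.
    have := le4 a (mem_head _ _); have := le4 b; rewrite !inE eqxx orbT => /(_ isT).
    by blia.
  by rewrite sum_nat_const; blia.
pose A := v |: (dn d2 |: (dn d1 |: B)).
have z21 : dn d2 \notin dn d1 |: B by rewrite in_setU1 negb_or eq_sym n12.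
have v21 : v \notin dn d2 |: (dn d1 |: B).
  by rewrite !in_setU1 !negb_or vB eq_sym z2v eq_sym z1v.
have cA : #|A| = 6%N by rewrite /A !cardsU1 v21 z21 z1B c3.
have sA : A \subset V0 by rewrite !subUset !sub1set vV z1V z2V.
have WA : wsum es A = (wsum es B + 20 + (dn d3 \in B) * 3)%N.
  rewrite (wsum_starp (mc_wf M) v21 Hp) (wsum_starp (mc_wf M) z21 H2).
  rewrite (wsum_starp (mc_wf M) z1B H1) /= w1 w2 w3 wr1 wc1 wu1 wr2 wc2 wu2 nr1 nr2.
  rewrite !in_setU1 !eqxx (negbTE vB) c1B u1B c2B u2B !orbT [v == dn d1]eq_sym (negbTE z1v).
  rewrite [dn d3 == _]eq_sym (negbTE n23) [dn d3 == _]eq_sym (negbTE n13) /=.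
  by blia.
(* The two neighbours have weight sum 10 instead of 9, which improves the count of [card_ge6] by 2;
   so the six vertices of [A] form a proper subset. *)
have cV : (8 <= #|V0|)%N.
  have one x : x \in V0 -> (\sum_(y in V0) (y == x) = 1)%N.
    by move=> xV; rewrite (bigD1 x) //= eqxx big1 // => y /andP[_ /negbTE ->].
  have : (\sum_(x in V0) (9 + ((x == dn d1) + (x == dn d2))) <=
      \sum_(x in V0) \sum_(d <- star es x) dw d)%N.
    apply: leq_sum => x xV; case: (eqVneq x (dn d1)) => [->|_].
      by rewrite (negbTE n12) (perm_big _ H1) !big_cons big_nil /= wr1 wc1 wu1.
    case: (eqVneq x (dn d2)) => [->|_]; last exact: (weight_ge9 M).
    by rewrite (perm_big _ H2) !big_cons big_nil /= wr2 wc2 wu2.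
  rewrite (sum_V0 M) !big_split /= !one // sum_nat_const.
  have := p3 M (subxx V0) (_ : V0 != set0); have : V0 != set0 by apply/set0Pn; exists v.
  by move=> -> /(_ isT); blia.
have pA : A \proper V0 by rewrite properEcard sA cA; blia.
have cA1 : (1 < #|A|)%N by rewrite cA.
have A6 := slack_ge6 M pA cA1.
have x3B : dn d3 \notin B.
  by apply/negP => x3B; rewrite x3B in WA; blia.
rewrite (negbTE x3B) in WA.
have fin dt d0 : dn dt \in B -> dw d0 = 4 -> dp d0 = dq dt ->
    dn dt != dn c2 -> dn dt != dn u2 ->
    perm_eq [seq d <- star ns (dn dt) | dn d \in B] [:: d0] ->
    [seq y <- [:: r1; c1; u1] | dn y == dn dt] = [:: dt] -> False.
  move=> tB wd0 pd0 tc2 tu2 Hns Et.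
  have [e [E1 _ e9]] := critical_end' KB tB Hns.
  have [eS _] := filter1 E1.
  have /andP[_ ew4] := w4 M eS.
  suff : (wsum es A + 7 <= 5 * #|A|)%N by rewrite cA; blia.
  apply: (slack_ge7_end M pA _ _ z1B tB E1 H1 Et).
  - by apply/subsetP => x xB; rewrite /A !in_setU1 xB !orbT.
  - by rewrite !inE eqxx !orbT.
  - by rewrite -pd0; apply: e9; rewrite wd0; blia.
  move=> u; rewrite !in_setU1 => /or3P[/eqP ->|/eqP ->|/orP[/eqP ->|->]//] _ uz.
  - rewrite multC (star_mult _ Hp) /=.
    rewrite (negbTE (_ : dn d1 != dn dt)); last by apply: contraNneq z1B => ->.
    rewrite (negbTE (_ : dn d2 != dn dt)); last by apply: contraNneq z2B => ->.
    by rewrite (negbTE (_ : dn d3 != dn dt)) //; apply: contraNneq x3B => ->.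
  - rewrite multC (star_mult _ H2) /= nr2.
    rewrite (negbTE (_ : v != dn dt)); last by apply: contraNneq vB => ->.
    by rewrite eq_sym (negbTE tc2) eq_sym (negbTE tu2).
  - by rewrite eqxx in uz.
have Fns x : perm_eq [seq d <- star ns x | dn d \in B]
    ([seq d <- star (newE (dn c1) (dq c1) (dn u1) (dq u1) 4) x | dn d \in B] ++
     [seq d <- star (newE (dn c2) (dq c2) (dn u2) (dq u2) 4) x | dn d \in B]).
  by rewrite -filter_cat; apply: perm_filter; apply: star_cat.
have F0 x : x != dn c2 -> x != dn u2 ->
    perm_eq [seq d <- star ns x | dn d \in B]
    [seq d <- star (newE (dn c1) (dq c1) (dn u1) (dq u1) 4) x | dn d \in B].
  move=> xc xu; apply: perm_trans (Fns x) _.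
  by rewrite (star_newE (dq c2) (dq u2) _ w0 k23) (negbTE xc) (negbTE xu) cats0.
have D x : x \in B -> (deg es B x + (((dn c1 == x) + (dn u1 == x)) +
    ((dn c2 == x) + (dn u2 == x))) = 2)%N.
  move=> xB; rewrite -(critical_deg KB xB) !deg_cat !deg_newE //.
  by rewrite c1B u1B c2B u2B !andbT.
have m23' : dn u1 != dn c1 by rewrite eq_sym.
have [Ec|/norP[cc cu]] := boolP ((dn c1 == dn c2) || (dn c1 == dn u2)); last first.
  apply: (fin c1 (dq c1, dn u1, dq u1, 4)) => //.
    by apply: perm_trans (F0 _ cc cu) _; rewrite star_newE // eqxx /= [dn (_, _, _, _) \in B]u1B.
  by rewrite /= nr1 (negbTE m12) eqxx (negbTE m23').
have [Eu|/norP[uc uu]] := boolP ((dn u1 == dn c2) || (dn u1 == dn u2)); last first.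
  apply: (fin u1 (dq u1, dn c1, dq c1, 4)) => //.
    apply: perm_trans (F0 _ uc uu) _.
    by rewrite star_newE // (negbTE m23') eqxx /= [dn (_, _, _, _) \in B]c1B.
  by rewrite /= nr1 (negbTE m13) eqxx (negbTE m23).
have Dc := D _ c1B; have Du := D _ u1B.
rewrite eqxx (negbTE m23') ![_ == dn c1]eq_sym in Dc.
rewrite eqxx (negbTE m23) ![_ == dn u1]eq_sym in Du.
have Dc0 : deg es B (dn c1) = 0 by case/orP: Ec Dc => ->; case: (_ == _); blia.
have Du0 : deg es B (dn u1) = 0 by case/orP: Eu Du => ->; case: (_ == _); blia.
have := deg0_wsum (mc_wf M) c1B Dc0.
have u1B' : dn u1 \in B :\ dn c1 by rewrite in_setD1 m23'.
have Du0' : deg es (B :\ dn c1) (dn u1) = 0.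
  by apply/eqP; rewrite -leqn0 -Du0 deg_sub // subD1set.
rewrite (deg0_wsum (mc_wf M) u1B' Du0').
have /cards1P[x ->] : #|(B :\ dn c1) :\ dn u1| == 1%N.
  by have := cardsD1 (dn c1) B; have := cardsD1 (dn u1) (B :\ dn c1); rewrite c1B u1B'; blia.
by rewrite (wsum_set1 _ (mc_wf M)); blia.
Qed.

(** Deleting [v] and both neighbours, each neighbour is replaced by a gadget that keeps it [rich];
    it then costs [v] two states instead of four. *)
Lemma no_two_Z : False.
Proof.
have [n12 n13 n23] : [/\ dn d1 != dn d2, dn d1 != dn d3 & dn d2 != dn d3].
  by apply: (distinct3 M Hp); rewrite ?w1 ?w2 ?w3.
have [m12 m13 m23] : [/\ dn r1 != dn c1, dn r1 != dn u1 & dn c1 != dn u1].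
  by apply: (distinct3 M H1); rewrite ?wr1 ?wc1 ?wu1.
have [k12 k13 k23] : [/\ dn r2 != dn c2, dn r2 != dn u2 & dn c2 != dn u2].
  by apply: (distinct3 M H2); rewrite ?wr2 ?wc2 ?wu2.
have [vV /andP[z1V z1v] /andP[z2V z2v] /andP[x3V x3v]] := star_in3 M Hp.
have [_ _ /andP[c1V c1z] /andP[u1V u1z]] := star_in3 M H1.
have [_ _ /andP[c2V c2z] /andP[u2V u2z]] := star_in3 M H2.
rewrite nr1 in m12 m13; rewrite nr2 in k12 k13.
have vz1 : v != dn d1 by rewrite eq_sym.
have vz2 : v != dn d2 by rewrite eq_sym.
have n21 : dn d2 != dn d1 by rewrite eq_sym.
pose C := v |: [set dn d1; dn d2].
have vC : v \notin [set dn d1; dn d2] by rewrite !inE negb_or vz1.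
have cC : #|C| = 3%N by rewrite /C cardsU1 vC cards2 n12.
have sC : C \subset V0 by rewrite !subUset !sub1set vV z1V z2V.
have pC : C \proper V0 by apply: (proper_lt M (v := v)); rewrite ?cC.
have W3 : (wsum es [set dn d1; dn d2] <= 3)%N.
  have := slack_ge6 M pC; rewrite cC (wsum_starp (mc_wf M) vC Hp) /= !inE !eqxx orbT w1 w2.
  by rewrite [dn d3 == _]eq_sym (negbTE n13) [dn d3 == _]eq_sym (negbTE n23); blia.
have c1z2 : dn c1 != dn d2.
  apply/eqP => E; exact: (triangle_positions M Hp w1 w2 w3 H1 wr1 wc1 wu1 H2 wr2 wc2 wu2).
have c2z1 : dn c2 != dn d1.
  apply/eqP => E; exact: (triangle_positions M (perm_trans Hp (perm3_213 _ _ _)) w2 w1 w3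
    H2 wr2 wc2 wu2 H1 wr1 wc1 wu1).
have u1z2 : dn u1 != dn d2.
  apply/negP => E; move: W3; rewrite (wsum2 (mc_wf M) n12) (perm_big _ H1) /= !big_cons big_nil E wu1.
  by do 2 case: ifP; blia.
have u2z1 : dn u2 != dn d1.
  apply/negP => E; move: W3; rewrite setUC (wsum2 (mc_wf M) n21) (perm_big _ H2) /= !big_cons big_nil E wu2.
  by do 2 case: ifP; blia.
have [g1 [gg1 g14 R1]] := gad1_fact (dq d1) (dp c1) (dp u1).
have [g2 [gg2 g24 R2]] := gad1_fact (dq d2) (dp c2) (dp u2).
pose ns := newE (dn c1) (dq c1) (dn u1) (dq u1) g1 ++
    newE (dn c2) (dq c2) (dn u2) (dq u2) g2.
have inC x : (x \in C) = [|| x == v, x == dn d1 | x == dn d2] by rewrite !inE.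
have c1C : dn c1 \in V0 :\: C.
  by rewrite in_setD inC c1V eq_sym (negbTE m12) (negbTE c1z) (negbTE c1z2).
have u1C : dn u1 \in V0 :\: C.
  by rewrite in_setD inC u1V eq_sym (negbTE m13) (negbTE u1z) (negbTE u1z2).
have c2C : dn c2 \in V0 :\: C.
  by rewrite in_setD inC c2V eq_sym (negbTE k12) (negbTE c2z) (negbTE c2z1).
have u2C : dn u2 \in V0 :\: C.
  by rewrite in_setD inC u2V eq_sym (negbTE k13) (negbTE u2z) (negbTE u2z1).
have [||phi|B [sB nB HB]] := @reduction _ _ _ M C (es ++ ns) sC.
- by apply/set0Pn; exists v; rewrite inC eqxx.
- by rewrite !wf_cat (mc_wf M) !wf_newE.
- rewrite !sat_cat !sat_newE c1C u1C c2C u2C /= => /and3P[Hphi Hn1 Hn2].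
  have rich1 := R1 _ _ Hn1; have rich2 := R2 _ _ Hn2.
  (* Two states are lost to each rich neighbour and four to [d3]: 8 of 10. *)
  have [|s] := @exists_state [:: seen (fun t => okw 3 (act t (dp c1)) (act (phi (dn c1)) (dq c1)) &&
        okw 4 (act t (dp u1)) (act (phi (dn u1)) (dq u1))) (dq d1) (dp d1);
      seen (fun t => okw 3 (act t (dp c2)) (act (phi (dn c2)) (dq c2)) &&
        okw 4 (act t (dp u2)) (act (phi (dn u2)) (dq u2))) (dq d2) (dp d2);
      fun s => okw 3 (act s (dp d3)) (act (phi (dn d3)) (dq d3))].
    have h1 := count_seen (dp d1) rich1; have h2 := count_seen (dp d2) rich2.
    by rewrite !big_cons big_nil count_okw //; move: h1 h2; blia.
  move=> /and4P[/exSP[t1 /andP[/andP[e1 e2] e3]] /exSP[t2 /andP[/andP[e4 e5] e6]] e7 _].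
  have z1B : dn d1 \notin V0 :\: C by rewrite in_setD inC eqxx orbT.
  have z2B : dn d2 \notin dn d1 |: (V0 :\: C).
    by rewrite in_setU1 negb_or n21 in_setD inC eqxx !orbT.
  have vB : v \notin V0 :\: C by rewrite in_setD inC eqxx.
  have EB : dn d2 |: (dn d1 |: (V0 :\: C)) = V0 :\ v.
    apply/setP => x; rewrite !in_setU1 in_setD1 in_setD inC.
    case: (eqVneq x (dn d2)) => [->|_]; first by rewrite z2v z2V.
    case: (eqVneq x (dn d1)) => [->|_]; first by rewrite z1v z1V.
    by rewrite !orbF.
  pose phi1 := upd phi (dn d1) t1; pose phi2 := upd phi1 (dn d2) t2.
  have Hs1 : sat es (dn d1 |: (V0 :\: C)) phi1.
    apply: (sat_ext (s := t1) (mc_wf M) z1B Hphi) => d.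
    rewrite (perm_mem H1) in_cons in_cons mem_seq1 => /or3P[] /eqP ->.
    - by rewrite nr1 (negbTE vB).
    - by rewrite /okD wc1.
    - by rewrite /okD wu1.
  have Hs2 : sat es (V0 :\ v) phi2.
    rewrite -EB; apply: (sat_ext (s := t2) (mc_wf M) z2B Hs1) => d.
    rewrite (perm_mem H2) in_cons in_cons mem_seq1 => /or3P[] /eqP ->.
    - by rewrite nr2 in_setU1 (negbTE vz1) (negbTE vB).
    - by rewrite /okD wc2 /phi1 /upd (negbTE c2z1).
    - by rewrite /okD wu2 /phi1 /upd (negbTE u2z1).
  apply: (extend1 M (s := s) vV Hs2) => d.
  rewrite (perm_mem Hp) !inE /okD /phi2 /phi1 /upd => /or3P[] /eqP ->.
  + by rewrite (negbTE n12) eqxx w1.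
  + by rewrite eqxx w2.
  + by rewrite [dn d3 == _]eq_sym (negbTE n23) [dn d3 == _]eq_sym (negbTE n13) w3.
have vB : v \notin B by apply/negP => /(subsetP sB); rewrite in_setD inC eqxx.
have z1B : dn d1 \notin B by apply/negP => /(subsetP sB); rewrite in_setD inC eqxx orbT.
have z2B : dn d2 \notin B by apply/negP => /(subsetP sB); rewrite in_setD inC eqxx !orbT.
have sBV : B \subset V0 := subset_trans sB (subsetDl _ _).
have pB : B \proper V0 by apply/properP; split=> //; exists v.
have W5 := subset5 M pB nB.
have cB : (0 < #|B|)%N by rewrite card_gt0.
have Wns : wsum (es ++ ns) B = (wsum es B + ((if (dn c1 \in B) && (dn u1 \in B) then g1 else 0) +
    (if (dn c2 \in B) && (dn u2 \in B) then g2 else 0)))%N.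
  by rewrite !wsum_cat !wsum_newE.
have one z (zV : z \in V0) (zv : v != z) (zB : z \notin B) :
    (wsum es (z |: B) + 6 <= 5 * #|B|.+1)%N.
  have <- : #|z |: B| = #|B|.+1 by rewrite cardsU1 zB.
  apply: (slack_ge6 M).
    apply/properP; split; first by rewrite subUset sub1set zV.
    by exists v => //; rewrite in_setU1 negb_or zv.
  by rewrite cardsU1 zB; blia.
have O1 := one _ z1V vz1 z1B; have O2 := one _ z2V vz2 z2B.
rewrite (wsum_starp (mc_wf M) z1B H1) /= nr1 (negbTE vB) wc1 wu1 in O1.
rewrite (wsum_starp (mc_wf M) z2B H2) /= nr2 (negbTE vB) wc2 wu2 in O2.
have notW4 : (wsum (es ++ ns) B + 4 <= 5 * #|B|)%N -> False.
  by move=> W4; case: HB => [|[]]; blia.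
case: (boolP (dn c1 \in B)) Wns O1 => c1B /= Wns O1; last first.
  by apply: notW4; move: Wns O2; case: (dn c2 \in B); case: (dn u2 \in B) => /=; blia.
case: (boolP (dn u1 \in B)) Wns O1 => u1B /= Wns O1; last first.
  by apply: notW4; move: Wns O2; case: (dn c2 \in B); case: (dn u2 \in B) => /=; blia.
case: (boolP (dn c2 \in B)) Wns O2 => c2B /= Wns O2; last by apply: notW4; blia.
case: (boolP (dn u2 \in B)) Wns O2 => u2B /= Wns O2; last by apply: notW4; blia.
have z21 : dn d2 \notin dn d1 |: B by rewrite in_setU1 negb_or n21.
have v21 : v \notin dn d2 |: (dn d1 |: B).
  by rewrite !in_setU1 !negb_or vB vz1 vz2.
pose A := v |: (dn d2 |: (dn d1 |: B)).
have cA : #|A| = #|B|.+3 by rewrite /A !cardsU1 v21 z21 z1B.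
have sA : A \subset V0 by rewrite !subUset !sub1set vV z1V z2V.
have WA : wsum es A = (wsum es B + 20 + (dn d3 \in B) * 3)%N.
  rewrite (wsum_starp (mc_wf M) v21 Hp) (wsum_starp (mc_wf M) z21 H2).
  rewrite (wsum_starp (mc_wf M) z1B H1) /= w1 w2 w3 wr1 wc1 wu1 wr2 wc2 wu2 nr1 nr2.
  rewrite !in_setU1 !eqxx (negbTE vB) c1B u1B c2B u2B !orbT (negbTE vz1).
  rewrite [dn d3 == _]eq_sym (negbTE n23) [dn d3 == _]eq_sym (negbTE n13) /=.
  by blia.
have W11 : (wsum es B + 11 <= 5 * #|B|)%N.
  case: (eqVneq A V0) => [EA|nA].
    have x3B : dn d3 \in B.
      have := x3V; rewrite -{1}EA !in_setU1 (negbTE x3v) eq_sym (negbTE n23) eq_sym (negbTE n13).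
      by [].
    have := p3 M sA; rewrite -card_gt0 cA WA x3B => /(_ isT); blia.
  have pA : A \proper V0 by rewrite properEneq nA.
  by have := slack_ge6 M pA; rewrite cA WA; blia.
case: HB => [|KB]; first by blia.
have W3B : (wsum (es ++ ns) B + 3 = 5 * #|B|)%N by case: KB.
have [G1 G2] : g1 = 4 /\ g2 = 4 by split; blia.
rewrite /ns G1 G2 in KB.
apply: (two_Z_exception KB) => //; first by blia.
by rewrite c1B u1B c2B.
Qed.

End TwoZ.
End Local.

(** * Three X neighbours of a vertex with weights 3, 3, 3, 2 *)

Lemma gad8_fact q pa pb : exists w, [/\ (w == 0%N) || (2 <= w <= 5)%N, (w <= 3)%N &
  forall xa xb, okw w xa xb ->
    rich (fun t => okw 3 (act t pa) xa && okw 3 (act t pb) xb) q].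
Proof.
have : all5 (fun q => all5 (fun pa => all5 (fun pb => exw (fun w => (w <= 3)%N &&
  all5 (fun xa => all5 (fun xb => if okw w xa xb then
    rich (fun t => okw 3 (act t pa) xa && okw 3 (act t pb) xb) q else true)))))).
  by vm_compute.
move=> /all5P/(_ q)/all5P/(_ pa)/all5P/(_ pb)/exwP[w [ww /andP[w3 H]]].
exists w; split=> // xa xb Hx.
by move: (all5P _ (all5P _ H xa) xb); rewrite Hx.
Qed.

Section Local.
Variable V : finType.
Implicit Types (es ns : seq (edge V)) (A B C D : {set V}) (phi f : V -> state).
Variables (es : seq (edge V)) (V0 : {set V}).
Hypothesis M : mincex es V0.

Definition isX z := (size (star es z) == 3) && all (fun d => dw d == 3) (star es z).

Lemma isX_dw z d : isX z -> d \in star es z -> dw d = 3.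
Proof. by move=> /andP[_ /allP H] /H /eqP. Qed.

Lemma isX_perm z r x : isX z -> r \in star es z -> x \in star es z -> r != x ->
  exists y, perm_eq (star es z) [:: r; x; y].
Proof.
move=> /andP[/eqP s3 _] rS xS rx.
have xR : x \in rem r (star es z).
  by move: xS; rewrite (perm_mem (perm_to_rem rS)) inE eq_sym (negbTE rx).
have Hp : perm_eq (star es z) [:: r, x & rem x (rem r (star es z))].
  by apply: perm_trans (perm_to_rem rS) _; rewrite perm_cons perm_to_rem.
have := perm_size Hp; rewrite s3; case E : (rem x _) Hp => [|y [|? ?]] //= Hp _.
by exists y.
Qed.

Lemma isX_rem z r : isX z -> r \in star es z ->
  (\sum_(d <- rem r (star es z)) (dw d).-1 < 5)%N.
Proof.
move=> zX rS; have := perm_to_rem rS => Hp.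
have : (\sum_(d <- star es z) (dw d).-1 = 3 * 2)%N.
  have /andP[/eqP s3 _] := zX.
  rewrite -{1}s3 -sum1_size big_distrl /= big_seq [RHS]big_seq.
  by apply: eq_bigr => d /(isX_dw zX) ->.
by rewrite (perm_big _ Hp) /= big_cons (isX_dw zX rS); blia.
Qed.

(** [X_reduction] at [z], deleting [z] and [dn x], yields a link between [dn y] and [v]. The
    alternatives with an edge of weight 4 are impossible: one puts it at [v], the other at an X
    neighbour of [v]. *)
Lemma X_link v z r x y :
  (forall d, d \in star es v -> (dw d <= 3)%N /\ (dw d = 3 -> isX (dn d))) ->
  isX z -> perm_eq (star es z) [:: r; x; y] -> dn r = v -> isX (dn x) ->
  exists2 d, d \in star es v & dw d = 2 /\ dn d = dn y.
Proof.
move=> Hv zX Hz nr xX.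
have Hz' : perm_eq (star es z) [:: x; y; r] := perm_trans Hz (perm3_231 _ _ _).
have dwz d : d \in [:: x; y; r] -> dw d = 3.
  by rewrite -(perm_mem Hz') => /(isX_dw zX).
have xS : x \in star es z by rewrite (perm_mem Hz') mem_head.
have rS := revd_star xS.
have [|||_ _] := X_reduction M Hz' _ _ _ (perm_to_rem rS) (isX_rem xX rS).
- by apply: dwz; rewrite mem_head.
- by apply: dwz; rewrite !inE eqxx orbT.
- by apply: dwz; rewrite !inE eqxx !orbT.
rewrite nr; case=> [H|[s [p [H1 H2]]]|[d dS d4]].
- by exists (revd (dn y) (dq y, v, dq r, 2)); first exact: revd_star H.
- have [_ /(_ (erefl _)) sX] := Hv _ (revd_star H2).
  by have := isX_dw sX (revd_star H1).
- by have [] := Hv d dS; rewrite d4.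
Qed.

(** By [X_link] the third neighbour of both would be [dn e], as [e] is the only dart of weight 2.
    The four vertices then carry weight at least 3 + 6 + 8, leaving slack 3. *)
Lemma X_nonadj v e di dj :
  (forall d, d \in star es v -> (dw d <= 3)%N /\ (dw d = 3 -> isX (dn d))) ->
  e \in star es v -> dw e = 2 ->
  (forall d, d \in star es v -> dw d = 2 -> d = e) ->
  di \in star es v -> dj \in star es v -> dw di = 3 -> dw dj = 3 ->
  dn di != dn dj -> mult es (dn di) (dn dj) = 0%N.
Proof.
move=> Hv eS e2 eU diS djS wi wj nij; apply/eqP/negPn/negP.
rewrite -lt0n /mult -has_count => /hasP[x xS /eqP nx].
have [_ /(_ wi) iX] := Hv _ diS; have [_ /(_ wj) jX] := Hv _ djS.
have [vV iV] := mc_starE M diS; have [_ jV] := mc_starE M djS.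
have [_ eV] := mc_starE M eS.
have /andP[iv _] := star_wf (mc_wf M) diS; have /andP[jv _] := star_wf (mc_wf M) djS.
have /andP[ev _] := star_wf (mc_wf M) eS.
have xX : isX (dn x) by rewrite nx.
have iR := revd_star diS; have jR := revd_star djS.
have [yi Hi] : exists y, perm_eq (star es (dn di)) [:: revd v di; x; y].
  apply: isX_perm => //; apply/eqP => E; have E' : v = dn x := congr1 (@dn V) E.
  by rewrite E' nx eqxx in jv.
have xR := revd_star xS; rewrite nx in xR.
have [yj Hj] : exists y, perm_eq (star es (dn dj)) [:: revd v dj; revd (dn di) x; y].
  apply: isX_perm => //; apply/eqP => E; have E' : v = dn di := congr1 (@dn V) E.
  by rewrite E' eqxx in iv.
have [f fS [f2 nf]] := X_link Hv iX Hi (erefl _) xX.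
have [f' fS' [f2' nf']] := X_link Hv jX Hj (erefl _) iX.
have Ei : dn yi = dn e by rewrite -nf (eU f).
have Ej : dn yj = dn e by rewrite -nf' (eU f').
have yiS : yi \in star es (dn di) by rewrite (perm_mem Hi) !inE eqxx !orbT.
have yjS : yj \in star es (dn dj) by rewrite (perm_mem Hj) !inE eqxx !orbT.
have ej : dn e != dn dj.
  by rewrite -Ej; have /andP[] := star_wf (mc_wf M) yjS.
have ei : dn e != dn di.
  by rewrite -Ei; have /andP[] := star_wf (mc_wf M) yiS.
pose D := [set dn dj; dn e].
have iD : dn di \notin D by rewrite !inE negb_or nij eq_sym ei.
have vD : v \notin dn di |: D.
  by rewrite !inE !negb_or ![v == _]eq_sym iv jv ev.
have c4 : #|v |: (dn di |: D)| = 4%N.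
  by rewrite cardsU1 vD cardsU1 iD cards2 eq_sym ej.
have pV : v |: (dn di |: D) \proper V0.
  by apply: (proper_lt M (v := v)); rewrite ?c4 // !subUset !sub1set vV iV jV eV.
have WD : (3 <= wsum es D)%N.
  rewrite (wsum2 (mc_wf M)) 1?eq_sym // (perm_big _ (perm_to_rem yjS)) /= big_cons.
  by rewrite Ej eqxx (isX_dw jX yjS) leq_addr.
have Wi : wsum es (dn di |: D) = (wsum es D + 6)%N.
  have wx := isX_dw iX xS; have wyi := isX_dw iX yiS.
  have [r [Er {}Hi]] : exists r, dn r = v /\ perm_eq (star es (dn di)) [:: r; x; yi].
    by exists (revd v di).
  rewrite (wsum_starp (mc_wf M) iD Hi) /= Er nx Ei wx wyi !inE !eqxx orbT.
  by rewrite ![v == _]eq_sym (negbTE jv) (negbTE ev).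
have Wv : (wsum es (dn di |: D) + 8 <= wsum es (v |: (dn di |: D)))%N.
  have d12 : dj \in rem di (star es v).
    move: djS; rewrite (perm_mem (perm_to_rem diS)) inE => /orP[/eqP E|//].
    by rewrite E eqxx in nij.
  have d13 : e \in rem dj (rem di (star es v)).
    move: eS; rewrite (perm_mem (perm_to_rem diS)) inE => /orP[/eqP E|].
      by rewrite E wi in e2.
    rewrite (perm_mem (perm_to_rem d12)) inE => /orP[/eqP E|//].
    by rewrite E wj in e2.
  have Pv : perm_eq (star es v) [:: di, dj, e & rem e (rem dj (rem di (star es v)))].
    apply: perm_trans (perm_to_rem diS) _; rewrite perm_cons.
    by apply: perm_trans (perm_to_rem d12) _; rewrite perm_cons perm_to_rem.
  rewrite (wsum_starp (mc_wf M) vD Pv) /= wi wj e2 !inE !eqxx !orbT.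
  by rewrite leq_add2l !mul1n !addnA leq_addr.
by have := slack_ge6 M pV; rewrite c4; blia.
Qed.

(** An end of a new edge has deficiency at least 10 - 3 - 4 and any other vertex at least 10 - 4 -
    4, so a total of 6 allows two ends. Two new darts at one vertex would have total weight 6, below
    the required 7. *)
Lemma critical_w3 ns B : critical (es ++ ns) B ->
  (forall x d, d \in star ns x -> (dw d <= 3)%N) ->
  (#|[set x in B | 0 < deg ns B x]%N| <= 2)%N /\
  {in B, forall x, (deg ns B x <= 1)%N}.
Proof.
move=> KB Hns.
have le4 x a b d : perm_eq [seq d <- star (es ++ ns) x | dn d \in B] [:: a; b] ->
    d \in [:: a; b] -> (dw d <= 4)%N.
  move=> Hab; rewrite -(perm_mem Hab) mem_filter mem_star_cat => /andP[_ /orP[]].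
    by move=> /(w4 M)/andP[].
  by move=> /Hns; blia.
split.
  pose g x : nat := if (0 < deg ns B x)%N then 3 else 2.
  have : (\sum_(x in B) g x <= 6)%N.
    apply: (critical_sum KB) => x xB a b Hab.
    have Ha := le4 x a b a Hab (mem_head _ _).
    have Hb : (dw b <= 4)%N by apply: (le4 x a b b Hab); rewrite !inE eqxx orbT.
    rewrite /g; case: ifP => [|_]; last by blia.
    rewrite /deg -has_count => /hasP[d dS dB].
    have : d \in [:: a; b] by rewrite -(perm_mem Hab) mem_filter dB mem_star_cat dS orbT.
    by have := Hns x d dS; rewrite !inE => + /orP[] /eqP E; rewrite E; blia.
  have : (\sum_(x in [set x in B | 0 < deg ns B x]%N) 3 <= \sum_(x in B) g x)%N.
    rewrite big_mkcond [leqRHS]big_mkcond; apply: leq_sum => x _.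
    by rewrite inE /g; case: (x \in B) => //=; case: ifP.
  by rewrite sum_nat_const; blia.
move=> x xB; have [_ /(_ x xB)[a [b [Hab ab7 _]]] _] := KB.
have D2 := critical_deg KB xB; rewrite deg_cat in D2.
rewrite leqNgt; apply/negP => D1.
have D0 : deg es B x = 0 by blia.
have le3 d : d \in [:: a; b] -> (dw d <= 3)%N.
  rewrite -(perm_mem Hab) mem_filter mem_star_cat => /andP[dB /orP[dS|/Hns //]].
  move/eqP: D0; rewrite /deg -leqn0 leqNgt -has_count.
  by move/hasPn/(_ _ dS)/negP/(_ dB).
have := le3 a (mem_head _ _); have := le3 b; rewrite !inE eqxx orbT => /(_ isT).
by blia.
Qed.

End Local.

Section Local.
Variable V : finType.
Implicit Types (es ns : seq (edge V)) (A B C D : {set V}) (phi f : V -> state).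
Variables (es : seq (edge V)) (V0 : {set V}).
Hypothesis M : mincex es V0.

(** A critical cycle cannot use two gadgets of weight at most 3: they would have more than two ends,
    or a shared end meeting two new darts. The functions [n] and [n'] are the degrees in the two
    gadgets. *)
Lemma critical_two_w3 ns B (n n' : V -> nat) a b a' b' : critical (es ++ ns) B ->
  (forall x d, d \in star ns x -> (dw d <= 3)%N) ->
  (forall x, n x + n' x <= deg ns B x)%N ->
  [&& a \in B, b \in B, a' \in B & b' \in B] -> a != b -> a' != b' ->
  [&& 0 < n a, 0 < n b, 0 < n' a' & 0 < n' b']%N -> False.
Proof.
move=> KB Hns Hn /and4P[aB bB a'B b'B] ab ab' /and4P[na nb na' nb'].
have [S2 D1] := critical_w3 M KB Hns.
set S := [set x in B | 0 < deg ns B x]%N in S2.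
have inS x : x \in B -> (0 < n x + n' x)%N -> x \in S.
  by move=> xB; have := Hn x; rewrite inE xB /=; blia.
have aS : a \in S by apply: inS => //; blia.
have bS : b \in S by apply: inS => //; blia.
have a'S : a' \in S by apply: inS => //; blia.
have b'S : b' \in S by apply: inS => //; blia.
have ES : S = [set a; b].
  by apply/esym/eqP; rewrite eqEcard subUset !sub1set aS bS cards2 ab.
have Hx x : x \in B -> (n x <= 1)%N /\ (n x = 0%N \/ n' x = 0%N).
  by move=> xB; have := Hn x; have := D1 x xB; blia.
move: a'S; rewrite ES !inE => /orP[] /eqP E; rewrite E in na' a'B.
  by have [] := Hx a aB; blia.
by have [] := Hx b bB; blia.
Qed.

Lemma X_spokes v d : d \in star es v -> isX es (dn d) ->
  exists r a b, [/\ perm_eq (star es (dn d)) [:: r; a; b], dn r = v, dp r = dq d,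
    dw r = 3 & dw a = 3 /\ dw b = 3].
Proof.
move=> dS zX; have rS := revd_star dS.
have := perm_size (perm_to_rem rS); have /andP[/eqP -> _] := zX.
case E : (rem _ _) => [|a [|b [|? ?]]] //= _.
have Hp : perm_eq (star es (dn d)) [:: revd v d; a; b] by rewrite -E perm_to_rem.
have Hw x : x \in [:: revd v d; a; b] -> dw x = 3.
  by rewrite -(perm_mem Hp) => /(isX_dw zX).
exists (revd v d), a, b; split=> //; first by apply: Hw; rewrite mem_head.
by split; apply: Hw; rewrite !inE eqxx ?orbT.
Qed.

(** All four vertices are deleted and each X neighbour is replaced by a gadget of weight at most 3
    that keeps it rich. The neighbours are pairwise nonadjacent by [X_nonadj], so they can be
    coloured one after another. *)
Lemma no_three_X v d1 d2 d3 e : perm_eq (star es v) [:: d1; d2; d3; e] ->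
  dw d1 = 3 -> dw d2 = 3 -> dw d3 = 3 -> dw e = 2 ->
  isX es (dn d1) -> isX es (dn d2) -> isX es (dn d3) -> False.
Proof.
move=> Hp w1 w2 w3 we X1 X2 X3.
have [S1 S2 S3 Se] : [/\ d1 \in star es v, d2 \in star es v, d3 \in star es v & e \in star es v].
  by rewrite !(perm_mem Hp) !inE !eqxx !orbT.
have [vV z1V] := mc_starE M S1; have [_ z2V] := mc_starE M S2.
have [_ z3V] := mc_starE M S3; have [_ eV] := mc_starE M Se.
have nv d : d \in star es v -> dn d != v by move=> /(star_wf (mc_wf M))/andP[].
have [z1v z2v z3v ev] := And4 (nv _ S1) (nv _ S2) (nv _ S3) (nv _ Se).
have [vz1 vz2 vz3 ve] : [/\ v != dn d1, v != dn d2, v != dn d3 & v != dn e].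
  by rewrite ![v == _]eq_sym.
have n12 : dn d1 != dn d2 by apply: (parallel M Hp); rewrite w1 w2.
have Hp13 : perm_eq (star es v) [:: d1; d3; d2; e].
  apply: perm_trans Hp _; rewrite perm_cons -[[:: d2; d3; e]]/([:: d2] ++ [:: d3] ++ [:: e]).
  by rewrite -[[:: d3; d2; e]]/([:: d3] ++ [:: d2] ++ [:: e]) perm_catCA perm_refl.
have n13 : dn d1 != dn d3 by apply: (parallel M Hp13); rewrite w1 w3.
have Hp23 : perm_eq (star es v) [:: d2; d3; d1; e].
  apply: perm_trans Hp _; rewrite -[[:: d1; d2; d3; e]]/([:: d1] ++ [:: d2; d3] ++ [:: e]).
  by rewrite -[[:: d2; d3; d1; e]]/([:: d2; d3] ++ [:: d1] ++ [:: e]) perm_catCA perm_refl.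
have n23 : dn d2 != dn d3 by apply: (parallel M Hp23); rewrite w2 w3.
have [n21 n31 n32] : [/\ dn d2 != dn d1, dn d3 != dn d1 & dn d3 != dn d2].
  by split; rewrite eq_sym.
have Hv d : d \in star es v -> (dw d <= 3)%N /\ (dw d = 3 -> isX es (dn d)).
  by rewrite (perm_mem Hp) !inE => /or4P[] /eqP ->; rewrite ?w1 ?w2 ?w3 ?we.
have eU d : d \in star es v -> dw d = 2 -> d = e.
  by rewrite (perm_mem Hp) !inE => /or4P[] /eqP ->; rewrite ?w1 ?w2 ?w3.
have enz d : isX es (dn d) -> dn e != dn d.
  move=> dX; apply/eqP => E; have eR := revd_star Se; rewrite E in eR.
  by have := isX_dw dX eR; change (dw e = 3 -> False); rewrite we.
have [ez1 ez2 ez3] := And3 (enz _ X1) (enz _ X2) (enz _ X3).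
have [r1 [a1 [b1 [H1 nr1 pr1 wr1 [wa1 wb1]]]]] := X_spokes S1 X1.
have [r2 [a2 [b2 [H2 nr2 pr2 wr2 [wa2 wb2]]]]] := X_spokes S2 X2.
have [r3 [a3 [b3 [H3 nr3 pr3 wr3 [wa3 wb3]]]]] := X_spokes S3 X3.
have spoke r a b d : perm_eq (star es (dn d)) [:: r; a; b] -> dn r = v ->
    dw r = 3 -> dw a = 3 -> dw b = 3 -> [/\ a \in star es (dn d), b \in star es (dn d),
    [&& dn a \in V0, v != dn a & dn a != dn d], [&& dn b \in V0, v != dn b & dn b != dn d] &
    dn a != dn b].
  move=> Hz nr wr wa wb; have [x1 x2 x3] : [/\ dn r != dn a, dn r != dn b & dn a != dn b].
    by apply: (distinct3 M Hz); rewrite ?wr ?wa ?wb.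
  have [_ _ /andP[h1 h2] /andP[h3 h4]] := star_in3 M Hz.
  by split; rewrite ?(perm_mem Hz) ?inE ?eqxx ?orbT // ?h1 ?h2 ?h3 ?h4 -?nr ?x1 ?x2.
have [A1 B1 /and3P[a1V va1 _] /and3P[b1V vb1 _] ab1] := spoke _ _ _ _ H1 nr1 wr1 wa1 wb1.
have [A2 B2 /and3P[a2V va2 _] /and3P[b2V vb2 _] ab2] := spoke _ _ _ _ H2 nr2 wr2 wa2 wb2.
have [A3 B3 /and3P[a3V va3 _] /and3P[b3V vb3 _] ab3] := spoke _ _ _ _ H3 nr3 wr3 wa3 wb3.
have nadj di dj : di \in star es v -> dj \in star es v -> dw di = 3 -> dw dj = 3 ->
    dn di != dn dj -> forall x, x \in star es (dn di) -> dn x != dn dj.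
  move=> diS djS wi wj nij x.
  exact: mult0 (X_nonadj M Hv Se we eU diS djS wi wj nij).
have N12 := nadj _ _ S1 S2 w1 w2 n12; have N13 := nadj _ _ S1 S3 w1 w3 n13.
have N21 := nadj _ _ S2 S1 w2 w1 n21; have N23 := nadj _ _ S2 S3 w2 w3 n23.
have N31 := nadj _ _ S3 S1 w3 w1 n31; have N32 := nadj _ _ S3 S2 w3 w2 n32.
have [a1z1 b1z1 a2z2] : [/\ dn a1 != dn d1, dn b1 != dn d1 & dn a2 != dn d2].
  by split; [have /andP[] := star_wf (mc_wf M) A1|have /andP[] := star_wf (mc_wf M) B1|
    have /andP[] := star_wf (mc_wf M) A2].
have [b2z2 a3z3 b3z3] : [/\ dn b2 != dn d2, dn a3 != dn d3 & dn b3 != dn d3].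
  by split; [have /andP[] := star_wf (mc_wf M) B2|have /andP[] := star_wf (mc_wf M) A3|
    have /andP[] := star_wf (mc_wf M) B3].
have [g1 [gg1 g13 R1]] := gad8_fact (dq d1) (dp a1) (dp b1).
have [g2 [gg2 g23 R2]] := gad8_fact (dq d2) (dp a2) (dp b2).
have [g3 [gg3 g33 R3]] := gad8_fact (dq d3) (dp a3) (dp b3).
pose ne1 := newE (dn a1) (dq a1) (dn b1) (dq b1) g1.
pose ne2 := newE (dn a2) (dq a2) (dn b2) (dq b2) g2.
pose ne3 := newE (dn a3) (dq a3) (dn b3) (dq b3) g3.
pose ns := ne1 ++ ne2 ++ ne3.
pose C := v |: (dn d1 |: [set dn d2; dn d3]).
have inC x : (x \in C) = [|| x == v, x == dn d1, x == dn d2 | x == dn d3] by rewrite !inE.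
have outC x : x \in V0 -> v != x -> x != dn d1 -> x != dn d2 -> x != dn d3 -> x \in V0 :\: C.
  by move=> xV vx x1 x2 x3; rewrite in_setD inC xV eq_sym (negbTE vx) (negbTE x1) (negbTE x2) (negbTE x3).
have a1C : dn a1 \in V0 :\: C by apply: outC; rewrite // ?N12 ?N13.
have b1C : dn b1 \in V0 :\: C by apply: outC; rewrite // ?N12 ?N13.
have a2C : dn a2 \in V0 :\: C by apply: outC; rewrite // ?N21 ?N23.
have b2C : dn b2 \in V0 :\: C by apply: outC; rewrite // ?N21 ?N23.
have a3C : dn a3 \in V0 :\: C by apply: outC; rewrite // ?N31 ?N32.
have b3C : dn b3 \in V0 :\: C by apply: outC; rewrite // ?N31 ?N32.
have sC : C \subset V0 by rewrite !subUset !sub1set vV z1V z2V.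
have [||phi|B [sB nB HB]] := @reduction _ _ _ M C (es ++ ns) sC.
- by apply/set0Pn; exists v; rewrite inC eqxx.
- by rewrite !wf_cat (mc_wf M) !wf_newE.
- rewrite !sat_cat !sat_newE a1C b1C a2C b2C a3C b3C /= => /and4P[Hphi Hn1 Hn2 Hn3].
  pose P (a b : dart V) t := okw 3 (act t (dp a)) (act (phi (dn a)) (dq a)) &&
    okw 3 (act t (dp b)) (act (phi (dn b)) (dq b)).
  (* Two states are lost to each rich neighbour and two to [e]: 8 of 10. *)
  have [|s] := @exists_state [:: seen (P a1 b1) (dq d1) (dp d1);
      seen (P a2 b2) (dq d2) (dp d2); seen (P a3 b3) (dq d3) (dp d3);
      fun s => okw 2 (act s (dp e)) (act (phi (dn e)) (dq e))].
    have h1 := count_seen (dp d1) (R1 _ _ Hn1); have h2 := count_seen (dp d2) (R2 _ _ Hn2).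
    have h3 := count_seen (dp d3) (R3 _ _ Hn3).
    by rewrite !big_cons big_nil count_okw //; move: h1 h2 h3; rewrite -!/(P _ _); blia.
  move=> /and5P[/exSP[t1 /andP[/andP[e1 e2] e3]] /exSP[t2 /andP[/andP[e4 e5] e6]]
    /exSP[t3 /andP[/andP[e7 e8] e9]] e10 _].
  have vB : v \notin V0 :\: C by rewrite in_setD inC eqxx.
  have z1B : dn d1 \notin V0 :\: C by rewrite in_setD inC eqxx orbT.
  have z2B : dn d2 \notin dn d1 |: (V0 :\: C).
    by rewrite in_setU1 negb_or n21 in_setD inC eqxx !orbT.
  have z3B : dn d3 \notin dn d2 |: (dn d1 |: (V0 :\: C)).
    by rewrite !in_setU1 !negb_or n31 n32 in_setD inC eqxx !orbT.
  have EB : dn d3 |: (dn d2 |: (dn d1 |: (V0 :\: C))) = V0 :\ v.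
    apply/setP => x; rewrite !in_setU1 in_setD1 in_setD inC.
    case: (eqVneq x (dn d3)) => [->|_]; first by rewrite z3v z3V.
    case: (eqVneq x (dn d2)) => [->|_]; first by rewrite z2v z2V.
    case: (eqVneq x (dn d1)) => [->|_]; first by rewrite z1v z1V.
    by rewrite !orbF.
  pose phi1 := upd phi (dn d1) t1; pose phi2 := upd phi1 (dn d2) t2.
  pose phi3 := upd phi2 (dn d3) t3.
  have Hs1 : sat es (dn d1 |: (V0 :\: C)) phi1.
    apply: (sat_ext (s := t1) (mc_wf M) z1B Hphi) => d.
    rewrite (perm_mem H1) in_cons in_cons mem_seq1 => /or3P[] /eqP ->.
    - by rewrite nr1 (negbTE vB).
    - by rewrite /okD wa1.
    - by rewrite /okD wb1.
  have Hs2 : sat es (dn d2 |: (dn d1 |: (V0 :\: C))) phi2.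
    apply: (sat_ext (s := t2) (mc_wf M) z2B Hs1) => d.
    rewrite (perm_mem H2) in_cons in_cons mem_seq1 => /or3P[] /eqP ->.
    - by rewrite nr2 in_setU1 (negbTE vz1) (negbTE vB).
    - by rewrite /okD wa2 /phi1 /upd (negbTE (N21 _ A2)).
    - by rewrite /okD wb2 /phi1 /upd (negbTE (N21 _ B2)).
  have Hs3 : sat es (V0 :\ v) phi3.
    rewrite -EB; apply: (sat_ext (s := t3) (mc_wf M) z3B Hs2) => d.
    rewrite (perm_mem H3) in_cons in_cons mem_seq1 => /or3P[] /eqP ->.
    - by rewrite nr3 !in_setU1 (negbTE vz1) (negbTE vz2) (negbTE vB).
    - by rewrite /okD wa3 /phi2 /phi1 /upd (negbTE (N32 _ A3)) (negbTE (N31 _ A3)).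
    - by rewrite /okD wb3 /phi2 /phi1 /upd (negbTE (N32 _ B3)) (negbTE (N31 _ B3)).
  apply: (extend1 M (s := s) vV Hs3) => d.
  rewrite (perm_mem Hp) !inE /okD /phi3 /phi2 /phi1 /upd => /or4P[] /eqP ->.
  + by rewrite (negbTE n13) (negbTE n12) eqxx w1.
  + by rewrite (negbTE n23) eqxx w2.
  + by rewrite eqxx w3.
  + by rewrite (negbTE ez3) (negbTE ez2) (negbTE ez1) we.
have vB : v \notin B by apply/negP => /(subsetP sB); rewrite in_setD inC eqxx.
have z1B : dn d1 \notin B by apply/negP => /(subsetP sB); rewrite in_setD inC eqxx orbT.
have z2B : dn d2 \notin B by apply/negP => /(subsetP sB); rewrite in_setD inC eqxx !orbT.
have z3B : dn d3 \notin B by apply/negP => /(subsetP sB); rewrite in_setD inC eqxx !orbT.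
have sBV : B \subset V0 := subset_trans sB (subsetDl _ _).
have pB : B \proper V0 by apply/properP; split=> //; exists v.
have W5 := subset5 M pB nB.
have cB : (0 < #|B|)%N by rewrite card_gt0.
have Wns : wsum (es ++ ns) B = (wsum es B + ((if (dn a1 \in B) && (dn b1 \in B) then g1 else 0) +
    ((if (dn a2 \in B) && (dn b2 \in B) then g2 else 0) +
     (if (dn a3 \in B) && (dn b3 \in B) then g3 else 0))))%N.
  by rewrite !wsum_cat !wsum_newE.
(* [Z1] ... bound the weight of [B] through [B] and some of the removed nodes. *)
have one d r a b : perm_eq (star es (dn d)) [:: r; a; b] -> dn r = v ->
    dw a = 3 -> dw b = 3 -> dn d \in V0 -> v != dn d -> dn d \notin B ->
    (wsum es B + ((dn a \in B) * 3 + (dn b \in B) * 3) + 1 <= 5 * #|B|)%N.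
  move=> Hz nr wa wb dV vd dB.
  have cd : #|dn d |: B| = #|B|.+1 by rewrite cardsU1 dB.
  have pd : dn d |: B \proper V0.
    apply/properP; split; first by rewrite subUset sub1set dV.
    by exists v => //; rewrite in_setU1 negb_or vd.
  have := slack_ge6 M pd; rewrite cd (wsum_starp (mc_wf M) dB Hz) /= nr (negbTE vB) wa wb.
  by blia.
have two di ri ai bi dj rj aj bj dk : perm_eq (star es (dn di)) [:: ri; ai; bi] ->
    perm_eq (star es (dn dj)) [:: rj; aj; bj] -> perm_eq (star es v) [:: di; dj; dk; e] ->
    dn ri = v -> dn rj = v -> dw ai = 3 -> dw bi = 3 -> dw aj = 3 -> dw bj = 3 ->
    [&& dw di == 3, dw dj == 3, dn di \in V0, dn dj \in V0 & dn dk \in V0] ->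
    [&& v != dn di, v != dn dj & v != dn dk] ->
    [&& dn di \notin B, dn dj \notin B & dn dk \notin B] ->
    [&& dn di != dn dj, dn di != dn dk & dn dj != dn dk] ->
    [&& dn aj != dn di, dn bj != dn di, dn e != dn di & dn e != dn dj] ->
    (wsum es B + ((dn ai \in B) * 3 + (dn bi \in B) * 3) +
      ((dn aj \in B) * 3 + (dn bj \in B) * 3) <= 5 * #|B| + 3)%N.
  move=> Hi Hj Hvp nri nrj wai wbi waj wbj /and5P[/eqP wi /eqP wj iV jV kV].
  move=> /and3P[vi vj vk] /and3P[iB jB kB] /and3P[ij ik jk] /and4P[aji bji ei ej].
  have jB' : dn dj \notin dn di |: B by rewrite in_setU1 negb_or eq_sym ij.
  have vB' : v \notin dn dj |: (dn di |: B) by rewrite !in_setU1 !negb_or vi vj.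
  have cd : #|v |: (dn dj |: (dn di |: B))| = #|B|.+3.
    by rewrite cardsU1 vB' cardsU1 jB' cardsU1 iB.
  have pd : v |: (dn dj |: (dn di |: B)) \proper V0.
    apply/properP; split; first by rewrite !subUset !sub1set vV iV jV.
    by exists (dn dk) => //; rewrite !in_setU1 !negb_or eq_sym vk eq_sym jk eq_sym ik.
  have := slack_ge6 M pd; rewrite cd (wsum_starp (mc_wf M) vB' Hvp).
  rewrite (wsum_starp (mc_wf M) jB' Hj) (wsum_starp (mc_wf M) iB Hi) /=.
  rewrite nri nrj wai wbi waj wbj wi wj !in_setU1 !eqxx !orbT (negbTE vB) (negbTE vi).
  rewrite (negbTE aji) (negbTE bji) /=.
  move: (nat_of_bool (dn ai \in B)) (nat_of_bool (dn bi \in B)) (nat_of_bool (dn aj \in B)).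
  by move: (nat_of_bool (dn bj \in B)) (nat_of_bool (_ || _)); blia.
have O1 := one _ _ _ _ H1 nr1 wa1 wb1 z1V vz1 z1B.
have O2 := one _ _ _ _ H2 nr2 wa2 wb2 z2V vz2 z2B.
have O3 := one _ _ _ _ H3 nr3 wa3 wb3 z3V vz3 z3B.
have T12 : (wsum es B + ((dn a1 \in B) * 3 + (dn b1 \in B) * 3) +
      ((dn a2 \in B) * 3 + (dn b2 \in B) * 3) <= 5 * #|B| + 3)%N.
  by apply: (two _ _ _ _ _ _ _ _ _ H1 H2 Hp) => //; rewrite ?w1 ?w2 ?z1V ?z2V ?z3V ?vz1
    ?vz2 ?vz3 ?z1B ?z2B ?z3B ?n12 ?n13 ?n23 ?(N21 _ A2) ?(N21 _ B2) ?ez1 ?ez2.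
have T13 : (wsum es B + ((dn a1 \in B) * 3 + (dn b1 \in B) * 3) +
      ((dn a3 \in B) * 3 + (dn b3 \in B) * 3) <= 5 * #|B| + 3)%N.
  by apply: (two _ _ _ _ _ _ _ _ _ H1 H3 Hp13) => //; rewrite ?w1 ?w3 ?z1V ?z2V ?z3V ?vz1
    ?vz2 ?vz3 ?z1B ?z2B ?z3B ?n12 ?n13 ?n32 ?(N31 _ A3) ?(N31 _ B3) ?ez1 ?ez3.
have T23 : (wsum es B + ((dn a2 \in B) * 3 + (dn b2 \in B) * 3) +
      ((dn a3 \in B) * 3 + (dn b3 \in B) * 3) <= 5 * #|B| + 3)%N.
  by apply: (two _ _ _ _ _ _ _ _ _ H2 H3 Hp23) => //; rewrite ?w2 ?w3 ?z1V ?z2V ?z3V ?vz1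
    ?vz2 ?vz3 ?z1B ?z2B ?z3B ?n21 ?n23 ?n31 ?(N32 _ A3) ?(N32 _ B3) ?ez2 ?ez3.
have T123 : (wsum es B + ((dn a1 \in B) * 3 + (dn b1 \in B) * 3) +
      ((dn a2 \in B) * 3 + (dn b2 \in B) * 3) +
      ((dn a3 \in B) * 3 + (dn b3 \in B) * 3) <= 5 * #|B| + 6)%N.
  have z21 : dn d2 \notin dn d1 |: B by rewrite in_setU1 negb_or n21.
  have z321 : dn d3 \notin dn d2 |: (dn d1 |: B) by rewrite !in_setU1 !negb_or n31 n32.
  have v321 : v \notin dn d3 |: (dn d2 |: (dn d1 |: B)).
    by rewrite !in_setU1 !negb_or vz1 vz2 vz3.
  pose A := v |: (dn d3 |: (dn d2 |: (dn d1 |: B))).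
  have cA : #|A| = #|B|.+4 by rewrite /A cardsU1 v321 cardsU1 z321 cardsU1 z21 cardsU1 z1B.
  have sA : A \subset V0 by rewrite !subUset !sub1set vV z1V z2V z3V.
  have WA : wsum es A = (wsum es B + ((dn a1 \in B) * 3 + (dn b1 \in B) * 3) +
      ((dn a2 \in B) * 3 + (dn b2 \in B) * 3) +
      ((dn a3 \in B) * 3 + (dn b3 \in B) * 3) + 9 + (dn e \in B) * 2)%N.
    rewrite (wsum_starp (mc_wf M) v321 Hp) (wsum_starp (mc_wf M) z321 H3).
    rewrite (wsum_starp (mc_wf M) z21 H2) (wsum_starp (mc_wf M) z1B H1) /=.
    rewrite w1 w2 w3 we wa1 wb1 wa2 wb2 wa3 wb3 nr1 nr2 nr3 !in_setU1 !eqxx !orbT.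
    rewrite (negbTE vB) (negbTE vz1) (negbTE vz2) (negbTE (N21 _ A2)) (negbTE (N21 _ B2)).
    rewrite (negbTE (N31 _ A3)) (negbTE (N31 _ B3)) (negbTE (N32 _ A3)) (negbTE (N32 _ B3)).
    rewrite (negbTE ez1) (negbTE ez2) (negbTE ez3) /=.
    move: (nat_of_bool (dn a1 \in B)) (nat_of_bool (dn b1 \in B)) (nat_of_bool (dn a2 \in B)).
    move: (nat_of_bool (dn b2 \in B)) (nat_of_bool (dn a3 \in B)) (nat_of_bool (dn b3 \in B)).
    by move: (nat_of_bool (dn e \in B)); blia.
  case: (eqVneq A V0) => [EA|nA].
    have eB : dn e \in B.
      by have := eV; rewrite -{1}EA !in_setU1 (negbTE ev) (negbTE ez1) (negbTE ez2) (negbTE ez3).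
    have := p3 M sA; rewrite -card_gt0 cA WA eB => /(_ isT).
    move: (nat_of_bool (dn a1 \in B)) (nat_of_bool (dn b1 \in B)) (nat_of_bool (dn a2 \in B)).
    by move: (nat_of_bool (dn b2 \in B)) (nat_of_bool (dn a3 \in B)) (nat_of_bool (dn b3 \in B)); blia.
  have pA : A \proper V0 by rewrite properEneq nA.
  have := slack_ge6 M pA; rewrite cA WA.
  move: (nat_of_bool (dn a1 \in B)) (nat_of_bool (dn b1 \in B)) (nat_of_bool (dn a2 \in B)).
  move: (nat_of_bool (dn b2 \in B)) (nat_of_bool (dn a3 \in B)) (nat_of_bool (dn b3 \in B)).
  by move: (nat_of_bool (dn e \in B)); clear O1 O2 O3 T12 T13 T23; blia.
have Hns x d : d \in star ns x -> (dw d <= 3)%N.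
  by rewrite !mem_star_cat => /or3P[] /newE_dw ->.
have K12 : critical (es ++ ns) B -> g1 = 3 -> g2 = 3 ->
    [&& dn a1 \in B, dn b1 \in B, dn a2 \in B & dn b2 \in B] -> False.
  move=> KB G1 G2 inB; have /and4P[i1 i2 i3 i4] := inB.
  apply: (critical_two_w3 (n := deg ne1 B) (n' := deg ne2 B) KB Hns _ inB ab1 ab2).
    by move=> x; rewrite !deg_cat; blia.
  by rewrite !deg_newE ?G1 ?G2 // i1 i2 i3 i4 !eqxx !addn_gt0 !orbT.
have K13 : critical (es ++ ns) B -> g1 = 3 -> g3 = 3 ->
    [&& dn a1 \in B, dn b1 \in B, dn a3 \in B & dn b3 \in B] -> False.
  move=> KB G1 G2 inB; have /and4P[i1 i2 i3 i4] := inB.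
  apply: (critical_two_w3 (n := deg ne1 B) (n' := deg ne3 B) KB Hns _ inB ab1 ab3).
    by move=> x; rewrite !deg_cat; blia.
  by rewrite !deg_newE ?G1 ?G2 // i1 i2 i3 i4 !eqxx !addn_gt0 !orbT.
have K23 : critical (es ++ ns) B -> g2 = 3 -> g3 = 3 ->
    [&& dn a2 \in B, dn b2 \in B, dn a3 \in B & dn b3 \in B] -> False.
  move=> KB G1 G2 inB; have /and4P[i1 i2 i3 i4] := inB.
  apply: (critical_two_w3 (n := deg ne2 B) (n' := deg ne3 B) KB Hns _ inB ab2 ab3).
    by move=> x; rewrite !deg_cat; blia.
  by rewrite !deg_newE ?G1 ?G2 // i1 i2 i3 i4 !eqxx !addn_gt0 !orbT.
have W3B : (5 * #|B| <= wsum (es ++ ns) B + 3)%N by case: HB => [|[]]; blia.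
have KB : (wsum (es ++ ns) B + 3 <= 5 * #|B|)%N -> critical (es ++ ns) B.
  by case: HB => // H H'; exfalso; blia.
(* A gadget counts when both its ends lie in [B]. With at most one the slack stays at least 4; with
   two or three it is still at least 3, and the remaining critical cycle would use two gadgets. *)
move: W3B KB O1 O2 O3 T12 T13 T23 T123 K12 K13 K23; rewrite Wns.
case: (dn a1 \in B); case: (dn b1 \in B); case: (dn a2 \in B); case: (dn b2 \in B);
 case: (dn a3 \in B); case: (dn b3 \in B) => /= W3B KB O1 O2 O3 T12 T13 T23 T123 K12 K13 K23;
 first [ by blia
  | by apply: K12; [apply: KB; blia|blia|blia|]
  | by apply: K13; [apply: KB; blia|blia|blia|]
  | by apply: K23; [apply: KB; blia|blia|blia|] ].
Qed.

End Local.

(** * Discharging *)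

Section Local.
Variable V : finType.
Implicit Types (es ns : seq (edge V)) (A B C D : {set V}) (phi f : V -> state).
Variables (es : seq (edge V)) (V0 : {set V}).
Hypothesis M : mincex es V0.

Definition num k (l : seq (dart V)) := count (fun d => dw d == k) l.

Lemma num_size (l : seq (dart V)) : {in l, forall d, 2 <= dw d <= 4}%N ->
  (size l = num 2 l + num 3 l + num 4 l)%N /\
  (\sum_(d <- l) dw d = 2 * num 2 l + 3 * num 3 l + 4 * num 4 l)%N.
Proof.
elim: l => [|d l IH] Hl; first by rewrite big_nil.
have [|E1 E2] := IH; first by move=> x xl; apply: Hl; rewrite inE xl orbT.
have := Hl d (mem_head _ _); rewrite big_cons /num /= -!/(num _ _) E1 E2.
move=> /andP[]; case: (dw d) => [|[|[|[|[|w]]]]] //= _ _; lia.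
Qed.

Lemma star_num v : (size (star es v) = num 2 (star es v) + num 3 (star es v) +
    num 4 (star es v))%N /\ (\sum_(d <- star es v) dw d =
   2 * num 2 (star es v) + 3 * num 3 (star es v) + 4 * num 4 (star es v))%N.
Proof. by apply: num_size => d; apply: (w4 M). Qed.

Lemma star_pred v : (\sum_(d <- star es v) (dw d).-1 =
   num 2 (star es v) + 2 * num 3 (star es v) + 3 * num 4 (star es v))%N.
Proof.
have [E1 E2] := star_num v.
have : (\sum_(d <- star es v) (dw d).-1 + size (star es v) = \sum_(d <- star es v) dw d)%N.
  rewrite -sum1_size -big_split /= big_seq [RHS]big_seq; apply: eq_bigr => d.
  by move=> /(w4 M); lia.
by rewrite E2 E1; lia.
Qed.

Lemma num0P k l : num k l = 0%N -> {in l, forall d, dw d <> k}.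
Proof.
move=> /eqP; rewrite -leqn0 leqNgt -has_count => /hasPn H d dl E.
by have := H d dl; rewrite /= E eqxx.
Qed.

Lemma num_gt0 k l d : d \in l -> dw d = k -> (0 < num k l)%N.
Proof. by move=> dl E; rewrite -has_count; apply/hasP; exists d; rewrite // E. Qed.

Lemma isX_num z : isX es z = [&& num 2 (star es z) == 0, num 3 (star es z) == 3 &
  num 4 (star es z) == 0]%N.
Proof.
have [E _] := star_num z; rewrite /isX all_count -/(num 3 _).
by apply/idP/idP; lia.
Qed.

(* A node of weight sum [s] has charge [s / 2 - 5]. The X nodes, of charge -1/2,
   receive [give z / 4] from each neighbour [z]. *)
Definition give z : nat :=
  if size (star es z) == 3 then (if num 4 (star es z) == 2 then 2 else 0)
  else if size (star es z) == 4 then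
    (if num 4 (star es z) == 0%N then (if (3 <= num 3 (star es z))%N then 1 else 0) else 2)
  else 2.

Definition numX v := count (fun d => isX es (dn d)) (star es v).

Lemma X_dart v d : d \in star es v -> isX es (dn d) -> dw d = 3.
Proof. by move=> dS dX; have := isX_dw dX (revd_star dS). Qed.

Lemma numX_num3 v : (numX v <= num 3 (star es v))%N.
Proof.
rewrite /numX /num; have : {in star es v, forall d, isX es (dn d) -> dw d == 3}.
  by move=> d dS dX; rewrite (X_dart dS dX).
elim: (star es v) => //= d l IH H; apply: leq_add; last first.
  by apply: IH => x xl; apply: H; rewrite inE xl orbT.
by case: (boolP (isX es (dn d))) => // dX; rewrite H // mem_head.
Qed.

(** The two cases that arithmetic leaves open are excluded configurations: weights 2, 2, 2, 3, with
    sum 9, and weights 3, 3, 3, 2 with three X neighbours, where the surplus 22 - 20 pays for two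
    only. *)
Lemma give_nonX v : v \in V0 -> ~~ isX es v ->
  (20 + give v * numX v <= 2 * \sum_(d <- star es v) dw d)%N.
Proof.
move=> vV; have [E1 ->] := star_num v; have nX := numX_num3 v.
have s3 := star_ge3 M vV; have R := excess_ge5 M vV; rewrite star_pred in R.
rewrite isX_num /give.
case: (eqVneq (size (star es v)) 3) => [e3|n3].
  have n2 : num 2 (star es v) = 0%N.
    apply/eqP; rewrite eqn0Ngt; apply/negP; rewrite /num -has_count => /hasP[d dS /eqP d2].
    by have := cubic_weight_ge3 M e3 dS; rewrite d2.
  by move: E1 nX; rewrite n2; case: (eqVneq (num 4 (star es v)) 2) => [->|] /=; lia.
have ext k : (0 < num k (star es v))%N -> size (star es v) = 4 ->
    exists d a b c, dw d = k /\ perm_eq (star es v) [:: d; a; b; c].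
  rewrite /num -has_count => /hasP[d dS /eqP dk] e4.
  have Hp := perm_to_rem dS; have := size_rem dS; rewrite e4.
  case: (rem _ _) Hp => [|a [|b [|c [|? ?]]]] //= Hp _.
  by exists d, a, b, c.
have perm_num k d a b c : perm_eq (star es v) [:: d; a; b; c] ->
    num k (star es v) = ((dw d == k) + ((dw a == k) + ((dw b == k) + ((dw c == k) + 0))))%N.
  by move=> /permP/(_ (fun d => dw d == k)).
case: (eqVneq (size (star es v)) 4) => [e4|n4]; last by move: E1; blia.
case: (eqVneq (num 4 (star es v)) 0%N) => [e0|n0]; last by move: E1; blia.
case: (leqP 3 (num 3 (star es v))) => h3 _; last first.
  suff : num 3 (star es v) <> 1%N by blia.
  move=> N3; have [|d [a [b [c [d3 Hp]]]]] := ext 3 _ e4; first by rewrite N3.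
  have P3 := perm_num 3 _ _ _ _ Hp; have P4 := perm_num 4 _ _ _ _ Hp.
  rewrite N3 d3 /= in P3; rewrite e0 in P4.
  have dw2 x : x \in [:: a; b; c] -> dw x = 2.
    move=> xl; have xS : x \in star es v by rewrite (perm_mem Hp) inE xl orbT.
    have := w4 M xS; move: xl P3 P4; rewrite !inE => /or3P[] /eqP ->; blia.
  have Hp' : perm_eq (star es v) [:: a; b; c; d].
    by apply: perm_trans Hp _; exact: permEl (perm_catC [:: d] [:: a; b; c]).
  by apply: (no2223 M Hp'); rewrite ?d3 // dw2 // !inE eqxx ?orbT.
case: (eqVneq (num 3 (star es v)) 4) => [N3|N3]; first by blia.
suff : numX v <> 3%N by blia.
move=> X3; have [|e [a [b [c [e2 Hp]]]]] := ext 2 _ e4; first by blia.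
have P2 := perm_num 2 _ _ _ _ Hp; have P4 := perm_num 4 _ _ _ _ Hp.
have n2 : num 2 (star es v) = 1%N by clear P2 P4 R nX; move/eqP: N3; blia.
rewrite n2 e2 /= in P2; rewrite e0 in P4.
have dw3 x : x \in [:: a; b; c] -> dw x = 3.
  move=> xl; have xS : x \in star es v by rewrite (perm_mem Hp) inE xl orbT.
  have := w4 M xS; move: xl P2 P4; rewrite !inE => /or3P[] /eqP ->; blia.
have eX : isX es (dn e) = false.
  apply/negP => eX; have eS : e \in star es v by rewrite (perm_mem Hp) mem_head.
  by have := X_dart eS eX; rewrite e2.
have : numX v = (isX es (dn e) + (isX es (dn a) + (isX es (dn b) + (isX es (dn c) + 0))))%N.
  by move/permP: Hp; apply.
rewrite X3 eX; case aX: (isX es (dn a)); case bX: (isX es (dn b)); case cX: (isX es (dn c)) => //= _.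
have Hp' : perm_eq (star es v) [:: a; b; c; e].
  by apply: perm_trans Hp _; exact: permEl (perm_catC [:: e] [:: a; b; c]).
have [wa wb wc] : [/\ dw a = 3, dw b = 3 & dw c = 3].
  by split; apply: dw3; rewrite !inE eqxx ?orbT.
exact: (no_three_X M Hp' wa wb wc e2 aX bX cX).
Qed.

(** The vertices to which [X_reduction] applies: without a dart of weight 3 their excess is below 5.
    Absence of weight 4 is what [no_link43] asks for in addition. *)
Definition light z := all (fun d => dw d <= 3)%N (star es z) &&
  (\sum_(d <- star es z) (dw d).-1 <= 6)%N.

(** These are the neighbours that can leave an X vertex with too little charge: light ones, those
    with weights 3, 3, 4, and those with at least three darts of weight 3 that give 1. *)
Lemma nbr_kind z r : r \in star es z -> dw r = 3 -> (give z <= 1)%N ->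
  [\/ light z, (exists c u, perm_eq (star es z) [:: r; c; u] /\ dw c = 3 /\ dw u = 4)
       /\ give z = 0%N |
      [/\ num 4 (star es z) = 0%N, (num 2 (star es z) <= 1)%N & give z = 1%N]].
Proof.
move=> rS r3; have [zV _] := mc_starE M rS.
have [E1 _] := star_num z; have s3 := star_ge3 M zV; have N3 := num_gt0 rS r3.
have lightI : num 4 (star es z) = 0%N -> (num 2 (star es z) + 2 * num 3 (star es z) <= 6)%N ->
    light z.
  move=> e0 le6; rewrite /light star_pred e0 muln0 addn0 le6 andbT.
  apply/allP => d dS; have := num0P e0 dS; have := w4 M dS; blia.
rewrite /give; case: (eqVneq (size (star es z)) 3) => [e3|n3].
  have n2 : num 2 (star es z) = 0%N.
    apply/eqP; rewrite eqn0Ngt; apply/negP; rewrite /num -has_count => /hasP[d dS /eqP d2].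
    by have := cubic_weight_ge3 M e3 dS; rewrite d2.
  case: (eqVneq (num 4 (star es z)) 2) => // n42 _.
  case: (eqVneq (num 4 (star es z)) 0%N) => [n40|n40].
    by constructor 1; apply: lightI => //; blia.
  constructor 2; split=> //; have Hp := perm_to_rem rS; have := size_rem rS; rewrite e3.
  case: (rem _ _) Hp => [|a [|b [|? ?]]] //= Hp _.
  have P3 : num 3 (star es z) = ((dw r == 3) + ((dw a == 3) + ((dw b == 3) + 0)))%N.
    by move/permP: Hp => /(_ (fun d => dw d == 3)).
  have P4 : num 4 (star es z) = ((dw r == 4) + ((dw a == 4) + ((dw b == 4) + 0)))%N.
    by move/permP: Hp => /(_ (fun d => dw d == 4)).
  rewrite r3 in P3 P4; case: (eqVneq (dw a) 4) P3 P4 => [a4|a4] P3 P4.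
    exists b, a; split; first exact: perm_trans Hp (perm3_132 _ _ _).
    by split=> //; move: P3 P4; rewrite a4 /=; blia.
  by exists a, b; split=> //; blia.
case: (eqVneq (size (star es z)) 4) => [e4|n4] //.
case: (eqVneq (num 4 (star es z)) 0%N) => [e0|n0] //.
case: (leqP 3 (num 3 (star es z))) => h3 _; first by constructor 3; split=> //; blia.
by constructor 1; apply: lightI => //; blia.
Qed.

Lemma light_link v e da db : perm_eq (star es v) [:: e; da; db] ->
  dw e = 3 -> dw da = 3 -> dw db = 3 -> light (dn e) ->
  [/\ dp da = dp e, dp db = dp e & linked es (dn da) (dq da) (dn db) (dq db)].
Proof.
move=> Hp we wa wb /andP[_ L].
have eR : revd v e \in star es (dn e) by apply: revd_star; rewrite (perm_mem Hp) mem_head.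
apply: (X_reduction M Hp we wa wb (perm_to_rem eR)).
move: L; rewrite (perm_big _ (perm_to_rem eR)) /= big_cons.
by change ((dw e).-1 + \sum_(d <- rem (revd v e) (star es (dn e))) (dw d).-1 <= 6 ->
  \sum_(d <- rem (revd v e) (star es (dn e))) (dw d).-1 < 5)%N; rewrite we; blia.
Qed.

Lemma light_edge v e da db : perm_eq (star es v) [:: e; da; db] ->
  dw e = 3 -> dw da = 3 -> dw db = 3 -> light (dn e) ->
  num 4 (star es (dn da)) = 0%N -> num 4 (star es (dn db)) = 0%N ->
  (dq da, dn db, dq db, 2) \in star es (dn da).
Proof.
move=> Hp we wa wb L a4 b4.
have [_ _ [//|[s [r [H _]]]|[d dS d4]]] := light_link Hp we wa wb L.
  by have := num0P a4 H.
by have := num0P b4 dS; rewrite d4.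
Qed.

(** All three forms of link fail: an edge of weight 2 cannot end at a cubic vertex, a path of
    weights 4 and 3 is excluded by [no_link43], and the end of [db] has no dart of weight 4. *)
Lemma light_Z v e dz db : perm_eq (star es v) [:: e; dz; db] ->
  dw e = 3 -> dw dz = 3 -> dw db = 3 -> light (dn e) ->
  (exists c u, perm_eq (star es (dn dz)) [:: revd v dz; c; u] /\ dw c = 3 /\ dw u = 4) ->
  num 4 (star es (dn db)) = 0%N -> False.
Proof.
move=> Hp we wz wb L [c [u [Hz [wc wu]]]] b4.
have [pz pb lk] := light_link Hp we wz wb L.
have sz : size (star es (dn dz)) = 3%N by rewrite (perm_size Hz).
case: lk => [H|[s [r [H1 H2]]]|[d dS d4]].
- by have := cubic_weight_ge3 M sz H.
- have Eu : (dq dz, s, r, 4) = u.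
    move: H1; rewrite (perm_mem Hz) !inE => /or3P[] /eqP E //.
      by have E' : 4 = dw dz := congr1 (@dw V) E; rewrite wz in E'.
    by have E' : 4 = dw c := congr1 (@dw V) E; rewrite wc in E'.
  have eR : revd v e \in star es (dn e) by apply: revd_star; rewrite (perm_mem Hp) mem_head.
  have /andP[/allP L3 L6] := L.
  rewrite (perm_big _ (perm_to_rem eR)) /= big_cons in L6.
  apply: (no_link43 M Hp we wz wb (perm_to_rem eR) _ _ Hz wc wu pz pb).
  + move: L6; change ((dw e).-1 + \sum_(d <- rem (revd v e) (star es (dn e))) (dw d).-1 <= 6 ->
      \sum_(d <- rem (revd v e) (star es (dn e))) (dw d).-1 < 5)%N; rewrite we; blia.
  + by move=> d /mem_rem /L3.
  + by rewrite -Eu.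
  + by rewrite -Eu.
- by have := num0P b4 dS; rewrite d4.
Qed.

Lemma two_Z v d1 d2 d3 : perm_eq (star es v) [:: d1; d2; d3] ->
  dw d1 = 3 -> dw d2 = 3 -> dw d3 = 3 ->
  (exists c u, perm_eq (star es (dn d1)) [:: revd v d1; c; u] /\ dw c = 3 /\ dw u = 4) ->
  (exists c u, perm_eq (star es (dn d2)) [:: revd v d2; c; u] /\ dw c = 3 /\ dw u = 4) ->
  False.
Proof.
move=> Hp w1 w2 w3 [c1 [u1 [H1 [wc1 wu1]]]] [c2 [u2 [H2 [wc2 wu2]]]].
exact: (no_two_Z M Hp w1 w2 w3 H1 w1 wc1 wu1 H2 w2 wc2 wu2).
Qed.

(** Links at light neighbours can only be edges of weight 2. Two of them meet in the third
    neighbour, which is therefore light as well; then all three pairs are linked, and the four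
    vertices have weight at least 9 + 6, too much for slack 6. *)
Lemma three_light v d1 d2 d3 : perm_eq (star es v) [:: d1; d2; d3] ->
  dw d1 = 3 -> dw d2 = 3 -> dw d3 = 3 ->
  light (dn d1) -> light (dn d2) ->
  light (dn d3) \/ (num 4 (star es (dn d3)) = 0%N /\ num 2 (star es (dn d3)) <= 1)%N -> False.
Proof.
move=> Hp w1 w2 w3 L1 L2 H3.
have L4 z : light z -> num 4 (star es z) = 0%N.
  move=> /andP[/allP L _]; apply/eqP; rewrite eqn0Ngt /num -has_count.
  by apply/hasPn => d /L; rewrite /=; case: eqP => // ->.
have n34 : num 4 (star es (dn d3)) = 0%N by case: H3 => [/L4|[]].
have E1 := light_edge Hp w1 w2 w3 L1 (L4 _ L2) n34.
have Hp2 : perm_eq (star es v) [:: d2; d1; d3] := perm_trans Hp (perm3_213 _ _ _).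
have E2 := light_edge Hp2 w2 w1 w3 L2 (L4 _ L1) n34.
have [n12 n13 n23] : [/\ dn d1 != dn d2, dn d1 != dn d3 & dn d2 != dn d3].
  by apply: (distinct3 M Hp); rewrite ?w1 ?w2 ?w3.
have R1 : (dq d3, dn d2, dq d2, 2) \in star es (dn d3) := revd_star E1.
have R2 : (dq d3, dn d1, dq d1, 2) \in star es (dn d3) := revd_star E2.
have R2' : (dq d3, dn d1, dq d1, 2) \in rem (dq d3, dn d2, dq d2, 2) (star es (dn d3)).
  move: R2; rewrite (perm_mem (perm_to_rem R1)) inE => /orP[/eqP E|//].
  have E' : dn d1 = dn d2 := congr1 (@dn V) E.
  by rewrite E' eqxx in n12.
have N2 : (2 <= num 2 (star es (dn d3)))%N.
  have /permP/(_ (fun d => dw d == 2)) := perm_to_rem R1.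
  by rewrite -/(num 2 _) => ->; have := num_gt0 R2' (erefl _); rewrite /= -/(num 2 _); blia.
have {H3} L3 : light (dn d3) by case: H3 => // -[_]; blia.
have Hp3 : perm_eq (star es v) [:: d3; d1; d2].
  by apply: perm_trans Hp _; rewrite perm_sym; exact: perm3_231.
have E3 := light_edge Hp3 w3 w1 w2 L3 (L4 _ L1) (L4 _ L2).
have [vV /andP[z1V z1v] /andP[z2V z2v] /andP[z3V z3v]] := star_in3 M Hp.
pose D := [set dn d2; dn d3].
have z1D : dn d1 \notin D by rewrite !inE negb_or n12.
have vD : v \notin dn d1 |: D by rewrite !inE !negb_or ![v == _]eq_sym z1v z2v.
have c4 : #|v |: (dn d1 |: D)| = 4%N by rewrite cardsU1 vD cardsU1 z1D cards2 n23.
have pV : v |: (dn d1 |: D) \proper V0.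
  by apply: (proper_lt M (v := v)); rewrite ?c4 // !subUset !sub1set vV z1V z2V.
have W2 : (2 <= wsum es D)%N.
  rewrite (wsum2 (mc_wf M)) // (perm_big _ (perm_to_rem E1)) /= big_cons.
  by rewrite [dn _ == _]eqxx leq_addr.
have W1 : (wsum es D + 4 <= wsum es (dn d1 |: D))%N.
  have E2' : (dq d1, dn d3, dq d3, 2) \in rem (dq d1, dn d2, dq d2, 2) (star es (dn d1)).
    move: E2; rewrite (perm_mem (perm_to_rem E3)) inE => /orP[/eqP E|//].
    have E' : dn d3 = dn d2 := congr1 (@dn V) E.
    by rewrite E' eqxx in n23.
  rewrite (wsum_star (mc_wf M)) // leq_add2l (perm_big _ (perm_to_rem E3)) /= big_cons.
  rewrite (perm_big _ (perm_to_rem E2')) /= big_cons !inE [dn _ == _]eqxx /=.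
  rewrite [X in if X then _ else _](_ : _ = true); last by rewrite [dn _ == dn d3]eqxx orbT.
  by rewrite addnA leq_addr.
have := slack_ge6 M pV; rewrite c4 (wsum_starp (mc_wf M) vD Hp) /= w1 w2 w3 !inE !eqxx !orbT; blia.
Qed.

(** The missing 1/2 is two quarters. If less arrives, at most one neighbour gives 1 and the others
    nothing; each combination of the kinds in [nbr_kind] is then excluded by one of the preceding
    lemmas, up to the order of the darts. *)
Lemma X_receives v : isX es v -> (2 <= \sum_(d <- star es v) give (dn d))%N.
Proof.
move=> vX; rewrite leqNgt; apply/negP => lt2.
have /andP[/eqP s3 _] := vX.
case Es : (star es v) s3 => [|d1 [|d2 [|d3 [|? ?]]]] //= _.
have Hp : perm_eq (star es v) [:: d1; d2; d3] by rewrite Es.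
have w3 d : d \in star es v -> dw d = 3 := isX_dw vX.
have [S1 S2 S3] : [/\ d1 \in star es v, d2 \in star es v & d3 \in star es v].
  by rewrite !(perm_mem Hp) !inE !eqxx !orbT.
rewrite Es !big_cons big_nil in lt2.
have kind d : d \in star es v -> (give (dn d) <= 1)%N -> _ :=
  fun dS g1 => nbr_kind (revd_star dS) (w3 d dS) g1.
have [k1 k2 k3] := And3 (kind _ S1 ltac:(blia)) (kind _ S2 ltac:(blia)) (kind _ S3 ltac:(blia)).
have {w3} [w1 w2 w3] := And3 (w3 _ S1) (w3 _ S2) (w3 _ S3).
have P132 := perm_trans Hp (perm3_132 _ _ _).
have P213 := perm_trans Hp (perm3_213 _ _ _).
have P231 := perm_trans Hp (perm3_231 _ _ _).
have P312 := perm_trans P132 (perm3_213 _ _ _).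
have P321 := perm_trans P231 (perm3_213 _ _ _).
have L4 z : light z -> num 4 (star es z) = 0%N.
  move=> /andP[/allP L _]; apply/eqP; rewrite eqn0Ngt /num -has_count.
  by apply/hasPn => d /L; rewrite /=; case: eqP => // ->.
case: k1 => [L1|[Z1 g1]|[f1 t1 g1]]; case: k2 => [L2|[Z2 g2]|[f2 t2 g2]];
  case: k3 => [L3|[Z3 g3]|[f3 t3 g3]]; first
  [ by blia
  | by exact: (two_Z Hp) | by exact: (two_Z P132) | by exact: (two_Z P231)
  | by exact: (light_Z Hp w1 w2 w3 L1 Z2 (L4 _ L3)) | by exact: (light_Z Hp w1 w2 w3 L1 Z2 f3)
  | by exact: (light_Z P132 w1 w3 w2 L1 Z3 (L4 _ L2)) | by exact: (light_Z P132 w1 w3 w2 L1 Z3 f2)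
  | by exact: (light_Z P213 w2 w1 w3 L2 Z1 (L4 _ L3)) | by exact: (light_Z P213 w2 w1 w3 L2 Z1 f3)
  | by exact: (light_Z P231 w2 w3 w1 L2 Z3 f1)
  | by exact: (light_Z P312 w3 w1 w2 L3 Z1 f2) | by exact: (light_Z P321 w3 w2 w1 L3 Z2 f1)
  | by apply: (three_light Hp) => //; left | by apply: (three_light Hp) => //; right
  | by apply: (three_light P132) => //; right | by apply: (three_light P231) => //; right ].
Qed.

Lemma give_X v : isX es v -> give v = 0%N.
Proof.
by move=> /[dup]; rewrite {1}isX_num /give => /and3P[_ _ /eqP ->] /andP[-> _].
Qed.

(** What is given equals what is received, so the charges sum to a nonnegative number: [wsum es V0]
    is at least five times the number of vertices, contrary to slack 3. *)
Lemma no_minimal_counterexample : False.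
Proof.
have [E|/set0Pn[v0 v0V]] := eqVneq V0 set0.
  by apply: (mc_unsat M); rewrite E; exists (fun => (Z0, false)); apply: sat0.
pose F u x (_ : nat) := (give u * isX es x)%N.
have swap := star_swap es F.
have out v : v \notin V0 -> star es v = [::].
  move=> vV; case E: (star es v) => [//|d l]; have dS : d \in star es v by rewrite E mem_head.
  by have [vV'] := mc_starE M dS; rewrite vV' in vV.
have inV (f : V -> dart V -> nat) : (\sum_v \sum_(d <- star es v) f v d =
    \sum_(v in V0) \sum_(d <- star es v) f v d)%N.
  rewrite [RHS]big_mkcond; apply: eq_bigr => v _; case: ifP => // /negbT vV.
  by rewrite out // big_nil.
have lhs : (\sum_(v in V0) give v * numX v = \sum_(v in V0) \sum_(d <- star es v) F v (dn d) (dw d))%N.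
  apply: eq_bigr => v _; rewrite /numX -sum1_count big_distrr /= big_mkcond.
  by apply: eq_bigr => d _; rewrite /F; case: (isX _ _); rewrite ?muln0.
have rhs : (\sum_(v in V0) (if isX es v then \sum_(d <- star es v) give (dn d) else 0) =
    \sum_(v in V0) \sum_(d <- star es v) F (dn d) v (dw d))%N.
  apply: eq_bigr => v _; rewrite /F; case: (isX es v); last by rewrite big1 // => d _; rewrite muln0.
  by apply: eq_bigr => d _; rewrite muln1.
have eqLR : (\sum_(v in V0) give v * numX v =
    \sum_(v in V0) (if isX es v then \sum_(d <- star es v) give (dn d) else 0))%N.
  by rewrite lhs rhs -(inV (fun v d => F v (dn d) (dw d))) -(inV (fun v d => F (dn d) v (dw d))).
have : (\sum_(v in V0) (20 + give v * numX v) <= \sum_(v in V0)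
    (2 * (\sum_(d <- star es v) dw d) +
     (if isX es v then \sum_(d <- star es v) give (dn d) else 0)))%N.
  apply: leq_sum => v vV; case: (boolP (isX es v)) => [vX|nX]; last first.
    by rewrite addn0; apply: give_nonX.
  rewrite (give_X vX) mul0n addn0; have := X_receives vX.
  have [_ ->] := star_num v; have := vX; rewrite isX_num => /and3P[/eqP -> /eqP -> /eqP ->].
  by blia.
have D : (\sum_(v in V0) 2 * (\sum_(d <- star es v) dw d) = 2 * (2 * wsum es V0))%N.
  by rewrite -(sum_V0 M) big_distrr.
rewrite [leqLHS]big_split [leqRHS]big_split /= D eqLR leq_add2r sum_nat_const.
have := p3 M (subxx V0) (_ : V0 != set0); have -> : V0 != set0 by apply/set0Pn; exists v0.
by move=> /(_ isT); blia.
Qed.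

End Local.

(** * Colouring from density *)

Section GoodSat.
Variable V : finType.
Implicit Types (es : seq (edge V)) (B : {set V}) (phi : V -> state).

Definition insideE (V0 : {set V}) es := [seq e <- es | inE_ V0 e].

Lemma wsum_insideE (V0 : {set V}) es B : B \subset V0 -> wsum (insideE V0 es) B = wsum es B.
Proof.
move=> sB; rewrite /wsum big_filter_cond; apply: eq_bigl => e.
case: (boolP (inE_ B e)) => [/andP[h1 h2]|]; rewrite ?andbF // andbT.
by rewrite /inE_ !(subsetP sB).
Qed.

Lemma sat_insideE (V0 : {set V}) es B phi : B \subset V0 ->
  sat (insideE V0 es) B phi = sat es B phi.
Proof.
move=> sB; apply/idP/idP => /allP H; apply/allP => e eS; apply/implyP => eB.
  have eV : inE_ V0 e by case/andP: eB => h1 h2; rewrite /inE_ !(subsetP sB).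
  by have := H e; rewrite mem_filter eV eS eB; apply.
by move: eS; rewrite mem_filter => /andP[_ /H]; rewrite eB.
Qed.

Lemma deg_insideE (V0 : {set V}) es B v : B \subset V0 -> v \in B ->
  deg (insideE V0 es) B v = deg es B v.
Proof.
move=> sB vB; have Hp := permEl (perm_filterC (inE_ V0) es).
have -> : deg es B v = deg ([seq e <- es | inE_ V0 e] ++ [seq e <- es | predC (inE_ V0) e]) B v.
  apply/permP; rewrite /star; apply: perm_map; apply: perm_filter.
  rewrite perm_sym; apply: perm_cat => //; exact: perm_map.
rewrite deg_cat [X in (_ + X)%N](_ : _ = 0%N) ?addn0 //.
apply/eqP; rewrite -leqn0 leqNgt -has_count; apply/hasPn => d.
rewrite mem_star !mem_filter /= inE_rev /inE_ /= => H; apply/negP => dB.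
by move: H; rewrite !(subsetP sB).
Qed.

(** Edges leaving [V0] affect neither goodness nor satisfiability inside [V0]; they are filtered out
    because [mincex] wants all edges inside. *)
Theorem good_sat es (V0 : {set V}) : wf es -> good es V0 -> exists phi, sat es V0 phi.
Proof.
have [n] := ubnP #|V0|; elim: n => // n IH in es V0 *; rewrite ltnS => Hn Hwf Hg.
apply: contrapT => U.
apply: (@no_minimal_counterexample V (insideE V0 es) V0); constructor.
- by apply/allP => e; rewrite mem_filter => /andP[_ /(allP Hwf)].
- by move=> e; rewrite mem_filter => /andP[].
- move=> B sB nB; have [H1 H2] := Hg B sB nB; rewrite wsum_insideE //; split=> // E HD.
  have [|phi Hphi] := H2 E; last by exists phi; rewrite sat_insideE.
  by move=> v vB; rewrite -(deg_insideE es sB vB) HD.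
- by move=> [phi]; rewrite sat_insideE // => Hphi; apply: U; exists phi.
- by move=> es' V1 wf' cV; apply: IH => //; apply: leq_trans Hn.
Qed.

Definition oedge (adj : rel V) (p : V * V) :=
  adj p.1 p.2 && (enum_rank p.1 < enum_rank p.2)%N.

(** An edge of the graph is a path of length 1, so it gets weight 4, at position [Z0] of both ends.
    The hypothesis is slack at least 4, which makes the clause on cycles of slack 3 vacuous. *)
Theorem density_colouring (adj : rel V) : symmetric adj -> irreflexive adj ->
  (forall S : {set V}, S != set0 ->
    (4 * #|[set p | [&& oedge adj p, p.1 \in S & p.2 \in S]]| + 4 <= 5 * #|S|)%N) ->
  exists f : V -> z5, forall u v, adj u v -> okw 4 (f u) (f v).
Proof.
move=> adjC adj0 dens.
pose es : seq (edge V) := [seq (p.1, (Z0, p.2, Z0, 4)) | p <- enum [set p | oedge adj p]].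
have Hwf : wf es.
  apply/allP => e /mapP[p]; rewrite mem_enum inE => /andP[Hp _] ->.
  by rewrite /wfE /= andbT; apply: contraTneq Hp => /= ->; rewrite adj0.
have W B : wsum es B = (4 * #|[set p | [&& oedge adj p, p.1 \in B & p.2 \in B]]|)%N.
  rewrite /wsum big_map big_enum_cond /= -sum1_card big_distrr /=.
  by apply: eq_big => [p|p _]; rewrite ?inE ?muln1.
have [|phi Hphi] := @good_sat es [set: V] Hwf.
  by move=> B _ nB; have := dens B nB; rewrite W; split; lia.
exists (fun v => act (phi v) Z0).
suff H u v : adj u v -> (enum_rank u < enum_rank v)%N -> okw 4 (act (phi u) Z0) (act (phi v) Z0).
  move=> u v uv; have [lt|lt|E] := ltngtP (enum_rank u) (enum_rank v); first exact: H.
    by rewrite okwC; apply: H => //; rewrite adjC.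
  by move: uv; rewrite (enum_rank_inj (ord_inj E)) adj0.
move=> uv lt; have := allP Hphi (u, (Z0, v, Z0, 4)); rewrite /inE_ !inE /=.
by apply; apply/mapP; exists (u, v); rewrite // mem_enum inE /oedge uv.
Qed.

End GoodSat.

From mathcomp Require Import all_order all_algebra.
Import GRing.Theory.

(** * Euler's inequality on a triangulated projective plane *)

Definition incident (W : finType) (u : W) (p : W * W) := (p.1 == u) || (p.2 == u).

Definition even_edges (W : finType) (b : {set W * W}) :=
  forall u, ~~ odd #|[set p in b | incident u p]|.

(** * Even subgraphs contain cycles *)

Section Even.
Variables (W : finType) (adj : rel W).
Hypotheses (adjC : symmetric adj) (adj0 : irreflexive adj).

Lemma oedge_neq (p : W * W) : oedge adj p -> p.1 != p.2.
Proof. by case/andP => h _; apply: contraTneq h => ->; rewrite adj0. Qed.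

Lemma sum_incident (p : W * W) : p.1 != p.2 -> (\sum_u (incident u p : nat) = 2)%N.
Proof.
move=> p12; rewrite (bigD1 p.1) //= (bigD1 p.2) 1?eq_sym //= /incident !eqxx orbT.
by rewrite big1 // => u /andP[h1 h2]; rewrite ![_ == u]eq_sym (negbTE h1) (negbTE h2).
Qed.

Lemma sum_degrees (b : {set W * W}) : {in b, forall p, p.1 != p.2} ->
  (\sum_u #|[set p in b | incident u p]| = 2 * #|b|)%N.
Proof.
move=> Hb; under eq_bigr => u _.
  rewrite -sum1_card (eq_bigl (fun p => (p \in b) && incident u p)); last by move=> p; rewrite inE.
  rewrite big_mkcondr /=; over.
rewrite exchange_big /= -sum1_card big_distrr /=; apply: eq_bigr => p pb.
rewrite muln1 -(sum_incident (Hb p pb)); apply: eq_bigr => u _; by case: (incident _ _).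
Qed.

(** The first vertex of a longest path has a second neighbour by parity, which must lie on the path
    and closes a cycle. Every vertex of the cycle has even nonzero degree in [b], hence at least 2,
    and double counting bounds the length by the size of [b]. *)
Lemma even_cycle (b : {set W * W}) : {subset b <= oedge adj} -> b != set0 ->
  even_edges b -> exists c : seq W, [/\ ucycle adj c, (2 < size c)%N & (size c <= #|b|)%N].
Proof.
move=> sb nb evb; pose r u v := ((u, v) \in b) || ((v, u) \in b).
have rC u v : r u v = r v u by rewrite /r orbC.
have radj u v : r u v -> adj u v.
  by case/orP => /sb /andP[] //=; rewrite adjC.
have r0 u v : r u v -> u != v by move=> /radj; apply: contraTneq => ->; rewrite adj0.
have other x y : r x y -> exists2 z, r x z & z != y.
  move=> rxy; pose p := if (x, y) \in b then (x, y) else (y, x).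
  have pb : p \in b by move: rxy; rewrite /p /r; case: ifP.
  have px : incident x p by rewrite /p /incident; case: ifP; rewrite /= eqxx ?orbT.
  have [p' /andP[p'b p'x] p'p] : exists2 p', (p' \in b) && incident x p' & p' != p.
    have pS : p \in [set p in b | incident x p] by rewrite inE pb.
    have := evb x; rewrite (cardsD1 p) pS add1n /= negbK => Ho.
    have /card_gt0P[p'] : (0 < #|[set p in b | incident x p] :\ p|)%N.
      by case: #|_| Ho.
    by rewrite !inE => /and3P[h1 h2 h3]; exists p'; rewrite ?h2.
  have /andP[_ lp] := sb _ pb; have /andP[_ lp'] := sb _ p'b.
  case/orP: p'x => /eqP Ex; [exists p'.2|exists p'.1].
  - by rewrite /r -{1}Ex -surjective_pairing p'b.
  - apply: contraNneq p'p => Ey; apply/eqP; move: lp lp'; rewrite /p.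
    by case: ifP => _ /=; rewrite [p']surjective_pairing /= Ex Ey // => h1 h2; lia.
  - by rewrite /r -{2}Ex -surjective_pairing p'b orbT.
  - apply: contraNneq p'p => Ey; apply/eqP; move: lp lp'; rewrite /p.
    by case: ifP => _ /=; rewrite [p']surjective_pairing /= Ex Ey // => h1 h2; lia.
have [p0 p0b] : exists p, p \in b by apply/set0Pn.
pose P l := [exists t : l.-tuple W, sorted r t && uniq t].
have P2 : exists l, (2 <= l)%N && P l.
  exists 2; apply/existsP; exists [tuple p0.1; p0.2]; rewrite /= /r -surjective_pairing p0b /=.
  by rewrite inE andbT (oedge_neq (sb _ p0b)).
have Pb l : (2 <= l)%N && P l -> (l <= #|W|)%N.
  by move=> /andP[_ /existsP[t /andP[_ /card_uniqP]]]; rewrite size_tuple => <-; apply: max_card.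
case: (ex_maxnP P2 Pb) => l /andP[l2 /existsP[t /andP[st ut]]] lmax.
have : size t = l by rewrite size_tuple.
case: (tval t) st ut => [|x [|y q]] /= st ut sl; [by rewrite -sl in l2|by rewrite -sl in l2|].
case/andP: st => rxy pq; rename ut into uxq.
have [z rxz zy] := other x y rxy.
have zin : z \in q.
  apply/negPn/negP => zq.
  have : (l.+1 <= l)%N; last by rewrite ltnn.
  apply: lmax; rewrite (leq_trans l2) //=; apply/existsP.
  have sz : size (z :: x :: y :: q) == l.+1 by rewrite /= sl.
  exists (Tuple sz); rewrite /= rC rxz rxy pq /=; move: uxq; rewrite /= !inE !negb_or.
  by rewrite (eq_sym z x) (r0 _ _ rxz) zy zq.
case/splitPr: zin pq uxq {sl} => q1 q2; rewrite -cat_rcons cat_path => /andP[pq1 _].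
pose c := x :: y :: rcons q1 z => uxq.
have uc : uniq c by move: (uxq : uniq (c ++ q2)); rewrite cat_uniq => /andP[].
have cr : cycle r c by rewrite /c /= rcons_path rxy pq1 last_rcons rC rxz.
exists c; split.
- apply/andP; split; last exact: uc.
  by apply: sub_path cr; apply: radj.
- by rewrite /= size_rcons.
have Hb : {in b, forall p, p.1 != p.2} by move=> p /sb; apply: oedge_neq.
have := sum_degrees Hb; rewrite (bigID (mem c)) /=.
have : (\sum_(u in c) 2 <= \sum_(u in c) #|[set p in b | incident u p]|)%N.
  apply: leq_sum => u uc'; have := evb u.
  have : (0 < #|[set p in b | incident u p]|)%N.
    have := next_cycle cr uc'; rewrite /r => /orP[] h; apply/card_gt0P.
      by exists (u, next c u); rewrite inE h /incident eqxx.
    by exists (next c u, u); rewrite inE h /incident eqxx orbT.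
  by case: #|_| => [|[|?]].
rewrite sum_nat_const; have /card_uniqP -> : uniq c by exact: uc.
move=> h1 h2; rewrite -[(_ <= _)%N](leq_pmul2l (isT : 0 < 2)%N) -h2 mulnC.
exact: leq_trans h1 (leq_addr _ _).
Qed.

End Even.

(** * Linear algebra over the field of two elements *)

Section Algebra.
Local Open Scope ring_scope.

Lemma natr_F2 k : (k%:R == 0 :> 'F_2) = ~~ odd k.
Proof. by rewrite -(dvdn_pcharf (pchar_Fp (isT : prime 2))) dvdn2. Qed.

Lemma F2_cases (x : 'F_2) : x = 0 \/ x = 1.
Proof. by case: x => [[|[|m]] Hm] //; [left|right]; apply: val_inj. Qed.

Lemma F2_addxx (x : 'F_2) : x + x = 0.
Proof. by case: (F2_cases x) => ->; apply: val_inj. Qed.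

Lemma F2_eq (x y : 'F_2) : x + y = 0 -> x = y.
Proof. by move=> h; apply: (addIr y); rewrite h F2_addxx. Qed.

(** The rows of the incidence matrix have two ones each, so its rank is below the number of
    vertices; with at least as many edges, a nonzero combination of rows vanishes, and its support
    is even. *)
Lemma exists_even (W : finType) (adj : rel W) : irreflexive adj ->
  (0 < #|W|)%N -> (#|W| <= #|[set p | oedge adj p]|)%N ->
  exists b : {set W * W}, [/\ {subset b <= oedge adj}, b != set0 & even_edges b].
Proof.
move=> adj0 W0; set E := [set p | oedge adj p] => leWE.
pose I : 'M['F_2]_(#|E|, #|W|) := \matrix_(i, j) (incident (enum_val j) (enum_val i))%:R.
have I1 : I *m (const_mx 1 : 'cV_#|W|) = 0.
  apply/matrixP => i j; rewrite !mxE.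
  under eq_bigr => k _ do rewrite !mxE mulr1.

  have := enum_valP i; rewrite inE => /(oedge_neq adj0) Hp.
  rewrite -natr_sum -(big_enum_val (fun u => incident u (enum_val i) : nat)) /=.
  by rewrite (sum_incident Hp); apply: val_inj.
have rk : (\rank I + 1 <= #|W|)%N.
  have := mulmx0_rank_max I1; rewrite [\rank (const_mx _)](_ : _ = 1%N) //.
  apply/eqP; rewrite eqn_leq rank_leq_col lt0n mxrank_eq0; apply/eqP => /matrixP.
  by case: (#|W|) W0 => // k _ /(_ ord0 ord0); rewrite !mxE.
have : kermx I != 0 by rewrite -mxrank_eq0 mxrank_ker subn_eq0 -ltnNge; lia.
case/rowV0Pn => v /sub_kermxP vI v0.
exists [set p in E | [exists i, (enum_val i == p) && (v 0 i != 0)]]; split.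
- by move=> p; rewrite !inE => /andP[].
- have [i vi] : exists i, v 0 i != 0.
    apply/existsP; apply: contraNT v0; rewrite negb_exists => /forallP h.
    by apply/eqP/rowP => i; rewrite mxE; apply/eqP/negPn.
  apply/set0Pn; exists (enum_val i); rewrite inE enum_valP.
  by apply/existsP; exists i; rewrite eqxx.
move=> u; rewrite -natr_F2.
have := congr1 (fun m : 'M_(_, _) => m 0 (enum_rank u)) vI; rewrite !mxE.
move=> H; rewrite -[X in _ == X]H -sum1_card natr_sum big_mkcond /=.
rewrite [X in _ == X](_ : _ = \sum_(p in E) (if (p \in [set p in E | [exists i, (enum_val i == p) && (v 0 i != 0)]]) && incident u p then 1 else 0)); last first.
  rewrite (big_enum_val (fun p => if _ then _ else _)) /=; apply: eq_bigr => i _.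
  rewrite !mxE enum_rankK inE enum_valP /=.
  have -> : [exists k, (enum_val k == enum_val i) && (v 0 k != 0)] = (v 0 i != 0).
    apply/existsP/idP => [[k /andP[/eqP /enum_val_inj -> //]]|h]; by exists i; rewrite eqxx.
  by case: (F2_cases (v 0 i)) => ->; case: (incident _ _); rewrite ?mul0r ?mulr0 ?mulr1.
rewrite [in X in _ == X]big_mkcond /=; apply/eqP/eq_bigr => p _.
rewrite !inE; case: (oedge adj p) => //=.
Qed.

(** A row [x] killed by [DS *m Q] makes [x *m DS] orthogonal to the kernel of [DO], hence a
    combination of rows of [DO]; so the left kernel lies in the span of [P]. *)
Lemma rank_dual (F : fieldType) s o m k p (DS : 'M[F]_(s, m)) (DO : 'M[F]_(o, m))
    (Q : 'M[F]_(m, k)) (P : 'M[F]_(p, s)) :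
  (forall y : 'cV_m, DO *m y = 0 -> exists z : 'cV_k, y = Q *m z) ->
  (forall (x : 'rV_s) (x' : 'rV_o), x *m DS = x' *m DO -> (x <= P)%MS) ->
  (s <= p + \rank (DS *m Q))%N.
Proof.
move=> HQ HP; have : (kermx (DS *m Q) <= P)%MS.
  apply/row_subP => i; set x := row i _.
  have xQ : x *m DS *m Q = 0.
    by rewrite -mulmxA; apply/sub_kermxP; apply: row_sub.
  have /submxP[x' Hx'] : (x *m DS <= DO)%MS; last exact: HP Hx'.
  rewrite submxE; apply/eqP/matrixP => a j; rewrite [RHS]mxE.
  have [|z Hz] := HQ (col j (cokermx DO)); first by rewrite colE mulmxA mulmx_coker mul0mx.
  have : x *m DS *m col j (cokermx DO) = 0 by rewrite Hz mulmxA xQ mul0mx.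
  rewrite colE mulmxA -colE => /matrixP/(_ a 0).
  by rewrite mxE [RHS]mxE.
move/mxrankS; rewrite mxrank_ker => h; have := rank_leq_row P.
by have := rank_leq_row (DS *m Q); lia.
Qed.

(** The nonzero columns add up to zero, so one of them is a combination of the others. *)
Lemma rank_zero_sum (F : fieldType) s k (B : 'M[F]_(s, k)) :
  (forall i, \sum_j B i j = 0) -> (0 < #|[set j | col j B != 0%R]|)%N ->
  (\rank B < #|[set j | col j B != 0%R]|)%N.
Proof.
move=> H0 /card_gt0P[j0]; rewrite inE => nj0; set J := [set j | _].
pose J' := J :\ j0.
have cJ : #|J| = #|J'|.+1 by rewrite (cardsD1 j0) inE nj0.
rewrite cJ ltnS.
pose B' := \matrix_(i < s, l < #|J'|) B i (enum_val l).
pose S : 'M[F]_(#|J'|, k) := \matrix_(l, j) (if j == j0 then - 1 else (enum_val l == j)%:R).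
suff -> : B = B' *m S by apply: leq_trans (mulmx_max_rank _ _) _.
have z i j : j \notin J -> B i j = 0.
  by rewrite inE negbK => /eqP /matrixP/(_ i 0); rewrite !mxE.
have sJ i : \sum_(l < #|J'|) B i (enum_val l) = - B i j0.
  rewrite -(big_enum_val (fun j => B i j)) /=; apply/eqP; rewrite -addr_eq0 addrC.
  have := H0 i; rewrite (bigD1 j0) //= => E0; rewrite -[X in _ == X]E0; apply/eqP.
  congr (_ + _); rewrite [RHS](bigID (mem J)) /= [X in _ + X]big1 ?addr0; last first.
    by move=> j /andP[_ /z].
  by apply: eq_bigl => j; rewrite !inE andbC.
apply/matrixP => i j; rewrite !mxE; case: (eqVneq j j0) => [->|nj].
  under eq_bigr => l _ do rewrite !mxE eqxx mulrN1.
  by rewrite sumrN sJ opprK.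
under eq_bigr => l _ do rewrite !mxE (negbTE nj).
case: (boolP (j \in J')) => jJ.
  rewrite (bigD1 (enum_rank_in jJ j)) //= enum_rankK_in // eqxx mulr1 big1 ?addr0 // => l nl.
  rewrite (negbTE (_ : enum_val l != j)) ?mulr0 //.
  by apply: contraNneq nl => Ej; apply/eqP/enum_val_inj; rewrite enum_rankK_in.
rewrite big1 => [|l _]; first by apply: z; move: jJ; rewrite !inE nj.
by rewrite (negbTE (_ : enum_val l != j)) ?mulr0 //; apply: contraNneq jJ => <-; apply: enum_valP.
Qed.

End Algebra.

Section Duality.
Local Open Scope ring_scope.

Lemma big_enum (T : finType) (V : nmodType) (f : T -> V) :
  \sum_(i < #|T|) f (enum_val i) = \sum_t f t.
Proof. by rewrite [RHS](big_enum_val f). Qed.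

(* [Q] spans the kernel of [DO], and [P] the combinations of rows of [DS] that
   belong to the row space of [DO]. *)
Lemma cycle_rank (X O T K R : finType) (F : fieldType) (S : {set X})
    (DS : X -> T -> F) (DO : O -> T -> F) (Q : T -> K -> F) (P : R -> X -> F)
    (B := fun s k => \sum_t DS s t * Q t k) :
  (forall y : T -> F, (forall o, \sum_t DO o t * y t = 0) ->
     exists z : K -> F, forall t, y t = \sum_k Q t k * z k) ->
  (forall (x : X -> F) (x' : O -> F),
     (forall t, \sum_(s in S) x s * DS s t = \sum_o x' o * DO o t) ->
     exists c : R -> F, forall s, s \in S -> x s = \sum_r c r * P r s) ->
  (forall s, s \in S -> \sum_k B s k = 0) ->
  (#|S| <= #|R| + #|[set k | [exists s in S, B s k != 0%R]]|.-1)%N.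
Proof.
move=> HQ HP H0.
pose mDS := \matrix_(i < #|S|, j < #|T|) DS (enum_val i) (enum_val j).
pose mDO := \matrix_(i < #|O|, j < #|T|) DO (enum_val i) (enum_val j).
pose mQ := \matrix_(i < #|T|, j < #|K|) Q (enum_val i) (enum_val j).
pose mP := \matrix_(i < #|R|, j < #|S|) P (enum_val i) (enum_val j).
have mB i j : (mDS *m mQ) i j = B (enum_val i) (enum_val j).
  rewrite mxE /B -[RHS]big_enum; apply: eq_bigr => l _; by rewrite !mxE.
have HQ' (y : 'cV_#|T|) : mDO *m y = 0 -> exists z, y = mQ *m z.
  move=> Hy; have [o|z Hz] := HQ (fun t => y (enum_rank t) 0).
    have := congr1 (fun A : 'cV_ _ => A (enum_rank o) 0) Hy; rewrite [RHS]mxE mxE => E0.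
    by rewrite -[RHS]E0 -[LHS]big_enum; apply: eq_bigr => l _; rewrite !mxE enum_rankK enum_valK.
  exists (\col_k z (enum_val k)); apply/colP => i; rewrite -[LHS](_ : y (enum_rank (enum_val i)) 0 = _).
    by rewrite Hz -[LHS]big_enum [RHS]mxE; apply: eq_bigr => l _; rewrite !mxE.
  by rewrite enum_valK.
have HP' (x : 'rV_#|S|) (x' : 'rV_#|O|) : x *m mDS = x' *m mDO -> (x <= mP)%MS.
  move=> Hx; case: (posnP #|S|) => [S0|/card_gt0P[s0 s0S]].
    suff -> : x = 0 by apply: sub0mx.
    by apply/rowP => i; case: i => k Hk; exfalso; move: Hk; rewrite S0.
  have [t|c Hc] := HP (fun s => x 0 (enum_rank_in s0S s)) (fun o => x' 0 (enum_rank o)).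
    have := congr1 (fun A : 'rV_ _ => A 0 (enum_rank t)) Hx; rewrite !mxE.
    under eq_bigr => l _ do rewrite !mxE enum_rankK.
    under [RHS]eq_bigr => l _ do rewrite !mxE enum_rankK.
    move=> Hx'; rewrite (big_enum_val (fun s => x 0 (enum_rank_in s0S s) * DS s t)).
    under eq_bigr => l _ do rewrite enum_valK_in.
    by rewrite Hx' -[RHS]big_enum; apply: eq_bigr => l _; rewrite enum_valK.
  apply/submxP; exists (\row_r c (enum_val r)); apply/rowP => i.
  rewrite -[in LHS](enum_valK_in s0S i) Hc ?enum_valP // -[LHS]big_enum [RHS]mxE.
  by apply: eq_bigr => l _; rewrite !mxE.
have rk := rank_dual HQ' HP'; apply: leq_trans rk _; rewrite leq_add2l.
have zs i : \sum_j (mDS *m mQ) i j = 0.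
  by under eq_bigr do rewrite mB; rewrite big_enum H0 ?enum_valP.
have := rank_zero_sum zs; set J := [set j | _]; set J' := [set k | _].
have cJ : #|J| = #|J'|.
  rewrite -(card_imset _ enum_val_inj); apply: eq_card => k; rewrite inE.
  apply/imsetP/existsP => [[j]|[s /andP[sS h]]].
    rewrite inE => /eqP/colP h ->; apply: contrapT => /forallNP h'; apply: h => i.
    rewrite mxE [RHS]mxE mB; apply/eqP; apply: contraPT (h' (enum_val i)) => nz.
    by rewrite enum_valP nz.
  exists (enum_rank k); last by rewrite enum_rankK.
  rewrite inE; apply: contraNneq h => /colP/(_ (enum_rank_in sS s)).
  by rewrite mxE [RHS]mxE mB enum_rankK enum_rankK_in // => ->.
rewrite cJ; case: (posnP #|J'|) => [J0 _|_ /(_ isT)]; last by case: #|J'|.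
rewrite J0 /= leqn0 mxrank_eq0; apply/eqP/matrixP => i j; rewrite [RHS]mxE.
have /eqP : #|J| = 0%N by rewrite cJ.
rewrite cards_eq0 => /eqP/setP/(_ j); rewrite !inE => /negbT; rewrite negbK => /eqP/colP/(_ i).
by rewrite mxE [X in _ = X]mxE.
Qed.

(* The regions are the components of the triangles across the open edges. *)
Lemma even_regions (X I T R : finType) (S : {set X}) (low up : I -> T) (op : pred I)
    (sel : X -> I) (P : R -> X -> 'F_2) :
  {in S &, injective sel} -> {in S, forall s, ~~ op (sel s)} ->
  (forall h : I -> 'F_2,
     (forall i, h i != 0 -> op i \/ exists2 s, s \in S & i = sel s) ->
     (forall t, \sum_(i | low i == t) h i + \sum_(i | up i == t) h i = 0) ->
     exists c : R -> 'F_2, forall s, s \in S -> h (sel s) = \sum_r c r * P r s) ->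
  exists2 region : T -> T, forall i, op i -> region (low i) = region (up i) &
  (#|S| <= #|R| + #|[set k | [exists s in S,
      (region (low (sel s)) == k) (+) (region (up (sel s)) == k)]]|.-1)%N.
Proof.
move=> selI selN HP.
pose r t t' := [exists i, op i && ((low i == t) && (up i == t') || (low i == t') && (up i == t))].
have rC : connect_sym r.
  apply: sym_connect_sym => t t'; apply: eq_existsb => i; by rewrite orbC.
pose reg := fingraph.root r; exists reg => [i oi|].
  apply/eqP; rewrite (root_connect rC); apply: connect1; apply/existsP; exists i.
  by rewrite oi !eqxx.
pose D i t : 'F_2 := (low i == t)%:R + (up i == t)%:R.
have sumD i (y : T -> 'F_2) : \sum_t D i t * y t = y (low i) + y (up i).
  have s1 a : \sum_t (a == t)%:R * y t = y a.
    rewrite (bigD1 a) //= eqxx mul1r big1 ?addr0 // => t; rewrite eq_sym => /negbTE ->.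
    by rewrite mul0r.
  under eq_bigr do rewrite mulrDl.
  by rewrite big_split /= !s1.
pose DS s := D (sel s).
pose DO i t := if op i then D i t else 0.
pose Q t k : 'F_2 := (reg t == k)%:R.
have BE s k : \sum_t DS s t * Q t k = (reg (low (sel s)) == k)%:R + (reg (up (sel s)) == k)%:R.
  exact: (sumD (sel s) (fun t => Q t k)).
apply: leq_trans (@cycle_rank X I T T R _ S DS DO Q P _ _ _) _.
(* The functions on triangles killed by all open edges are those constant on regions. *)
- move=> y Hy; have yc t t' : connect r t t' -> y t = y t'.
    case/connectP => p; elim: p t => [|a p IH] t /=; first by move=> _ ->.
    case/andP => /existsP[i /andP[oi h]] pa e; rewrite -(IH a pa e).
    have := Hy i; under eq_bigr => l _ do rewrite /DO oi.
    by rewrite sumD => /F2_eq; case/orP: h => /andP[/eqP -> /eqP ->].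
  exists y => t; rewrite (bigD1 (reg t)) //= /Q eqxx mul1r big1.
    by rewrite addr0; apply: yc; apply: connect_root.
  by move=> k; rewrite eq_sym => /negbTE ->; rewrite mul0r.
(* The coefficients on selected and on open edges are joined into one function on all edges, which
   is closed because the two sides of [Hx] cancel over this field. *)
- move=> x x' Hx; pose h i := \sum_(s in S | sel s == i) x s + (if op i then x' i else 0).
  have hsel s : s \in S -> h (sel s) = x s.
    move=> sS; rewrite /h (negbTE (selN _ sS)) addr0 (big_pred1 s) // => s' /=.
    apply/andP/eqP => [[s'S /eqP]|->]; last by rewrite sS eqxx.
    exact: selI.
  have [i|t|c Hc] := HP h.
  + rewrite /h; case: ifP => [|_]; [by left|rewrite addr0 => nz; right].
    apply: contrapT => nex; case/negP: nz; apply/eqP; apply: big1 => s /andP[sS /eqP Es].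
    by case: nex; exists s.
  + rewrite -[LHS](_ : \sum_i h i * D i t = _).
      rewrite /h; under eq_bigr do rewrite mulrDl.
      rewrite big_split /= -[X in _ + X](_ : \sum_(s in S) x s * DS s t = _); last first.
        by rewrite Hx; apply: eq_bigr => i _; rewrite /DO; case: ifP; rewrite ?mul0r ?mulr0.
      rewrite [X in X + _](_ : _ = \sum_(s in S) x s * DS s t) ?F2_addxx //.
      under eq_bigr do rewrite mulr_suml.
      rewrite (exchange_big_dep (mem S)) /=; last by move=> ? ? _ /andP[].
      apply: eq_bigr => s sS; rewrite (big_pred1 (sel s)) // => i /=.
      by rewrite sS eq_sym.
    rewrite /D; under eq_bigr do rewrite mulrDr.
    rewrite big_split /=; congr (_ + _).
      by rewrite [RHS]big_mkcond; apply: eq_bigr => i _; case: eqP; rewrite ?mulr1 ?mulr0.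
    by rewrite [RHS]big_mkcond; apply: eq_bigr => i _; case: eqP; rewrite ?mulr1 ?mulr0.
  by exists c => s sS; rewrite -hsel // Hc.
- move=> s sS; under eq_bigr do rewrite BE.
  have s1 a : \sum_(k : T) (a == k)%:R = 1 :> 'F_2.
    rewrite (bigD1 a) //= eqxx big1 ?addr0 // => t; by rewrite eq_sym => /negbTE ->.
  by rewrite big_split /= !s1 F2_addxx.
rewrite leq_add2l.
rewrite (_ : [set k | _] = [set k | [exists s in S, (reg (low (sel s)) == k) (+) (reg (up (sel s)) == k)]]) //.
apply/setP => k; rewrite !inE; apply: eq_existsb => s; rewrite BE; congr (_ && _).
by case: (reg _ == k); case: (reg _ == k).
Qed.

End Duality.

(* The square [0, n] x [0, n] of lattice points, opposite boundary points being
   identified, is a triangulated projective plane: the cell (i, j) is cut by the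
   diagonal from (i, j) to (i+1, j+1). An edge is a cell together with [None]
   for its diagonal, [Some false] for its bottom side and [Some true] for its
   right side; the bottom and right sides of all cells represent every edge once. *)
Section Grid.
Variable m : nat.
Local Notation n := m.+1.

Definition cell : finType := ('I_n * 'I_n)%type.
Definition gedge : finType := (cell * option bool)%type.
Definition triangle : finType := (cell * bool)%type.

Definition end1 (e : gedge) : nat * nat :=
  if e.2 == Some true then (e.1.1.+1, e.1.2 : nat) else (e.1.1 : nat, e.1.2 : nat).
Definition end2 (e : gedge) : nat * nat :=
  if e.2 == Some false then (e.1.1.+1, e.1.2 : nat) else (e.1.1.+1, e.1.2.+1).

(** Leaving the square through a side re-enters it at the opposite side with the order along that
    side reversed; this is the antipodal identification on cells. *)
Definition above (c : cell) : cell :=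
  (if c.2 == m :> nat then rev_ord c.1 else c.1, ordS c.2).
Definition below (c : cell) : cell :=
  (if c.2 == 0 :> nat then rev_ord c.1 else c.1, ord_pred c.2).
Definition leftof (c : cell) : cell :=
  (ord_pred c.1, if c.1 == 0 :> nat then rev_ord c.2 else c.2).
Definition rightof (c : cell) : cell :=
  (ordS c.1, if c.1 == m :> nat then rev_ord c.2 else c.2).

(** The lower triangle of a cell has the diagonal, the bottom and the right side; the upper one has
    the diagonal, the top and the left side, which belong to other cells. So every edge lies on one
    lower and one upper triangle. *)
Definition lower (e : gedge) : triangle := (e.1, false).
Definition upper (e : gedge) : triangle :=
  (match e.2 with None => e.1 | Some false => below e.1 | Some true => rightof e.1 end, true).

Lemma ordS0 (i : 'I_n) : (ordS i == 0 :> nat) = (i == m :> nat).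
Proof.
rewrite /=; have := ltn_ord i; rewrite ltnS leq_eqVlt => /orP[/eqP->|h].
  by rewrite modnn !eqxx.
by rewrite modn_small // (ltn_eqF h).
Qed.

Lemma ord_predm (i : 'I_n) : (ord_pred i == m :> nat) = (i == 0 :> nat).
Proof. by rewrite -ordS0 ord_predK. Qed.

Lemma val_ord_pred (i : 'I_n) : ord_pred i = (if i == 0 :> nat then m else i.-1) :> nat.
Proof.
case: eqP => [i0|/eqP i0]; first by rewrite /= i0 modn_small.
have -> : nat_of_ord (ord_pred i) = (i.-1 + n) %% n by rewrite /=; congr (_ %% _); lia.
by rewrite modnDr modn_small // (leq_ltn_trans (leq_pred _)).
Qed.

Lemma belowK : cancel below above.
Proof.
move=> [i j]; have := ord_predm j; rewrite /above /= ord_predK => ->.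
by case: eqP => _; rewrite ?rev_ordK.
Qed.

Lemma aboveK : cancel above below.
Proof.
move=> [i j]; have := ordS0 j; rewrite /below /= ordSK => ->.
by case: eqP => _; rewrite ?rev_ordK.
Qed.

Lemma leftofK : cancel leftof rightof.
Proof.
move=> [i j]; have := ord_predm i; rewrite /rightof /= ord_predK => ->.
by case: eqP => _; rewrite ?rev_ordK.
Qed.

Lemma rightofK : cancel rightof leftof.
Proof.
move=> [i j]; have := ordS0 i; rewrite /leftof /= ordSK => ->.
by case: eqP => _; rewrite ?rev_ordK.
Qed.

Local Open Scope ring_scope.

(** A cocycle: the values on the sides of each triangle add up to zero. One of the two sums is
    empty, depending on whether [t] is a lower or an upper triangle. *)
Definition closed_cochain (h : gedge -> 'F_2) := forall t,
  \sum_(e | lower e == t) h e + \sum_(e | upper e == t) h e = 0.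

Lemma sum_lower h c : \sum_(e | lower e == (c, false)) h e =
  h (c, None) + (h (c, Some false) + h (c, Some true)) :> 'F_2.
Proof.
rewrite (eq_bigl (fun e => e \in [:: (c, None); (c, Some false); (c, Some true)])); last first.
  by case=> [c' [[]|]]; rewrite !inE /lower !xpair_eqE /= ?andbT ?andbF ?orbF.
by rewrite -big_uniq /= ?big_cons ?big_nil ?addr0 // !inE !xpair_eqE /= !andbF.
Qed.

Lemma sum_upper h c : \sum_(e | upper e == (c, true)) h e =
  h (c, None) + (h (above c, Some false) + h (leftof c, Some true)) :> 'F_2.
Proof.
rewrite (eq_bigl (fun e => e \in [:: (c, None); (above c, Some false); (leftof c, Some true)])); last first.
  by case=> [c' [[]|]]; rewrite !inE /upper !xpair_eqE /= ?andbT ?andbF ?orbF //;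
    rewrite ?(can2_eq rightofK leftofK) ?(can2_eq belowK aboveK).
by rewrite -big_uniq /= ?big_cons ?big_nil ?addr0 // !inE !xpair_eqE /= !andbF.
Qed.

Lemma closed_cochainP h : closed_cochain h <-> forall c,
  h (c, None) + (h (c, Some false) + h (c, Some true)) = 0 /\
  h (c, None) + (h (above c, Some false) + h (leftof c, Some true)) = 0.
Proof.
have lu c : \sum_(e | lower e == (c, true)) h e = 0.
  by rewrite big_pred0 // => e; rewrite /lower xpair_eqE andbF.
have ul c : \sum_(e | upper e == (c, false)) h e = 0.
  by rewrite big_pred0 // => e; rewrite /upper xpair_eqE andbF.
split=> [H c|H [c []]].
- by have := H (c, false); have := H (c, true); rewrite sum_lower sum_upper lu ul addr0 add0r.
- by rewrite sum_upper lu add0r; case: (H c).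
- by rewrite sum_lower ul addr0; case: (H c).
Qed.

(** * Integrating closed cochains on the grid *)

Section Potential.
Variable h : gedge -> 'F_2.
Hypothesis Hh : closed_cochain h.

Definition hval k (i j : nat) := h ((inord i, inord j), k).
(** The top and left sides of the square are not represented as edges; they are read off at the
    antipodal bottom and right sides, in reversed order. *)
Definition hor i j := if j == n then hval (Some false) (m - i) 0 else hval (Some false) i j.
Definition ver i j := if i == 0%N then hval (Some true) m (m - j) else hval (Some true) i.-1 j.
(* [h] is integrated along the bottom side and then upwards. The result respects
   the identification of antipodes up to the constant [pot n n], the value of [h]
   on an essential cycle. *)
Definition pot i j := \sum_(0 <= k < i) hor k 0 + \sum_(0 <= k < j) ver i k.

Lemma hval_ord k (i j : 'I_n) : hval k i j = h ((i, j), k).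
Proof. by rewrite /hval !inord_val. Qed.

Lemma lower_cell i j : (i < n)%N -> (j < n)%N -> hval None i j + (hor i j + ver i.+1 j) = 0.
Proof.
by move=> i_n j_n; rewrite /hor ltn_eqF // /ver /=; have [+ _] := (closed_cochainP h).1 Hh (inord i, inord j).
Qed.

Lemma upper_cell i j : (i < n)%N -> (j < n)%N -> hval None i j + (hor i j.+1 + ver i j) = 0.
Proof.
move=> i_n j_n; have [_ <-] := (closed_cochainP h).1 Hh (inord i, inord j).
congr (_ + (_ + _)).
- rewrite /hor /hval eqSS /above /= inordK //.
  by case: eqP => e; congr (h (_, _, _)); apply: val_inj; rewrite /= !inordK // ?e ?modnn ?modn_small //; lia.
- rewrite /ver /hval /leftof /= inordK //.
  have := val_ord_pred (inord i); rewrite !inordK //.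
  move: (ord_pred _) => k; case: eqP => e Ek; congr (h (_, _, _)); apply: val_inj.
  - by rewrite /= Ek inordK.
  - by rewrite /= !inordK //; lia.
  - by rewrite /= Ek inordK //; lia.
Qed.

Lemma potSr i j : pot i j.+1 = pot i j + ver i j.
Proof. by rewrite /pot big_nat_recr //= addrA. Qed.

Lemma F2_add4 (a b c d e : 'F_2) : a + (b + c) = 0 -> a + (d + e) = 0 -> b + c = d + e.
Proof. by move=> /F2_eq <- /F2_eq. Qed.

(** Independence of the path, by induction on the height: the two triangles of a cell share the
    diagonal, so going right then up equals going up then right. *)
Lemma potSl i j : (i < n)%N -> (j <= n)%N -> pot i.+1 j = pot i j + hor i j.
Proof.
move=> i_n; elim: j => [_|j IH j_n].
  by rewrite /pot !(big_geq (leqnn 0)) big_nat_recr //= !addr0.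
rewrite !potSr IH 1?ltnW //.
move: (pot i j) (F2_add4 (lower_cell i_n j_n) (upper_cell i_n j_n)) => a E.
by rewrite -!addrA E [hor i j.+1 + _]addrC.
Qed.

Lemma pot_end (e : gedge) : pot (end1 e).1 (end1 e).2 + pot (end2 e).1 (end2 e).2 = h e.
Proof.
have cancel2 (a b : 'F_2) : a + (a + b) = b by rewrite addrA F2_addxx add0r.
case: e => [[i j] [[]|]]; rewrite -hval_ord /=.
- by rewrite potSr cancel2.
- by rewrite potSl ?(ltnW (ltn_ord j)) // cancel2 /hor ltn_eqF.
rewrite potSr potSl ?(ltnW (ltn_ord j)) //; move: (pot i j) => a; rewrite -addrA cancel2.
by apply: esym; apply: F2_eq; apply: lower_cell.
Qed.

Lemma hor_antipode i : (i < n)%N -> hor (m - i) n = hor i 0.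
Proof. by move=> i_n; rewrite /hor eqxx subKn. Qed.

Lemma ver_antipode j : (j < n)%N -> ver n (m - j) = ver 0 j.
Proof. by []. Qed.

(** Antipodal boundary edges carry the same value, so the difference of the potentials at antipodes
    is constant along the boundary; at the origin it is [pot h n n]. *)
Lemma pot_antipode i j : (i <= n)%N -> (j <= n)%N -> [|| i == 0, i == n, j == 0 | j == n]%N ->
  pot (n - i) (n - j) = pot i j + pot n n.
Proof.
move=> i_n j_n; move Ec: (pot n n) => c.
have shift (p x y : 'F_2) : p + x = y + c -> p = y + x + c.
  by move=> E; apply: (addIr x); rewrite E [RHS]addrAC -(addrA y) F2_addxx addr0.
have h0 k : (k <= n)%N -> pot (n - k) n = pot k 0 + c.
  elim: k => [_|k IH k_n]; first by rewrite subn0 Ec [in RHS]/pot !(big_geq (leqnn 0)) !add0r.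
  have E : (n - k)%N = (m - k).+1 by lia.
  have := IH (ltnW k_n); rewrite E potSl; try lia.
  by rewrite hor_antipode // subSS [pot k.+1 0]potSl //; apply: shift.
have v0 k : (k <= n)%N -> pot n (n - k) = pot 0 k + c.
  elim: k => [_|k IH k_n]; first by rewrite subn0 Ec [in RHS]/pot !(big_geq (leqnn 0)) !add0r.
  have E : (n - k)%N = (m - k).+1 by lia.
  have := IH (ltnW k_n); rewrite E potSr; try lia.
  by rewrite ver_antipode // subSS [pot 0 k.+1]potSr //; apply: shift.
have flip (a b : 'F_2) : a = b + c -> b = a + c by move=> ->; rewrite -addrA F2_addxx addr0.
case/or4P => /eqP E; rewrite {}E ?subn0 ?subnn.
- exact: v0.
- by apply: flip; rewrite -v0 ?leq_subr // subKn.
- exact: h0.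
- by apply: flip; rewrite -h0 ?leq_subr // subKn.
Qed.

End Potential.
End Grid.

(** * The density bound for a graph carried by a labelled grid *)

Section GridGraph.
Variables (W : finType) (adj : rel W) (m : nat) (lam : nat -> nat -> option W).
Local Notation n := m.+1.
Hypotheses (adjC : symmetric adj) (adj0 : irreflexive adj).
Hypothesis girth10 : forall c : seq W, ucycle adj c -> (2 < size c)%N -> (10 <= size c)%N.
Local Notation boundary i j := [|| i == 0, i == n, j == 0 | j == n]%N.
Hypothesis lam_antipode : forall i j, (i <= n)%N -> (j <= n)%N -> boundary i j ->
  lam (n - i) (n - j) = lam i j.
Local Notation lab q := (lam q.1 q.2).
(** Connectedness of the class of [u] in the identified grid, tested on boolean functions: one that
    is constant along edges inside the class and at antipodes is constant on the class. This avoids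
    paths across the identification. *)
Hypothesis lam_connected : forall u (g : nat -> nat -> bool),
  (forall e : gedge m, lab (end1 e) = Some u -> lab (end2 e) = Some u ->
     g (end1 e).1 (end1 e).2 = g (end2 e).1 (end2 e).2) ->
  (forall i j, (i <= n)%N -> (j <= n)%N -> boundary i j -> lam i j = Some u ->
     g (n - i)%N (n - j)%N = g i j) ->
  forall i j i' j', (i <= n)%N -> (j <= n)%N -> (i' <= n)%N -> (j' <= n)%N ->
    lam i j = Some u -> lam i' j' = Some u -> g i j = g i' j'.
Hypothesis lam_edge : forall p, oedge adj p -> exists e : gedge m,
  lab (end1 e) = Some p.1 /\ lab (end2 e) = Some p.2 \/
  lab (end1 e) = Some p.2 /\ lab (end2 e) = Some p.1.

Local Notation S := [set p | oedge adj p].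
Local Open Scope ring_scope.

Lemma F2_neq0 (x y : 'F_2) : (x != 0) = (y != 0) -> x = y.
Proof. by case: (F2_cases x) => ->; case: (F2_cases y) => ->. Qed.

Lemma sum_F2_incident (f : W -> 'F_2) p : p.1 != p.2 ->
  \sum_u f u * (incident u p)%:R = f p.1 + f p.2.
Proof.
move=> p12; rewrite (bigD1 p.1) //= (bigD1 p.2) 1?eq_sym //= /incident !eqxx orbT !mulr1.
rewrite big1 ?addr0 // => u /andP[h1 h2].
by rewrite ![_ == u]eq_sym (negbTE h1) (negbTE h2) mulr0.
Qed.

Lemma hor_add (h h' : gedge m -> 'F_2) i j : hor (fun e => h e + h' e) i j = hor h i j + hor h' i j.
Proof. by rewrite /hor; case: ifP. Qed.

Lemma ver_add (h h' : gedge m -> 'F_2) i j : ver (fun e => h e + h' e) i j = ver h i j + ver h' i j.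
Proof. by rewrite /ver; case: ifP. Qed.

Lemma pot_add (h h' : gedge m -> 'F_2) i j : pot (fun e => h e + h' e) i j = pot h i j + pot h' i j.
Proof.
rewrite /pot; under eq_bigr do rewrite hor_add.
under [X in _ + X = _]eq_bigr do rewrite ver_add.
by rewrite !big_split /= addrACA.
Qed.

Lemma pot0 i j : pot (fun _ : gedge m => 0) i j = 0 :> 'F_2.
Proof. by rewrite /pot !big1 ?addr0 // => k _; rewrite /hor /ver /hval if_same. Qed.

Lemma closed_cochain_add (h h' : gedge m -> 'F_2) :
  closed_cochain h -> closed_cochain h' -> closed_cochain (fun e => h e + h' e).
Proof. by move=> H H' t; rewrite !big_split /= addrACA H H' addr0. Qed.

Definition inner (e : gedge m) := (lab (end1 e) == lab (end2 e)) && (lab (end1 e) != None).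

(** The potential does not change along inner edges and, as [pot h n n = 0], agrees at antipodes; so
    it is constant on every connected class, and [f] is its value there. *)
Lemma closed_inner h : closed_cochain h -> (forall e, inner e -> h e = 0) -> pot h n n = 0 ->
  exists f : W -> 'F_2, forall e u v, lab (end1 e) = Some u -> lab (end2 e) = Some v ->
    h e = f u + f v.
Proof.
move=> Hh Hi K0.
pose f u := if [pick p : 'I_n.+1 * 'I_n.+1 | lam p.1 p.2 == Some u] is Some p then pot h p.1 p.2 else 0.
have fE u i j : (i <= n)%N -> (j <= n)%N -> lam i j = Some u -> pot h i j = f u.
  move=> i_n j_n Eu; rewrite /f; case: pickP => [[i' j'] /= /eqP Eu'|/(_ (inord i, inord j))].
    apply: F2_neq0; apply: (@lam_connected u (fun i j => pot h i j != 0)) => //.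
    - move=> e e1 e2; congr (_ != _); apply: F2_eq.
      by rewrite pot_end // Hi // /inner e1 e2 !eqxx.
    - by move=> a b an bn ab _; rewrite pot_antipode // K0 addr0.
    - by rewrite -ltnS.
    - by rewrite -ltnS.
  by rewrite /= !inordK // Eu eqxx.
have end_le (e : gedge m) : [&& (end1 e).1 <= n, (end1 e).2 <= n, (end2 e).1 <= n & (end2 e).2 <= n]%N.
  case: e => [[i j] k]; have := ltn_ord i; have := ltn_ord j; rewrite /end1 /end2 /=.
  by case: ifP => _ /=; case: ifP => _ /=; lia.
exists f => e u v Eu Ev; have /and4P[h1 h2 h3 h4] := end_le e.
by rewrite -(pot_end Hh) (fE u) // (fE v).
Qed.

(** The coboundary of the indicator function of a class. Cells on the border need the invariance of
    labels under antipodes. *)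
Lemma closed_label u : closed_cochain (fun e : gedge m =>
  (lab (end1 e) == Some u)%:R + (lab (end2 e) == Some u)%:R).
Proof.
pose L i j : 'F_2 := (lam i j == Some u)%:R.
have tri (a b c : 'F_2) : (a + b) + ((a + c) + (c + b)) = 0.
  by case: (F2_cases a) => ->; case: (F2_cases b) => ->; case: (F2_cases c) => ->; apply: val_inj.
apply/closed_cochainP => -[i j]; split; first exact: (tri (L i j) (L i.+1 j.+1) (L i.+1 j)).
have Ea : (lab (end1 (above (i, j), Some false)) == Some u)%:R +
    (lab (end2 (above (i, j), Some false)) == Some u)%:R = L i j.+1 + L i.+1 j.+1 :> 'F_2.
  rewrite /above /=; case: (eqVneq (j : nat) m) => [Ej|nj] /=.
    have E1 : lam (n - i.+1) 0 = lam i.+1 n.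
      by rewrite -(@lam_antipode i.+1 n) ?eqxx ?orbT ?subnn.
    have E2 : lam (n - i.+1).+1 0 = lam i n.
      by rewrite -(@lam_antipode i n) ?eqxx ?orbT ?subnn ?subnSK // ltnW.
    by rewrite Ej modnn E1 E2 addrC.
  have jm : (j.+1 < n)%N by have := ltn_ord j; rewrite ltnS leq_eqVlt (negbTE nj).
  by rewrite modn_small.
have El : (lab (end1 (leftof (i, j), Some true)) == Some u)%:R +
    (lab (end2 (leftof (i, j), Some true)) == Some u)%:R = L i j + L i j.+1 :> 'F_2.
  have := val_ord_pred i; rewrite /end1 /end2 /= => ->; case: (eqVneq (i : nat) 0%N) => [Ei|ni] /=.
    have E1 : lam n (n - j.+1) = lam 0 j.+1.
      by rewrite -(@lam_antipode 0 j.+1) ?eqxx ?orbT ?subn0.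
    have E2 : lam n (n - j.+1).+1 = lam 0 j.
      by rewrite -(@lam_antipode 0 j) ?eqxx ?orbT ?subn0 ?subnSK // ltnW.
    by rewrite E1 E2 addrC /L Ei.
  by rewrite prednK // lt0n.
rewrite Ea El /=; have := tri (L i j) (L i.+1 j.+1) (L i j.+1).
by rewrite [L i j.+1 + _ + _]addrC.
Qed.

(** One grid edge is selected for each graph edge, and regions are formed by crossing all grid edges
    that are neither selected nor inside a class. The boundary of a region is an even subgraph, so
    girth applies, and [even_regions] supplies Euler's inequality. *)
Lemma grid_density : (0 < #|W|)%N -> (4 * #|S| + 5 <= 5 * #|W|)%N.
Proof.
move=> W0; case: (ltnP #|S| #|W|) => [|leWS]; first by lia.
have W10 : (10 <= #|W|)%N.
  have [b [sb b0 eb]] := exists_even adj0 W0 leWS.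
  have [c [cc c2 _]] := even_cycle adjC adj0 sb b0 eb.
  by apply: leq_trans (girth10 cc c2) _; case/andP: cc => _ /card_uniqP <-; apply: max_card.
have /boolp.choice[sel Hsel] p : exists e : gedge m, oedge adj p ->
    lab (end1 e) = Some p.1 /\ lab (end2 e) = Some p.2 \/
    lab (end1 e) = Some p.2 /\ lab (end2 e) = Some p.1.
  case: (boolP (oedge adj p)) => [/lam_edge[e He]|np]; first by exists e.
  by exists ((ord0, ord0), None).
have selI : {in S &, injective sel}.
  move=> p q; rewrite !inE => Hp Hq E; have := Hsel p Hp; rewrite E.
  move: Hp Hq (Hsel q Hq) => /andP[_ l1] /andP[_ l2]; case: p q l1 l2 {E} => [a b] [a' b'] /= l1 l2.
  case=> [] [-> ->] [] [[Ea] [Eb]]; subst=> //; by move: (ltn_trans l1 l2); rewrite ltnn.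
have sel_inner p : oedge adj p -> ~~ inner (sel p).
  move=> Hp; have np := oedge_neq adj0 Hp; rewrite /inner; apply/nandP; left.
  case: (Hsel p Hp) => [] [-> ->]; apply: contraNneq np => -[->] //.
pose op e := ~~ inner e && (e \notin sel @: S).
have selN : {in S, forall s, ~~ op (sel s)}.
  by move=> s sS; rewrite /op negb_and (imset_f sel sS) orbT.
pose good h := closed_cochain h /\ forall e, h e != 0 -> op e \/ exists2 s, s \in S & e = sel s.
have goodI h : good h -> forall e, inner e -> h e = 0.
  move=> [_ H] e ie; apply/eqP; apply: contraTT ie => /H[/andP[] //|[s]].
  by rewrite inE => sS ->; apply: sel_inner.
have [u0 _] : exists u0 : W, u0 \in W by apply/card_gt0P.
(* A single bit, [pot h n n], keeps a good cochain from being a coboundary. One fixed cochain on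
   which the bit is 1, if there is any, corrects all others. *)
have [hs [ghs Hhs]] : exists hs, good hs /\ forall h, good h ->
    exists k, pot (fun e => h e + k * hs e) n n = 0.
  case: (pselect (exists2 h, good h & pot h n n = 1)) => [[hs ghs E1]|none].
    exists hs; split=> // h gh; exists (pot h n n); rewrite pot_add.
    case: (F2_cases (pot h n n)) => -> /=.
      rewrite add0r -[RHS](pot0 n n); congr (pot _ n n); apply/funext => e; exact: mul0r.
    have -> : pot (fun e => 1 * hs e) n n = 1.
      by rewrite -[RHS]E1; congr (pot _ n n); apply/funext => e; exact: mul1r.
    exact: F2_addxx.
  exists (fun=> 0); split.
    split=> [t|e]; last by rewrite eqxx.
    by rewrite !big1 ?addr0.
  move=> h gh; exists 0; case: (F2_cases (pot h n n)) => [E0|E1]; last by case: none; exists h.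
  by rewrite -[RHS]E0; congr (pot _ n n); apply/funext => e; rewrite mul0r addr0.
(* The stars of all vertices add up to zero, so that of [u0] is redundant and its place is given to
   [hs]. The number of rows is thus the number of vertices; without an essential cycle it would be
   one less. *)
pose P u s : 'F_2 := if u == u0 then hs (sel s) else (incident u s)%:R.
have [h Hsupp Hcl|region Hop] := even_regions (low := @lower m) (up := @upper m) (P := P) selI selN.
  have gh : good h by [].
  have [k Hk] := Hhs h gh.
  have gk : good (fun e => h e + k * hs e).
    case: (F2_cases k) => -> .
      rewrite (_ : (fun e => _) = h) //; apply/funext => e; by rewrite mul0r addr0.
    split; first by apply: closed_cochain_add => // t; under eq_bigr do rewrite mul1r;
      under [X in _ + X]eq_bigr do rewrite mul1r; apply: ghs.1.
    move=> e; rewrite mul1r; case: (eqVneq (h e) 0) => [->|/Hsupp //].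
    by rewrite add0r; apply: ghs.2.
  have [f Hf] := closed_inner gk.1 (goodI _ gk) Hk.
  exists (fun u => if u == u0 then k else f u + f u0) => s; rewrite inE => sS.
  have s12 := oedge_neq adj0 sS.
  rewrite (bigD1 u0) //= /P eqxx.
  have -> : \sum_(u | u != u0) (if u == u0 then k else f u + f u0) *
      (if u == u0 then hs (sel s) else (incident u s)%:R) = f s.1 + f s.2.
    rewrite [LHS](_ : _ = \sum_u (f u + f u0) * (incident u s)%:R).
      by rewrite sum_F2_incident // addrACA F2_addxx addr0.
    rewrite [RHS](bigD1 u0) //= F2_addxx mul0r add0r; apply: eq_bigr => u /negbTE -> //.
  have Es : h (sel s) + k * hs (sel s) = f s.1 + f s.2.
    case: (Hsel s sS) => [] [E1 E2]; first by rewrite (Hf _ _ _ E1 E2).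
    by rewrite (Hf _ _ _ E1 E2) addrC.
  by rewrite -Es addrCA F2_addxx addr0.
pose b k := [set s in S | (region (lower (sel s)) == k) (+) (region (upper (sel s)) == k)].
have sb k : {subset b k <= oedge adj} by move=> s; rewrite !inE => /andP[].
(* The coboundary of the class of [u] pairs to zero with the boundary of a region. Inner edges have
   coboundary zero and open edges are not on the boundary, so only the selected edges incident to
   [u] are counted. *)
have eb k : even_edges (b k).
  move=> u; rewrite -natr_F2; pose inc (e : gedge m) : 'F_2 := (lab (end1 e) == Some u)%:R + (lab (end2 e) == Some u)%:R.
  pose r t : 'F_2 := (region t == k)%:R.
  have tot : \sum_e inc e * (r (lower e) + r (upper e)) = 0.
    transitivity (\sum_t r t * (\sum_(e | lower e == t) inc e + \sum_(e | upper e == t) inc e)); last first.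
      by rewrite big1 // => t _; rewrite (closed_label u t) mulr0.
    under eq_bigr do rewrite mulrDr; under [RHS]eq_bigr do rewrite mulrDr.
    rewrite !big_split /=; congr (_ + _).
      rewrite (partition_big (@lower m) predT) //=; apply: eq_bigr => t _; rewrite mulr_sumr.
      by apply: eq_bigr => e /eqP ->; rewrite mulrC.
    rewrite (partition_big (@upper m) predT) //=; apply: eq_bigr => t _; rewrite mulr_sumr.
    by apply: eq_bigr => e /eqP ->; rewrite mulrC.
  have z e : e \notin sel @: S -> inc e * (r (lower e) + r (upper e)) = 0.
    move=> ne; case: (boolP (inner e)) => [/andP[/eqP Ee _]|ni].
      by rewrite /inc Ee F2_addxx mul0r.
    by rewrite /r Hop ?F2_addxx ?mulr0 // /op ni ne.
  rewrite (bigID (mem (sel @: S))) /= [X in _ + X]big1 ?addr0 in tot; last exact: z.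
  rewrite big_imset //= in tot.
  rewrite -[X in _ == X]tot -sum1_card natr_sum big_mkcond /= [X in _ == X]big_mkcond /=.
  apply/eqP/eq_bigr => s _; rewrite !inE; case: (boolP (oedge adj s)) => //= sS.
  have -> : inc (sel s) = (incident u s)%:R.
    have s12 := oedge_neq adj0 sS.
    rewrite /inc /incident; case: (Hsel s sS) => [] [-> ->]; rewrite !(inj_eq Some_inj);
      case: (eqVneq s.1 u) => [E|_]; case: (eqVneq s.2 u) => [E'|_] //=; by rewrite ?addr0 ?add0r // E E' eqxx in s12 *.
  rewrite /r; case: (region _ == k); case: (region _ == k); case: (incident u s) => //=;
    by rewrite ?mul0r ?mulr0 ?mul1r ?addr0 ?add0r ?F2_addxx.
set J := [set k : triangle m | _] => Hle.
have bJ k : k \in J -> (10 <= #|b k|)%N.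
  rewrite inE => /existsP[s /andP[sS h]].
  have nb : b k != set0 by apply/set0Pn; exists s; rewrite inE sS.
  have [c [cc c2 cb]] := even_cycle adjC adj0 (sb k) nb (eb k).
  exact: leq_trans (girth10 cc c2) cb.
have J1 : (#|J| * 10 <= 2 * #|S|)%N.
  rewrite -sum_nat_const; apply: leq_trans (_ : \sum_(k in J) #|b k| <= _)%N; first exact: leq_sum.
  apply: leq_trans (_ : \sum_k #|b k| <= _)%N.
    by rewrite [leqRHS](bigID (mem J)) leq_addr.
  rewrite -sum1_card big_distrr /=.
  under eq_bigr => k _.
    rewrite -sum1_card (eq_bigl (fun s => (s \in S) && ((region (lower (sel s)) == k) (+) (region (upper (sel s)) == k)))); last by move=> s; rewrite !inE.
    rewrite big_mkcondr; over.
  rewrite exchange_big /=; apply: leq_sum => s _; rewrite muln1.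
  have s1 a : (\sum_(k : triangle m) (a == k : nat) = 1)%N.
    by rewrite (bigD1 a) //= eqxx big1 // => k; rewrite eq_sym => /negbTE ->.
  apply: leq_trans (_ : \sum_k ((region (lower (sel s)) == k) + (region (upper (sel s)) == k)) <= _)%N.
    by apply: leq_sum => k _; case: (_ == k); case: (_ == k).
  by rewrite big_split /= !s1.
(* Without nonzero boundaries there are at most as many edges as vertices, and [W10] suffices.
   Otherwise 5 e <= 5 w + 5 j - 5, and 10 j <= 2 e. *)
move: Hle J1 W10 leWS; clear; move: #|S| #|W| #|J| => s w j; lia.
Qed.

End GridGraph.

(** Counting ordered pairs removes the dependence on ranks, which change when passing to the subtype
    of a vertex set. *)
Lemma card_oedge (W : finType) (r : rel W) (S : {set W}) : symmetric r -> irreflexive r ->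
  (2 * #|[set q | [&& oedge r q, q.1 \in S & q.2 \in S]]| =
   #|[set q : W * W | [&& r q.1 q.2, q.1 \in S & q.2 \in S]]|)%N.
Proof.
move=> rC r0; set A := [set q | [&& oedge r q, _ & _]]; set B := RHS.
pose sw (q : W * W) := (q.2, q.1).
have swI : injective sw by move=> [a b] [c d] [-> ->].
rewrite mul2n -addnn -[X in (_ + X)%N](card_imset _ swI) -cardsUI.
have -> : A :&: sw @: A = set0.
  apply/setP => -[u v]; rewrite !inE; apply/negP => /andP[/andP[/andP[_ l] _]].
  move=> /imsetP[[u' v']]; rewrite inE => /andP[/andP[_ l'] _] [Eu Ev].
  by subst; move: (ltn_trans l l'); rewrite ltnn.
rewrite cards0 addn0; apply: eq_card => -[u v]; rewrite !inE /=.
have -> : ((u, v) \in sw @: A) = [&& oedge r (v, u), v \in S & u \in S].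
  apply/imsetP/idP => [[[u' v']]|h]; first by rewrite inE => h [-> ->].
  by exists (v, u); rewrite ?inE.
rewrite /oedge /= (rC v u); case: (boolP (r u v)) => //= ruv.
case: (ltngtP (enum_rank u) (enum_rank v)) => [_|_|/ord_inj/enum_rank_inj E].
- by rewrite orbF.
- by case: (u \in S); case: (v \in S).
by rewrite E r0 in ruv.
Qed.

(** Equality or adjacency in the triangular lattice: both coordinates and their difference change by
    at most 1, so the second diagonal of a cell is excluded. *)
Definition hex (p q : nat * nat) : bool :=
  [&& p.1 <= q.1.+1, q.1 <= p.1.+1, p.2 <= q.2.+1, q.2 <= p.2.+1,
    p.1 + q.2 <= (q.1 + p.2).+1 & q.1 + p.2 <= (p.1 + q.2).+1]%N.

(** * Lattice points of the square up to antipodes *)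

Section Lattice.
Variable M : nat.
Local Notation n := (M + M)%N.

Definition on_boundary (p : nat * nat) := [|| p.1 == 0, p.1 == n, p.2 == 0 | p.2 == n]%N.
Definition antipode (p : nat * nat) := (n - p.1, n - p.2)%N.

Definition in_grid (p : nat * nat) := (p.1 <= n)%N && (p.2 <= n)%N.

Definition hex_linked p q := [|| hex p q, on_boundary q && hex p (antipode q) |
  on_boundary p && hex (antipode p) q].

End Lattice.

Section HexEdges.
Variables (M m : nat).
Hypothesis Mm : m.+1 = M + M.
Local Notation joins E q q' := (end1 E = q /\ end2 E = q' \/ end1 E = q' /\ end2 E = q).

(** Steps along the left or top side of the square are not edges of the grid; there the antipodal
    step is one. *)
Lemma hex_step i j di dj : (di <= 1)%N -> (dj <= 1)%N -> (0 < di + dj)%N ->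
  in_grid M (i, j) -> in_grid M (i + di, j + dj) ->
  exists E : gedge m, joins E (i, j) (i + di, j + dj) \/
    [/\ on_boundary M (i, j), on_boundary M (i + di, j + dj) &
        joins E (antipode M (i, j)) (antipode M (i + di, j + dj))].
Proof.
have inK k : (k <= m)%N -> (inord k : 'I_m.+1) = k :> nat by move=> h; rewrite inordK.
rewrite /in_grid /on_boundary /antipode /= -Mm => di1 dj1 d0 /andP[i1 j1] /andP[i2 j2].
case: di di1 d0 i2 => [|[|//]] _ d0 i2; case: dj dj1 d0 j2 => [|[|//]] _ // _ j2.
- case: (posnP i) => [i0|ipos].
    exists ((inord m, inord (m - j)), Some true); right; subst i; split; rewrite ?eqxx ?orbT //.
    by right; rewrite /end1 /end2 /= !inK; try lia; split; congr (_, _); lia.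
  exists ((inord i.-1, inord j), Some true); left; left; rewrite /end1 /end2 /= !inK; try lia.
  by split; congr (_, _); lia.
- case: (ltnP j m.+1) => jm.
    exists ((inord i, inord j), Some false); left; left; rewrite /end1 /end2 /= !inK; try lia.
    by split; congr (_, _); lia.
  exists ((inord (m - i), inord 0), Some false); right; have -> : j = m.+1 by lia.
  rewrite addn0 eqxx !orbT; split=> //.
  by right; rewrite /end1 /end2 /= !inK; try lia; split; congr (_, _); lia.
exists ((inord i, inord j), None); left; left; rewrite /end1 /end2 /= !inK; try lia.
by split; congr (_, _); lia.
Qed.

Lemma hex_gedge q q' : in_grid M q -> in_grid M q' -> hex q q' -> q != q' ->
  exists E : gedge m, joins E q q' \/
    [/\ on_boundary M q, on_boundary M q' & joins E (antipode M q) (antipode M q')].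
Proof.
case: q q' => [i j] [i' j'] gq gq' /and5P[/= h1 h2 h3 h4 /andP[h5 h6]] nq.
have nij : (i != i') || (j != j') by move: nq; rewrite xpair_eqE negb_and.
case: (leqP (i + j) (i' + j')) => hs.
  have Ei : i' = i + (i' - i) by lia.
  have Ej : j' = j + (j' - j) by lia.
  rewrite Ei Ej in gq' *; apply: hex_step => //; lia.
have Ei : i = i' + (i - i') by lia.
have Ej : j = j' + (j - j') by lia.
have [||||E HE] := @hex_step i' j' (i - i') (j - j') _ _ _ gq'; try lia; first by rewrite -Ei -Ej.
rewrite -Ei -Ej in HE.
exists E; case: HE => [[]|[b1 b2 []]] h; [left; right|left; left|right; split=> //; right|right; split=> //; left]; tauto.
Qed.

End HexEdges.

From mathcomp Require Import generic_quotient lra ring.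
From mathcomp Require Import all_classical all_reals all_analysis.
Import Order.TTheory Num.Theory.
Import numFieldNormedType.Exports.

(** * Drawings in the projective plane *)

Section Topology.
Local Open Scope classical_set_scope.
Local Open Scope ring_scope.

Local Open Scope classical_set_scope.
Local Open Scope ring_scope.

(** * Open covers along an arc *)

Section Paths.
Variables (R : realType) (X : topologicalType) (g : R -> X) (I : Type) (W : I -> set X).
Hypotheses (cg : continuous g) (oW : forall i, open (W i)) (covW : forall x, exists i, W i x).

Lemma open_preimages (P : set I) : open [set r | exists2 i, P i & W i (g r)].
Proof.
rewrite (_ : [set r | _] = \bigcup_(i in P) (g @^-1` W i)); last first.
  by apply/seteqP; split=> r [i ? ?]; exists i.
by apply: bigcup_open => i _; move/continuousP: cg; apply.
Qed.

(** The segment is connected: the parameters covered by sets with [h] true and those covered by sets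
    with [h] false form two disjoint open sets. *)
Lemma chain_connected (s t : R) (h : I -> bool) :
  (forall i j r, s <= r <= t -> W i (g r) -> W j (g r) -> h i = h j) ->
  forall i j r r', s <= r <= t -> s <= r' <= t -> W i (g r) -> W j (g r') -> h i = h j.
Proof.
move=> Hh.
have key i j r r' : s <= r <= t -> s <= r' <= t -> W i (g r) -> W j (g r') -> h i -> h j.
  move=> rst r'st Wi Wj hi.
  pose C b := [set r | exists2 i, h i = b & W i (g r)].
  have oC b : open (C b) by apply: open_preimages.
  have EB : `[s, t]%classic `&` C true = `[s, t]%classic.
    apply: (@segment_connected _ s t).
    - by exists r; split; [rewrite /= in_itv|exists i].
    - by exists (C true).
    - exists (~` C false); first exact: open_closedC.
      apply/seteqP; split=> x [xst]; rewrite /= in_itv /= in xst.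
        move=> [k hk Wk]; split; first by rewrite /= in_itv.
        by move=> [k' hk' Wk']; move: (Hh k k' x xst Wk Wk'); rewrite hk hk'.
      move=> nC; split; first by rewrite /= in_itv.
      have [k Wk] := covW (g x); exists k => //.
      by case E: (h k) => //; case: nC; exists k.
  have : (`[s, t]%classic `&` C true) r' by rewrite EB /= in_itv.
  by move=> [_ [k hk Wk]]; rewrite -(Hh k j r').
move=> i j r r' rst r'st Wi Wj; apply/idP/idP; first exact: key rst r'st Wi Wj.
exact: key r'st rst Wj Wi.
Qed.

(** At the supremum [c] of the admissible parameters some [W i] covers a whole interval. It contains
    an admissible [t] just before [c] and, just after, a point of a set satisfying [B]; so the part
    up to [t] avoids [B] and yet overlaps it through [W i]. *)
Lemma frontier (B : I -> Prop) (a b : R) : 0 <= a -> a <= b ->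
  (forall i r, 0 <= r <= a -> W i (g r) -> ~ B i) ->
  (forall i, W i (g b) -> B i) ->
  exists t i j x, [/\ a <= t <= b, forall i r, 0 <= r <= t -> W i (g r) -> ~ B i,
    W i (g t), B j & W i x /\ W j x].
Proof.
move=> a0 ab Ha Hb.
pose Z := [set t | a <= t <= b /\ forall i r, 0 <= r <= t -> W i (g r) -> ~ B i].
have Za : Z a by split; rewrite ?lexx.
have hsZ : has_sup Z by split; [exists a|exists b => t [/andP[]]].
pose c := sup Z.
have ac : a <= c by apply: (ub_le_sup hsZ.2).
have cb : c <= b by apply: ge_sup; [exists a|move=> t [/andP[]]].
have [i Wc] := covW (g c).
have /nbhs_ballP[e /= e0 He] : nbhs c (g @^-1` W i).
  by apply: cg; apply: open_nbhs_nbhs.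
have {}He r : c - e < r -> r < c + e -> W i (g r).
  by move=> h1 h2; apply: He; rewrite /ball /= ltr_distlC h1.
have [t [/andP[a_t tb] Zt] ct] := sup_adherent e0 hsZ.
have tc : t <= c by apply: (ub_le_sup hsZ.2); split; rewrite ?a_t.
have Wt : W i (g t) by apply: He => //; rewrite (le_lt_trans tc) // ltrDl.
have niB : ~ B i by apply: (Zt i t); rewrite // lexx (le_trans a0 a_t).
have cb' : c + e / 2 <= b.
  rewrite leNgt; apply/negP => h; apply: niB; apply: Hb; apply: He.
    by rewrite (lt_le_trans _ cb) // gtrBl.
  by rewrite (lt_trans h) // ltrD2l gtr_pMr // invf_lt1 // ltr1n.
have [j [r [r0 Wj Bj]]] : exists j r, [/\ 0 <= r <= c + e / 2, W j (g r) & B j].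
  apply: contrapT => h; suff : c + e / 2 <= c by rewrite gerDl leNgt divr_gt0.
  apply: (ub_le_sup hsZ.2); split.
    by rewrite cb' andbT (le_trans ac) // lerDl ltW // divr_gt0.
  by move=> k r rle Wk Bk; apply: h; exists k, r.
exists t, i, j, (g r); split=> //; first by rewrite a_t.
split=> //; apply: He.
  apply: (lt_trans ct); rewrite ltNge; apply/negP => rt.
  by apply: (Zt j r) => //; case/andP: r0 => -> _.
case/andP: r0 => _ h; apply: (le_lt_trans h).
by rewrite ltrD2l gtr_pMr // invf_lt1 // ltr1n.
Qed.

End Paths.

Local Open Scope classical_set_scope.
Local Open Scope ring_scope.

(** * The cells of the lattice points *)

Section Stars.
Variables (R : realType) (M : nat).
Hypothesis M0 : (0 < M)%N.
Local Notation n := (M + M)%N.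

(** Its level surfaces are double pyramids over a square; the upper half, seen from above, is the
    square of the grid, with the equator as its boundary. *)
Definition gauge (x y z : R) : R := Num.max `|x| `|y| + `|z|.

(* The lattice point (i, j) stands for the direction of (a, b, M - max(|a|,|b|)) with
   a = i - M and b = j - M, on the pyramid of the vectors of gauge M. *)
Definition lstar (p : nat * nat) (x y z : R) : bool :=
  let N := gauge x y z in let a := p.1%:R - M%:R in let b := p.2%:R - M%:R in
  [&& `|M%:R * x - a * N| < N, `|M%:R * y - b * N| < N,
    `|M%:R * (x - y) - (a - b) * N| < N & on_boundary M p || (0 < z)].

Lemma gaugeN x y z : gauge (- x) (- y) (- z) = gauge x y z.
Proof. by rewrite /gauge !normrN. Qed.

(** Both scaled coordinates are rounded down, so their difference is also within one unit. On the
    equator one coordinate equals the gauge up to sign, and rounding is exact there: the lattice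
    point lies on the boundary, as the last condition of [lstar] demands. *)
Lemma lstar_cover x y z : 0 < gauge x y z -> 0 <= z ->
  exists p, [/\ p.1 <= n, p.2 <= n & lstar p x y z]%N.
Proof.
move=> N0 z0; have MR : 0 < M%:R :> R by rewrite ltr0n.
have xN : `|x| <= gauge x y z by rewrite /gauge -[leLHS]addr0 lerD // le_max lexx.
have yN : `|y| <= gauge x y z by rewrite /gauge -[leLHS]addr0 lerD // le_max lexx orbT.
move NE: (gauge x y z) N0 xN yN => N N0 xN yN.
have coord (t : R) : `|t| <= N -> exists i : nat, [/\ (i <= n)%N,
    (i%:R - M%:R) * N <= M%:R * t, M%:R * t < (i%:R - M%:R + 1) * N &
    t = N -> i = n].
  move=> tN; pose s := M%:R * t / N + M%:R.
  have sE : M%:R * t = (s - M%:R) * N by rewrite /s addrK divfK // gt_eqF.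
  have s0 : 0 <= s.
    have : 0 <= s * N; last by rewrite pmulr_lge0.
    move: tN; rewrite ler_norml => /andP[h1 h2]; have : 0 <= M%:R * (N + t) by apply: mulr_ge0; [exact: ltW|lra].
    by move: sE; lra.
  have sn : s <= n%:R.
    have : 0 <= (n%:R - s) * N; last by rewrite pmulr_lge0 ?subr_ge0.
    move: tN; rewrite ler_norml => /andP[h1 h2]; have : 0 <= M%:R * (N - t) by apply: mulr_ge0; [exact: ltW|lra].
    by move: sE; rewrite natrD; lra.
  have /andP[i1 i2] := truncn_itv s0; exists (Num.truncn s); split.
  - by rewrite -(ler_nat R) (le_trans i1).
  - by rewrite sE ler_pM2r //; lra.
  - by rewrite sE ltr_pM2r //; move: i2; rewrite -natr1; lra.
  move=> tE; suff -> : s = n%:R by rewrite natrK.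
  by rewrite /s tE mulfK ?gt_eqF // natrD.
have [i [i_n i1 i2 iN]] := coord x xN; have [j [j_n j1 j2 jN]] := coord y yN.
have i0 : x = - N -> i = 0%N.
  move=> xE; move: i1; rewrite xE mulrN -mulNr ler_pM2r // => i1.
  have : i%:R <= 0 :> R by lra.
  by rewrite lern0 => /eqP.
have j0 : y = - N -> j = 0%N.
  move=> yE; move: j1; rewrite yE mulrN -mulNr ler_pM2r // => j1.
  have : j%:R <= 0 :> R by lra.
  by rewrite lern0 => /eqP.
exists (i, j); split=> //; rewrite /lstar NE /=; apply/and4P; split.
- by rewrite ltr_norml; apply/andP; split; lra.
- by rewrite ltr_norml; apply/andP; split; lra.
- by rewrite ltr_norml; apply/andP; split; lra.
move: z0; rewrite le_eqVlt => /orP[/eqP z0|->]; last by rewrite orbT.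
apply/orP; left; rewrite /on_boundary /=.
have : N = `|x| \/ N = `|y|.
  rewrite -NE /gauge -z0 normr0 addr0; case: (leP `|x| `|y|) => _; by [right|left].
case=> NE'.
  case: (ger0P x) NE' => _ NE'; first by rewrite iN // eqxx !orbT.
  by rewrite i0 // NE' opprK.
case: (ger0P y) NE' => _ NE'; first by rewrite jN // eqxx !orbT.
by rewrite j0 ?eqxx ?orbT // NE' opprK.
Qed.

Lemma lstar_gauge p x y z : lstar p x y z -> 0 < gauge x y z.
Proof. by case/and4P => h _ _ _; apply: le_lt_trans h. Qed.

Lemma lstar_hex p q x y z : lstar p x y z -> lstar q x y z -> hex p q.
Proof.
move=> Hp Hq; have N0 := lstar_gauge Hp; move: Hp Hq.
rewrite /lstar; move: (gauge x y z) N0 => N N0.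
rewrite !ltr_norml => /and4P[/andP[a1 a2] /andP[b1 b2] /andP[c1 c2] _].
case/and4P => /andP[a1' a2'] /andP[b1' b2'] /andP[c1' c2'] _.
have two (i j k l : nat) : ((i%:R + j%:R) - (k%:R + l%:R) : R) * N < 2%:R * N -> (i + j <= (k + l).+1)%N.
  rewrite ltr_pM2r // => h; rewrite -ltnS -(ltr_nat R) -[X in _ < X]natr1 -natr1 !natrD; lra.
apply/and5P; split.
- by rewrite -[p.1]addn0 -[q.1]addn0; apply: two; lra.
- by rewrite -[p.1]addn0 -[q.1]addn0; apply: two; lra.
- by rewrite -[p.2]addn0 -[q.2]addn0; apply: two; lra.
- by rewrite -[p.2]addn0 -[q.2]addn0; apply: two; lra.
by apply/andP; split; apply: two; lra.
Qed.

Lemma lstar_antipode p x y z : (p.1 <= n)%N -> (p.2 <= n)%N -> on_boundary M p ->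
  lstar p (- x) (- y) (- z) -> on_boundary M (antipode M p) /\ lstar (antipode M p) x y z.
Proof.
move=> p1 p2 bp; have bp' : on_boundary M (antipode M p).
  by move: bp; rewrite /on_boundary /antipode /=; lia.
rewrite /lstar gaugeN bp bp' /= !andbT; move: (gauge x y z) => N H; split=> //.
rewrite !natrB // !natrD; move: H; rewrite !ltr_norml.
by move=> /and3P[/andP[a1 a2] /andP[b1 b2] /andP[c1 c2]]; apply/and3P; split; apply/andP; split; lra.
Qed.

(** The third coordinate follows the height [c] of the pyramid over the lattice point. Its sign is
    controlled by the last condition of [lstar], as [c] vanishes on the boundary. *)
Lemma lstar_z p x y z (c := M%:R - Num.max `|p.1%:R - M%:R| `|p.2%:R - M%:R| : R) :
  (p.1 <= n)%N -> (p.2 <= n)%N -> lstar p x y z ->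
  [/\ 0 <= c, c <= M%:R & `|M%:R * z - c * gauge x y z| <= gauge x y z].
Proof.
move=> p1 p2 Hs; have N0 := lstar_gauge Hs; move: Hs; rewrite /lstar /c => {c}.
have NE : gauge x y z = Num.max `|x| `|y| + `|z| by [].
have p1R : p.1%:R <= M%:R + M%:R :> R by rewrite -natrD ler_nat.
have p2R : p.2%:R <= M%:R + M%:R :> R by rewrite -natrD ler_nat.
have p10 : 0 <= p.1%:R :> R by [].
have p20 : 0 <= p.2%:R :> R by [].
have aM : `|p.1%:R - M%:R| <= M%:R :> R by rewrite ler_norml; apply/andP; split; lra.
have bM : `|p.2%:R - M%:R| <= M%:R :> R by rewrite ler_norml; apply/andP; split; lra.
have bd : on_boundary M p -> Num.max `|p.1%:R - M%:R| `|p.2%:R - M%:R| = M%:R :> R.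
  move=> bp; apply/eqP; rewrite eq_le ge_max aM bM /= le_max.
  have l0 : M%:R <= `|0%:R - M%:R : R| by rewrite sub0r normrN ger0_norm.
  have ln : M%:R <= `|n%:R - M%:R : R| by rewrite natrD addrK ger0_norm.
  by case/or4P: bp => /eqP ->; rewrite ?l0 ?ln ?orbT.
move: (gauge x y z) N0 NE => N N0 NE /and4P[Ha Hb _ Hz].
have dist (u v : R) : `|M%:R * u - v * N| < N -> `|M%:R * `|u| - `|v| * N| < N.
  move=> H; apply: le_lt_trans H; rewrite -[X in X * `|u|](ger0_norm (ler0n _ M)).
  by rewrite -[X in `|v| * X](ger0_norm (ltW N0)) -!normrM ler_dist_dist.
move: (dist _ _ Ha) (dist _ _ Hb); rewrite !ltr_norml => /andP[a1 a2] /andP[b1 b2].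
have a0 := normr_ge0 (p.1%:R - M%:R : R); have b0 := normr_ge0 (p.2%:R - M%:R : R).
move: bd aM bM a0 b0 a1 a2 b1 b2; clear -Hz NE N0 M0.
move: `|p.1%:R - M%:R| `|p.2%:R - M%:R| => a b bd aM bM a0 b0 a1 a2 b1 b2.
split.
- by rewrite subr_ge0 ge_max aM bM.
- by rewrite gerBl le_max a0.
suff Hc : `|M%:R * `|z| - (M%:R - Num.max a b) * N| <= N.
  case: (ger0P z) Hc Hz => // z0 Hc /orP[/bd E|]; last by rewrite ltNge (ltW z0).
  by move: Hc; rewrite E subrr mul0r !subr0 normrM normrN -normrM.
have Ez : M%:R * `|z| = M%:R * N - Num.max (M%:R * `|x|) (M%:R * `|y|).
  by rewrite NE -maxr_pMr // mulrDr addrAC subrr add0r.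
rewrite Ez ler_norml -subr_ge0; clear -a1 a2 b1 b2 N0.
have abN : (a <= b) = (a * N <= b * N) by rewrite ler_pM2r.
case: (leP a b) => ab; case: (leP (M%:R * `|x|) (M%:R * `|y|)) => xy; apply/andP; split;
  move: ab; rewrite ?abN ?ltNge ?abN -?ltNge => ab; lra.
Qed.

(** Both vectors are near multiples of (a, b), so the main terms of the determinant cancel; six
    error terms remain, each at most [M%:R * (N * N')] after scaling by the square of [M%:R]. *)
Lemma cross_le (a b x y x' y' N N' : R) : 0 <= N -> 0 <= N' -> `|a| <= M%:R -> `|b| <= M%:R ->
  `|M%:R * x - a * N| <= N -> `|M%:R * y - b * N| <= N ->
  `|M%:R * x' - a * N'| <= N' -> `|M%:R * y' - b * N'| <= N' ->
  M%:R * `|x * y' - x' * y| <= 6 * (N * N').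
Proof.
move=> N0 N'0 aM bM; have MR : 0 < M%:R :> R by rewrite ltr0n.
move Eu: (M%:R * x - a * N) => u; move Ev: (M%:R * y - b * N) => v.
move Eu': (M%:R * x' - a * N') => u'; move Ev': (M%:R * y' - b * N') => v' Hu Hv Hu' Hv'.
have M1 : 1 <= M%:R :> R by rewrite ler1n.
have pr (c d e f : R) : `|c| <= e -> `|d| <= f -> `|c * d| <= e * f.
  by move=> ? ?; rewrite normrM ler_pM.
have NN : N * N' <= M%:R * (N * N') by rewrite ler_peMl // mulr_ge0.
rewrite -(ler_pM2l MR) -[X in X * (_ * `|_|)](ger0_norm (ltW MR)) -[X in _ * (X * `|_|)](ger0_norm (ltW MR)) -!normrM.
have -> : M%:R * (M%:R * (x * y' - x' * y)) =
    a * (N * v') + b * (u * N') + u * v' - (a * (v * N') + b * (N * u') + u' * v).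
  by rewrite -Eu -Ev -Eu' -Ev'; ring.
have nN : `|N| <= N by rewrite ger0_norm.
have nN' : `|N'| <= N' by rewrite ger0_norm.
have h1 := pr _ _ _ _ aM (pr _ _ _ _ nN Hv').
have h2 := pr _ _ _ _ bM (pr _ _ _ _ Hu nN').
have h3 := pr _ _ _ _ Hu Hv'.
have h4 := pr _ _ _ _ aM (pr _ _ _ _ Hv nN').
have h5 := pr _ _ _ _ bM (pr _ _ _ _ nN Hu').
have h6 := pr _ _ _ _ Hu' Hv.
move: h1 h2 h3 h4 h5 h6; rewrite !ler_norml.
move=> /andP[h1 k1] /andP[h2 k2] /andP[h3 k3] /andP[h4 k4] /andP[h5 k5] /andP[h6 k6].
by apply/andP; split; lra.
Qed.

(** By Lagrange's identity the left factor is a sum of three squared determinants. The gauge is at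
    most 2 on the unit sphere, so [cross_le] bounds each determinant by 24 over [M%:R], and 1728 is
    three times the square of 24. *)
Lemma lstar_close p x y z x' y' z' : (p.1 <= n)%N -> (p.2 <= n)%N ->
  x ^+ 2 + y ^+ 2 + z ^+ 2 = 1 -> x' ^+ 2 + y' ^+ 2 + z' ^+ 2 = 1 ->
  lstar p x y z -> lstar p x' y' z' ->
  M%:R * (1 - (x * x' + y * y' + z * z') ^+ 2) <= 1728.
Proof.
move=> p1 p2 E E' Hs Hs'; have N0 := ltW (lstar_gauge Hs); have N'0 := ltW (lstar_gauge Hs').
have [c0 cM Hz] := lstar_z p1 p2 Hs; have [_ _ Hz'] := lstar_z p1 p2 Hs'.
have small (u v w : R) : u ^+ 2 + v ^+ 2 + w ^+ 2 = 1 -> `|u| <= 1.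
  move=> h; rewrite -[leRHS]ger0_norm // -ler_sqr ?nnegrE // -!normrX !ger0_norm ?sqr_ge0 //.
  by rewrite expr1n -h -addrA lerDl addr_ge0 ?sqr_ge0.
have gauge2 (u v w : R) : u ^+ 2 + v ^+ 2 + w ^+ 2 = 1 -> gauge u v w <= 2.
  move=> h; have hu := small _ _ _ h.
  have hv : `|v| <= 1 by apply: (small v u w); lra.
  have hw : `|w| <= 1 by apply: (small w u v); lra.
  by rewrite /gauge (_ : 2 = 1 + 1 :> R) // lerD // ge_max hu hv.
have NN : gauge x y z * gauge x' y' z' <= 4.
  by rewrite (_ : 4 = 2 * 2 :> R) ?ler_pM ?gauge2 // -natrM.
have p1R : p.1%:R <= M%:R + M%:R :> R by rewrite -natrD ler_nat.
have p2R : p.2%:R <= M%:R + M%:R :> R by rewrite -natrD ler_nat.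
have p10 : 0 <= p.1%:R :> R by [].
have p20 : 0 <= p.2%:R :> R by [].
have aM : `|p.1%:R - M%:R| <= M%:R :> R by rewrite ler_norml; apply/andP; split; lra.
have bM : `|p.2%:R - M%:R| <= M%:R :> R by rewrite ler_norml; apply/andP; split; lra.
move: c0 cM Hz Hz'; set c := _ - Num.max _ _ => c0 cM Hz Hz'.
have cM' : `|c| <= M%:R by rewrite ger0_norm.
move: Hs Hs' => /and4P[/ltW Hx /ltW Hy _ _] /and4P[/ltW Hx' /ltW Hy' _ _].
have k1 := cross_le N0 N'0 aM bM Hx Hy Hx' Hy'.
have k2 := cross_le N0 N'0 aM cM' Hx Hz Hx' Hz'.
have k3 := cross_le N0 N'0 bM cM' Hy Hz Hy' Hz'.
have -> : 1 - (x * x' + y * y' + z * z') ^+ 2 =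
    (x * y' - x' * y) ^+ 2 + (x * z' - x' * z) ^+ 2 + (y * z' - y' * z) ^+ 2.
  by rewrite -[1](mulr1 1) -[X in X * 1]E -[X in _ * X]E'; ring.
have M1 : 1 <= M%:R :> R by rewrite ler1n.
have sq (u : R) : M%:R * `|u| <= 6 * (gauge x y z * gauge x' y' z') -> M%:R * u ^+ 2 <= 576.
  move=> h; have {h} : M%:R * `|u| <= 24 by lra.
  rewrite -real_normK ?num_real //; have := normr_ge0 u; move: `|u| => w w0 h.
  have : (M%:R * w) * (M%:R * w) <= 24 * 24 by rewrite ler_pM // mulr_ge0.
  have : M%:R * w ^+ 2 <= M%:R * (M%:R * w ^+ 2) by rewrite ler_peMl // mulr_ge0 ?sqr_ge0.
  by rewrite expr2 => h1 h2; lra.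
by move: (sq _ k1) (sq _ k2) (sq _ k3); lra.
Qed.

End Stars.

Local Open Scope classical_set_scope.
Local Open Scope ring_scope.

Section ContinuousOps.
Variables (R : realType) (T : topologicalType) (f g : T -> R) (x : T).
Hypotheses (cf : {for x, continuous f}) (cg : {for x, continuous g}).

Lemma cts_add : {for x, continuous (fun y => f y + g y)}.
Proof. exact: (@continuousD R R^o T f g x). Qed.

Lemma cts_sub : {for x, continuous (fun y => f y - g y)}.
Proof. exact: (@continuousB R R^o T f g x). Qed.

Lemma cts_mul : {for x, continuous (fun y => f y * g y)}.
Proof. exact: (@continuousM R T f g x). Qed.

Lemma cts_max : {for x, continuous (fun y => Num.max (f y) (g y))}.
Proof. exact: (@continuous_max R T f g x). Qed.

Lemma cts_norm : {for x, continuous (fun y => `|f y|)}.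
Proof. by apply: (@continuous_comp _ _ _ f Num.norm); [exact: cf|exact: norm_continuous]. Qed.

End ContinuousOps.

(** * The projective plane as a quotient of the sphere *)

Section ProjectivePlane.
Variable R : realType.
Local Notation P2 := (projective_plane R).

Definition coord (k : nat) (v : 'rV[R]_3) : R := v 0 (inord k).

Lemma coord_eq (u v : 'rV[R]_3) : coord 0 u = coord 0 v -> coord 1 u = coord 1 v ->
  coord 2 u = coord 2 v -> u = v.
Proof.
move=> h0 h1 h2; apply/rowP => i; rewrite -(inord_val i).
by case: i => [[|[|[|//]]] ?].
Qed.

Lemma coordN k v : coord k (- v) = - coord k v.
Proof. by rewrite /coord mxE. Qed.

Lemma coord_continuous' k : continuous (coord k).
Proof. exact: coord_continuous. Qed.

Lemma sphereE (v : 'rV[R]_3) : sphere R v <->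
  coord 0 v ^+ 2 + coord 1 v ^+ 2 + coord 2 v ^+ 2 = 1.
Proof.
have inE k (h : (k < 3)%N) : inord k = Ordinal h by apply: val_inj; rewrite /= inordK.
rewrite /sphere /= !big_ord_recr big_ord0 /= add0r /coord.
rewrite (inE 0%N isT) (inE 1%N isT) (inE 2%N isT).
by split=> <-; congr (v _ _ ^+ 2 + v _ _ ^+ 2 + v _ _ ^+ 2); apply: val_inj.
Qed.

Lemma sphere_val (x : sphere R) :
  coord 0 (set_val x) ^+ 2 + coord 1 (set_val x) ^+ 2 + coord 2 (set_val x) ^+ 2 = 1.
Proof. by apply/sphereE; apply: set_valP. Qed.

Definition to_sphere (v : 'rV[R]_3) (hv : sphere R v) : sphere R := exist _ v (mem_set hv).

Definition proj (x : sphere R) : P2 :=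
  (\pi_(quotient_topology {eq_quot antipodal_equivRel R}) x)%qT.

Lemma proj_surj (P : P2) : exists x, proj x = P.
Proof. by exists (repr P); rewrite /proj reprK. Qed.

Lemma proj_eq (x y : sphere R) : proj x = proj y <->
  set_val x = set_val y \/ set_val x = - set_val y.
Proof.
have -> : proj x = proj y <-> antipodal x y.
  by split=> [h|h]; [exact/(@eqmodP _ (antipodal_equivRel R))|exact/(@eqmodP _ (antipodal_equivRel R))].
rewrite /antipodal; split=> [/orP[]/eqP ->|[] ->]; rewrite ?eqxx ?orbT //; by [left|right].
Qed.

Lemma open_proj (A : set P2) : open (proj @^-1` A) -> open A.
Proof. by []. Qed.

Lemma set_val_continuous : continuous (set_val : sphere R -> 'rV[R]_3).
Proof. exact: initial_continuous. Qed.

Lemma proj_continuous : continuous proj.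
Proof. exact: pi_continuous. Qed.

Definition starv M p (v : 'rV[R]_3) := lstar M p (coord 0 v) (coord 1 v) (coord 2 v).

Lemma sphereN (v : 'rV[R]_3) : sphere R v -> sphere R (- v).
Proof. by move=> /sphereE h; apply/sphereE; rewrite !coordN !sqrrN. Qed.

Definition nb M p : set P2 := [set P | exists2 x, proj x = P & starv M p (set_val x)].

Lemma nb_proj M p x : nb M p (proj x) <-> starv M p (set_val x) \/ starv M p (- set_val x).
Proof.
split=> [[y /proj_eq[->|->] h]|[h|h]]; [by left|by right|by exists x|].
exists (to_sphere (sphereN (set_valP x))); last by rewrite set_valE.
by apply/proj_eq; right; rewrite set_valE.
Qed.

Lemma gauge_continuous : continuous (fun v => gauge (coord 0 v) (coord 1 v) (coord 2 v)).
Proof.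
move=> v; apply: (@cts_add R _ (fun v => Num.max `|coord 0 v| `|coord 1 v|) (fun v => `|coord 2 v|)).
  apply: (@cts_max R _ (fun v => `|coord 0 v|) (fun v => `|coord 1 v|));
    by apply: cts_norm; exact: coord_continuous'.
by apply: cts_norm; exact: coord_continuous'.
Qed.

Lemma open_lt (f g : 'rV[R]_3 -> R) : continuous f -> continuous g -> open [set v | f v < g v].
Proof.
move=> cf cg; rewrite (_ : [set v | _] = (fun v => g v - f v) @^-1` [set y | 0 < y]).
  suff /continuousP : continuous (fun v => g v - f v) by apply; exact: open_gt.
  by move=> v; apply: cts_sub; [exact: cg|exact: cf].
by apply/seteqP; split=> v /=; rewrite subr_gt0.
Qed.

Lemma open_starv M p : open [set v | starv M p v].
Proof.
have cmul (a : R) (f : 'rV[R]_3 -> R) : continuous f -> continuous (fun v : 'rV[R]_3 => a * f v : R).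
  by move=> cf v; apply: cts_mul; [exact: cst_continuous|exact: cf].
have csub (f g : 'rV[R]_3 -> R) : continuous f -> continuous g -> continuous (fun v => f v - g v).
  by move=> cf cg v; apply: cts_sub; [exact: cf|exact: cg].
have cnorm (f : 'rV[R]_3 -> R) : continuous f -> continuous (fun v => `|f v|).
  by move=> cf v; apply: cts_norm; exact: cf.
have part (a : R) (f : 'rV[R]_3 -> R) : continuous f -> open [set v | `|M%:R * f v - a * gauge (coord 0 v) (coord 1 v) (coord 2 v)|
    < gauge (coord 0 v) (coord 1 v) (coord 2 v)].
  move=> cf; apply: open_lt; last exact: gauge_continuous.
  apply: cnorm (fun v => M%:R * f v - a * gauge (coord 0 v) (coord 1 v) (coord 2 v)) _.
  by apply: csub; apply: cmul => //; apply: gauge_continuous.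
have op : open [set v : 'rV[R]_3 | on_boundary M p || (0 < coord 2 v)].
  case: (on_boundary M p) => /=.
    by rewrite (_ : [set _ | _] = setT); [exact: openT|apply/seteqP; split].
  by apply: open_lt; [exact: cst_continuous|exact: coord_continuous'].
rewrite (_ : [set v | _] = [set v | `|M%:R * coord 0 v - (p.1%:R - M%:R) * gauge (coord 0 v) (coord 1 v) (coord 2 v)|
    < gauge (coord 0 v) (coord 1 v) (coord 2 v)] `&`
  [set v | `|M%:R * coord 1 v - (p.2%:R - M%:R) * gauge (coord 0 v) (coord 1 v) (coord 2 v)|
    < gauge (coord 0 v) (coord 1 v) (coord 2 v)] `&`
  [set v | `|M%:R * (coord 0 v - coord 1 v) - ((p.1%:R - M%:R) - (p.2%:R - M%:R)) * gauge (coord 0 v) (coord 1 v) (coord 2 v)|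
    < gauge (coord 0 v) (coord 1 v) (coord 2 v)] `&` [set v : 'rV[R]_3 | on_boundary M p || (0 < coord 2 v)]).
  apply: openI => //; apply: openI; first by apply: openI; apply: part; exact: coord_continuous'.
  by apply: part; apply: csub; exact: coord_continuous'.
apply/seteqP; split=> v; first by move=> /and4P[? ? ? ?].
by move=> [[[h1 h2] h3] h4]; apply/and4P; split.
Qed.

Lemma open_nb M p : open (nb M p).
Proof.
apply: open_proj.
rewrite (_ : _ @^-1` _ = set_val @^-1` ([set v | starv M p v] `|` -%R @^-1` [set v | starv M p v])).
  move/continuousP: set_val_continuous; apply; apply: openU; first exact: open_starv.
  by move/continuousP: (@oppr_continuous R 'rV[R]_3); apply; exact: open_starv.
by apply/seteqP; split=> x; [move=> /nb_proj|move=> h; apply/nb_proj].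
Qed.

Section Lattice.
Variable M : nat.
Hypothesis M0 : (0 < M)%N.
Local Notation n := (M + M)%N.

Lemma gauge_sphere (x : sphere R) : 0 < gauge (coord 0 (set_val x)) (coord 1 (set_val x)) (coord 2 (set_val x)).
Proof.
rewrite lt_neqAle /gauge addr_ge0 ?le_max ?normr_ge0 // andbT eq_sym paddr_eq0 ?le_max ?normr_ge0 //.
apply/negP => /andP[h /eqP h2]; have := sphere_val x.
have mle : Num.max `|coord 0 (set_val x)| `|coord 1 (set_val x)| <= 0 by rewrite (eqP h).
move: mle; rewrite ge_max !normr_le0 => /andP[/eqP -> /eqP ->].
by move/eqP: h2; rewrite normr_eq0 => /eqP ->; rewrite !expr0n /= !addr0 => /eqP; rewrite eq_sym oner_eq0.
Qed.

Lemma nb_cover P : exists2 p, in_grid M p & nb M p P.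
Proof.
have [x <-] := proj_surj P.
case: (leP 0 (coord 2 (set_val x))) => z0.
  have [p [p1 p2 h]] := lstar_cover M0 (gauge_sphere x) z0.
  by exists p; [rewrite /in_grid p1|apply/nb_proj; left].
have g0 : 0 < gauge (coord 0 (- set_val x)) (coord 1 (- set_val x)) (coord 2 (- set_val x)).
  by rewrite !coordN gaugeN gauge_sphere.
have [|p [p1 p2 h]] := lstar_cover M0 g0; first by rewrite coordN oppr_ge0 ltW.
by exists p; [rewrite /in_grid p1|apply/nb_proj; right].
Qed.

Lemma nb_antipode p P : in_grid M p -> on_boundary M p -> nb M p P -> nb M (antipode M p) P.
Proof.
move=> /andP[p1 p2] bp; have [x <-] := proj_surj P; move=> /nb_proj[h|h]; apply/nb_proj; [right|left].
  have h' : lstar M p (- coord 0 (- set_val x)) (- coord 1 (- set_val x)) (- coord 2 (- set_val x)).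
    by rewrite -!coordN opprK.
  by have [] := lstar_antipode M0 p1 p2 bp h'.
by move: h; rewrite /starv !coordN => /(lstar_antipode M0 p1 p2 bp)[].
Qed.

(** When the two cells are seen through opposite representatives, one lattice point is on the
    boundary, since interior cells lie in the open upper half space; replacing it by its antipode
    restores a common representative. *)
Lemma nb_linked p q P : in_grid M p -> in_grid M q -> nb M p P -> nb M q P -> hex_linked M p q.
Proof.
have [x <-] := proj_surj P; move=> /andP[p1 p2] /andP[q1 q2] Hp Hq.
have opp_case v : starv M p v -> starv M q (- v) -> hex_linked M p q.
  move=> hp hq; case: (boolP (on_boundary M q)) => bq.
    have [_ h] : on_boundary M (antipode M q) /\ starv M (antipode M q) v.
      by apply: lstar_antipode => //; move: hq; rewrite /starv !coordN.
    by rewrite /hex_linked bq (lstar_hex hp h) orbT.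
  case: (boolP (on_boundary M p)) => bp.
    have [_ h] : on_boundary M (antipode M p) /\ starv M (antipode M p) (- v).
      by apply: lstar_antipode => //; rewrite !coordN !opprK.
    by rewrite /hex_linked bp (lstar_hex h hq) !orbT.
  move: hp hq; rewrite /starv /lstar (negbTE bp) (negbTE bq) /= => /and4P[_ _ _ h] /and4P[_ _ _].
  by rewrite coordN oppr_gt0 ltNge (ltW h).
move: Hp Hq => /nb_proj[hp|hp] /nb_proj[hq|hq].
- by rewrite /hex_linked (lstar_hex hp hq).
- exact: opp_case hp hq.
- by apply: opp_case hp _; rewrite opprK.
- by rewrite /hex_linked (lstar_hex hp hq).
Qed.

End Lattice.
End ProjectivePlane.

Local Open Scope classical_set_scope.
Local Open Scope ring_scope.

(** * Separating disjoint compact arcs by small cells *)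

Section Separation.
Variable R : realType.
Local Notation P2 := (projective_plane R).

Definition dot (u v : 'rV[R]_3) : R :=
  coord 0 u * coord 0 v + coord 1 u * coord 1 v + coord 2 u * coord 2 v.

(** The squared cosine of the angle between two lines. It serves as a closeness function on the
    projective plane, equal to 1 only on the diagonal. *)
Definition dot2 (P Q : P2) : R := dot (set_val (repr P)) (set_val (repr Q)) ^+ 2.

Lemma dot2_proj x y : dot2 (proj x) (proj y) = dot (set_val x) (set_val y) ^+ 2.
Proof.
have sgn (z : sphere R) : set_val (repr (proj z)) = set_val z \/ set_val (repr (proj z)) = - set_val z.
  by apply/proj_eq; rewrite /proj reprK.
have dN u v : dot (- u) v = - dot u v by rewrite /dot !coordN; ring.
have dC u v : dot u v = dot v u by rewrite /dot; ring.
rewrite /dot2; case: (sgn x) => ->; case: (sgn y) => ->; by rewrite ?dN ?(dC _ (- _)) ?dN ?sqrrN // dC.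
Qed.

(* Lagrange's identity for unit vectors. *)
Lemma dot2_lt1 (P Q : P2) : P <> Q -> dot2 P Q < 1.
Proof.
have [x <-] := proj_surj P; have [y <-] := proj_surj Q => ne.
rewrite dot2_proj /dot; move: (sphere_val x) (sphere_val y) ne.
set u := set_val x; set v := set_val y => ux vy ne.
have E : 1 - (coord 0 u * coord 0 v + coord 1 u * coord 1 v + coord 2 u * coord 2 v) ^+ 2 =
    (coord 0 u * coord 1 v - coord 0 v * coord 1 u) ^+ 2 +
    (coord 0 u * coord 2 v - coord 0 v * coord 2 u) ^+ 2 +
    (coord 1 u * coord 2 v - coord 1 v * coord 2 u) ^+ 2.
  by rewrite -[1](mulr1 1) -[X in X * 1]ux -[X in _ * X]vy; ring.
rewrite lt_neqAle; apply/andP; split; last first.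
  by rewrite -subr_ge0 E !addr_ge0 // sqr_ge0.
apply/eqP => /eqP; rewrite sqrf_eq1 => /orP[]/eqP d1; apply: ne; apply/proj_eq; [left|right].
  have : (coord 0 u - coord 0 v) ^+ 2 + (coord 1 u - coord 1 v) ^+ 2 + (coord 2 u - coord 2 v) ^+ 2 = 0.
    transitivity ((coord 0 u ^+ 2 + coord 1 u ^+ 2 + coord 2 u ^+ 2) + (coord 0 v ^+ 2 + coord 1 v ^+ 2 + coord 2 v ^+ 2)
        - 2 * (coord 0 u * coord 0 v + coord 1 u * coord 1 v + coord 2 u * coord 2 v)); first by ring.
    by rewrite ux vy d1; ring.
  move/eqP; rewrite !paddr_eq0 ?addr_ge0 ?sqr_ge0 // !sqrf_eq0 !subr_eq0.
  by move=> /andP[/andP[/eqP h0 /eqP h1] /eqP h2]; apply: coord_eq.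
have : (coord 0 u + coord 0 v) ^+ 2 + (coord 1 u + coord 1 v) ^+ 2 + (coord 2 u + coord 2 v) ^+ 2 = 0.
  transitivity ((coord 0 u ^+ 2 + coord 1 u ^+ 2 + coord 2 u ^+ 2) + (coord 0 v ^+ 2 + coord 1 v ^+ 2 + coord 2 v ^+ 2)
      + 2 * (coord 0 u * coord 0 v + coord 1 u * coord 1 v + coord 2 u * coord 2 v)); first by ring.
  by rewrite ux vy d1; ring.
move/eqP; rewrite !paddr_eq0 ?addr_ge0 ?sqr_ge0 // !sqrf_eq0 !addr_eq0.
by move=> /andP[/andP[/eqP h0 /eqP h1] /eqP h2]; apply: coord_eq; rewrite coordN.
Qed.

Lemma nb_close M p (P Q : P2) : (0 < M)%N -> in_grid M p -> nb M p P -> nb M p Q ->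
  M%:R * (1 - dot2 P Q) <= 1728.
Proof.
move=> M0 /andP[p1 p2] [x <- hx] [y <- hy]; rewrite dot2_proj.
exact: (lstar_close M0 p1 p2 (sphere_val x) (sphere_val y) hx hy).
Qed.

(** Products of two coordinates are unchanged by the antipodal map, hence continuous on the
    quotient; they express [dot2] as a sum of products. *)
Definition veronese i j (P : P2) : R := coord i (set_val (repr P)) * coord j (set_val (repr P)).

Lemma veronese_continuous i j : continuous (veronese i j).
Proof.
have cx k : continuous (fun x : sphere R => coord k (set_val x)).
  move=> x; apply: (@continuous_comp _ _ _ (@set_val _ (sphere R)) (coord k)).
    exact: set_val_continuous.
  exact: coord_continuous'.
apply: (@repr_comp_continuous _ _ _ (fun x : sphere R => coord i (set_val x) * coord j (set_val x))).
  by move=> x; apply: (@cts_mul R _ (fun x : sphere R => coord i (set_val x)) (fun x => coord j (set_val x))); apply: cx.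
move=> x y /eqP /proj_eq h; apply/eqP; case: h => ->; rewrite // !coordN; ring.
Qed.

Lemma dot2_continuous (T : topologicalType) (f g : T -> P2) :
  continuous f -> continuous g -> continuous (fun t => dot2 (f t) (g t)).
Proof.
move=> cf cg.
have cv i j : continuous (fun t => veronese i j (f t) * veronese i j (g t)).
  move=> t; apply: (@cts_mul R T (fun t => veronese i j (f t)) (fun t => veronese i j (g t))).
    by apply: continuous_comp; [exact: cf|exact: veronese_continuous].
  by apply: continuous_comp; [exact: cg|exact: veronese_continuous].
have -> : (fun t => dot2 (f t) (g t)) = fun t =>
    \sum_(i < 3) \sum_(j < 3) veronese i j (f t) * veronese i j (g t).
  by apply/funext => t; rewrite !big_ord_recr /= !big_ord0 /dot2 /dot /veronese /=; ring.
have csum n (h : 'I_n -> T -> R) : (forall k, continuous (h k)) -> continuous (fun t => \sum_k h k t).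
  elim: n h => [|n IH] h ch.
    rewrite (_ : (fun t => _) = fun=> 0); first exact: cst_continuous.
    by apply/funext => t; rewrite big_ord0.
  rewrite (_ : (fun t => _) = fun t => \sum_(k < n) h (widen_ord (leqnSn n) k) t + h ord_max t).
    by move=> t; apply: cts_add; [apply: IH|apply: ch].
  by apply/funext => t; rewrite big_ord_recr.
by apply: (csum 3%N _ _) => i; apply: (csum 3%N _ _) => j; apply: cv.
Qed.

(** By compactness [dot2] has a maximum below 1 over the two arcs. Points of one cell satisfy the
    bound of [nb_close], which fails for large [M]. *)
Lemma separation (f g : R -> P2) (a b c d : R) : continuous f -> continuous g ->
  (forall s t, a <= s <= b -> c <= t <= d -> f s <> g t) ->
  exists M0, forall M p s t, (M0 <= M)%N -> (0 < M)%N -> in_grid M p ->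
    a <= s <= b -> c <= t <= d -> nb M p (f s) -> nb M p (g t) -> False.
Proof.
move=> cf cg dis.
have [ab|ab] := leP a b; last first.
  exists 0%N => M p s t _ _ _ /andP[h1 h2]; by have := le_trans h1 h2; rewrite leNgt ab.
have [cd|cd] := leP c d; last first.
  exists 0%N => M p s t _ _ _ _ /andP[h1 h2]; by have := le_trans h1 h2; rewrite leNgt cd.
pose F (r : R * R) := dot2 (f r.1) (g r.2).
have cF : continuous F.
  by apply: dot2_continuous => r; apply: continuous_comp; [exact: cvg_fst|exact: cf|exact: cvg_snd|exact: cg].
have [|||m Hm Fm] := @compact_EVT_max _ R F (`[a, b]%classic `*` `[c, d]%classic).
- by exists (a, c); split; rewrite /= in_itv /= lexx.
- by apply: compact_setX; exact: segment_compact.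
- exact: continuous_subspaceT.
move: Hm; rewrite inE => -[]; rewrite /= !in_itv /= => m1 m2.
have e0 : 0 < 1 - F m by rewrite subr_gt0; apply/dot2_lt1/dis.
exists (Num.truncn (1728 / (1 - F m))).+1 => M p s t leM M0 gp sab tcd h1 h2.
have := nb_close M0 gp h1 h2; apply/negP; rewrite -ltNge.
have Fst : F (s, t) <= F m by apply: Fm; rewrite inE; split; rewrite /= in_itv.
apply: (@lt_le_trans _ _ (M%:R * (1 - F m))); last first.
  by rewrite ler_pM2l ?ltr0n //; move: Fst; rewrite /F /=; lra.
rewrite -ltr_pdivrMr //; apply: lt_le_trans (truncnS_gt _) _.
by rewrite ler_nat.
Qed.

End Separation.

Section Arcs.
Variable R : realType.
Local Open Scope classical_set_scope.
Local Open Scope ring_scope.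

(** Arcs are continuous only within the unit interval; composing with this retraction makes them
    continuous on the whole line. *)
Definition clamp (t : R) : R := Num.max 0 (Num.min t 1).

Lemma clamp_in t : 0 <= clamp t <= 1.
Proof. by rewrite /clamp le_max lexx /= ge_max ler01 /= ge_min lexx orbT. Qed.

Lemma clampE t : 0 <= t <= 1 -> clamp t = t.
Proof. by move=> /andP[t0 t1]; rewrite /clamp (min_idPl t1) (max_idPr t0). Qed.

Lemma clamp_continuous : continuous clamp.
Proof.
move=> t; apply: (@cts_max R R (fun=> 0) (fun t => Num.min t 1)); first exact: cst_continuous.
apply: (@continuous_min R R id (fun=> 1)); [by move=> ? h; exact: h|exact: cst_continuous].
Qed.

Lemma clamp_arc_continuous (X : topologicalType) (g : R -> X) :
  {within `[0, 1], continuous g} -> continuous (g \o clamp).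
Proof.
move=> /subspace_continuousP cg t U HU.
have c01 s : `[0, 1]%classic (clamp s) by rewrite /= in_itv /= clamp_in.
have h : nbhs t [set s | `[0, 1]%classic (clamp s) -> U (g (clamp s))].
  exact: clamp_continuous (cg _ (c01 t) U HU).
by apply: (@filterS _ (nbhs t) _ _ _ _ h) => s; apply.
Qed.

End Arcs.

Local Open Scope classical_set_scope.
Local Open Scope ring_scope.

Lemma thirds (R : realType) : [&& 0 < 1 / 3 :> R, 1 / 3 < 2 / 3 :> R, 0 < 2 / 3 :> R & 2 / 3 < 1 :> R].
Proof. by apply/and4P; split; lra. Qed.

(** * From a drawing to a labelled lattice *)

Section Discretization.
Variables (R : realType) (G : sgraph).
Local Notation P2 := (projective_plane R).
Variables (p : G -> P2) (a : G -> G -> set P2).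
Hypothesis Hd : drawing R p a.
Local Notation oe := (oedge (@adj G)).

Lemma oedge_pair_inj (e e' : G * G) : oe e -> oe e' ->
  [set e.1; e.2]%SET = [set e'.1; e'.2]%SET -> e = e'.
Proof.
case: e e' => [u v] [u' v'] /andP[/= _ l] /andP[/= _ l'] /setP E.
have := E u; have := E v; rewrite !inE !eqxx orbT /= => /esym h1 /esym h2.
have nuv : u != v by apply: contraTneq l => ->; rewrite ltnn.
case/orP: h2 => /eqP Eu; case/orP: h1 => /eqP Ev; subst; rewrite ?eqxx // in nuv *.
by move: (ltn_trans l l'); rewrite ltnn.
Qed.

Definition parametrizes (g : G * G -> R -> P2) := forall e, oe e ->
  [/\ continuous (g e), {in `[0, 1] &, injective (g e)}, g e 0 = p e.1, g e 1 = p e.2 &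
    forall t, 0 <= t <= 1 -> a e.1 e.2 (g e t)].

Lemma parametrization : exists g, parametrizes g.
Proof.
have /boolp.choice[g Hg] e : exists g : R -> P2, oe e -> [/\ continuous g, {in `[0, 1] &, injective g},
    g 0 = p e.1, g 1 = p e.2 & forall t, 0 <= t <= 1 -> a e.1 e.2 (g t)]; last by exists g.
case: (boolP (oe e)) => [/andP[ae _]|_]; last by exists (fun=> p e.1).
have [g [cg gi g0 g1 ga]] := drawing_arc Hd ae.
have in01 t : t \in `[0, 1] = (0 <= t <= 1) by rewrite in_itv.
exists (g \o clamp (R:=R)) => _; split=> /=.
- exact: clamp_arc_continuous.
- by move=> s t; rewrite !in01 => hs ht; rewrite /= !clampE //; apply: gi; rewrite in01.
- by rewrite clampE // lexx ler01.
- by rewrite clampE // lexx ler01.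
- by move=> t ht; rewrite clampE // ga; exists t; rewrite // /= in01.
Qed.

(** Every arc is split at 2/3: the first piece belongs to the first end of the edge and the last
    third to the second end, [base] naming the owner. The first piece is shortened later so that its
    cells avoid those of the last third. *)
Definition lo (b : bool) : R := if b then 2 / 3 else 0.
Definition hi (b : bool) : R := if b then 1 else 2 / 3.
Definition base (h : G * G * bool) : G := if h.2 then h.1.2 else h.1.1.

(** Arcs of different edges meet only at a common end, and by injectivity a piece contains no other
    end of its edge than its base. *)
Lemma pieces_disjoint (g : G * G -> R -> P2) (Hg : parametrizes g) (h h' : G * G * bool) s t :
  oe h.1 -> oe h'.1 -> h.1 != h'.1 -> base h != base h' ->
  lo h.2 <= s <= hi h.2 -> lo h'.2 <= t <= hi h'.2 -> g h.1 s <> g h'.1 t.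
Proof.
have in01 (r : R) : r \in `[0, 1] = (0 <= r <= 1) by rewrite in_itv.
have i01 b r : lo b <= r <= hi b -> 0 <= r <= 1.
  by case: b => /andP[h1 h2]; apply/andP; rewrite /lo /hi in h1 h2; split; lra.
have isbase (k : G * G * bool) r w : oe k.1 -> lo k.2 <= r <= hi k.2 -> w \in [set k.1.1; k.1.2]%SET ->
    g k.1 r = p w -> w = base k.
  case: k => [[u v] b] /= /Hg[_ gi g0 g1 _] hr; rewrite !inE => /orP[]/eqP -> E.
    have r0 : r = 0 by apply: gi; rewrite ?E ?g0 // in01 ?lexx ?ler01 // (i01 b).
    by case: b hr => //; rewrite r0 /lo => /andP[h1 _]; by have /and4P[] := thirds R; rewrite !ltNge h1.
  have r1 : r = 1 by apply: gi; rewrite ?E ?g1 // in01 ?lexx ?ler01 // (i01 b).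
  by case: b hr => //; rewrite r1 /hi => /andP[_ h1]; by have /and4P[] := thirds R; rewrite !ltNge h1.
move=> oh oh' ne nb hs ht E.
have [_ _ _ _ ga] := Hg _ oh; have [_ _ _ _ ga'] := Hg _ oh'.
have nS : [set h.1.1; h.1.2]%SET != [set h'.1.1; h'.1.2]%SET.
  by apply: contraNneq ne => /(oedge_pair_inj oh oh') ->.
case/andP: (oh) => ah _; case/andP: (oh') => ah' _.
have [w] : [set p w | w in [set w | w \in ([set h.1.1; h.1.2] :&: [set h'.1.1; h'.1.2])%SET]] (g h.1 s).
  apply: (drawing_cross Hd ah ah' nS); split; first by apply: ga; apply: i01 hs.
  by rewrite E; apply: ga'; apply: i01 ht.
rewrite /= inE => /andP[w1 w2] Ew; case/eqP: nb.
rewrite -(isbase h s w oh hs w1 (esym Ew)); apply: (isbase h' t) => //.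
by rewrite -E.
Qed.

Lemma separated (g : G * G -> R -> P2) (Hg : parametrizes g) :
  exists2 M, (0 < M)%N & (forall h h' q s t,
      oe h.1 -> oe h'.1 -> h.1 != h'.1 -> base h != base h' -> in_grid M q ->
      lo h.2 <= s <= hi h.2 -> lo h'.2 <= t <= hi h'.2 ->
      nb M q (g h.1 s) -> nb M q (g h'.1 t) -> False) /\
    (forall e q s t, oe e -> in_grid M q -> 0 <= s <= 1 / 3 -> 2 / 3 <= t <= 1 ->
      nb M q (g e s) -> nb M q (g e t) -> False).
Proof.
have /boolp.choice[f1 Hf1] (hh : (G * G * bool) * (G * G * bool)) : exists M0,
    oe hh.1.1 -> oe hh.2.1 -> hh.1.1 != hh.2.1 -> base hh.1 != base hh.2 ->
    forall M q s t, (M0 <= M)%N -> (0 < M)%N -> in_grid M q ->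
    lo hh.1.2 <= s <= hi hh.1.2 -> lo hh.2.2 <= t <= hi hh.2.2 ->
      nb M q (g hh.1.1 s) -> nb M q (g hh.2.1 t) -> False.
  case: (pselect [/\ oe hh.1.1, oe hh.2.1, hh.1.1 != hh.2.1 & base hh.1 != base hh.2]); last first.
    by move=> h; exists 0%N => ? ? ? ?; case: h.
  move=> [h1 h2 h3 h4]; have [c1 _ _ _ _] := Hg _ h1; have [c2 _ _ _ _] := Hg _ h2.
  have [s t hs ht|M0 HM] := separation (a := lo hh.1.2) (b := hi hh.1.2) (c := lo hh.2.2) (d := hi hh.2.2) c1 c2.
    exact: (pieces_disjoint Hg h1 h2 h3 h4 hs ht).
  by exists M0.
have /boolp.choice[f2 Hf2] (e : G * G) : exists M0, oe e ->
    forall M q s t, (M0 <= M)%N -> (0 < M)%N -> in_grid M q ->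
    0 <= s <= 1 / 3 -> 2 / 3 <= t <= 1 -> nb M q (g e s) -> nb M q (g e t) -> False.
  case: (boolP (oe e)) => [oh|_]; last by exists 0%N.
  have [c1 gi _ _ _] := Hg _ oh.
  have [s t /andP[s0 s1] /andP[t0 t1] E|M0 HM] := separation (a := 0) (b := 1 / 3) (c := 2 / 3) (d := 1) c1 c1; last by exists M0.
  have : s = t by apply: gi; rewrite // in_itv /=; apply/andP; split; lra.
  by lra.
pose M1 := (\max_hh f1 hh)%N; pose M2 := (\max_e f2 e)%N.
have l1 hh : (f1 hh <= (M1 + M2).+1)%N.
  by apply: leqW; apply: leq_trans (leq_addr _ _); apply: leq_bigmax.
have l2 e : (f2 e <= (M1 + M2).+1)%N.
  by apply: leqW; apply: leq_trans (leq_addl _ _); apply: leq_bigmax.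
exists (M1 + M2).+1 => //; split=> [h h' q s t o1 o2 ne nb iq hs ht|e q s t o iq hs ht].
  exact: (Hf1 (h, h') o1 o2 ne nb _ q s t (l1 _)).
exact: (Hf2 e o _ q s t (l2 _)).
Qed.

Local Notation lab lam q := (lam q.1 q.2).

Theorem discretization : exists m (lam : nat -> nat -> option G),
  [/\ forall i j, (i <= m.+1)%N -> (j <= m.+1)%N ->
        [|| i == 0, i == m.+1, j == 0 | j == m.+1]%N ->
        lam (m.+1 - i)%N (m.+1 - j)%N = lam i j,
      forall u (g : nat -> nat -> bool),
        (forall e : gedge m, lab lam (end1 e) = Some u -> lab lam (end2 e) = Some u ->
           g (end1 e).1 (end1 e).2 = g (end2 e).1 (end2 e).2) ->
        (forall i j, (i <= m.+1)%N -> (j <= m.+1)%N ->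
           [|| i == 0, i == m.+1, j == 0 | j == m.+1]%N -> lam i j = Some u ->
           g (m.+1 - i)%N (m.+1 - j)%N = g i j) ->
        forall i j i' j', (i <= m.+1)%N -> (j <= m.+1)%N -> (i' <= m.+1)%N -> (j' <= m.+1)%N ->
          lam i j = Some u -> lam i' j' = Some u -> g i j = g i' j' &
      forall e, oe e -> exists E : gedge m,
        lab lam (end1 E) = Some e.1 /\ lab lam (end2 E) = Some e.2 \/
        lab lam (end1 E) = Some e.2 /\ lab lam (end2 E) = Some e.1].
Proof.
have [g Hg] := parametrization; have [M M0 [sep1 sep2]] := separated Hg.
pose W q : set P2 := [set P | in_grid M q /\ nb M q P].
have oW q : open (W q).
  rewrite /W; case: (in_grid M q).
    rewrite (_ : [set _ | _] = nb M q); first exact: open_nb.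
    by apply/seteqP; split=> [P []|P].
  rewrite (_ : [set _ | _] = set0); first exact: open0.
  by apply/seteqP; split=> [P []|P].
have covW P : exists q, W q P by have [q] := nb_cover M0 P; exists q.
(* The first third and the last third share no cell. The first piece is prolonged from 1/3 as far as
   this remains so, and stops next to a pair of overlapping cells, one of each piece, which will
   realise the edge. *)
have front (e : G * G) : exists t, oe e -> [/\ 0 <= t <= 2 / 3,
    forall q r s, 0 <= r <= t -> 2 / 3 <= s <= 1 -> W q (g e r) -> W q (g e s) -> False &
    exists q q' s x, [/\ W q (g e t), 2 / 3 <= s <= 1, W q' (g e s), W q x & W q' x]].
  case: (boolP (oe e)) => [oh|_]; last by exists 0.
  have [ce _ _ _ _] := Hg _ oh.
  pose B q := exists2 s, 2 / 3 <= s <= 1 & W q (g e s).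
  have [||q r hr [iq Wr] [s hs [_ Ws]]|q Wq|t [q [q' [x [/andP[t1 t2] Ht Wq [s hs Ws] [Wx Wx']]]]]] :=
    frontier ce oW covW (B := B) (a := 1 / 3) (b := 2 / 3).
  - by lra.
  - by lra.
  - exact: (sep2 e q r s).
  - by exists (2 / 3) => //; apply/andP; split; lra.
  exists t => _; split; first by apply/andP; split; lra.
    by move=> q0 r s0 hr hs0 h1 h2; apply: (Ht q0 r hr h1); exists s0.
  by exists q, q', s, x.
have {front}/boolp.choice[tau Htau] := front.
pose top (h : G * G * bool) := if h.2 then 1 else tau h.1.
have top_hi h : oe h.1 -> top h <= hi h.2.
  by case: h => [e [|]] oh; rewrite /top /hi //=; have [/andP[]] := Htau e oh.
have lo_top h : oe h.1 -> lo h.2 <= top h.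
  by case: h => [e [|]] oh; rewrite /top /lo /=; [lra|have [/andP[]] := Htau e oh].
(* The class of a vertex consists of the lattice points whose cells meet one of its pieces; all
   pieces contain the point [p u], which makes the class connected. *)
pose cls u q := exists h t, [/\ oe h.1, base h = u, lo h.2 <= t <= top h & W q (g h.1 t)].
(* Pieces of different edges with different bases share no cell by the choice of [M], and the two
   pieces of one edge share none by the choice of [tau]. *)
have cls_inj u v q : cls u q -> cls v q -> u = v.
  move=> [h [s [oh <- hs Ws]]] [h' [t [oh' <- ht Wt]]]; apply/eqP; apply: contraT => nb.
  exfalso; case: (eqVneq h.1 h'.1) => [E|ne]; last first.
    apply: (sep1 h h' q s t oh oh' ne nb Ws.1 _ _ Ws.2 Wt.2).
      by case/andP: hs => -> /le_trans -> //; apply: top_hi.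
    by case/andP: ht => -> /le_trans -> //; apply: top_hi.
  case: h h' oh oh' nb hs ht Ws Wt E => [e b] [e' b'] /= oh _ nb hs ht Ws Wt E; subst e'.
  have [_ Ht _] := Htau e oh.
  case: b b' nb hs ht Ws Wt => [] []; rewrite /base /= ?eqxx //= => _ hs ht Ws Wt.
    exact: (Ht q t s ht hs Wt Ws).
  exact: (Ht q s t hs ht Ws Wt).
have cls_grid u q : cls u q -> in_grid M q by move=> [h [t [_ _ _ []]]].
have cls_antipode u q : on_boundary M q -> cls u q -> cls u (antipode M q).
  move=> bq [h [t [oh bh ht [gq Wq]]]]; exists h, t; split=> //; split; last exact: nb_antipode.
  by rewrite /in_grid /antipode /= !leq_subr.
pose lam i j := [pick u | `[< cls u (i, j) >]].
have lamP u i j : lam i j = Some u <-> cls u (i, j).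
  rewrite /lam; split; first by case: pickP => // v /asboolP h [<-].
  by move=> h; case: pickP => [v /asboolP /cls_inj/(_ h) -> //|/(_ u)]; rewrite asboolT.
exists (M + M).-1, lam; have Mm : ((M + M).-1).+1 = (M + M)%N by rewrite prednK // addn_gt0 M0.
have labP u (q : nat * nat) : lab lam q = Some u <-> cls u q.
  by rewrite lamP -surjective_pairing.
have W_linked q q' x : W q x -> W q' x -> hex_linked M q q'.
  by move=> [h1 h2] [h3 h4]; apply: nb_linked h2 h4.
rewrite Mm; split.
- move=> i j i_n j_n bd; have gij : in_grid M (i, j) by rewrite /in_grid i_n.
  have bd' : on_boundary M (antipode M (i, j)).
    by move: bd; rewrite /on_boundary /antipode /=; lia.
  have aa : antipode M (antipode M (i, j)) = (i, j) by rewrite /antipode /= !subKn.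
  case E : (lam i j) => [u|]; first exact/lamP/(cls_antipode u (i, j) bd)/lamP.
  case E' : (lam _ _) => [v|//]; have := cls_antipode v _ bd' ((lamP _ _ _).1 E').
  by rewrite aa => /lamP; rewrite E.
- move=> u f Hf Ha.
  have fa q : on_boundary M q -> cls u q -> lab f (antipode M q) = lab f q.
    move=> bq cq; apply: Ha => //; [by case/andP: (cls_grid _ _ cq)|by case/andP: (cls_grid _ _ cq)|exact/labP].
  have fhex q q' : hex q q' -> cls u q -> cls u q' -> lab f q = lab f q'.
    move=> hq cq cq'; case: (eqVneq q q') => [-> //|nq].
    have [E HE] := hex_gedge Mm (cls_grid _ _ cq) (cls_grid _ _ cq') hq nq.
    have fE q1 q2 : end1 E = q1 /\ end2 E = q2 \/ end1 E = q2 /\ end2 E = q1 ->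
        cls u q1 -> cls u q2 -> lab f q1 = lab f q2.
      by move=> [] [E1 E2] c1 c2; [|symmetry]; rewrite -E1 -E2; apply: Hf; rewrite ?E1 ?E2; apply/labP.
    case: HE => [/fE|[b1 b2 /fE HE]]; first exact.
    by rewrite -(fa q) // -(fa q') //; apply: HE; apply: cls_antipode.
  have flink q q' : hex_linked M q q' -> cls u q -> cls u q' -> lab f q = lab f q'.
    move=> /or3P[h|/andP[b h]|/andP[b h]] c1 c2; first exact: fhex.
      by rewrite -(fa q') //; apply: fhex => //; apply: cls_antipode.
    by rewrite -(fa q) //; apply: fhex => //; apply: cls_antipode.
  have fpiece h q q' s t : oe h.1 -> base h = u -> lo h.2 <= s <= top h -> lo h.2 <= t <= top h ->
      W q (g h.1 s) -> W q' (g h.1 t) -> lab f q = lab f q'.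
    move=> oh bh hs ht Ws Wt; have [ce _ _ _ _] := Hg _ oh.
    apply: (@chain_connected R _ (g h.1) _ W ce oW covW (lo h.2) (top h) (fun q => lab f q) _ q q' s t) => //.
    move=> q1 q2 r hr W1 W2; apply: flink; first exact: W_linked W1 W2.
      by exists h, r.
    by exists h, r.
  (* A cell at the drawn vertex is the reference to which every cell of the class is connected along
     a piece. *)
  have [q0 Wq0] := covW (p u).
  have f0 q : cls u q -> lab f q = lab f q0.
    move=> [h [t [oh bh ht Wt]]]; have [_ _ g0 g1 _] := Hg _ oh.
    case: h oh bh ht Wt g0 g1 => [e [|]] /= oh bh ht Wt g0 g1; rewrite /base /= in bh.
      by apply: (fpiece (e, true) q q0 t 1) => //; rewrite ?g1 ?bh // /top /lo /=; apply/andP; split; lra.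
    apply: (fpiece (e, false) q q0 t 0) => //; rewrite ?g0 ?bh // /lo lexx /=.
    exact: (lo_top (e, false) oh).
  by move=> i j i' j' _ _ _ _ /lamP/f0 /= -> /lamP/f0 /= ->.
move=> e oh; have [_ _ [q [q' [s [x [Wq hs Wq' Wx Wx']]]]]] := Htau e oh.
have cq : cls e.1 q.
  by exists (e, false), (tau e); split=> //; rewrite /top /= lexx (lo_top (e, false) oh).
have cq' : cls e.2 q' by exists (e, true), s; split.
have [q1 [q2 [c1 c2 hq]]] : exists q1 q2, [/\ cls e.1 q1, cls e.2 q2 & hex q1 q2].
  case/or3P: (W_linked _ _ _ Wx Wx') => [h|/andP[b h]|/andP[b h]].
  - by exists q, q'.
  - by exists q, (antipode M q'); split=> //; apply: cls_antipode.
  - by exists (antipode M q), q'; split=> //; apply: cls_antipode.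
have nq : q1 != q2.
  apply/eqP => E; rewrite -E in c2; case/andP: oh => _; rewrite (cls_inj _ _ _ c1 c2).
  by rewrite ltnn.
have [E HE] := hex_gedge Mm (cls_grid _ _ c1) (cls_grid _ _ c2) hq nq.
exists E.
have fin q3 q4 : cls e.1 q3 -> cls e.2 q4 -> end1 E = q3 /\ end2 E = q4 \/ end1 E = q4 /\ end2 E = q3 ->
    lab lam (end1 E) = Some e.1 /\ lab lam (end2 E) = Some e.2 \/
    lab lam (end1 E) = Some e.2 /\ lab lam (end2 E) = Some e.1.
  by move=> c3 c4 [] [-> ->]; [left|right]; split; apply/labP.
case: HE => [|[b1 b2]]; first exact: fin.
by apply: fin; apply: cls_antipode.
Qed.

End Discretization.

Local Open Scope classical_set_scope.
Local Open Scope ring_scope.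

Lemma drawable_embed (R : realType) (X Y : topologicalType) (f : X -> Y) (G : sgraph) :
  continuous f -> injective f -> drawable R X G -> drawable R Y G.
Proof.
move=> cf fI [p [a [pI pa pS pv pc]]]; exists (f \o p), (fun u v => f @` a u v); split.
- exact: inj_comp.
- move=> u v uv; have [g [cg gI g0 g1 ->]] := pa u v uv.
  exists (f \o g); split; rewrite /= ?g0 ?g1 //.
  + apply: within_continuous_comp cg => y _; exact: cf.
  + by move=> s t hs ht /fI; apply: gI.
  + by rewrite image_comp.
- by move=> u v uv; rewrite pS.
- by move=> u v w uv [y ay /fI Ey]; apply: pv uv _; rewrite -Ey.
move=> u v u' v' uv uv' ne z [[y ay <-] [y' ay' /fI Ey]]; rewrite Ey in ay'.
by have [w hw <-] := pc u v u' v' uv uv' ne y (conj ay ay'); exists w.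
Qed.

(** * The plane inside the projective plane *)

Section CentralProjection.
Variable R : realType.

Definition affine_norm (P : R * R) : R := Num.sqrt (P.1 ^+ 2 + P.2 ^+ 2 + 1).

(** The unit vector in the direction (x, y, 1): central projection onto the open upper hemisphere,
    which contains no two antipodes. *)
Definition affine_vec (P : R * R) : 'rV[R]_3 :=
  P.1 / affine_norm P *: delta_mx 0 (inord 0) + P.2 / affine_norm P *: delta_mx 0 (inord 1)
  + (affine_norm P)^-1 *: delta_mx 0 (inord 2).

Lemma affine_norm_gt0 P : 0 < affine_norm P.
Proof. by rewrite sqrtr_gt0 ltr_wpDl // addr_ge0 ?sqr_ge0. Qed.

Lemma coord_affine P : [/\ coord 0 (affine_vec P) = P.1 / affine_norm P,
  coord 1 (affine_vec P) = P.2 / affine_norm P & coord 2 (affine_vec P) = (affine_norm P)^-1].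
Proof.
have E (i j : nat) : (i < 3)%N -> (j < 3)%N -> (inord i == inord j :> 'I_3) = (i == j).
  by move=> hi hj; rewrite -val_eqE /= !inordK.
by split; rewrite /coord /affine_vec !mxE !eqxx /= !E //= ?mulr1 ?mulr0 ?addr0 ?add0r.
Qed.

Lemma affine_vec_sphere P : sphere R (affine_vec P).
Proof.
apply/sphereE; have [-> -> ->] := coord_affine P; have r0 := affine_norm_gt0 P.
have E : affine_norm P ^+ 2 = P.1 ^+ 2 + P.2 ^+ 2 + 1.
  by rewrite sqr_sqrtr // addr_ge0 // addr_ge0 ?sqr_ge0.
have nz : affine_norm P != 0 by rewrite gt_eqF.
transitivity ((P.1 ^+ 2 + P.2 ^+ 2 + 1) / affine_norm P ^+ 2); first by field.
by rewrite -E divff // expf_neq0.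
Qed.

Definition affine (P : R * R) : projective_plane R := proj (to_sphere (affine_vec_sphere P)).

Lemma affine_inj : injective affine.
Proof.
move=> P Q /proj_eq; rewrite !set_valE /=.
have [a0 a1 a2] := coord_affine P; have [b0 b1 b2] := coord_affine Q.
have P0 := affine_norm_gt0 P; have Q0 := affine_norm_gt0 Q.
case=> E; rewrite E in a0 a1 a2; last first.
  have : 0 < (affine_norm P)^-1 by rewrite invr_gt0.
  by rewrite -a2 coordN b2 oppr_gt0 ltNge invr_ge0 ltW.
have En : affine_norm Q = affine_norm P by apply: GRing.invr_inj; rewrite -a2 -b2.
have nz : affine_norm P != 0 by rewrite gt_eqF.
have E1 : P.1 = Q.1 by apply: (mulIf (invr_neq0 nz)); rewrite -a0 b0 En.
have E2 : P.2 = Q.2 by apply: (mulIf (invr_neq0 nz)); rewrite -a1 b1 En.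
by rewrite [P]surjective_pairing [Q]surjective_pairing E1 E2.
Qed.

Lemma affine_continuous : continuous affine.
Proof.
have c1 : continuous (fst : R * R -> R) by move=> P; exact: cvg_fst.
have c2 : continuous (snd : R * R -> R) by move=> P; exact: cvg_snd.
have cn : continuous affine_norm.
  move=> P; apply: (@continuous_comp _ _ _ (fun P : R * R => P.1 ^+ 2 + P.2 ^+ 2 + 1) Num.sqrt); last first.
    exact: sqrt_continuous.
  apply: (@cts_add R _ (fun P : R * R => P.1 ^+ 2 + P.2 ^+ 2) (fun=> 1)); last exact: cst_continuous.
  apply: (@cts_add R _ (fun P : R * R => P.1 ^+ 2) (fun P => P.2 ^+ 2)).
    apply: (@cts_mul R _ fst fst); exact: c1.
  apply: (@cts_mul R _ snd snd); exact: c2.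
have cv : continuous (fun P => (affine_norm P)^-1).
  by move=> P; apply: (@continuousV R _ affine_norm); [rewrite gt_eqF ?affine_norm_gt0|exact: cn].
have cs (k : R * R -> R) (w : 'rV[R]_3) : continuous k -> continuous (fun P => k P *: w).
  by move=> ck P; apply: (@continuousZl R 'rV[R]_3 _ k w); exact: ck.
have ca (k l : R * R -> 'rV[R]_3) : continuous k -> continuous l -> continuous (fun P => k P + l P).
  by move=> ck cl P; apply: (@continuousD R 'rV[R]_3 _ k l); [exact: ck|exact: cl].
have cvec : continuous affine_vec.
  apply: (ca _ _); [apply: (ca _ _)|]; apply: (cs _ _) => // P.
    by apply: (@cts_mul R _ fst (fun P => (affine_norm P)^-1)); [exact: c1|exact: cv].
  by apply: (@cts_mul R _ snd (fun P => (affine_norm P)^-1)); [exact: c2|exact: cv].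
move=> P; apply: (@continuous_comp _ _ _ (fun P => to_sphere (affine_vec_sphere P)) (@proj R)); last first.
  exact: proj_continuous.
move: P; apply/continuousP => _ [B oB <-].
rewrite (_ : _ @^-1` _ = affine_vec @^-1` B); first by move/continuousP: cvec; apply.
by apply/seteqP; split=> P /=; rewrite set_valE.
Qed.

Lemma planar_projective G : planar R G -> projective_planar R G.
Proof. exact: drawable_embed affine_continuous affine_inj. Qed.

End CentralProjection.

(** The drawing of the whole graph is discretized once; for a vertex set [S] the labels outside it
    are erased by [insub], which leaves a labelled grid for the induced subgraph. *)
Theorem projective_density (R : realType) (G : sgraph) : projective_planar R G ->
  (forall c : seq G, ucycle (@adj G) c -> (2 < size c)%N -> (10 <= size c)%N) ->
  forall S : {set G}, S != finset.set0 ->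
  (4 * #|[set q | [&& oedge (@adj G) q, q.1 \in S & q.2 \in S]]%SET| + 5 <= 5 * #|S|)%N.
Proof.
move=> [p [a Hd]] girth10 S S0.
have [m [lam [lamA lamC lamE]]] := discretization Hd.
pose W : finType := {u : G | u \in S}.
pose r : rel W := fun u v => adj (val u) (val v).
have rC : symmetric r by move=> u v; rewrite /r adj_sym.
have r0 : irreflexive r by move=> u; rewrite /r adj_irr.
pose lam' i j : option W := obind insub (lam i j).
have lamP i j (w : W) : lam' i j = Some w <-> lam i j = Some (val w).
  rewrite /lam'; case: (lam i j) => [u|] //=; split=> [h|[->]]; last by rewrite valK.
  by rewrite -[u](@insubK _ _ W) ?h //.
have cW : #|W| = #|S| by rewrite card_sig; apply: eq_card => u; rewrite !inE.
have := @grid_density W r m lam' rC r0 _ _ _ _ _.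
rewrite cW => dens; suff -> : #|[set q | [&& oedge (@adj G) q, q.1 \in S & q.2 \in S]]%SET| =
    #|[set q | oedge r q]%SET|.
  apply: dens.
  - move=> c cc; rewrite -(size_map val); apply: girth10.
    move: cc; rewrite /ucycle map_inj_uniq; last exact: val_inj.
    by rewrite cycle_map.
  - by move=> i j ? ? ?; rewrite /lam' lamA.
  - move=> u g Hg Ha i j i' j' h1 h2 h3 h4 /lamP E /lamP E'.
    apply: (lamC (val u) g) => //.
      by move=> e /lamP e1 /lamP e2; apply: Hg.
    by move=> k l ? ? ? /lamP; apply: Ha.
  - move=> q oq; have [u' [v' [ou Eq]]] : exists u v : W, oedge (@adj G) (val u, val v) /\ ((u, v) = q \/ (v, u) = q).
      case: q oq => u v /andP[/= ruv _]; case: (ltngtP (enum_rank (val u)) (enum_rank (val v))) => h.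
      - by exists u, v; split; [rewrite /oedge /= h andbT|left].
      - by exists v, u; split; [rewrite /oedge /= h andbT adj_sym|right].
      by move: ruv; rewrite /r (enum_rank_inj (ord_inj h)) adj_irr.
    have [e He] := lamE _ ou; exists e; rewrite !lamP.
    by case: Eq => <- /=; [exact: He|apply/or_comm].
  - by rewrite card_gt0.
apply/eqP; rewrite -(eqn_pmul2l (isT : (0 < 2)%N)); apply/eqP; rewrite card_oedge; [|exact: adj_sym|exact: adj_irr].
have := @card_oedge W r [set: W]%SET rC r0.
rewrite (_ : [set q | [&& oedge r q, q.1 \in _ & q.2 \in _]]%SET = [set q | oedge r q]%SET); last first.
  by apply/setP => q; rewrite !inE /= !andbT.
move=> ->; pose h (q : W * W) := (val q.1, val q.2).
have hI : injective h by move=> [u v] [u' v'] [/val_inj -> /val_inj ->].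
rewrite -(card_imset _ hI); apply: eq_card => -[u v]; rewrite !inE /=.
apply/idP/imsetP => [/and3P[ruv uS vS]|[[u' v']]].
  by exists (Sub u uS, Sub v vS); rewrite ?inE //= /h /= ?SubK //= /r ?SubK ruv.
by rewrite !inE !andbT => ruv [-> ->]; apply/and3P; split; [exact: ruv|exact: valP|exact: valP].
Qed.

End Topology.

Definition z5_ord (x : z5) : 'I_5 :=
  match x with Z0 => @Ordinal 5 0 isT | Z1 => @Ordinal 5 1 isT | Z2 => @Ordinal 5 2 isT | Z3 => @Ordinal 5 3 isT | Z4 => @Ordinal 5 4 isT end.

Lemma z5_ord_adj x y : okw 4 x y -> C5_adj (z5_ord x) (z5_ord y).
Proof. by case: x; case: y. Qed.

Local Open Scope ring_scope.
Local Open Scope ereal_scope.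

Theorem corollary3 (R : realType) (G : sgraph) :
  planar R G \/ projective_planar R G ->
  10%:R%:E <= girth R G ->
  exists f : G -> C5, is_hom f.
Proof.
move=> PG girth10; have {}PG : projective_planar R G by case: PG => // /planar_projective.
have [|f Hf] := density_colouring (@adj_sym G) (@adj_irr G); last first.
  by exists (fun u => z5_ord (f u)) => u v /Hf/z5_ord_adj.
have Hc (c : seq G) : ucycle (@adj G) c -> (2 < size c)%N -> (10 <= size c)%N.
  move=> cc c2; rewrite -(ler_nat R) -lee_fin; apply: le_trans girth10 _.
  by apply: ereal_inf_lbound; exists c.
move=> S S0; apply: leq_trans (projective_density PG Hc S0).
by rewrite leq_add2l.
Qed.
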